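(* Let $s\in\mathbb{R}$ and $1<p<\infty$ satisfy one of the following: (i) $s>1-\frac1p$ if $1<p\le 3$; (ii) $s>\frac43-\frac2p$ if $3\le p<\infty$. Then the cubic HNLS $i\partial_t u+\Box u+|u|^2u=0$ on $\mathbb{T}^2$ is unconditionally locally well-posed in $\mathcal{F}L^{s,p}(\mathbb{T}^2)$: for every $u_0\in\mathcal{F}L^{s,p}(\mathbb{T}^2)$ there exist $T>0$ and a solution $u\in C([0,T];\mathcal{F}L^{s,p}(\mathbb{T}^2))$ with $u|_{t=0}=u_0$, which is unique in the entire class $C([0,T];\mathcal{F}L^{s,p}(\mathbb{T}^2))$ (without intersecting with any auxiliary function space), and depends continuously on $u_0$.
   Context: $\mathbb{T}^2=(\mathbb{R}/2\pi\mathbb{Z})^2$; $\widehat f(n)$ denotes Fourier coefficients, $\langle\cdot\rangle=(1+|\cdot|^2)^{1/2}$, and $\|f\|_{\mathcal{F}L^{s,p}}=\|\langle n\rangle^s\widehat f(n)\|_{\ell^p_n(\mathbb{Z}^2)}$. $\Box=\partial_{x_1}^2-\partial_{x_2}^2$. Under the stated conditions $\mathcal{F}L^{s,p}(\mathbb{T}^2)\subset L^3(\mathbb{T}^2)$, so $|u|^2u$ is defined for $u\in C([0,T];\mathcal{F}L^{s,p})$ and solutions are understood in the distributional (equivalently Duhamel) sense: $u(t)=e^{it\Box}u_0+i\int_0^te^{i(t-t')\Box}(|u|^2u)(t')dt'$. *)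

(* Defs.v *)
From Stdlib Require Import Reals ZArith.
From Coquelicot Require Import Coquelicot.
Open Scope R_scope.

(** Lattice Z^2 (Fourier frequencies on T^2 = (R/2piZ)^2). *)
Definition Z2 := (Z * Z)%type.

Definition jbr (n : Z2) : R := sqrt (1 + IZR (fst n) ^ 2 + IZR (snd n) ^ 2).

Definition rpow (x p : R) : R := if Rle_dec x 0 then 0 else Rpower x p.

Definition box_sum {G : AbelianMonoid} (N : nat) (f : Z2 -> G) : G :=
  sum_n (fun i => sum_n (fun j =>
      f ((Z.of_nat i - Z.of_nat N)%Z, (Z.of_nat j - Z.of_nat N)%Z)) (2 * N)) (2 * N).

Definition in_box (N : nat) (n : Z2) : bool :=
  (Z.abs (fst n) <=? Z.of_nat N)%Z && (Z.abs (snd n) <=? Z.of_nat N)%Z.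

(** An element of FL^{s,p}(T^2) is represented by its Fourier coefficients a : Z2 -> C. *)
Definition FL_term (s p : R) (a : Z2 -> C) (n : Z2) : R :=
  rpow (Rpower (jbr n) s * Cmod (a n)) p.

(** Partial sums of ||a||_{FL^{s,p}}^p over boxes (nondecreasing in N). *)
Definition FL_partial (s p : R) (a : Z2 -> C) (N : nat) : R :=
  box_sum N (FL_term s p a).

Definition inFL (s p : R) (a : Z2 -> C) : Prop :=
  ex_finite_lim_seq (FL_partial s p a).

Definition FLnorm (s p : R) (a : Z2 -> C) : R :=
  rpow (real (Lim_seq (FL_partial s p a))) (/ p).

Definition Csub_seq (a b : Z2 -> C) : Z2 -> C := fun n => (a n - b n)%C.

Definition CFL (s p T : R) (u : R -> Z2 -> C) : Prop :=
  (forall t, 0 <= t <= T -> inFL s p (u t)) /\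
  (forall t, 0 <= t <= T -> forall eps, 0 < eps -> exists delta, 0 < delta /\
     forall t', 0 <= t' <= T -> Rabs (t' - t) < delta ->
       FLnorm s p (Csub_seq (u t') (u t)) < eps).

Definition cis (theta : R) : C := (cos theta, sin theta).

(** Symbol of Box = d_1^2 - d_2^2: Box e^{in.x} = -(n1^2 - n2^2) e^{in.x},
    so e^{it Box} acts on Fourier coefficients by e^{-it q(n)}. *)
Definition q (n : Z2) : R := IZR (fst n) ^ 2 - IZR (snd n) ^ 2.

(** Fourier coefficient at n of |u_N|^2 u_N, u_N the box-truncation of u to [-N,N]^2:
    sum over n1 - n2 + n3 = n of a(n1) conj(a(n2)) a(n3), all n_j in the box. *)
Definition cubic_trunc (a : Z2 -> C) (N : nat) (n : Z2) : C :=
  box_sum N (fun n1 => box_sum N (fun n2 =>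
    let n3 := ((fst n - fst n1 + fst n2)%Z, (snd n - snd n1 + snd n2)%Z) in
    if in_box N n3 then (a n1 * Cconj (a n2) * a n3)%C else RtoC 0)).

(** Fourier coefficient of |u|^2 u (in L^1 since FL^{s,p} embeds in L^3) equals
    the limit of those of |u_N|^2 u_N, since u_N -> u in FL^{s,p}, hence in L^3. *)
Definition cubic_coef (a : Z2 -> C) (n : Z2) (c : C) : Prop :=
  filterlim (fun N => cubic_trunc a N n) eventually (locally c).

(** u is a (Duhamel) solution on [0,T] with data u0:
    u(t) = e^{it Box} u0 + i int_0^t e^{i(t-t')Box} (|u|^2 u)(t') dt',
    written coefficientwise in Fourier variables. *)
Definition duhamel_sol (T : R) (u0 : Z2 -> C) (u : R -> Z2 -> C) : Prop :=
  exists NL : R -> Z2 -> C,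
    (forall t, 0 <= t <= T -> forall n, cubic_coef (u t) n (NL t n)) /\
    (forall t, 0 <= t <= T -> forall n, exists I : C,
        is_RInt (fun t' => (cis (- ((t - t') * q n)) * NL t' n)%C) 0 t I /\
        u t n = (cis (- (t * q n)) * u0 n + Ci * I)%C).

Definition FL_solution (s p T : R) (u0 : Z2 -> C) (u : R -> Z2 -> C) : Prop :=
  CFL s p T u /\ duhamel_sol T u0 u.

(* Main.v *)
(* The gauged profile [V_n = e^(i t q(n) - 2 i th) u_n], [th' = mass u], satisfies [V' = i N(t, V)], where [N] contains
   only the interactions [n1 - n2 + n3 = n] with [n1, n3 <> n] and the diagonal term [-|V_n|^2 V_n].  On a short interval
   the integrated equation is a contraction for the Fourier coefficients of [V] in space and time, in l^p with weights
   [<n>^s <k>^b].  By Holder, the trilinear estimate reduces to bounding, uniformly in [n] and [m], the sums of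
   [<n_a>^(-s p') <n_b>^(-s p')] over the interactions of phase [m]; since [s p' > 1], this follows from the spacing of
   lattice points on lines and from the divisor bound for lattice points on hyperbolas.
   Uniqueness needs no regularity beyond [C_t FL^(s,p)]: let [y_s] be the solution of the contraction argument through
   [(s, V(s))].  Its flow is Lipschitz for the weak norm [sup_n], and in that norm [V] agrees with [y_s] to first order
   at [s], because the cubic term is bounded from l^(3/2) to l^oo and [FL^(s,p)] embeds in l^(3/2).  Hence [s |-> y_s(t)]
   has zero derivative, and [V(t) = y_t(t) = y_0(t)]. *)

Require Import Defs.
From Stdlib Require Import Reals ZArith List Lra Lia ClassicalEpsilon FunctionalExtensionality Permutation Znumtheory.
From Coquelicot Require Import Coquelicot.
Import ListNotations.
Open Scope R_scope.

(** * Real powers *)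

(** Short time enters without a cutoff. Functions of time are series in [e^(i k t)], [k] an integer,
    read only on an interval of length [1/(2L)]. There the constant 1 has an absolutely convergent
    expansion in the frequencies [2 L j] with [j <> 0]; multiplying the low time frequencies of the
    forcing by it moves them beyond [L] without changing values on the interval. Dividing by [k]
    then gains [L^(b-1)], the only small factor of the contraction. The exponent is
    [b = 1 - 1/(2p)]: [b p' > 1] makes weighted coefficients summable in [k], and [b < 1] leaves the
    gain. The two lower bounds for [s] cross at [p = 3], and in either range both hold:
    [s > 1 - 1/p] serves the counting, [s > 4/3 - 2/p] the embedding. The obstacle to the weak
    estimate is that the factor measured in [sup_n] has no spatial weight, so the counting has to
    close with any two of the three weights. In the coordinates [x + y], [x - y] the phase is the
    bilinear form [x y' + y x']; one pair of weights then leads to lines only, the other pairs to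
    hyperbolas as well. *)

Lemma rpow_0 a : rpow 0 a = 0.
Proof. unfold rpow. destruct (Rle_dec 0 0); lra. Qed.

Lemma rpow_pos_eq x a : 0 < x -> rpow x a = Rpower x a.
Proof. intros H. unfold rpow. destruct (Rle_dec x 0); lra. Qed.

Lemma rpow_nonneg x a : 0 <= rpow x a.
Proof.
  unfold rpow. destruct (Rle_dec x 0); [lra|]. unfold Rpower. left; apply exp_pos.
Qed.

Lemma rpow_gt0 x a : 0 < x -> 0 < rpow x a.
Proof. intros H. rewrite rpow_pos_eq by assumption. apply exp_pos. Qed.

Lemma rpow_mult x y a : 0 <= x -> 0 <= y -> rpow (x * y) a = rpow x a * rpow y a.
Proof.
  intros [Hx|<-] [Hy|<-]; rewrite ?Rmult_0_l, ?Rmult_0_r, ?rpow_0; try lra.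
  rewrite !rpow_pos_eq by nra. symmetry. apply Rpower_mult_distr; assumption.
Qed.

Lemma rpow_rpow x a b : rpow (rpow x a) b = rpow x (a * b).
Proof.
  destruct (Rle_dec x 0) as [H|H].
  - unfold rpow at 2 3. destruct (Rle_dec x 0); [|lra]. apply rpow_0.
  - assert (0 < x) by lra. rewrite (rpow_pos_eq x) by assumption.
    rewrite rpow_pos_eq by apply exp_pos. rewrite Rpower_mult, rpow_pos_eq; trivial.
Qed.

(** The convention [rpow x a = 0] for [x <= 0] makes both sides vanish there, so the exponent rules
    are used without case distinctions. *)
Lemma rpow_plus x a b : rpow x (a + b) = rpow x a * rpow x b.
Proof.
  unfold rpow. destruct (Rle_dec x 0); [ring|apply Rpower_plus].
Qed.

Lemma rpow_1 x : 0 <= x -> rpow x 1 = x.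
Proof.
  intros [H|<-]; [|apply rpow_0]. rewrite rpow_pos_eq by assumption. apply Rpower_1, H.
Qed.

Lemma rpow_one a : rpow 1 a = 1.
Proof. rewrite rpow_pos_eq by lra. unfold Rpower. rewrite ln_1, Rmult_0_r. apply exp_0. Qed.

Lemma rpow_x0 x : 0 < x -> rpow x 0 = 1.
Proof. intros H. rewrite rpow_pos_eq by assumption. apply Rpower_O, H. Qed.

Lemma rpow_le x y a : 0 <= a -> 0 <= x <= y -> rpow x a <= rpow y a.
Proof.
  intros Ha [[Hx|<-] Hy]; [|rewrite rpow_0; apply rpow_nonneg].
  rewrite !rpow_pos_eq by lra. apply Rle_Rpower_l; lra.
Qed.

Lemma rpow_lt x y a : 0 < a -> 0 <= x < y -> rpow x a < rpow y a.
Proof.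
  intros Ha [[Hx|<-] Hy]; [|rewrite rpow_0; apply rpow_gt0; lra].
  rewrite !rpow_pos_eq by lra. apply exp_increasing.
  apply Rmult_lt_compat_l; [assumption|]. apply ln_increasing; assumption.
Qed.

Lemma rpow_opp x a : rpow x (- a) = / rpow x a.
Proof.
  destruct (Rle_dec x 0) as [H|H].
  - unfold rpow. destruct (Rle_dec x 0); [|lra]. rewrite Rinv_0; reflexivity.
  - rewrite !rpow_pos_eq by lra. apply Rpower_Ropp.
Qed.

Lemma rpow_neg_le x y a : 0 <= a -> 0 < x <= y -> rpow y (- a) <= rpow x (- a).
Proof.
  intros Ha Hx. rewrite !rpow_opp. apply Rinv_le_contravar.
  - apply rpow_gt0; lra.
  - apply rpow_le; lra.
Qed.

Lemma rpow_exp_le x a b : 1 <= x -> a <= b -> rpow x a <= rpow x b.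
Proof. intros Hx H. rewrite !rpow_pos_eq by lra. apply Rle_Rpower; lra. Qed.

Lemma rpow_inv_r x a : 0 <= x -> a <> 0 -> rpow (rpow x a) (/ a) = x.
Proof. intros Hx Ha. rewrite rpow_rpow, Rinv_r by assumption. apply rpow_1, Hx. Qed.

Lemma rpow_inv_l x a : 0 <= x -> a <> 0 -> rpow (rpow x (/ a)) a = x.
Proof. intros Hx Ha. rewrite rpow_rpow, Rinv_l by assumption. apply rpow_1, Hx. Qed.

Lemma rpow_le_inv x y a : 0 < a -> 0 <= x -> 0 <= y -> rpow x a <= rpow y a -> x <= y.
Proof.
  intros Ha Hx Hy H. destruct (Rle_dec x y); [assumption|].
  assert (rpow y a < rpow x a) by (apply rpow_lt; lra). lra.
Qed.

Lemma rpow_eq0 x a : 0 <= x -> rpow x a = 0 -> x = 0.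
Proof.
  intros [H|<-] E; [|reflexivity]. pose proof (rpow_gt0 x a H). lra.
Qed.

Lemma rpow_2 x : 0 <= x -> rpow x 2 = x * x.
Proof.
  intros H. replace 2 with (1 + 1) by ring. rewrite rpow_plus, rpow_1; trivial.
Qed.

Lemma ln_le_sub1 x : 0 < x -> ln x <= x - 1.
Proof.
  intros H. pose proof (exp_ineq1_le (ln x)). rewrite exp_ln in H0 by assumption. lra.
Qed.

(** Concavity of [ln]: its tangent line at the mean [M] lies above it, and the weighted first-order
    terms cancel. Young, Hölder, Minkowski and the three-term inequality [amgm3] all descend from
    here. *)
Lemma weighted_amgm x y r : 0 <= x -> 0 <= y -> 0 <= r <= 1 ->
  rpow x r * rpow y (1 - r) <= r * x + (1 - r) * y.
Proof.
  intros [Hx|<-] [Hy|<-] Hr; rewrite ?rpow_0; try nra.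
  set (M := r * x + (1 - r) * y).
  assert (HM : 0 < M) by (unfold M; nra).
  rewrite !rpow_pos_eq by assumption. unfold Rpower. rewrite <- exp_plus.
  rewrite <- (exp_ln M) by assumption.
  assert (E : r * ln x + (1 - r) * ln y <= ln M).
  { pose proof (ln_le_sub1 (x / M) (Rdiv_lt_0_compat _ _ Hx HM)).
    pose proof (ln_le_sub1 (y / M) (Rdiv_lt_0_compat _ _ Hy HM)).
    rewrite ln_div in H, H0 by assumption.
    assert (r * (x / M) + (1 - r) * (y / M) = 1) by (unfold M; field; unfold M in HM; lra).
    nra. }
  destruct E as [E|E]; [left; apply exp_increasing, E|rewrite E; lra].
Qed.

Lemma young x y p p' : 0 <= x -> 0 <= y -> 1 < p -> 1 < p' -> / p + / p' = 1 ->
  x * y <= rpow x p' / p' + rpow y p / p.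
Proof.
  intros Hx Hy Hp Hp' E.
  assert (0 < / p) by (apply Rinv_0_lt_compat; lra).
  assert (0 < / p') by (apply Rinv_0_lt_compat; lra).
  pose proof (weighted_amgm (rpow x p') (rpow y p) (/ p') (rpow_nonneg _ _) (rpow_nonneg _ _)
    ltac:(lra)) as H1.
  replace (1 - / p') with (/ p) in H1 by lra.
  rewrite !rpow_inv_r in H1 by lra. unfold Rdiv. lra.
Qed.

Lemma two_ab a b : a * b <= / 2 * (a * a) + / 2 * (b * b).
Proof. pose proof (Rle_0_sqr (a - b)) as H. unfold Rsqr in H. lra. Qed.

Lemma rpow_convex x y r a : 0 <= x -> 0 <= y -> 0 <= r <= 1 -> 1 < a ->
  rpow (r * x + (1 - r) * y) a <= r * rpow x a + (1 - r) * rpow y a.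
Proof.
  intros Hx Hy Hr Ha.
  set (z := r * x + (1 - r) * y).
  assert (Hz : 0 <= z) by (unfold z; nra).
  (* Young's inequality gives the tangent line of [t^a] at [z]. *)
  assert (T : forall t, 0 <= t -> rpow z a + a * rpow z (a - 1) * (t - z) <= rpow t a).
  { intros t Ht. destruct Hz as [Hz|<-].
    2:{ rewrite !rpow_0. pose proof (rpow_nonneg t a). lra. }
    assert (Ei : / a + / (a / (a - 1)) = 1) by (field; lra).
    assert (Hp' : 1 < a / (a - 1)).
    { replace (a / (a - 1)) with (1 + / (a - 1)) by (field; lra).
      pose proof (Rinv_0_lt_compat (a - 1)). lra. }
    pose proof (young (rpow z (a - 1)) t a (a / (a - 1)) (rpow_nonneg _ _) Ht Ha Hp' Ei) as Y.
    rewrite rpow_rpow in Y. replace ((a - 1) * (a / (a - 1))) with a in Y by (field; lra).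
    assert (E : rpow z a = rpow z (a - 1) * z).
    { rewrite <- (rpow_1 z) at 3 by lra. rewrite <- rpow_plus. f_equal; ring. }
    assert (Y2 : a * (rpow z (a - 1) * t) <= (a - 1) * rpow z a + rpow t a).
    { apply Rmult_le_compat_l with (r := a) in Y; [|lra].
      replace (a * (rpow z a / (a / (a - 1)) + rpow t a / a))
        with ((a - 1) * rpow z a + rpow t a) in Y by (field; lra). exact Y. }
    rewrite E in *. nra. }
  pose proof (T x Hx) as T1. pose proof (T y Hy) as T2.
  assert (r * (x - z) + (1 - r) * (y - z) = 0) by (unfold z; ring).
  set (K := a * rpow z (a - 1)) in *.
  assert (r * (K * (x - z)) + (1 - r) * (K * (y - z)) = 0)
    by (rewrite <- (Rmult_0_r K), <- H; ring).
  nra.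
Qed.

(** * Sums of nonnegative families *)

Definition ind (P : Prop) : R := if excluded_middle_informative P then 1 else 0.

Lemma ind_true (P : Prop) : P -> ind P = 1.
Proof. unfold ind. destruct (excluded_middle_informative P); tauto. Qed.

Lemma ind_false (P : Prop) : ~ P -> ind P = 0.
Proof. unfold ind. destruct (excluded_middle_informative P); tauto. Qed.

Lemma ind_bound (P : Prop) : 0 <= ind P <= 1.
Proof. unfold ind. destruct (excluded_middle_informative P); lra. Qed.

(** Classical decidability of equality, so that [nodup] and [in_dec] work on lists over any index
    type. *)
Definition ceq {A : Type} (a b : A) : {a = b} + {a <> b} :=
  excluded_middle_informative (a = b).

Fixpoint sumL {A : Type} (f : A -> R) (l : list A) : R :=
  match l with nil => 0 | a :: l' => f a + sumL f l' end.

Lemma sumL_nonneg {A} (f : A -> R) l : (forall a, 0 <= f a) -> 0 <= sumL f l.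
Proof. intros H. induction l; simpl; [lra|]. specialize (H a). lra. Qed.

Lemma sumL_le {A} (f g : A -> R) l : (forall a, In a l -> f a <= g a) -> sumL f l <= sumL g l.
Proof.
  induction l as [|a l IH]; simpl; intros H; [lra|].
  pose proof (H a (or_introl eq_refl)). assert (sumL f l <= sumL g l) by auto. lra.
Qed.

Lemma sumL_ext {A} (f g : A -> R) l : (forall a, In a l -> f a = g a) -> sumL f l = sumL g l.
Proof.
  intros H. apply Rle_antisym; apply sumL_le; intros a Ha; rewrite H by assumption; lra.
Qed.

Lemma sumL_plus {A} (f g : A -> R) l : sumL (fun a => f a + g a) l = sumL f l + sumL g l.
Proof. induction l; simpl; lra. Qed.

Lemma sumL_scal {A} c (f : A -> R) l : sumL (fun a => c * f a) l = c * sumL f l.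
Proof. induction l; simpl; lra. Qed.

Lemma sumL_const {A} c (l : list A) : sumL (fun _ => c) l = INR (length l) * c.
Proof. induction l; simpl sumL; simpl length; rewrite ?S_INR; simpl; lra. Qed.

Lemma sumL_app {A} (f : A -> R) l l' : sumL f (l ++ l') = sumL f l + sumL f l'.
Proof. induction l; simpl; lra. Qed.

Lemma sumL_map {A B} (f : B -> R) (g : A -> B) l : sumL f (map g l) = sumL (fun a => f (g a)) l.
Proof. induction l; simpl; congruence. Qed.

Lemma sumL_incl {A} (f : A -> R) l l' : (forall a, 0 <= f a) -> NoDup l -> incl l l' ->
  sumL f l <= sumL f l'.
Proof.
  intros Hf. revert l'. induction l as [|a l IH]; intros l' Hn Hi; simpl.
  - apply sumL_nonneg, Hf.
  - inversion Hn as [|? ? Ha Hl]; subst.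
    destruct (in_split a l' (Hi a (or_introl eq_refl))) as (l1 & l2 & ->).
    assert (sumL f l <= sumL f (l1 ++ l2)).
    { apply IH; [assumption|]. intros x Hx.
      assert (In x (l1 ++ a :: l2)) as Hx' by (apply Hi; right; assumption).
      apply in_or_app. apply in_app_or in Hx'. destruct Hx' as [|[->|]]; auto. contradiction. }
    rewrite sumL_app in *. simpl. lra.
Qed.

Lemma sumL_list_prod {A B} (f : A * B -> R) la lb :
  sumL f (list_prod la lb) = sumL (fun a => sumL (fun b => f (a, b)) lb) la.
Proof.
  induction la as [|a la IH]; simpl; [reflexivity|].
  rewrite sumL_app, sumL_map, IH. reflexivity.
Qed.

Lemma NoDup_list_prod {A B} (la : list A) (lb : list B) :
  NoDup la -> NoDup lb -> NoDup (list_prod la lb).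
Proof.
  intros Ha Hb. induction Ha as [|a la Hna Ha IH]; simpl; [constructor|].
  apply NoDup_app.
  - apply FinFun.Injective_map_NoDup; [|assumption]. intros x y E. congruence.
  - assumption.
  - intros [x y] Hx Hy. apply in_map_iff in Hx as (z & E & _). injection E as <- <-.
    apply in_prod_iff in Hy. tauto.
Qed.

(** For nonnegative [f] this says that the unordered sum exists and is at most [K]. Nearly all
    estimates are stated in this form, which avoids infinite sums and enumerations of the index
    sets. *)
Definition SB {A : Type} (f : A -> R) (K : R) : Prop :=
  forall l, NoDup l -> sumL f l <= K.

Lemma SB_nonneg {A} (f : A -> R) K : SB f K -> 0 <= K.
Proof. intros H. apply (H nil). constructor. Qed.

Lemma SB_le {A} (f g : A -> R) K : (forall a, f a <= g a) -> SB g K -> SB f K.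
Proof. intros H Hg l Hl. eapply Rle_trans; [apply sumL_le; auto|apply Hg, Hl]. Qed.

Lemma SB_weaken {A} (f : A -> R) K K' : SB f K -> K <= K' -> SB f K'.
Proof. intros H HK l Hl. eapply Rle_trans; [apply H, Hl|assumption]. Qed.

Lemma SB_term {A} (f : A -> R) K a : SB f K -> f a <= K.
Proof.
  intros H. assert (NoDup [a]) as N by (constructor; [simpl; tauto|constructor]).
  specialize (H _ N). simpl in H. lra.
Qed.

Lemma SB_plus {A} (f g : A -> R) K K' : SB f K -> SB g K' -> SB (fun a => f a + g a) (K + K').
Proof. intros Hf Hg l Hl. rewrite sumL_plus. specialize (Hf l Hl). specialize (Hg l Hl). lra. Qed.

Lemma SB_scal {A} c (f : A -> R) K : 0 <= c -> SB f K -> SB (fun a => c * f a) (c * K).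
Proof. intros Hc Hf l Hl. rewrite sumL_scal. apply Rmult_le_compat_l; auto. Qed.

Lemma sumL_filter {A} (f : A -> R) (t : A -> bool) l : (forall a, t a = false -> f a = 0) ->
  sumL f (filter t l) = sumL f l.
Proof.
  intros H. induction l as [|a l IH]; simpl; [reflexivity|].
  destruct (t a) eqn:E; simpl; rewrite IH; [reflexivity|]. rewrite H by assumption. ring.
Qed.

Lemma NoDup_map_on {A B} (phi : A -> B) l : NoDup l ->
  (forall a a', In a l -> In a' l -> phi a = phi a' -> a = a') -> NoDup (map phi l).
Proof.
  intros Hn. induction Hn as [|a l Ha Hl IH]; simpl; intros H; constructor.
  - intros Hi. apply in_map_iff in Hi as (x & E & Hx).
    assert (x = a) by (apply H; auto). subst. contradiction.
  - apply IH. intros; apply H; auto.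
Qed.

(** Comparison along a change of indices. Domination and injectivity are required only on the
    support of [f], so constraints on the indices can be carried by factors [ind]. *)
Lemma SB_inj {A B} (phi : A -> B) (f : A -> R) (g : B -> R) K :
  (forall b, 0 <= g b) ->
  (forall a, f a <> 0 -> f a <= g (phi a)) ->
  (forall a a', f a <> 0 -> f a' <> 0 -> phi a = phi a' -> a = a') ->
  SB g K -> SB f K.
Proof.
  intros Hg Hfg Hi HS l Hl.
  set (t := fun a => if Req_dec_T (f a) 0 then false else true).
  assert (Ht : forall a, t a = true -> f a <> 0)
    by (intros a; unfold t; destruct (Req_dec_T (f a) 0); [discriminate|auto]).
  rewrite <- (sumL_filter f t l) by (intros a; unfold t; destruct (Req_dec_T (f a) 0); [auto|discriminate]).
  apply Rle_trans with (sumL g (map phi (filter t l))).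
  - rewrite sumL_map. apply sumL_le. intros a Ha. apply filter_In in Ha as [_ Ha]. auto.
  - apply HS. apply NoDup_map_on; [apply NoDup_filter, Hl|].
    intros a a' Ha Ha'. apply filter_In in Ha as [_ Ha]. apply filter_In in Ha' as [_ Ha']. auto.
Qed.

(** Tonelli: a finite set of pairs sits inside the product of its two projections, where the sum can
    be iterated. *)
Lemma SB_prod {A B} (f : A -> B -> R) (g : A -> R) K :
  (forall a b, 0 <= f a b) -> (forall a, SB (f a) (g a)) -> SB g K ->
  SB (fun x => f (fst x) (snd x)) K.
Proof.
  intros Hf H HK l Hl.
  set (la := nodup ceq (map fst l)). set (lb := nodup ceq (map snd l)).
  apply Rle_trans with (sumL (fun x => f (fst x) (snd x)) (list_prod la lb)).
  - apply sumL_incl; auto. intros [a b] Hab. apply in_prod_iff.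
    split; apply nodup_In; [apply (in_map fst _ _ Hab)|apply (in_map snd _ _ Hab)].
  - rewrite sumL_list_prod. simpl.
    apply Rle_trans with (sumL g la); [|apply HK, NoDup_nodup].
    apply sumL_le. intros a _. apply H, NoDup_nodup.
Qed.

(** Summation by the values of [pi], obtained from [SB_prod] through the graph [a |-> (pi a, a)]. *)
Lemma SB_fiber {A B} (pi : A -> B) (f : A -> R) (g : B -> R) K :
  (forall a, 0 <= f a) -> (forall b, SB (fun a => f a * ind (pi a = b)) (g b)) -> SB g K ->
  SB f K.
Proof.
  intros Hf H HK.
  apply (SB_inj (fun a => (pi a, a)) f (fun x => f (snd x) * ind (pi (snd x) = fst x))).
  - intros x. apply Rmult_le_pos; [apply Hf|apply ind_bound].
  - intros a _. simpl. rewrite ind_true by reflexivity. lra.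
  - congruence.
  - apply (SB_prod (fun b a => f a * ind (pi a = b)) g); auto.
    intros b a. apply Rmult_le_pos; [apply Hf|apply ind_bound].
Qed.

Lemma SB_mul_prod {A B} (f : A -> R) (g : B -> R) K K' :
  (forall a, 0 <= f a) -> (forall b, 0 <= g b) -> SB f K -> SB g K' ->
  SB (fun x => f (fst x) * g (snd x)) (K * K').
Proof.
  intros Hf Hg HK HK'.
  apply (SB_prod (fun a b => f a * g b) (fun a => f a * K')).
  - intros. apply Rmult_le_pos; auto.
  - intros a. apply SB_scal; auto.
  - intros l Hl. rewrite (sumL_ext _ (fun a => K' * f a)) by (intros; ring).
    rewrite sumL_scal, Rmult_comm. apply Rmult_le_compat_r; [eapply SB_nonneg; eauto|auto].
Qed.

(** * Unordered sums as suprema of finite sums *)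

Definition tsum {A : Type} (f : A -> R) : R :=
  real (Lub_Rbar (fun x => exists l, NoDup l /\ x = sumL f l)).

Lemma tsum_lub {A} (f : A -> R) K : SB f K ->
  is_lub_Rbar (fun x => exists l, NoDup l /\ x = sumL f l) (Finite (tsum f)).
Proof.
  intros H. unfold tsum.
  set (E := fun x => exists l, NoDup l /\ x = sumL f l).
  pose proof (Lub_Rbar_correct E) as [H1 H2].
  assert (L0 : Rbar_le (Finite 0) (Lub_Rbar E)) by (apply H1; exists nil; split; [constructor|reflexivity]).
  assert (LK : Rbar_le (Lub_Rbar E) (Finite K)).
  { apply H2. intros x (l & Hl & ->). apply H, Hl. }
  destruct (Lub_Rbar E) as [r| |] eqn:EL; simpl in *; try contradiction.
  split; assumption.
Qed.

Lemma tsum_SB {A} (f : A -> R) K : SB f K -> SB f (tsum f).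
Proof.
  intros H l Hl. destruct (tsum_lub f K H) as [H1 _].
  apply (H1 (sumL f l)). exists l; auto.
Qed.

Lemma tsum_le {A} (f : A -> R) K : SB f K -> tsum f <= K.
Proof.
  intros H. destruct (tsum_lub f K H) as [_ H2].
  apply (H2 (Finite K)). intros x (l & Hl & ->). apply H, Hl.
Qed.

Lemma tsum_approx {A} (f : A -> R) K eps : SB f K -> 0 < eps ->
  exists l, NoDup l /\ tsum f - eps < sumL f l.
Proof.
  intros H He. apply NNPP. intros N.
  assert (SB f (tsum f - eps)).
  { intros l Hl. apply Rnot_lt_le. intros Hlt. apply N. exists l; auto. }
  apply tsum_le in H0. lra.
Qed.

Lemma tsum_nonneg {A} (f : A -> R) K : SB f K -> 0 <= tsum f.
Proof. intros H. apply tsum_SB in H. eapply SB_nonneg; eauto. Qed.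

(** The inner sums are suprema, which finite lists only approach. Nearly optimal lists over distinct
    first coordinates are disjoint, so their union is an admissible list of pairs; the errors are
    halved at each step and add up to at most [eps]. *)
Lemma SB_prod_inv {A B} (f : A -> B -> R) K : (forall a b, 0 <= f a b) ->
  SB (fun x => f (fst x) (snd x)) K -> (forall a, SB (f a) K) /\ SB (fun a => tsum (f a)) K.
Proof.
  intros Hf H.
  assert (HA : forall a, SB (f a) K).
  { intros a. apply (SB_inj (fun b => (a, b)) (f a) (fun x => f (fst x) (snd x))); auto.
    - intros; simpl; lra.
    - congruence. }
  split; [assumption|].
  assert (G : forall la, NoDup la -> forall eps, 0 < eps -> exists l, NoDup l /\
     (forall x, In x l -> In (fst x) la) /\
     sumL (fun a => tsum (f a)) la - eps <= sumL (fun x => f (fst x) (snd x)) l).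
  { intros la Hla. induction Hla as [|a la Ha Hla IH]; intros eps He.
    - exists nil. simpl. split; [constructor|]. split; [tauto|lra].
    - destruct (IH (eps / 2)) as (l & Hl & Hin & Hs); [lra|].
      destruct (tsum_approx (f a) K (eps / 2) (HA a)) as (lb & Hlb & Hs2); [lra|].
      exists (map (pair a) lb ++ l). split; [|split].
      + apply NoDup_app; auto.
        * apply FinFun.Injective_map_NoDup; auto. intros ? ?; congruence.
        * intros x Hx Hx'. apply in_map_iff in Hx as (b & <- & _). apply Hin in Hx'. contradiction.
      + intros x Hx. apply in_app_or in Hx as [Hx|Hx].
        * apply in_map_iff in Hx as (b & <- & _). left; reflexivity.
        * right; auto.
      + rewrite sumL_app, sumL_map. simpl.
        change (sumL (fun b => f a b) lb) with (sumL (f a) lb). lra. }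
  intros la Hla. apply Rle_trans with (K); [|lra].
  apply Rnot_lt_le. intros Hlt.
  destruct (G la Hla ((sumL (fun a => tsum (f a)) la - K) / 2)) as (l & Hl & _ & Hs); [lra|].
  specialize (H l Hl). lra.
Qed.

(** Young's inequality after normalising [f] by [K^(1/p')] and [g] by [K'^(1/p)]. A vanishing bound
    cannot be normalised, but then the corresponding factor is 0 everywhere. *)
Lemma SB_holder {A} (f g : A -> R) K K' p p' : (forall a, 0 <= f a) -> (forall a, 0 <= g a) ->
  1 < p -> 1 < p' -> / p + / p' = 1 ->
  SB (fun a => rpow (f a) p') K -> SB (fun a => rpow (g a) p) K' ->
  SB (fun a => f a * g a) (rpow K (/ p') * rpow K' (/ p)).
Proof.
  intros Hf Hg Hp Hp' E HK HK'.
  pose proof (SB_nonneg _ _ HK) as K0. pose proof (SB_nonneg _ _ HK') as K0'.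
  destruct K0 as [K0|<-].
  2:{ intros l Hl. rewrite (sumL_ext _ (fun _ => 0)).
      - rewrite sumL_const, rpow_0. lra.
      - intros a _. pose proof (SB_term _ _ a HK) as Ha. simpl in Ha.
        rewrite (rpow_eq0 (f a) p'); [ring|auto|]. pose proof (rpow_nonneg (f a) p'). lra. }
  destruct K0' as [K0'|<-].
  2:{ intros l Hl. rewrite (sumL_ext _ (fun _ => 0)).
      - rewrite sumL_const, rpow_0. lra.
      - intros a _. pose proof (SB_term _ _ a HK') as Ha. simpl in Ha.
        rewrite (rpow_eq0 (g a) p); [ring|auto|]. pose proof (rpow_nonneg (g a) p). lra. }
  set (u := rpow K (/ p')). set (v := rpow K' (/ p)).
  assert (Hu : 0 < u) by (apply rpow_gt0; assumption).
  assert (Hv : 0 < v) by (apply rpow_gt0; assumption).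
  intros l Hl.
  apply Rle_trans with (u * v * sumL (fun a => / (p' * K) * rpow (f a) p' + / (p * K') * rpow (g a) p) l).
  - rewrite <- sumL_scal. apply sumL_le. intros a _.
    pose proof (young (/ u * f a) (/ v * g a) p p') as Y.
    assert (0 < / u) by (apply Rinv_0_lt_compat; assumption).
    assert (0 < / v) by (apply Rinv_0_lt_compat; assumption).
    specialize (Y ltac:(apply Rmult_le_pos; [lra|auto]) ltac:(apply Rmult_le_pos; [lra|auto]) Hp Hp' E).
    rewrite !rpow_mult in Y by (auto; lra).
    assert (E1 : rpow (/ u) p' = / K).
    { unfold u. rewrite <- rpow_opp, rpow_rpow. replace (- / p' * p') with (- (1)) by (field; lra).
      rewrite rpow_opp, rpow_1; lra. }
    assert (E2 : rpow (/ v) p = / K').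
    { unfold v. rewrite <- rpow_opp, rpow_rpow. replace (- / p * p) with (- (1)) by (field; lra).
      rewrite rpow_opp, rpow_1; lra. }
    rewrite E1, E2 in Y.
    replace (f a * g a) with (u * v * (/ u * f a * (/ v * g a))) by (field; lra).
    apply Rmult_le_compat_l; [nra|].
    replace (/ (p' * K) * rpow (f a) p' + / (p * K') * rpow (g a) p)
      with (/ K * rpow (f a) p' / p' + / K' * rpow (g a) p / p) by (field; lra).
    exact Y.
  - rewrite sumL_plus, !sumL_scal. rewrite <- (Rmult_1_r (u * v)) at 2.
    apply Rmult_le_compat_l; [nra|].
    specialize (HK l Hl). specialize (HK' l Hl). rewrite <- E, (Rplus_comm (/ p)).
    assert (0 < / (p' * K)) by (apply Rinv_0_lt_compat; nra).
    assert (0 < / (p * K')) by (apply Rinv_0_lt_compat; nra).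
    apply Rplus_le_compat.
    + apply Rle_trans with (/ (p' * K) * K); [apply Rmult_le_compat_l; lra|]. right; field; lra.
    + apply Rle_trans with (/ (p * K') * K'); [apply Rmult_le_compat_l; lra|]. right; field; lra.
Qed.

(** [f + g] is [K + K'] times a convex combination of [f / K] and [g / K'], and the [p]-th power is
    convex. The cases [K = 0] and [K' = 0] are separate for the same reason as in Hölder's
    inequality. *)
Lemma SB_minkowski {A} (f g : A -> R) K K' p : (forall a, 0 <= f a) -> (forall a, 0 <= g a) ->
  1 < p -> 0 <= K -> 0 <= K' ->
  SB (fun a => rpow (f a) p) (rpow K p) -> SB (fun a => rpow (g a) p) (rpow K' p) ->
  SB (fun a => rpow (f a + g a) p) (rpow (K + K') p).
Proof.
  intros Hf Hg Hp [K0|<-] [K0'|<-] HK HK'.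
  - set (r := K / (K + K')).
    assert (Hr : 0 <= r <= 1).
    { unfold r. split; [apply Rdiv_le_0_compat; lra|]. apply Rmult_le_reg_r with (K + K'); [lra|].
      unfold Rdiv. rewrite Rmult_assoc, Rinv_l; lra. }
    intros l Hl.
    apply Rle_trans with (rpow (K + K') p *
      sumL (fun a => r * (rpow (/ K) p * rpow (f a) p) + (1 - r) * (rpow (/ K') p * rpow (g a) p)) l).
    + rewrite <- sumL_scal. apply sumL_le. intros a _.
      assert (0 < / K) by (apply Rinv_0_lt_compat; assumption).
      assert (0 < / K') by (apply Rinv_0_lt_compat; assumption).
      replace (f a + g a) with ((K + K') * (r * (/ K * f a) + (1 - r) * (/ K' * g a)))
        by (unfold r; field; lra).
      assert (0 <= / K * f a) by (apply Rmult_le_pos; [lra|auto]).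
      assert (0 <= / K' * g a) by (apply Rmult_le_pos; [lra|auto]).
      rewrite rpow_mult by (try nra).
      apply Rmult_le_compat_l; [apply rpow_nonneg|].
      rewrite <- !rpow_mult by (auto; lra). apply rpow_convex; assumption.
    + rewrite sumL_plus, !sumL_scal. rewrite <- (Rmult_1_r (rpow (K + K') p)) at 2.
      apply Rmult_le_compat_l; [apply rpow_nonneg|].
      specialize (HK l Hl). specialize (HK' l Hl).
      assert (E : forall k, 0 < k -> rpow (/ k) p * rpow k p = 1).
      { intros k Hk. assert (0 < / k) by (apply Rinv_0_lt_compat; assumption).
        rewrite <- rpow_mult, Rinv_l, rpow_one by lra. reflexivity. }
      apply Rle_trans with (r * (rpow (/ K) p * rpow K p) + (1 - r) * (rpow (/ K') p * rpow K' p)).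
      * apply Rplus_le_compat; (apply Rmult_le_compat_l; [lra|]);
          (apply Rmult_le_compat_l; [apply rpow_nonneg|assumption]).
      * rewrite !E by assumption. lra.
  - rewrite Rplus_0_r. apply (SB_le _ (fun a => rpow (f a) p)); [|assumption].
    intros a. pose proof (SB_term _ _ a HK') as Ha. simpl in Ha. rewrite rpow_0 in Ha.
    rewrite (rpow_eq0 (g a) p); [rewrite Rplus_0_r; lra|auto|]. pose proof (rpow_nonneg (g a) p). lra.
  - rewrite Rplus_0_l. apply (SB_le _ (fun a => rpow (g a) p)); [|assumption].
    intros a. pose proof (SB_term _ _ a HK) as Ha. simpl in Ha. rewrite rpow_0 in Ha.
    rewrite (rpow_eq0 (f a) p); [rewrite Rplus_0_l; lra|auto|]. pose proof (rpow_nonneg (f a) p). lra.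
  - rewrite Rplus_0_r. apply (SB_le _ (fun a => rpow (f a) p)); [|assumption].
    intros a. pose proof (SB_term _ _ a HK') as Ha. simpl in Ha. rewrite rpow_0 in Ha.
    rewrite (rpow_eq0 (g a) p); [rewrite Rplus_0_r; lra|auto|]. pose proof (rpow_nonneg (g a) p). lra.
Qed.

(** * Unconditional sums of complex families *)

Fixpoint sumC {A : Type} (f : A -> C) (l : list A) : C :=
  match l with nil => RtoC 0 | a :: l' => (f a + sumC f l')%C end.

Lemma sumC_mod {A} (f : A -> C) l : Cmod (sumC f l) <= sumL (fun a => Cmod (f a)) l.
Proof.
  induction l as [|a l IH]; simpl.
  - rewrite Cmod_0. lra.
  - eapply Rle_trans; [apply Cmod_triangle|]. lra.
Qed.

Lemma sumC_ext {A} (f g : A -> C) l : (forall a, In a l -> f a = g a) -> sumC f l = sumC g l.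
Proof.
  induction l as [|a l IH]; simpl; intros H; [reflexivity|].
  rewrite (H a), IH; auto.
Qed.

Lemma sumC_plus {A} (f g : A -> C) l :
  sumC (fun a => (f a + g a)%C) l = (sumC f l + sumC g l)%C.
Proof. induction l as [|a l IH]; simpl; [|rewrite IH]; ring. Qed.

Lemma sumC_scal {A} c (f : A -> C) l : sumC (fun a => (c * f a)%C) l = (c * sumC f l)%C.
Proof. induction l as [|a l IH]; simpl; [|rewrite IH]; ring. Qed.

Lemma sumC_app {A} (f : A -> C) l l' : sumC f (l ++ l') = (sumC f l + sumC f l')%C.
Proof. induction l as [|a l IH]; simpl; [|rewrite IH]; ring. Qed.

Lemma sumC_map {A B} (f : B -> C) (g : A -> B) l : sumC f (map g l) = sumC (fun a => f (g a)) l.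
Proof. induction l; simpl; congruence. Qed.

Lemma sumC_filter {A} (f : A -> C) (t : A -> bool) l : (forall a, t a = false -> f a = RtoC 0) ->
  sumC f (filter t l) = sumC f l.
Proof.
  intros H. induction l as [|a l IH]; simpl; [reflexivity|].
  destruct (t a) eqn:E; simpl; rewrite IH; [reflexivity|]. rewrite H by assumption. ring.
Qed.

Lemma sumC_list_prod {A B} (f : A * B -> C) la lb :
  sumC f (list_prod la lb) = sumC (fun a => sumC (fun b => f (a, b)) lb) la.
Proof.
  induction la as [|a la IH]; simpl; [reflexivity|].
  rewrite sumC_app, sumC_map, IH. reflexivity.
Qed.

Lemma sumC_RtoC {A} (f : A -> R) l : sumC (fun a => RtoC (f a)) l = RtoC (sumL f l).
Proof. induction l as [|a l IH]; simpl; [reflexivity|]. rewrite IH, RtoC_plus. reflexivity. Qed.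

(** Convergence along the directed set of finite subsets, that is, unconditional convergence; no
    order on the index set is involved. *)
Definition HasSum {A : Type} (f : A -> C) (S : C) : Prop :=
  forall eps, 0 < eps -> exists l0, forall l, NoDup l -> incl l0 l -> Cmod (sumC f l - S) <= eps.

Lemma Cmod_sub_swap x y : Cmod (x - y) = Cmod (y - x).
Proof. rewrite <- Cmod_opp. f_equal. ring. Qed.

Lemma Cmod_sub_tri x y z : Cmod (x - z) <= Cmod (x - y) + Cmod (y - z).
Proof. replace (x - z)%C with ((x - y) + (y - z))%C by ring. apply Cmod_triangle. Qed.

Lemma Ceq_eps x y : (forall eps, 0 < eps -> Cmod (x - y) <= eps) -> x = y.
Proof.
  intros H. destruct (Rle_lt_dec (Cmod (x - y)) 0) as [H0|H0].
  - assert (E : (x - y)%C = RtoC 0) by (apply Cmod_eq_0; pose proof (Cmod_ge_0 (x - y)); lra).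
    replace x with ((x - y) + y)%C by ring. rewrite E. ring.
  - specialize (H (Cmod (x - y) / 2) ltac:(lra)). lra.
Qed.

Lemma HasSum_unique {A} (f : A -> C) S S' : HasSum f S -> HasSum f S' -> S = S'.
Proof.
  intros H H'. apply Ceq_eps. intros eps He.
  destruct (H (eps / 2) ltac:(lra)) as [l0 H0]. destruct (H' (eps / 2) ltac:(lra)) as [l1 H1].
  set (l := nodup ceq (l0 ++ l1)).
  assert (Hn : NoDup l) by apply NoDup_nodup.
  assert (I0 : incl l0 l) by (intros x Hx; apply nodup_In, in_or_app; auto).
  assert (I1 : incl l1 l) by (intros x Hx; apply nodup_In, in_or_app; auto).
  specialize (H0 l Hn I0). specialize (H1 l Hn I1).
  eapply Rle_trans; [apply (Cmod_sub_tri _ (sumC f l))|]. rewrite Cmod_sub_swap. lra.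
Qed.

Lemma HasSum_plus {A} (f g : A -> C) S S' : HasSum f S -> HasSum g S' ->
  HasSum (fun a => (f a + g a)%C) (S + S')%C.
Proof.
  intros H H' eps He.
  destruct (H (eps / 2) ltac:(lra)) as [l0 H0]. destruct (H' (eps / 2) ltac:(lra)) as [l1 H1].
  exists (l0 ++ l1). intros l Hn Hi. rewrite sumC_plus.
  replace (sumC f l + sumC g l - (S + S'))%C with ((sumC f l - S) + (sumC g l - S'))%C by ring.
  eapply Rle_trans; [apply Cmod_triangle|].
  assert (Cmod (sumC f l - S) <= eps / 2) by (apply H0; auto; intros x Hx; apply Hi, in_or_app; auto).
  assert (Cmod (sumC g l - S') <= eps / 2) by (apply H1; auto; intros x Hx; apply Hi, in_or_app; auto).
  lra.
Qed.

Lemma HasSum_scal {A} c (f : A -> C) S : HasSum f S -> HasSum (fun a => (c * f a)%C) (c * S)%C.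
Proof.
  intros H eps He. pose proof (Cmod_ge_0 c) as Hc.
  destruct (H (eps / (Cmod c + 1)) ltac:(apply Rdiv_lt_0_compat; lra)) as [l0 H0].
  exists l0. intros l Hn Hi. specialize (H0 l Hn Hi). rewrite sumC_scal.
  replace (c * sumC f l - c * S)%C with (c * (sumC f l - S))%C by ring.
  rewrite Cmod_mult. set (x := Cmod (sumC f l - S)) in *.
  apply Rle_trans with ((Cmod c + 1) * (eps / (Cmod c + 1))).
  - apply Rmult_le_compat; try lra. apply Cmod_ge_0.
  - right; field; lra.
Qed.

Lemma HasSum_tsum {A} (f : A -> R) K : (forall a, 0 <= f a) -> SB f K ->
  HasSum (fun a => RtoC (f a)) (RtoC (tsum f)).
Proof.
  intros Hf H eps He. destruct (tsum_approx f K eps H He) as (l0 & Hl0 & Hs).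
  exists l0. intros l Hn Hi. rewrite sumC_RtoC, <- RtoC_minus, Cmod_R.
  pose proof (sumL_incl f l0 l Hf Hl0 Hi). pose proof (tsum_SB f K H l Hn).
  apply Rabs_le. lra.
Qed.

Lemma HasSum_ext {A} (f g : A -> C) S : (forall a, f a = g a) -> HasSum f S -> HasSum g S.
Proof. intros E. replace g with f; [auto|]. apply functional_extensionality, E. Qed.

(** Reduces to nonnegative families: the positive and negative parts of the real and imaginary parts
    are all dominated by [Cmod (f a)]. *)
Lemma HasSum_exists {A} (f : A -> C) K : SB (fun a => Cmod (f a)) K -> exists S, HasSum f S.
Proof.
  intros H.
  assert (G : forall h : A -> R, (forall a, Rabs (h a) <= Cmod (f a)) ->
            exists S, HasSum (fun a => RtoC (h a)) S).
  { intros h Hh.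
    set (h1 := fun a => Rmax (h a) 0). set (h2 := fun a => Rmax (- h a) 0).
    assert (B1 : SB h1 K).
    { apply (SB_le _ (fun a => Cmod (f a))); [|assumption]. intros a. unfold h1.
      specialize (Hh a). pose proof (Rle_abs (h a)). pose proof (Cmod_ge_0 (f a)).
      apply Rmax_lub; lra. }
    assert (B2 : SB h2 K).
    { apply (SB_le _ (fun a => Cmod (f a))); [|assumption]. intros a. unfold h2.
      specialize (Hh a). pose proof (Rle_abs (- h a)). rewrite Rabs_Ropp in H0.
      pose proof (Cmod_ge_0 (f a)). apply Rmax_lub; lra. }
    assert (P1 : forall a, 0 <= h1 a) by (intros; apply Rmax_r).
    assert (P2 : forall a, 0 <= h2 a) by (intros; apply Rmax_r).
    exists (RtoC (tsum h1) + RtoC (-1) * RtoC (tsum h2))%C.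
    apply (HasSum_ext (fun a => RtoC (h1 a) + RtoC (-1) * RtoC (h2 a))%C).
    - intros a. rewrite <- RtoC_mult, <- RtoC_plus. f_equal. unfold h1, h2.
      unfold Rmax. destruct (Rle_dec (h a) 0), (Rle_dec (- h a) 0); lra.
    - apply HasSum_plus; [|apply HasSum_scal]; eapply HasSum_tsum; eauto. }
  assert (M : forall z : C, Rabs (fst z) <= Cmod z /\ Rabs (snd z) <= Cmod z).
  { intros z. pose proof (Rmax_Cmod z). split; eapply Rle_trans; try exact H0; [apply Rmax_l|apply Rmax_r]. }
  destruct (G (fun a => fst (f a))) as [S1 H1]; [intros; apply M|].
  destruct (G (fun a => snd (f a))) as [S2 H2]; [intros; apply M|].
  exists (S1 + Ci * S2)%C.
  apply (HasSum_ext (fun a => RtoC (fst (f a)) + Ci * RtoC (snd (f a)))%C).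
  - intros a. destruct (f a) as [x y]. unfold RtoC, Ci, Cplus, Cmult. simpl. f_equal; ring.
  - apply HasSum_plus; [|apply HasSum_scal]; assumption.
Qed.

(** A choice of sum, meaningful only when one exists; this is why the rules for it carry [SB]
    hypotheses. *)
Definition csum {A : Type} (f : A -> C) : C := epsilon (inhabits (RtoC 0)) (HasSum f).

Lemma csum_HasSum {A} (f : A -> C) K : SB (fun a => Cmod (f a)) K -> HasSum f (csum f).
Proof. intros H. unfold csum. apply epsilon_spec. eapply HasSum_exists; eauto. Qed.

Lemma csum_eq {A} (f : A -> C) S : HasSum f S -> csum f = S.
Proof.
  intros H. apply (HasSum_unique f); [|assumption]. unfold csum. apply epsilon_spec. exists S; assumption.
Qed.

Lemma csum_ext {A} (f g : A -> C) : (forall a, f a = g a) -> csum f = csum g.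
Proof. intros H. f_equal. apply functional_extensionality, H. Qed.

Lemma HasSum_bound {A} (f : A -> C) S K : HasSum f S -> SB (fun a => Cmod (f a)) K -> Cmod S <= K.
Proof.
  intros HS HK. apply Rnot_lt_le. intros Hlt.
  destruct (HS ((Cmod S - K) / 2) ltac:(lra)) as [l0 H0].
  specialize (H0 (nodup ceq l0) (NoDup_nodup _ _) ltac:(intros x Hx; apply nodup_In, Hx)).
  specialize (HK (nodup ceq l0) (NoDup_nodup _ _)).
  pose proof (sumC_mod f (nodup ceq l0)).
  assert (Cmod S <= Cmod (S - sumC f (nodup ceq l0)) + Cmod (sumC f (nodup ceq l0))).
  { replace S with ((S - sumC f (nodup ceq l0)) + sumC f (nodup ceq l0))%C at 1 by ring. apply Cmod_triangle. }
  rewrite Cmod_sub_swap in H1. lra.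
Qed.

Lemma csum_bound {A} (f : A -> C) K : SB (fun a => Cmod (f a)) K -> Cmod (csum f) <= K.
Proof. intros H. eapply HasSum_bound; [eapply csum_HasSum|]; eauto. Qed.

Lemma csum_plus {A} (f g : A -> C) K K' : SB (fun a => Cmod (f a)) K -> SB (fun a => Cmod (g a)) K' ->
  csum (fun a => (f a + g a)%C) = (csum f + csum g)%C.
Proof. intros H H'. apply csum_eq, HasSum_plus; eapply csum_HasSum; eauto. Qed.

Lemma csum_scal {A} c (f : A -> C) K : SB (fun a => Cmod (f a)) K ->
  csum (fun a => (c * f a)%C) = (c * csum f)%C.
Proof. intros H. apply csum_eq, HasSum_scal; eapply csum_HasSum; eauto. Qed.

Lemma csum_minus {A} (f g : A -> C) K K' : SB (fun a => Cmod (f a)) K -> SB (fun a => Cmod (g a)) K' ->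
  csum (fun a => (f a - g a)%C) = (csum f - csum g)%C.
Proof.
  intros H H'. apply csum_eq.
  apply (HasSum_ext (fun a => f a + RtoC (-1) * g a)%C).
  - intros a. ring.
  - replace (csum f - csum g)%C with (csum f + RtoC (-1) * csum g)%C by ring.
    apply HasSum_plus; [|apply HasSum_scal]; eapply csum_HasSum; eauto.
Qed.

Lemma csum_single {A} (f : A -> C) a0 : (forall a, a <> a0 -> f a = RtoC 0) -> csum f = f a0.
Proof.
  intros H. apply csum_eq. intros eps He. exists [a0]. intros l Hn Hi.
  assert (E : sumC f l = f a0).
  { destruct (in_split a0 l (Hi a0 (or_introl eq_refl))) as (l1 & l2 & ->).
    apply NoDup_remove_2 in Hn.
    rewrite sumC_app. simpl.
    assert (Z : forall l', ~ In a0 l' -> sumC f l' = RtoC 0).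
    { induction l' as [|b l' IH]; simpl; [reflexivity|]. intros Hb.
      rewrite IH, H by tauto. ring. }
    rewrite !Z by (intros Hx; apply Hn, in_or_app; auto). ring. }
  rewrite E. unfold Cminus. rewrite Cplus_opp_r, Cmod_0. lra.
Qed.

Lemma SB_tail {A} (f : A -> R) K eps : (forall a, 0 <= f a) -> SB f K -> 0 < eps ->
  exists l0, NoDup l0 /\ SB (fun a => if in_dec ceq a l0 then 0 else f a) eps.
Proof.
  intros Hf H He. destruct (tsum_approx f K eps H He) as (l0 & Hl0 & Hs).
  exists l0. split; [assumption|]. intros l Hl.
  set (t := fun a => if in_dec ceq a l0 then false else true).
  set (g := fun a => if in_dec ceq a l0 then 0 else f a).
  rewrite <- (sumL_filter g t) by (intros a; unfold t, g; destruct (in_dec ceq a l0); [auto|discriminate]).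
  assert (Hd : NoDup (l0 ++ filter t l)).
  { apply NoDup_app; auto using NoDup_filter. intros a Ha Hb. apply filter_In in Hb as [_ Hb].
    unfold t in Hb. destruct (in_dec ceq a l0); [discriminate|contradiction]. }
  pose proof (tsum_SB f K H _ Hd) as Hb. rewrite sumL_app in Hb.
  assert (sumL g (filter t l) <= sumL f (filter t l)).
  { apply sumL_le. intros a _. unfold g. destruct (in_dec ceq a l0); [apply Hf|lra]. }
  lra.
Qed.

(** For a fixed list [la] the inner sums are approximated simultaneously by sums over one list [lb].
    Enlarging [lb] makes the product of [la] and [lb] contain the list demanded by the convergence
    of the double sum. *)
Lemma HasSum_fubini {A B} (f : A -> B -> C) K S :
  SB (fun x => Cmod (f (fst x) (snd x))) K -> HasSum (fun x => f (fst x) (snd x)) S ->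
  HasSum (fun a => csum (f a)) S.
Proof.
  intros HK HS eps He.
  destruct (SB_prod_inv (fun a b => Cmod (f a b)) K) as [HA _]; auto.
  { intros; apply Cmod_ge_0. }
  destruct (HS (eps / 2) ltac:(lra)) as [l0 H0].
  exists (map fst l0). intros la Hn Hi.
  assert (HB : forall e, 0 < e -> exists lb0, forall lb, NoDup lb -> incl lb0 lb ->
     Cmod (sumC (fun a => csum (f a)) la - sumC (fun a => sumC (f a) lb) la) <= e).
  { clear Hn Hi. induction la as [|a la IH]; intros e Hep.
    - exists nil. intros. simpl. unfold Cminus. rewrite Cplus_opp_r, Cmod_0. lra.
    - destruct (IH (e / 2) ltac:(lra)) as [lb0 Hb0].
      destruct (csum_HasSum (f a) K (HA a) (e / 2) ltac:(lra)) as [lb1 Hb1].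
      exists (lb0 ++ lb1). intros lb Hlb Hi. simpl.
      replace (csum (f a) + sumC (fun a0 => csum (f a0)) la - (sumC (f a) lb + sumC (fun a0 => sumC (f a0) lb) la))%C
        with ((csum (f a) - sumC (f a) lb) + (sumC (fun a0 => csum (f a0)) la - sumC (fun a0 => sumC (f a0) lb) la))%C by ring.
      eapply Rle_trans; [apply Cmod_triangle|].
      specialize (Hb0 lb Hlb ltac:(intros x Hx; apply Hi, in_or_app; auto)).
      specialize (Hb1 lb Hlb ltac:(intros x Hx; apply Hi, in_or_app; auto)).
      rewrite Cmod_sub_swap in Hb1. lra. }
  destruct (HB (eps / 2) ltac:(lra)) as [lb0 Hlb0].
  set (lb := nodup ceq (lb0 ++ map snd l0)).
  assert (Nb : NoDup lb) by apply NoDup_nodup.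
  specialize (Hlb0 lb Nb ltac:(intros x Hx; apply nodup_In, in_or_app; auto)).
  specialize (H0 (list_prod la lb) (NoDup_list_prod _ _ Hn Nb)).
  rewrite sumC_list_prod in H0. simpl in H0.
  assert (Hi0 : incl l0 (list_prod la lb)).
  { intros [a b] Hab. apply in_prod_iff. split.
    - apply Hi. apply (in_map fst _ _ Hab).
    - apply nodup_In, in_or_app. right. apply (in_map snd _ _ Hab). }
  specialize (H0 Hi0).
  eapply Rle_trans; [apply (Cmod_sub_tri _ (sumC (fun a => sumC (f a) lb) la))|].
  change (sumC (fun a => sumC (fun b => f a b) lb) la) with (sumC (fun a => sumC (f a) lb) la) in H0. lra.
Qed.

Lemma csum_fubini {A B} (f : A -> B -> C) K :
  SB (fun x => Cmod (f (fst x) (snd x))) K ->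
  csum (fun x => f (fst x) (snd x)) = csum (fun a => csum (f a)).
Proof.
  intros HK. symmetry. apply csum_eq. eapply HasSum_fubini; eauto. eapply (csum_HasSum (fun x => f (fst x) (snd x))); eauto.
Qed.

(** [phi] may miss indices, but only where [f] vanishes; and since it is injective, the list
    required for [f] pulls back to a finite list. *)
Lemma HasSum_inj {A B} (phi : A -> B) (f : B -> C) S :
  (forall a a', phi a = phi a' -> a = a') -> (forall b, f b <> RtoC 0 -> exists a, phi a = b) ->
  HasSum f S -> HasSum (fun a => f (phi a)) S.
Proof.
  intros Hi Hs H eps He. destruct (H eps He) as [l0 H0].
  assert (G : exists l1, forall a, In (phi a) l0 -> In a l1).
  { clear H0. induction l0 as [|b l0 [l1 IH]].
    - exists nil. intros a [].
    - destruct (classic (exists a, phi a = b)) as [[a <-]|N].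
      + exists (a :: l1). intros a' [E|Hin]; [left; apply Hi; auto|right; auto].
      + exists l1. intros a [E|Hin]; [exfalso; apply N; eauto|auto]. }
  destruct G as [l1 H1].
  exists l1. intros l Hn Hincl.
  set (t := fun b => if in_dec ceq b (map phi l) then false else true).
  set (l2 := nodup ceq l0).
  specialize (H0 (map phi l ++ filter t l2)).
  assert (N : NoDup (map phi l ++ filter t l2)).
  { apply NoDup_app.
    - apply FinFun.Injective_map_NoDup; auto.
    - apply NoDup_filter, NoDup_nodup.
    - intros b Hb Hb'. apply filter_In in Hb' as [_ Hb']. unfold t in Hb'.
      destruct (in_dec ceq b (map phi l)); [discriminate|contradiction]. }
  assert (I : incl l0 (map phi l ++ filter t l2)).
  { intros b Hb. apply in_or_app. destruct (in_dec ceq b (map phi l)) as [Hm|Hm]; [left; auto|right].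
    apply filter_In. split; [apply nodup_In, Hb|]. unfold t. destruct (in_dec ceq b (map phi l)); tauto. }
  specialize (H0 N I). rewrite sumC_app, sumC_map in H0.
  assert (Z : sumC f (filter t l2) = RtoC 0).
  { rewrite (sumC_ext _ (fun _ => RtoC 0)).
    - clear. induction (filter t l2) as [|b m IH]; simpl; [reflexivity|]. rewrite IH. ring.
    - intros b Hb. apply filter_In in Hb as [Hb Ht]. apply NNPP. intros Nz.
      destruct (Hs b Nz) as [a <-].
      unfold t in Ht. destruct (in_dec ceq (phi a) (map phi l)) as [|Hm]; [discriminate|].
      apply Hm, in_map, Hincl, H1. unfold l2 in Hb. apply nodup_In in Hb. exact Hb. }
  rewrite Z in H0. rewrite Cplus_0_r in H0. exact H0.
Qed.

Lemma csum_inj {A B} (phi : A -> B) (f : B -> C) K :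
  (forall a a', phi a = phi a' -> a = a') -> (forall b, f b <> RtoC 0 -> exists a, phi a = b) ->
  SB (fun b => Cmod (f b)) K -> csum (fun a => f (phi a)) = csum f.
Proof. intros Hi Hs HK. apply csum_eq, HasSum_inj; auto. eapply csum_HasSum; eauto. Qed.

Lemma csum_conj {A} (f : A -> C) K : SB (fun a => Cmod (f a)) K ->
  csum (fun a => Cconj (f a)) = Cconj (csum f).
Proof.
  intros H. apply csum_eq. intros eps He.
  destruct (csum_HasSum f K H eps He) as [l0 H0]. exists l0. intros l Hn Hi.
  specialize (H0 l Hn Hi).
  assert (E : sumC (fun a => Cconj (f a)) l = Cconj (sumC f l)).
  { clear. induction l as [|a l IH]; simpl.
    - unfold Cconj, RtoC. simpl. rewrite Ropp_0. reflexivity.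
    - rewrite IH. symmetry. apply Cplus_conj. }
  rewrite E, <- Cminus_conj, Cmod_conj. exact H0.
Qed.

(** * Lattice sums *)

(** Discrete form of comparing [(b-1) t^(-b)] with its integral over [[x, x+1]], so that sums
    telescope. After factoring out [(x+1)^(1-b)] it reads [((x+1)/x)^(b-1) >= 1 + (b-1)/(x+1)],
    which follows from [e^y >= 1 + y] and [ln y <= y - 1]. *)
Lemma rpow_telescope x b : 1 < b -> 0 < x ->
  (b - 1) * rpow (x + 1) (- b) <= rpow x (1 - b) - rpow (x + 1) (1 - b).
Proof.
  intros Hb Hx.
  assert (E : rpow (x + 1) (1 - b) = rpow (x + 1) (- b) * (x + 1)).
  { rewrite <- (rpow_1 (x + 1)) at 3 by lra. rewrite <- rpow_plus. f_equal; ring. }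
  assert (E2 : rpow x (1 - b) = rpow (x + 1) (1 - b) * rpow ((x + 1) / x) (b - 1)).
  { unfold Rdiv. rewrite rpow_mult by (try (left; apply Rinv_0_lt_compat); lra).
    replace (rpow (/ x) (b - 1)) with (rpow x (1 - b)).
    2:{ replace (1 - b) with (- (b - 1)) by ring. rewrite <- (rpow_1 x) at 2 by lra.
        rewrite <- rpow_opp, rpow_rpow. f_equal; ring. }
    rewrite <- Rmult_assoc, <- rpow_plus. replace (1 - b + (b - 1)) with 0 by ring.
    rewrite rpow_x0 by lra. ring. }
  assert (Hu : 0 < (x + 1) / x) by (apply Rdiv_lt_0_compat; lra).
  assert (L : 1 + (b - 1) * / (x + 1) <= rpow ((x + 1) / x) (b - 1)).
  { rewrite rpow_pos_eq by assumption. unfold Rpower.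
    eapply Rle_trans; [|apply exp_ineq1_le]. apply Rplus_le_compat_l.
    apply Rmult_le_compat_l; [lra|].
    pose proof (ln_le_sub1 (/ ((x + 1) / x)) (Rinv_0_lt_compat _ Hu)) as H.
    rewrite ln_Rinv in H by assumption.
    replace (/ ((x + 1) / x) - 1) with (- / (x + 1)) in H by (field; lra). lra. }
  rewrite E2. pose proof (rpow_gt0 (x + 1) (- b)) as P. specialize (P ltac:(lra)).
  apply Rmult_le_compat_l with (r := rpow (x + 1) (1 - b)) in L; [|apply rpow_nonneg].
  rewrite Rmult_plus_distr_l, Rmult_1_r in L. rewrite E in L at 2.
  replace (rpow (x + 1) (- b) * (x + 1) * ((b - 1) * / (x + 1))) with ((b - 1) * rpow (x + 1) (- b))
    in L by (field; lra). lra.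
Qed.

Lemma sum_nat_bound b : 1 < b -> SB (fun i : nat => rpow (INR i + 1) (- b)) (1 + / (b - 1)).
Proof.
  intros Hb.
  assert (Hi : 0 < / (b - 1)) by (apply Rinv_0_lt_compat; lra).
  assert (G : forall N, sumL (fun i : nat => rpow (INR i + 1) (- b)) (seq 0 (S N))
                <= 1 + / (b - 1) - / (b - 1) * rpow (INR N + 1) (1 - b)).
  { induction N as [|N IH].
    - simpl. rewrite Rplus_0_l, !rpow_one. lra.
    - rewrite seq_S, sumL_app. rewrite S_INR in *. simpl in *.
      pose proof (pos_INR N).
      pose proof (rpow_telescope (INR N + 1) b Hb ltac:(lra)) as T.
      apply Rmult_le_compat_l with (r := / (b - 1)) in T; [|lra].
      rewrite <- Rmult_assoc, Rinv_l, Rmult_1_l in T by lra.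
      change (match N with 0%nat => 1 | S _ => INR N + 1 end) with (INR (S N)). rewrite S_INR. lra. }
  intros l Hl.
  set (N := list_max l).
  apply Rle_trans with (sumL (fun i : nat => rpow (INR i + 1) (- b)) (seq 0 (S N))).
  - apply sumL_incl; auto using rpow_nonneg. intros x Hx. apply in_seq.
    assert (x <= N)%nat; [|lia]. unfold N.
    pose proof (proj1 (list_max_le l (list_max l)) (le_n _)) as F. rewrite Forall_forall in F. auto.
  - specialize (G N). pose proof (rpow_nonneg (INR N + 1) (1 - b)). nra.
Qed.

Lemma sum_Z_bound b : 1 < b ->
  SB (fun k : Z => rpow (1 + Rabs (IZR k)) (- b)) (2 * (1 + / (b - 1))).
Proof.
  intros Hb. pose proof (sum_nat_bound b Hb) as H.
  assert (E : forall k, 1 + Rabs (IZR k) = INR (Z.abs_nat k) + 1).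
  { intros k. rewrite INR_IZR_INZ, Zabs2Nat.id_abs, abs_IZR. ring. }
  assert (G : forall P : Z -> Prop, (forall k k', P k -> P k' -> Z.abs_nat k = Z.abs_nat k' -> k = k') ->
    SB (fun k : Z => rpow (1 + Rabs (IZR k)) (- b) * ind (P k)) (1 + / (b - 1))).
  { intros P HP. apply (SB_inj Z.abs_nat _ (fun i : nat => rpow (INR i + 1) (- b))); auto using rpow_nonneg.
    - intros k _. rewrite E. pose proof (ind_bound (P k)). pose proof (rpow_nonneg (INR (Z.abs_nat k) + 1) (- b)). nra.
    - intros k k' Hk Hk'. apply HP; apply NNPP; intros N.
      + apply Hk. rewrite ind_false by assumption. ring.
      + apply Hk'. rewrite ind_false by assumption. ring. }
  replace (2 * (1 + / (b - 1))) with ((1 + / (b - 1)) + (1 + / (b - 1))) by ring.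
  apply (SB_le _ (fun k => rpow (1 + Rabs (IZR k)) (- b) * ind (0 <= k)%Z +
                           rpow (1 + Rabs (IZR k)) (- b) * ind (k < 0)%Z)).
  - intros k. destruct (Z_lt_le_dec k 0).
    + rewrite (ind_false (0 <= k)%Z), (ind_true (k < 0)%Z) by lia. lra.
    + rewrite (ind_true (0 <= k)%Z), (ind_false (k < 0)%Z) by lia. lra.
  - apply SB_plus; apply G; intros; lia.
Qed.

(** * Lattice geometry: norms, primitive directions and lines *)

Definition zadd (P Q : Z2) : Z2 := (fst P + fst Q, snd P + snd Q)%Z.

Definition nrm (P : Z2) : Z := Z.max (Z.abs (fst P)) (Z.abs (snd P)).

(** An integer-valued substitute for the bracket, so that comparisons of size on the lattice are
    left to integer arithmetic. *)
Definition J (P : Z2) : R := IZR (1 + nrm P).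

Lemma J_ge1 P : 1 <= J P.
Proof. unfold J. apply IZR_le. unfold nrm. lia. Qed.

Lemma J_fst P : 1 + Rabs (IZR (fst P)) <= J P.
Proof. unfold J. rewrite plus_IZR, <- abs_IZR. apply Rplus_le_compat_l, IZR_le. unfold nrm. lia. Qed.

Lemma J_snd P : 1 + Rabs (IZR (snd P)) <= J P.
Proof. unfold J. rewrite plus_IZR, <- abs_IZR. apply Rplus_le_compat_l, IZR_le. unfold nrm. lia. Qed.

Lemma Rabs1_pos x : 1 <= 1 + Rabs x.
Proof. pose proof (Rabs_pos x). lra. Qed.

(** [J] dominates both coordinates, so half of the exponent goes to each and the double sum
    splits. *)
Lemma sum_Z2_bound g : 2 < g -> exists K, SB (fun P => rpow (J P) (- g)) K.
Proof.
  intros Hg. pose proof (sum_Z_bound (g / 2) ltac:(lra)) as H.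
  eexists. eapply SB_le; [|exact (SB_mul_prod _ _ _ _ (fun k => rpow_nonneg _ _) (fun k => rpow_nonneg _ _) H H)].
  intros P. simpl. replace (- g) with (- (g / 2) + - (g / 2)) by lra. rewrite rpow_plus.
  pose proof (J_fst P). pose proof (J_snd P). pose proof (Rabs1_pos (IZR (fst P))).
  pose proof (Rabs1_pos (IZR (snd P))).
  apply Rmult_le_compat; try apply rpow_nonneg; apply rpow_neg_le; lra.
Qed.

Lemma SB_shift (f : Z2 -> R) K n : (forall P, 0 <= f P) -> SB f K -> SB (fun P => f (zadd n P)) K.
Proof.
  intros Hf H. apply (SB_inj (zadd n) _ f); auto; try (intros; lra).
  intros [a b] [c d] _ _. unfold zadd. simpl. intros E. injection E. intros. f_equal; lia.
Qed.

(** The primitive vector in the direction of [k]; its norm is the spacing of lattice points on lines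
    with that direction. *)
Definition prim (k : Z2) : Z2 :=
  (fst k / Z.gcd (fst k) (snd k), snd k / Z.gcd (fst k) (snd k))%Z.

Lemma prim_spec k : k <> (0, 0)%Z -> exists g u v : Z,
  (0 < g /\ fst k = g * fst (prim k) /\ snd k = g * snd (prim k) /\
   u * fst (prim k) + v * snd (prim k) = 1)%Z.
Proof.
  destruct k as [c d]. unfold prim. simpl. intros Hk.
  set (g := Z.gcd c d).
  assert (Hg : (0 < g)%Z).
  { pose proof (Z.gcd_nonneg c d). destruct (Z.eq_dec g 0) as [E|]; [|fold g in H; lia].
    exfalso. apply Hk. apply Z.gcd_eq_0 in E as [-> ->]. reflexivity. }
  destruct (Z.gcd_divide_l c d) as [c' Ec]. destruct (Z.gcd_divide_r c d) as [d' Ed]. fold g in Ec, Ed.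
  destruct (Z.gcd_bezout c d g eq_refl) as (u & v & E).
  assert (c / g = c')%Z by (rewrite Ec at 1; apply Z.div_mul; lia).
  assert (d / g = d')%Z by (rewrite Ed at 1; apply Z.div_mul; lia).
  exists g, u, v. rewrite H, H0. repeat split; try lia.
  apply Z.mul_reg_l with g; [lia|]. rewrite Ec, Ed in E. nia.
Qed.

Lemma nrm_prim_pos k : k <> (0, 0)%Z -> (1 <= nrm (prim k))%Z.
Proof.
  intros Hk. destruct (prim_spec k Hk) as (g & u & v & Hg & _ & _ & E).
  unfold nrm. destruct (Z.eq_dec (fst (prim k)) 0), (Z.eq_dec (snd (prim k)) 0); lia.
Qed.

Lemma nrm_minimizer (Q : Z2 -> Prop) n P0 : Q P0 ->
  exists P, Q P /\ forall P', Q P' -> (nrm (zadd n P) <= nrm (zadd n P'))%Z.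
Proof.
  assert (G : forall N P0, Q P0 -> (nrm (zadd n P0) < Z.of_nat N)%Z ->
    exists P, Q P /\ forall P', Q P' -> (nrm (zadd n P) <= nrm (zadd n P'))%Z).
  { induction N as [|N IH]; intros P1 H1 HN.
    - unfold nrm in HN. lia.
    - destruct (classic (exists P, Q P /\ (nrm (zadd n P) < nrm (zadd n P1))%Z)) as [(P & HP & HL)|N1].
      + apply (IH P HP). lia.
      + exists P1. split; [assumption|]. intros P' HP'. apply Z.nlt_ge. intros HL. apply N1. eauto. }
  intros H. apply (G (S (Z.to_nat (nrm (zadd n P0)))) P0 H).
  assert (0 <= nrm (zadd n P0))%Z by (unfold nrm; lia). lia.
Qed.

(** The polar form of [x y], evaluated at [P] and [k = (c, d)]. For fixed [k <> 0] it describes a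
    line of direction [(c, -d)]; it is symmetric, so each of the two points puts the other on a
    line. *)
Definition online (k : Z2) (m : Z) (P : Z2) : Prop := (fst P * snd k + snd P * fst k = m)%Z.

(* The points of a lattice line are spaced by at least [nrm (prim k)], so all of them but
   one of minimal norm are as far away as the spacing forces them to be. *)
Lemma line_sum a : 1 < a -> exists K, 0 <= K /\ forall n k m, exists P0, k <> (0, 0)%Z ->
  SB (fun P => rpow (J (zadd n P)) (- a) * ind (online k m P /\ P <> P0)) (K * rpow (J (prim k)) (- a)).
Proof.
  intros Ha. pose proof (sum_Z_bound a Ha) as HZ.
  set (K0 := 2 * (1 + / (a - 1))) in *.
  assert (HK0 : 0 <= K0) by (eapply SB_nonneg; exact HZ).
  exists (rpow (/ 8) (- a) * K0). split; [apply Rmult_le_pos; [apply rpow_nonneg|assumption]|].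
  intros n k m.
  destruct (classic (exists P, online k m P)) as [[P1 H1]|N].
  2:{ exists (0, 0)%Z. intros Hk l Hl. rewrite (sumL_ext _ (fun _ => 0)).
      - rewrite sumL_const, Rmult_0_r. apply Rmult_le_pos; [|apply rpow_nonneg].
        apply Rmult_le_pos; [apply rpow_nonneg|assumption].
      - intros P _. rewrite ind_false; [ring|]. intros [H _]. apply N; eauto. }
  destruct (nrm_minimizer (online k m) n P1 H1) as (P0 & H0 & Hmin).
  exists P0. intros Hk.
  destruct (prim_spec k Hk) as (g & u & v & Hg & Ec & Ed & Euv).
  pose proof (nrm_prim_pos k Hk) as Hp.
  set (c := fst (prim k)) in *. set (d := snd (prim k)) in *.
  (* Bezout coefficients give the integer parameter of a point along the line, counted from [P0] in
     steps of the primitive direction. *)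
  set (j := fun P : Z2 => (u * (fst P - fst P0) - v * (snd P - snd P0))%Z).
  assert (Hj : forall P, online k m P -> (fst P = fst P0 + j P * c /\ snd P = snd P0 - j P * d)%Z).
  { intros P HP. unfold online in *. rewrite Ec, Ed in *. unfold j.
    set (x := (fst P - fst P0)%Z). set (y := (snd P - snd P0)%Z).
    assert (E : (x * d + y * c = 0)%Z).
    { apply Z.mul_reg_l with g; [lia|]. rewrite Z.mul_0_r. unfold x, y. nia. }
    split.
    - replace ((u * x - v * y) * c)%Z with (x * (u * c + v * d) - v * (x * d + y * c))%Z by ring.
      rewrite E, Euv. unfold x. ring.
    - replace ((u * x - v * y) * d)%Z with (u * (x * d + y * c) - y * (u * c + v * d))%Z by ring.
      rewrite E, Euv. unfold y. ring. }
  replace (rpow (/ 8) (- a) * K0 * rpow (J (prim k)) (- a))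
    with ((rpow (/ 8) (- a) * rpow (J (prim k)) (- a)) * K0) by ring.
  apply (SB_inj j _ (fun i => (rpow (/ 8) (- a) * rpow (J (prim k)) (- a)) * rpow (1 + Rabs (IZR i)) (- a))).
  - intros i. repeat apply Rmult_le_pos; apply rpow_nonneg.
  - intros P Hnz.
    assert (HP : online k m P /\ P <> P0).
    { apply NNPP; intros X; apply Hnz; rewrite ind_false by assumption; ring. }
    rewrite ind_true, Rmult_1_r by assumption. destruct HP as [HP HPne].
    destruct (Hj P HP) as [Ex Ey].
    assert (Jne : j P <> 0%Z).
    { intros E. apply HPne. rewrite E in *. destruct P, P0; simpl in *. f_equal; lia. }
    pose proof (J_ge1 (prim k)). pose proof (Rabs1_pos (IZR (j P))).
    rewrite <- !rpow_mult by (try apply Rmult_le_pos; lra).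
    apply rpow_neg_le; [lra|]. split; [nra|].
    (* Minimality of [P0] gives [|j| |prim k| <= 2 |n + P|]. Both factors on the left are at least
       1, so adding 1 to each costs at most the factor 4, whence 8. *)
    assert (L : (8 * (1 + nrm (zadd n P)) >= (1 + nrm (prim k)) * (1 + Z.abs (j P)))%Z).
    { specialize (Hmin P HP).
      assert (Z.abs (j P) * nrm (prim k) <= 2 * nrm (zadd n P))%Z.
      { assert (Z.abs (j P) * nrm (prim k) <= nrm (zadd n P) + nrm (zadd n P0))%Z; [|lia].
        unfold nrm at 1. fold c d. rewrite <- Z.mul_max_distr_nonneg_l by lia.
        rewrite <- !Z.abs_mul. unfold nrm, zadd. simpl. rewrite Ex, Ey. lia. }
      assert (1 <= Z.abs (j P))%Z by lia. nia. }
    apply Z.ge_le in L. apply IZR_le in L. rewrite !mult_IZR in L. unfold J in *.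
    rewrite (plus_IZR 1 (Z.abs _)), abs_IZR in L. lra.
  - intros P P' Hnz Hnz' E.
    assert (HP : online k m P /\ P <> P0).
    { apply NNPP; intros X; apply Hnz; rewrite ind_false by assumption; ring. }
    assert (HP' : online k m P' /\ P' <> P0).
    { apply NNPP; intros X; apply Hnz'; rewrite ind_false by assumption; ring. }
    destruct (Hj P (proj1 HP)) as [Ex Ey]. destruct (Hj P' (proj1 HP')) as [Ex' Ey'].
    rewrite E in *. destruct P, P'; simpl in *. f_equal; lia.
  - apply SB_scal; [|assumption]. apply Rmult_le_pos; apply rpow_nonneg.
Qed.

Lemma prim_gcd k : k <> (0, 0)%Z -> prim (prim k) = prim k.
Proof.
  intros Hk. destruct (prim_spec k Hk) as (g & u & v & Hg & Ec & Ed & Euv).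
  assert (E : Z.gcd (fst (prim k)) (snd (prim k)) = 1%Z).
  { apply Z.bezout_1_gcd. exists u, v. exact Euv. }
  unfold prim at 1. rewrite E, !Z.div_1_r. destruct (prim k); reflexivity.
Qed.

Lemma SB_half_sq {A} (f g : A -> R) K K' : SB (fun a => f a * f a) K -> SB (fun a => g a * g a) K' ->
  SB (fun a => f a * g a) (/ 2 * K + / 2 * K').
Proof.
  intros H H'. eapply SB_le; [intros a; apply two_ab|]. apply SB_plus; apply SB_scal; auto; lra.
Qed.

Lemma ind_nz (P : Prop) x : x * ind P <> 0 -> P.
Proof. intros H. apply NNPP. intros N. apply H. rewrite ind_false by assumption. ring. Qed.

Lemma rpow_sq x a : rpow x (- a) * rpow x (- a) = rpow x (- (2 * a)).
Proof. rewrite <- rpow_plus. f_equal. ring. Qed.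

(** Points with the same primitive direction [e] lie on a line through the origin, where all but one
    contribute a total of order [|e|^(-a)]; with the second factor this leaves [|e|^(-2a)], summable
    since [2a > 2]. There is at most one exceptional point per direction, so these are indexed by
    their direction and Cauchy-Schwarz applies. *)
Lemma direction_sum a : 1 < a -> exists K, forall n,
  SB (fun k => rpow (J (zadd n k)) (- a) * rpow (J (prim k)) (- a) * ind (k <> (0, 0)%Z)) K.
Proof.
  intros Ha. destruct (line_sum a Ha) as (K1 & HK1 & HL).
  destruct (sum_Z2_bound (2 * a) ltac:(lra)) as [K2 HK2].
  exists ((/ 2 * K2 + / 2 * K2) + K1 * K2). intros n.
  (* [online (fl e) 0] is the line through the origin spanned by [e]; the sign undoes the reflection
     built into [online]. *)
  set (fl := fun e : Z2 => (fst e, - snd e)%Z).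
  set (star := fun e : Z2 => epsilon (inhabits (0, 0)%Z) (fun P0 => fl e <> (0,0)%Z ->
      SB (fun P => rpow (J (zadd n P)) (- a) * ind (online (fl e) 0 P /\ P <> P0)) (K1 * rpow (J (prim (fl e))) (- a)))).
  assert (Hst : forall e, fl e <> (0,0)%Z -> SB (fun P => rpow (J (zadd n P)) (- a) * ind (online (fl e) 0 P /\ P <> star e))
     (K1 * rpow (J (prim (fl e))) (- a))).
  { intros e. unfold star. apply epsilon_spec, HL. }
  apply (SB_le _ (fun k =>
     (rpow (J (zadd n k)) (- a) * ((rpow (J (prim k)) (- a)) * ind (k <> (0, 0)%Z /\ k = star (prim k)))) +
     rpow (J (zadd n k)) (- a) * rpow (J (prim k)) (- a) * ind (k <> (0, 0)%Z /\ k <> star (prim k)))).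
  { intros k. destruct (classic (k = (0,0)%Z)) as [E|E].
    - rewrite !ind_false by tauto. lra.
    - rewrite (ind_true (k <> _)) by assumption.
      destruct (classic (k = star (prim k))) as [E'|E'].
      + rewrite ind_true, ind_false by tauto. lra.
      + rewrite ind_false, ind_true by tauto. lra. }
  apply SB_plus.
  - apply SB_half_sq.
    + eapply SB_le; [intros k; rewrite rpow_sq; apply Rle_refl|].
      apply (SB_shift (fun P => rpow (J P) (- (2 * a)))); auto using rpow_nonneg.
    + apply (SB_inj prim _ (fun P => rpow (J P) (- (2 * a)))); auto using rpow_nonneg.
      * intros k _. rewrite <- rpow_sq. pose proof (ind_bound (k <> (0, 0)%Z /\ k = star (prim k))).
        pose proof (rpow_nonneg (J (prim k)) (- a)). set (x := rpow _ _) in *. set (i := ind _) in *.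
        apply Rmult_le_compat; nra.
      * intros k k' H H' E.
        rewrite <- !Rmult_assoc in H, H'. apply ind_nz in H, H'. destruct H, H'. congruence.
  - apply (SB_fiber prim _ (fun e => K1 * (rpow (J e) (- a) * rpow (J e) (- a)))).
    + intros k. repeat apply Rmult_le_pos; try apply rpow_nonneg. apply ind_bound.
    + intros e.
      destruct (classic (exists k, k <> (0,0)%Z /\ prim k = e)) as [[k0 [Hk0 Ek0]]|N].
      2:{ intros l Hl. rewrite (sumL_ext _ (fun _ => 0)).
          - rewrite sumL_const, Rmult_0_r. repeat apply Rmult_le_pos; auto using rpow_nonneg.
          - intros k _. destruct (classic (k = (0,0)%Z)).
            + rewrite (ind_false (_ /\ _)) by tauto. ring.
            + rewrite (ind_false (prim k = e)); [ring|]. intros E. apply N. eauto. }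
      assert (Ee : prim e = e) by (rewrite <- Ek0; apply prim_gcd, Hk0).
      assert (Hfe : fl e <> (0,0)%Z).
      { pose proof (nrm_prim_pos k0 Hk0) as X. rewrite Ek0 in X. unfold fl. intros E. injection E as E1 E2.
        unfold nrm in X. lia. }
      assert (EJ : J (prim (fl e)) = J e).
      { rewrite <- Ee at 2. unfold J, nrm, prim, fl. simpl. rewrite Z.gcd_opp_r.
        pose proof (Z.gcd_divide_r (fst e) (snd e)) as [z Ez].
        set (g := Z.gcd (fst e) (snd e)) in *.
        assert (Hg : g <> 0%Z) by (unfold g; intros X; apply Z.gcd_eq_0 in X as [X1 X2]; apply Hfe; unfold fl; rewrite X1, X2; reflexivity).
        rewrite Z.div_opp_l_z by (try apply Z_mod_zero_opp_full; auto; rewrite Ez at 1; apply Z_mod_mult).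
        rewrite Z.abs_opp. reflexivity. }
      replace (K1 * (rpow (J e) (- a) * rpow (J e) (- a)))
        with (rpow (J e) (- a) * (K1 * rpow (J (prim (fl e))) (- a))) by (rewrite EJ; ring).
      eapply SB_le; [|apply (SB_scal (rpow (J e) (- a)) _ _ (rpow_nonneg _ _) (Hst e Hfe))].
      intros k. simpl. rewrite <- (Rmult_assoc (rpow (J e) (- a))).
      destruct (classic (prim k = e)) as [E|E].
      2:{ rewrite (ind_false (prim k = e)) by assumption. rewrite Rmult_0_r.
          repeat apply Rmult_le_pos; try apply rpow_nonneg. apply ind_bound. }
      rewrite (ind_true (prim k = e)), Rmult_1_r, E by assumption.
      destruct (classic (k <> (0,0)%Z /\ k <> star e)) as [[H1 H2]|H1].
      2:{ rewrite (ind_false (_ /\ _)) by assumption. rewrite Rmult_0_r.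
          repeat apply Rmult_le_pos; try apply rpow_nonneg. apply ind_bound. }
      rewrite !ind_true; auto; [lra|]. split; [|assumption].
      destruct (prim_spec k H1) as (g & u & v & Hg & Ec & Ed & _). rewrite E in Ec, Ed.
      unfold online, fl. simpl. rewrite Ec, Ed. ring.
    + apply SB_scal; [assumption|]. eapply SB_le; [|exact HK2].
      intros P. rewrite rpow_sq. lra.
Qed.

Lemma SB_zero {A} (f : A -> R) : (forall a, f a <= 0) -> SB f 0.
Proof.
  intros H l _. eapply Rle_trans; [apply (sumL_le f (fun _ => 0)); auto|]. rewrite sumL_const. lra.
Qed.

(* If neither point is the exceptional one on the line determined by the other, then
   [line_sum] and [direction_sum] apply; otherwise each point determines the other. *)
Lemma two_point_sum_13 a : 1 < a -> exists K, forall n m,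
  SB (fun x : Z2 * Z2 => rpow (J (zadd n (fst x))) (- a) * rpow (J (zadd n (snd x))) (- a) *
      ind (fst x <> (0,0)%Z /\ snd x <> (0,0)%Z /\ online (snd x) m (fst x))) K.
Proof.
  intros Ha. destruct (line_sum a Ha) as (K1 & HK1 & HL).
  destruct (sum_Z2_bound (2 * a) ltac:(lra)) as [K2 HK2].
  destruct (direction_sum a Ha) as [K3 HK3].
  exists (K1 * K3 + K1 * K3 + (/ 2 * K2 + / 2 * K2)). intros n m.
  set (w := fun P => rpow (J (zadd n P)) (- a)).
  (* [line_sum] names its exceptional point before assuming [k <> 0], so a choice function is
     available on the whole lattice. *)
  set (star := fun k : Z2 => epsilon (inhabits (0, 0)%Z) (fun P0 => k <> (0,0)%Z ->
      SB (fun P => w P * ind (online k m P /\ P <> P0)) (K1 * rpow (J (prim k)) (- a)))).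
  assert (Hst : forall k, k <> (0,0)%Z -> SB (fun P => w P * ind (online k m P /\ P <> star k))
     (K1 * rpow (J (prim k)) (- a))).
  { intros k. unfold star. apply epsilon_spec, HL. }
  assert (Hw : forall P, 0 <= w P) by (intros; apply rpow_nonneg).
  assert (S1 : SB (fun x : Z2 * Z2 => w (fst x) * (w (snd x) * ind (snd x <> (0,0)%Z /\ online (fst x) m (snd x) /\
       snd x <> star (fst x) /\ fst x <> (0,0)%Z))) (K1 * K3)).
  { apply (SB_prod (fun k P => w k * (w P * ind (P <> (0,0)%Z /\ online k m P /\ P <> star k /\ k <> (0,0)%Z)))
             (fun k => K1 * (w k * rpow (J (prim k)) (- a) * ind (k <> (0,0)%Z)))).
    - intros. repeat apply Rmult_le_pos; auto. apply ind_bound.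
    - intros k. destruct (classic (k = (0,0)%Z)) as [E|E].
      + rewrite (ind_false (k <> _)) by tauto. rewrite !Rmult_0_r. apply SB_zero. intros P.
        rewrite ind_false by tauto. lra.
      + rewrite (ind_true (k <> _)) by tauto.
        replace (K1 * (w k * rpow (J (prim k)) (- a) * 1)) with (w k * (K1 * rpow (J (prim k)) (- a))) by ring.
        apply SB_scal; auto. eapply SB_le; [|apply (Hst k E)]. intros P. simpl.
        apply Rmult_le_compat_l; auto.
        destruct (classic (online k m P /\ P <> star k)).
        * rewrite (ind_true (online k m P /\ P <> star k)) by assumption. apply ind_bound.
        * rewrite !ind_false by tauto. lra.
    - apply SB_scal; auto. apply HK3. }
  apply (SB_le _ (fun x =>
     w (snd x) * (w (fst x) * ind (fst x <> (0,0)%Z /\ online (snd x) m (fst x) /\ fst x <> star (snd x) /\ snd x <> (0,0)%Z)) +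
     w (fst x) * (w (snd x) * ind (snd x <> (0,0)%Z /\ online (fst x) m (snd x) /\ snd x <> star (fst x) /\ fst x <> (0,0)%Z)) +
     (w (fst x) * ind (fst x = star (snd x) /\ snd x = star (fst x))) *
     (w (snd x) * ind (fst x = star (snd x) /\ snd x = star (fst x))))).
  { intros [P Q]. simpl. fold (w P) (w Q).
    pose proof (Hw P). pose proof (Hw Q). assert (0 <= w P * w Q) by nra.
    match goal with |- _ <= ?A + ?B + ?D =>
      assert (0 <= A) by (repeat apply Rmult_le_pos; auto; apply ind_bound);
      assert (0 <= B) by (repeat apply Rmult_le_pos; auto; apply ind_bound);
      assert (0 <= D) by (repeat apply Rmult_le_pos; auto; apply ind_bound) end.
    destruct (classic (P <> (0,0)%Z /\ Q <> (0,0)%Z /\ online Q m P)) as [(H5 & H6 & H7)|N].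
    2:{ rewrite (ind_false (P <> _ /\ _ /\ online _ _ _)) by assumption. lra. }
    rewrite (ind_true (P <> _ /\ Q <> _ /\ online _ _ _)) by tauto.
    assert (online P m Q) by (unfold online in *; lia).
    destruct (classic (P = star Q)) as [E1|E1].
    2:{ rewrite (ind_true (P <> _ /\ online Q m P /\ _)) in * by tauto. lra. }
    destruct (classic (Q = star P)) as [E2|E2].
    2:{ rewrite (ind_true (Q <> _ /\ online P m Q /\ _)) in * by tauto. lra. }
    rewrite (ind_true (P = star Q /\ Q = star P)) in * by tauto. lra. }
  apply SB_plus; [apply SB_plus|].
  - apply (SB_inj (fun x : Z2 * Z2 => (snd x, fst x)) _ _ _) with (4 := S1).
    + intros. repeat apply Rmult_le_pos; auto. apply ind_bound.
    + intros [P Q] _. simpl. lra.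
    + intros [P Q] [P' Q'] _ _ E. simpl in E. congruence.
  - exact S1.
  - assert (D : forall pr : Z2 * Z2 -> Z2, (pr = fst \/ pr = snd) ->
      SB (fun x : Z2 * Z2 => w (pr x) * ind (fst x = star (snd x) /\ snd x = star (fst x)) *
         (w (pr x) * ind (fst x = star (snd x) /\ snd x = star (fst x)))) K2).
    { intros pr Hpr.
      apply (SB_inj pr _ (fun P => rpow (J (zadd n P)) (- (2 * a)))).
      - intros; apply rpow_nonneg.
      - intros x _. rewrite <- rpow_sq. fold (w (pr x)). pose proof (Hw (pr x)).
        pose proof (ind_bound (fst x = star (snd x) /\ snd x = star (fst x))).
        set (i := ind _) in *. apply Rmult_le_compat; nra.
      - intros [P Q] [P' Q'] H H' E. rewrite <- !Rmult_assoc in H, H'.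
        apply ind_nz in H, H'. simpl in *. destruct Hpr as [-> | ->]; simpl in E; subst; intuition congruence.
      - apply (SB_shift (fun P => rpow (J P) (- (2 * a)))); auto using rpow_nonneg. }
    apply SB_half_sq; [apply (D fst); auto|apply (D snd); auto].
Qed.

(** * The divisor bound and lattice points on hyperbolas *)

Lemma prime_divisor_exists m : (1 < m)%Z -> exists p, prime p /\ (p | m)%Z.
Proof.
  intros Hm. assert (H0 : (0 <= m)%Z) by lia. revert Hm. pattern m.
  apply Z_lt_induction; [|exact H0]. clear m H0. intros m IH Hm.
  destruct (classic (prime m)) as [Hp|Hp].
  - exists m. split; [assumption|apply Z.divide_refl].
  - destruct (not_prime_divide m Hm Hp) as (n & Hn & Hd).
    destruct (IH n) as (p & Pp & Hpn); try lia.
    exists p. split; [assumption|]. eapply Z.divide_trans; eauto.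
Qed.

Lemma prime_part_split p m : prime p -> (0 < m)%Z ->
  exists e m', (m = p ^ Z.of_nat e * m' /\ ~ (p | m') /\ 0 < m')%Z.
Proof.
  intros Hp Hm. pose proof (prime_ge_2 p Hp). assert (H0 : (0 <= m)%Z) by lia. revert Hm. pattern m.
  apply Z_lt_induction; [|exact H0]. clear m H0. intros m IH Hm.
  destruct (classic (p | m)%Z) as [[k Hk]|N].
  - destruct (IH k) as (e & m' & E & Hn & Hpos); try nia.
    exists (S e), m'. split; [|tauto]. rewrite Nat2Z.inj_succ, Z.pow_succ_r, Hk, E by lia. ring.
  - exists 0%nat, m. split; [|tauto]. change (Z.of_nat 0) with 0%Z. rewrite Z.pow_0_r. ring.
Qed.

Lemma divisor_split p e m d : prime p -> (d | p ^ Z.of_nat e * m)%Z ->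
  exists i d', (i <= e)%nat /\ (d' | m)%Z /\ d = (p ^ Z.of_nat i * d')%Z.
Proof.
  intros Hp. revert d. induction e as [|e IH]; intros d Hd.
  - exists 0%nat, d. change (Z.of_nat 0) with 0%Z in *. rewrite Z.pow_0_r, Z.mul_1_l in *. auto.
  - rewrite Nat2Z.inj_succ, Z.pow_succ_r in Hd by lia.
    destruct (classic (p | d)%Z) as [[d1 E]|N].
    + destruct (IH d1) as (i & d' & Hi & Hd' & Ed).
      { apply Z.mul_divide_cancel_l with p; [pose proof (prime_ge_2 p Hp); lia|].
        rewrite Z.mul_assoc. rewrite (Z.mul_comm p d1), <- E. exact Hd. }
      exists (S i), d'. split; [lia|]. split; [assumption|].
      rewrite Nat2Z.inj_succ, Z.pow_succ_r by lia. rewrite E, Ed. ring.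
    + destruct (IH d) as (i & d' & Hi & Hd' & Ed).
      { rewrite <- Z.mul_assoc in Hd. apply Gauss with p; [assumption|].
        apply rel_prime_sym, prime_rel_prime; assumption. }
      exists i, d'. repeat split; auto.
Qed.

Lemma sum_le_nat e : SB (fun i : nat => ind (i <= e)%nat) (INR e + 1).
Proof.
  intros l Hl. apply Rle_trans with (sumL (fun _ : nat => 1) (seq 0 (S e))).
  - set (t := fun i => if le_dec i e then true else false).
    rewrite <- (sumL_filter (fun i : nat => ind (i <= e)%nat) t).
    2:{ intros a. unfold t. destruct (le_dec a e); [discriminate|]. intros _. apply ind_false; assumption. }
    eapply Rle_trans; [apply (sumL_le _ (fun _ => 1)); intros; apply ind_bound|].
    apply sumL_incl; [intros; lra|apply NoDup_filter, Hl|].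
    intros x Hx. apply filter_In in Hx as [_ Hx]. unfold t in Hx. apply in_seq.
    destruct (le_dec x e); [lia|discriminate].
  - rewrite sumL_const, length_seq, S_INR. lra.
Qed.

Definition divisor_count_le (m : Z) (K : R) : Prop := SB (fun d : Z => ind ((d | m)%Z /\ (0 < d)%Z)) K.

(** A divisor of [p^e m] is some [p^i d'] with [i <= e] and [d' | m]. A chosen pair [(i, d')]
    determines the divisor, so the choice is injective. *)
Lemma divisor_count_mul p e m K : prime p -> divisor_count_le m K ->
  divisor_count_le (p ^ Z.of_nat e * m) ((INR e + 1) * K).
Proof.
  intros Hp HK. unfold divisor_count_le in *. pose proof (prime_ge_2 p Hp) as H2.
  set (phi := fun d : Z => epsilon (inhabits (0%nat, 0%Z)) (fun x : nat * Z =>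
     (fst x <= e)%nat /\ (snd x | m)%Z /\ d = (p ^ Z.of_nat (fst x) * snd x)%Z)).
  assert (Hphi : forall d, (d | p ^ Z.of_nat e * m)%Z ->
     (fst (phi d) <= e)%nat /\ (snd (phi d) | m)%Z /\ d = (p ^ Z.of_nat (fst (phi d)) * snd (phi d))%Z).
  { intros d Hd. unfold phi. apply epsilon_spec.
    destruct (divisor_split p e m d Hp Hd) as (i & d' & H). exists (i, d'). exact H. }
  apply (SB_inj phi _ (fun x => ind (fst x <= e)%nat * ind ((snd x | m)%Z /\ (0 < snd x)%Z))).
  - intros. apply Rmult_le_pos; apply ind_bound.
  - intros d H. assert (Hd : (d | p ^ Z.of_nat e * m)%Z /\ (0 < d)%Z)
      by (apply NNPP; intros N; apply H, ind_false, N).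
    destruct (Hphi d (proj1 Hd)) as (H3 & H4 & H5).
    rewrite !ind_true; auto; [lra|]. split; [assumption|].
    assert (0 < p ^ Z.of_nat (fst (phi d)))%Z by (apply Z.pow_pos_nonneg; lia). nia.
  - intros d d' H H' E.
    assert (Hd : (d | p ^ Z.of_nat e * m)%Z /\ (0 < d)%Z)
      by (apply NNPP; intros N; apply H, ind_false, N).
    assert (Hd' : (d' | p ^ Z.of_nat e * m)%Z /\ (0 < d')%Z)
      by (apply NNPP; intros N; apply H', ind_false, N).
    destruct (Hphi d (proj1 Hd)) as (_ & _ & H5). destruct (Hphi d' (proj1 Hd')) as (_ & _ & H5').
    rewrite H5, H5', E. reflexivity.
  - apply (SB_mul_prod (fun i : nat => ind (i <= e)%nat) (fun d => ind ((d | m)%Z /\ (0 < d)%Z)));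
      auto using sum_le_nat; intros; apply ind_bound.
Qed.

Lemma divisor_bound eps : 0 < eps -> exists K, 0 <= K /\ forall m : Z, (0 < m)%Z ->
  divisor_count_le m (K * rpow (IZR m) eps).
Proof.
  intros He.
  assert (L2 : 0 < ln 2) by (rewrite <- ln_1; apply ln_increasing; lra).
  (* With this value [e + 1 <= C0 (1 + e eps ln 2) <= C0 2^(e eps)] for every [e]. *)
  set (C0 := 1 + / (eps * ln 2)).
  assert (HC0 : 1 <= C0).
  { unfold C0. assert (0 < / (eps * ln 2)) by (apply Rinv_0_lt_compat; nra). lra. }
  (* Chosen so that [p^eps >= 2] for every [p >= B]. *)
  destruct (INR_unbounded (Rpower 2 (/ eps))) as [B HB].
  set (c := fun m : Z => sumL (fun i : nat => ind (prime (Z.of_nat i) /\ (Z.of_nat i | m)%Z)) (seq 0 B)).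
  (* The worst-case factor C0 is paid only for the finitely many primes below B; for a larger
     prime p one has [e + 1 <= 2^e <= p^(eps e)]. *)
  assert (G : forall m, (0 <= m)%Z -> (0 < m)%Z -> divisor_count_le m (rpow C0 (c m) * rpow (IZR m) eps)).
  { intros m Hm0. pattern m. apply Z_lt_induction; [|exact Hm0]. clear m Hm0. intros m IH Hm.
    destruct (Z.eq_dec m 1) as [->|N1].
    - rewrite rpow_one, Rmult_1_r.
      assert (1 <= rpow C0 (c 1%Z)).
      { rewrite <- (rpow_x0 C0) by lra. apply rpow_exp_le; [lra|]. apply sumL_nonneg. intros; apply ind_bound. }
      unfold divisor_count_le. apply SB_weaken with 1; [|assumption].
      apply (SB_inj (fun _ => tt) _ (fun _ : unit => 1)).
      + intros; lra.
      + intros; apply ind_bound.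
      + intros d d' Hd Hd' _.
        assert (X : (d | 1)%Z /\ (0 < d)%Z) by (apply NNPP; intros N; apply Hd, ind_false, N).
        assert (X' : (d' | 1)%Z /\ (0 < d')%Z) by (apply NNPP; intros N; apply Hd', ind_false, N).
        destruct X as [X Y], X' as [X' Y']. apply Z.divide_1_r_nonneg in X, X'; lia.
      + intros l Hl. rewrite sumL_const, Rmult_1_r. change 1 with (INR 1). apply le_INR.
        destruct l as [|[] [|[] l]]; simpl; try lia.
        inversion Hl as [|? ? X _]; subst. exfalso; apply X; left; reflexivity.
    - destruct (prime_divisor_exists m) as (p & Hp & Hd); [lia|].
      pose proof (prime_ge_2 p Hp) as Hp2.
      destruct (prime_part_split p m Hp Hm) as (e & m' & E & Hn & Hm').
      assert (He1 : e <> 0%nat).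
      { intros ->. apply Hn. change (Z.of_nat 0) with 0%Z in E. rewrite Z.pow_0_r in E.
        replace m' with m by lia. exact Hd. }
      assert (Hpe : (p <= p ^ Z.of_nat e)%Z).
      { rewrite <- (Z.pow_1_r p) at 1. apply Z.pow_le_mono_r; lia. }
      assert (HI : divisor_count_le m' (rpow C0 (c m') * rpow (IZR m') eps)) by (apply IH; nia).
      rewrite E at 1. eapply SB_weaken; [apply divisor_count_mul; eauto|].
      assert (Em : rpow (IZR m) eps = rpow (IZR p) (INR e * eps) * rpow (IZR m') eps).
      { rewrite E, mult_IZR, <- pow_IZR.
        assert (0 < IZR p) by (apply IZR_lt; lia).
        rewrite rpow_mult by (try apply pow_le; try apply IZR_le; lia || lra).
        f_equal. rewrite <- rpow_rpow. f_equal. rewrite rpow_pos_eq, Rpower_pow; auto. }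
      assert (Hc : forall i, ind (prime (Z.of_nat i) /\ (Z.of_nat i | m')%Z) <= ind (prime (Z.of_nat i) /\ (Z.of_nat i | m)%Z)).
      { intros i. destruct (classic (prime (Z.of_nat i) /\ (Z.of_nat i | m')%Z)) as [[X Y]|X].
        - rewrite !ind_true; try tauto; try lra. split; [assumption|]. rewrite E. apply Z.divide_mul_r, Y.
        - rewrite ind_false by assumption. apply ind_bound. }
      assert (Hp2' : 2 <= IZR p) by (apply IZR_le; lia).
      pose proof (pos_INR e) as Hie.
      pose proof (rpow_nonneg (IZR m') eps) as Hm'e.
      rewrite Em.
      destruct (Z_lt_le_dec p (Z.of_nat B)) as [HpB|HpB].
      + assert (Hc2 : c m' + 1 <= c m).
        { unfold c.
          assert (In (Z.to_nat p) (seq 0 B)) as Hin by (apply in_seq; lia).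
          destruct (in_split _ _ Hin) as (l1 & l2 & El). rewrite El, !sumL_app. simpl.
          rewrite !Z2Nat.id by lia.
          rewrite (ind_false (_ /\ (p | m')%Z)), (ind_true (_ /\ (p | m)%Z)) by tauto.
          pose proof (sumL_le _ _ l1 (fun i _ => Hc i)). pose proof (sumL_le _ _ l2 (fun i _ => Hc i)).
          simpl in *. lra. }
        assert (H1 : C0 * rpow C0 (c m') <= rpow C0 (c m)).
        { rewrite <- (rpow_1 C0) at 1 by lra. rewrite <- rpow_plus. apply rpow_exp_le; lra. }
        assert (H2 : INR e + 1 <= C0 * rpow (IZR p) (INR e * eps)).
        { apply Rle_trans with (C0 * rpow 2 (INR e * eps)).
          - rewrite rpow_pos_eq by lra. unfold Rpower.
            apply Rle_trans with (C0 * (1 + INR e * eps * ln 2)).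
            + unfold C0. assert (0 < / (eps * ln 2)) by (apply Rinv_0_lt_compat; nra).
              replace ((1 + / (eps * ln 2)) * (1 + INR e * eps * ln 2))
                with (1 + INR e + / (eps * ln 2) + INR e * eps * ln 2) by (field; split; lra).
              assert (0 <= INR e * eps) by nra. nra.
            + apply Rmult_le_compat_l; [lra|]. apply exp_ineq1_le.
          - apply Rmult_le_compat_l; [lra|]. apply rpow_le; [nra|lra]. }
        pose proof (rpow_nonneg C0 (c m')). pose proof (rpow_nonneg (IZR p) (INR e * eps)).
        apply Rle_trans with ((C0 * rpow (IZR p) (INR e * eps)) * (rpow C0 (c m') * rpow (IZR m') eps)).
        * apply Rmult_le_compat_r; [nra|assumption].
        * replace (C0 * rpow (IZR p) (INR e * eps) * (rpow C0 (c m') * rpow (IZR m') eps))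
            with ((C0 * rpow C0 (c m')) * (rpow (IZR p) (INR e * eps) * rpow (IZR m') eps)) by ring.
          apply Rmult_le_compat_r; [nra|assumption].
      + assert (H1 : rpow C0 (c m') <= rpow C0 (c m)) by (apply rpow_exp_le; [lra|]; apply sumL_le; auto).
        assert (H2 : INR e + 1 <= rpow (IZR p) (INR e * eps)).
        { apply Rle_trans with (rpow 2 (INR e)).
          - rewrite rpow_pos_eq, Rpower_pow by lra. clear. induction e as [|e IH]; [simpl; lra|].
            rewrite S_INR. simpl. pose proof (pos_INR e). lra.
          - rewrite (Rmult_comm (INR e)), <- rpow_rpow. apply rpow_le; [lra|]. split; [lra|].
            rewrite <- (rpow_inv_l 2 eps) by lra. apply rpow_le; [lra|]. split; [apply rpow_nonneg|].
            rewrite (rpow_pos_eq 2) by lra. apply Rle_trans with (INR B); [lra|].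
            rewrite INR_IZR_INZ. apply IZR_le; lia. }
        pose proof (rpow_nonneg C0 (c m')). pose proof (rpow_nonneg (IZR p) (INR e * eps)).
        apply Rle_trans with (rpow (IZR p) (INR e * eps) * (rpow C0 (c m') * rpow (IZR m') eps)).
        * apply Rmult_le_compat_r; [nra|assumption].
        * replace (rpow (IZR p) (INR e * eps) * (rpow C0 (c m') * rpow (IZR m') eps))
            with (rpow C0 (c m') * (rpow (IZR p) (INR e * eps) * rpow (IZR m') eps)) by ring.
          apply Rmult_le_compat_r; [nra|assumption]. }
  exists (rpow C0 (INR B)). split; [apply rpow_nonneg|]. intros m Hm.
  eapply SB_weaken; [apply G; lia|]. apply Rmult_le_compat_r; [apply rpow_nonneg|].
  apply rpow_exp_le; [lra|]. unfold c.
  eapply Rle_trans; [apply (sumL_le _ (fun _ => 1)); intros; apply ind_bound|].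
  rewrite sumL_const, length_seq. lra.
Qed.

(** [D] is twice the signed area of the triangle with vertices [(Xi, Yi)]. Since [Yi = M / Xi], the
    product [D X1 X2 X3] is [M] times a Vandermonde product, and likewise, up to sign, with [X] and
    [Y] exchanged; the two identities are multiplied and [M^2] is cancelled. *)
Lemma hyperbola_det (X1 Y1 X2 Y2 X3 Y3 M : Z) : M <> 0%Z ->
  (X1 * Y1 = M)%Z -> (X2 * Y2 = M)%Z -> (X3 * Y3 = M)%Z ->
  let D := (X1 * Y2 - X2 * Y1 + (X2 * Y3 - X3 * Y2) + (X3 * Y1 - X1 * Y3))%Z in
  (D * D * M = - (((X1 - X2) * (X2 - X3) * (X3 - X1)) * ((Y1 - Y2) * (Y2 - Y3) * (Y3 - Y1))))%Z.
Proof.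
  intros HM E1 E2 E3 D.
  assert (A : (D * (X1 * X2 * X3) = M * ((X1 - X2) * (X2 - X3) * (X3 - X1)))%Z).
  { transitivity (X1 * X1 * X3 * (X2 * Y2) - X2 * X2 * X3 * (X1 * Y1) + (X2 * X2 * X1 * (X3 * Y3)
      - X3 * X3 * X1 * (X2 * Y2)) + (X3 * X3 * X2 * (X1 * Y1) - X1 * X1 * X2 * (X3 * Y3)))%Z.
    - unfold D. ring.
    - rewrite E1, E2, E3. ring. }
  assert (B : (D * (Y1 * Y2 * Y3) = - M * ((Y1 - Y2) * (Y2 - Y3) * (Y3 - Y1)))%Z).
  { transitivity (Y2 * Y2 * Y3 * (X1 * Y1) - Y1 * Y1 * Y3 * (X2 * Y2) + (Y3 * Y3 * Y1 * (X2 * Y2)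
      - Y2 * Y2 * Y1 * (X3 * Y3)) + (Y1 * Y1 * Y2 * (X3 * Y3) - Y3 * Y3 * Y2 * (X1 * Y1)))%Z.
    - unfold D. ring.
    - rewrite E1, E2, E3. ring. }
  apply Z.mul_reg_l with (M * M)%Z; [nia|].
  transitivity ((D * (X1 * X2 * X3)) * (D * (Y1 * Y2 * Y3)))%Z.
  - transitivity (D * D * ((X1 * Y1) * (X2 * Y2) * (X3 * Y3)))%Z; [rewrite E1, E2, E3; ring|ring].
  - rewrite A, B. ring.
Qed.

(** Doubled coordinates allow the centre [(A/2, B/2)] to be a half-integer point. *)
Definition onhyp (A B M : Z) (k : Z2) : Prop := ((2 * fst k - A) * (2 * snd k - B) = M)%Z.

Lemma prod6_bound a b c d e f N : (0 <= N)%Z -> (Z.abs a <= N)%Z -> (Z.abs b <= N)%Z -> (Z.abs c <= N)%Z ->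
  (Z.abs d <= N)%Z -> (Z.abs e <= N)%Z -> (Z.abs f <= N)%Z ->
  (Z.abs ((a * b * c) * (d * e * f)) <= N ^ 6)%Z.
Proof.
  intros HN Ha Hb Hc Hd He Hf. rewrite !Z.abs_mul.
  replace (N ^ 6)%Z with ((N * N * N) * (N * N * N))%Z by ring.
  repeat apply Z.mul_le_mono_nonneg; try assumption; repeat apply Z.mul_nonneg_nonneg; apply Z.abs_nonneg.
Qed.

(** Distinct points of the hyperbola differ in both coordinates, so the right side of
    [hyperbola_det] is nonzero. Hence the integer [D] is nonzero and [|M|] is at most that product
    of six differences, each at most [4 N] in doubled coordinates. *)
Lemma hyperbola_three_points A B M n k1 k2 k3 N : M <> 0%Z ->
  onhyp A B M k1 -> onhyp A B M k2 -> onhyp A B M k3 -> k1 <> k2 -> k2 <> k3 -> k3 <> k1 ->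
  (nrm (zadd n k1) <= N)%Z -> (nrm (zadd n k2) <= N)%Z -> (nrm (zadd n k3) <= N)%Z ->
  (Z.abs M <= (4 * N) ^ 6)%Z.
Proof.
  intros HM H1 H2 H3 N12 N23 N31 L1 L2 L3. unfold onhyp in *.
  assert (Hx : forall k k', onhyp A B M k -> onhyp A B M k' -> k <> k' ->
     (2 * fst k - A <> 2 * fst k' - A /\ 2 * snd k - B <> 2 * snd k' - B)%Z).
  { intros k k' Hk Hk' Hne. unfold onhyp in *. split; intros E.
    - apply Hne. rewrite E in Hk. assert (2 * fst k' - A <> 0)%Z by nia.
      assert (2 * snd k - B = 2 * snd k' - B)%Z by (apply Z.mul_reg_l with (2 * fst k' - A)%Z; congruence).
      destruct k, k'; cbn [fst snd] in *; f_equal; lia.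
    - apply Hne. rewrite E in Hk. assert (2 * snd k' - B <> 0)%Z by nia.
      assert (2 * fst k - A = 2 * fst k' - A)%Z by (apply Z.mul_reg_r with (2 * snd k' - B)%Z; congruence).
      destruct k, k'; cbn [fst snd] in *; f_equal; lia. }
  pose proof (hyperbola_det _ _ _ _ _ _ M HM H1 H2 H3) as D.
  destruct (Hx k1 k2 H1 H2 N12) as [X1 Y1]. destruct (Hx k2 k3 H2 H3 N23) as [X2 Y2].
  destruct (Hx k3 k1 H3 H1 N31) as [X3 Y3].
  unfold nrm, zadd in L1, L2, L3. simpl in L1, L2, L3.
  set (x1 := (2 * fst k1 - A)%Z) in *. set (x2 := (2 * fst k2 - A)%Z) in *. set (x3 := (2 * fst k3 - A)%Z) in *.
  set (y1 := (2 * snd k1 - B)%Z) in *. set (y2 := (2 * snd k2 - B)%Z) in *. set (y3 := (2 * snd k3 - B)%Z) in *.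
  cbv zeta in D.
  set (d := (x1 * y2 - x2 * y1 + (x2 * y3 - x3 * y2) + (x3 * y1 - x1 * y3))%Z) in *.
  set (V := ((x1 - x2) * (x2 - x3) * (x3 - x1) * ((y1 - y2) * (y2 - y3) * (y3 - y1)))%Z) in *.
  assert (HV : V <> 0%Z).
  { unfold V. intros E. rewrite !Z.mul_eq_0 in E.
    destruct E as [[[E|E]|E]|[[E|E]|E]]; apply (proj1 (Z.sub_move_0_r _ _)) in E; contradiction. }
  assert (Hd : (1 <= d * d)%Z).
  { assert (d <> 0)%Z by (intros E; apply HV; rewrite E in D; clear - D; lia). clearbody d. clear - H. nia. }
  apply Z.le_trans with (Z.abs V).
  - apply Z.le_trans with (Z.abs (d * d * M)); [|rewrite D, Z.abs_opp; apply Z.le_refl].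
    rewrite Z.abs_mul. rewrite (Z.abs_eq (d * d)) by (clear - Hd; lia).
    pose proof (Z.abs_nonneg M) as HM0. clearbody d. clear - Hd HM0. nia.
  - apply prod6_bound; unfold x1, x2, x3, y1, y2, y3; clear - L1 L2 L3; lia.
Qed.

Lemma SB_card_le2 {A} (f : A -> R) : (forall a, 0 <= f a <= 1) ->
  (forall a b c, f a <> 0 -> f b <> 0 -> f c <> 0 -> a = b \/ b = c \/ c = a) -> SB f 2.
Proof.
  intros H1 H3 l Hl.
  set (t := fun a => if Req_dec_T (f a) 0 then false else true).
  rewrite <- (sumL_filter f t) by (intros a; unfold t; destruct (Req_dec_T (f a) 0); [auto|discriminate]).
  assert (Ht : forall a, In a (filter t l) -> f a <> 0).
  { intros a Ha. apply filter_In in Ha as [_ Ha]. unfold t in Ha. destruct (Req_dec_T (f a) 0); [discriminate|auto]. }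
  pose proof (NoDup_filter t Hl) as Hn.
  destruct (filter t l) as [|a [|b [|c m]]]; simpl.
  - lra.
  - specialize (H1 a). lra.
  - pose proof (H1 a). pose proof (H1 b). lra.
  - exfalso. inversion Hn as [|? ? Na Hn']; subst. inversion Hn' as [|? ? Nb _]; subst.
    destruct (H3 a b c) as [E|[E|E]]; try (apply Ht; simpl; tauto); subst; simpl in *; tauto.
Qed.

(* A box of side N containing three points of the hyperbola forces [|M| <= (4N)^6]; hence all
   points but two are far from the origin compared with M, and there are few of these by the
   divisor bound. *)
Lemma hyperbola_sum eta : 0 < eta -> exists K, 0 <= K /\ forall n A B M, M <> 0%Z ->
  SB (fun k => rpow (J (zadd n k)) (- eta) * ind (onhyp A B M k)) K.
Proof.
  intros He. destruct (divisor_bound (eta / 6) ltac:(lra)) as (K1 & HK1 & HD).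
  set (K2 := rpow 4096 (eta / 6)).
  exists (2 + 2 * (K2 * K1)). split; [unfold K2; pose proof (rpow_nonneg 4096 (eta / 6)); nra|].
  intros n A B M HM.
  set (aM := Z.abs M). assert (HaM : (0 < aM)%Z) by (unfold aM; lia).
  assert (HaR : 0 < IZR aM) by (apply IZR_lt; lia).
  set (small := fun k => (4096 * (nrm (zadd n k)) ^ 6 < aM)%Z).
  assert (HJ : forall k, 0 <= rpow (J (zadd n k)) (- eta) <= 1).
  { intros k. split; [apply rpow_nonneg|]. rewrite <- (rpow_one (- eta)).
    apply rpow_neg_le; [lra|]. pose proof (J_ge1 (zadd n k)). lra. }
  apply (SB_le _ (fun k => rpow (J (zadd n k)) (- eta) * ind (onhyp A B M k /\ small k) +
                           rpow (J (zadd n k)) (- eta) * ind (onhyp A B M k /\ ~ small k))).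
  { intros k. pose proof (HJ k). destruct (classic (onhyp A B M k)), (classic (small k)).
    - rewrite (ind_true (onhyp _ _ _ _)), ind_true, ind_false by tauto. lra.
    - rewrite (ind_true (onhyp _ _ _ _)), ind_false, ind_true by tauto. lra.
    - rewrite !ind_false by tauto. lra.
    - rewrite !ind_false by tauto. lra. }
  apply SB_plus.
  - apply SB_card_le2.
    + intros k. pose proof (HJ k). pose proof (ind_bound (onhyp A B M k /\ small k)). nra.
    + intros a b c Ha Hb Hc. apply ind_nz in Ha, Hb, Hc.
      destruct Ha as [Ha Sa], Hb as [Hb Sb], Hc as [Hc Sc].
      apply NNPP. intros N.
      set (N0 := Z.max (nrm (zadd n a)) (Z.max (nrm (zadd n b)) (nrm (zadd n c)))).
      assert (L : (aM <= (4 * N0) ^ 6)%Z).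
      { apply (hyperbola_three_points A B M n a b c); unfold N0; try tauto; try lia. }
      assert (S0 : (4096 * N0 ^ 6 < aM)%Z).
      { unfold small in *. unfold N0.
        destruct (Z.max_spec (nrm (zadd n a)) (Z.max (nrm (zadd n b)) (nrm (zadd n c)))) as [[_ ->]|[_ ->]]; auto.
        destruct (Z.max_spec (nrm (zadd n b)) (nrm (zadd n c))) as [[_ ->]|[_ ->]]; auto. }
      rewrite Z.pow_mul_l in L. change (4 ^ 6)%Z with 4096%Z in L. lia.
  (* The number [2 x - A] divides [M] and determines the point; divisors of both signs occur, hence
     the factor 2. *)
  - assert (D0 : SB (fun d : Z => ind (d | M)%Z) (2 * (K1 * rpow (IZR aM) (eta / 6)))).
    { specialize (HD aM HaM). unfold divisor_count_le in HD.
      replace (2 * (K1 * rpow (IZR aM) (eta / 6))) with (K1 * rpow (IZR aM) (eta / 6) + K1 * rpow (IZR aM) (eta / 6)) by ring.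
      apply (SB_le _ (fun d => ind ((d | aM)%Z /\ (0 < d)%Z) + ind ((- d | aM)%Z /\ (0 < - d)%Z))).
      - intros d. destruct (classic (d | M)%Z) as [H|H].
        + assert (d <> 0)%Z by (intros ->; destruct H; lia).
          assert (d | aM)%Z by (unfold aM; apply Z.divide_abs_r, H).
          rewrite (ind_true (d | M)%Z) by assumption.
          destruct (Z_lt_le_dec 0 d).
          * rewrite (ind_true (_ /\ (0 < d)%Z)) by tauto.
            pose proof (ind_bound ((- d | aM)%Z /\ (0 < - d)%Z)). lra.
          * rewrite (ind_true (_ /\ (0 < - d)%Z)).
            2:{ split; [|lia]. apply Z.divide_opp_l. assumption. }
            pose proof (ind_bound ((d | aM)%Z /\ (0 < d)%Z)). lra.
        + rewrite ind_false by assumption.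
          pose proof (ind_bound ((- d | aM)%Z /\ (0 < - d)%Z)).
          pose proof (ind_bound ((d | aM)%Z /\ (0 < d)%Z)). lra.
      - apply SB_plus; [assumption|].
        apply (SB_inj Z.opp _ (fun d => ind ((d | aM)%Z /\ (0 < d)%Z))); auto.
        + intros; apply ind_bound.
        + intros; lra.
        + intros; lia. }
    (* Failure of [small] bounds [J^6] below by [|M| / 4096], with [4096 = 4^6]. The resulting
       weight compensates exactly the growth [|M|^(eta/6)] of the divisor bound. *)
    set (w := rpow (IZR aM / 4096) (- (eta / 6))).
    replace (2 * (K2 * K1)) with (w * (2 * (K1 * rpow (IZR aM) (eta / 6)))).
    2:{ unfold w, K2, Rdiv at 1. rewrite rpow_mult by lra.
        replace (/ 4096) with (rpow 4096 (- (1))) by (rewrite rpow_opp, rpow_1; lra).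
        rewrite rpow_rpow, rpow_opp.
        replace (- (1) * - (eta / 6)) with (eta / 6) by field.
        pose proof (rpow_gt0 (IZR aM) (eta / 6) HaR). field. lra. }
    apply (SB_inj (fun k => 2 * fst k - A)%Z _ (fun d => w * ind (d | M)%Z)).
    + intros d. apply Rmult_le_pos; [apply rpow_nonneg|apply ind_bound].
    + intros k Hk. pose proof (ind_nz _ _ Hk) as [H1 H2]. rewrite ind_true by tauto.
      rewrite (ind_true (_ | M)%Z).
      2:{ exists (2 * snd k - B)%Z. unfold onhyp in H1. lia. }
      rewrite !Rmult_1_r. unfold w.
      replace (- eta) with (6 * - (eta / 6)) by field. rewrite <- rpow_rpow.
      apply rpow_neg_le; [lra|]. split; [apply Rdiv_lt_0_compat; lra|].
      replace 6 with (INR 6) by (simpl; ring). pose proof (J_ge1 (zadd n k)).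
      rewrite rpow_pos_eq, Rpower_pow by lra.
      unfold small in H2. apply Z.nlt_ge in H2. apply IZR_le in H2. rewrite mult_IZR in H2.
      change 6%Z with (Z.of_nat 6) in H2. rewrite <- pow_IZR in H2.
      assert (IZR (nrm (zadd n k)) ^ 6 <= J (zadd n k) ^ 6).
      { apply pow_incr. unfold J. rewrite plus_IZR. split; [apply IZR_le; unfold nrm; lia|lra]. }
      lra.
    + intros k k' Hk Hk' E. apply ind_nz in Hk, Hk'. destruct Hk as [H1 _], Hk' as [H1' _].
      unfold onhyp in *. rewrite E in H1.
      assert (2 * fst k' - A <> 0)%Z by nia.
      assert (2 * snd k - B = 2 * snd k' - B)%Z by (apply Z.mul_reg_l with (2 * fst k' - A)%Z; congruence).
      destruct k, k'; cbn [fst snd] in *; f_equal; lia.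
    + apply SB_scal; [apply rpow_nonneg|exact D0].
Qed.

(** * Counting resonant interactions *)

Lemma J_weight_1d a z P : 0 <= a -> z = fst P \/ z = snd P ->
  rpow (J P) (- a) <= rpow (1 + Rabs (IZR z)) (- a).
Proof.
  intros Ha Hz. pose proof (Rabs1_pos (IZR z)). apply rpow_neg_le; [assumption|].
  destruct Hz as [-> | ->]; [pose proof (J_fst P)|pose proof (J_snd P)]; lra.
Qed.

(** On a degenerate family the pair is recovered from one coordinate of each point, and the weight
    in that coordinate alone is summable because [a > 1]. *)
Lemma SB_degenerate (Q : Z2 * Z2 -> Prop) (phi : Z2 * Z2 -> Z * Z) n a : 1 < a ->
  (forall x, Q x -> fst (phi x) = fst (zadd n (fst x)) \/ fst (phi x) = snd (zadd n (fst x))) ->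
  (forall x, Q x -> snd (phi x) = fst (zadd n (snd x)) \/ snd (phi x) = snd (zadd n (snd x))) ->
  (forall x y, Q x -> Q y -> phi x = phi y -> x = y) ->
  SB (fun x => rpow (J (zadd n (fst x))) (- a) * rpow (J (zadd n (snd x))) (- a) * ind (Q x))
     ((2 * (1 + / (a - 1))) * (2 * (1 + / (a - 1)))).
Proof.
  intros Ha H1 H2 H3. pose proof (sum_Z_bound a Ha) as HZ.
  apply (SB_inj phi _ (fun y => rpow (1 + Rabs (IZR (fst y))) (- a) * rpow (1 + Rabs (IZR (snd y))) (- a))).
  - intros; apply Rmult_le_pos; apply rpow_nonneg.
  - intros x Hx. apply ind_nz in Hx. rewrite ind_true, Rmult_1_r by assumption.
    apply Rmult_le_compat; try apply rpow_nonneg; apply J_weight_1d; auto; lra.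
  - intros x y Hx Hy. apply ind_nz in Hx, Hy. auto.
  - apply (SB_mul_prod (fun z => rpow (1 + Rabs (IZR z)) (- a)) (fun z => rpow (1 + Rabs (IZR z)) (- a)));
      auto using rpow_nonneg.
Qed.

(* [(a, b)] and [(e, f)] are the offsets of two of the three interacting frequencies, and
   [a f + b e - 2 a b = (e f - (2a - e) (2b - f)) / 2]. *)
Lemma two_point_sum_12 a : 1 < a -> exists K, forall n m,
  SB (fun x : Z2 * Z2 => rpow (J (zadd n (fst x))) (- a) * rpow (J (zadd n (snd x))) (- a) *
      ind (fst x <> (0,0)%Z /\ online (fst x) (m + 2 * (fst (fst x) * snd (fst x))) (snd x))) K.
Proof.
  intros Ha. destruct (line_sum a Ha) as (K1 & HK1 & HL).
  (* Half of the excess: [a - eta > 1] keeps the planar sum of exponent [2 (a - eta)] finite, and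
     [2 eta > 0] is what [hyperbola_sum] consumes. *)
  set (eta := (a - 1) / 2).
  assert (Heta : 0 < eta) by (unfold eta; lra).
  destruct (sum_Z2_bound (2 * a) ltac:(lra)) as [K2 HK2].
  destruct (sum_Z2_bound (2 * (a - eta)) ltac:(unfold eta; lra)) as [K2' HK2'].
  destruct (direction_sum a Ha) as [K3 HK3].
  destruct (hyperbola_sum (2 * eta) ltac:(lra)) as (K4 & HK4 & HH).
  set (K5 := (2 * (1 + / (a - 1))) * (2 * (1 + / (a - 1)))).
  exists (K1 * K3 + (/ 2 * K2' + / 2 * (K2 * K4)) + (K5 + K5 + (K5 + K5))). intros n m.
  set (w := fun P => rpow (J (zadd n P)) (- a)).
  set (m' := fun k : Z2 => (m + 2 * (fst k * snd k))%Z).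
  set (star := fun k : Z2 => epsilon (inhabits (0, 0)%Z) (fun P0 => k <> (0,0)%Z ->
      SB (fun P => w P * ind (online k (m' k) P /\ P <> P0)) (K1 * rpow (J (prim k)) (- a)))).
  assert (Hst : forall k, k <> (0,0)%Z -> SB (fun P => w P * ind (online k (m' k) P /\ P <> star k))
     (K1 * rpow (J (prim k)) (- a))).
  { intros k. unfold star. apply epsilon_spec, HL. }
  assert (Hw : forall P, 0 <= w P) by (intros; apply rpow_nonneg).
  set (M := fun k2 : Z2 => (fst k2 * snd k2 - 2 * m)%Z).
  assert (Hhyp : forall k1 k2, online k1 (m' k1) k2 -> onhyp (fst k2) (snd k2) (M k2) k1).
  { intros k1 k2 H. unfold online, onhyp, M, m' in *. lia. }
  set (E1 := fun x : Z2 * Z2 => fst x <> (0,0)%Z /\ online (fst x) (m' (fst x)) (snd x)).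
  set (A1 := fun x : Z2 * Z2 => w (fst x) * (w (snd x) * ind (E1 x /\ snd x <> star (fst x)))).
  set (A2 := fun x : Z2 * Z2 => w (fst x) * w (snd x) * ind (E1 x /\ snd x = star (fst x) /\ M (snd x) <> 0%Z)).
  (* If [M = 0] the hyperbola degenerates into the lines [2 x1 = x2] and [2 y1 = y2]. Each is split
     according to whether that value vanishes, which decides which coordinates determine the
     pair. *)
  set (D1 := fun x : Z2 * Z2 => (online (fst x) (m' (fst x)) (snd x) /\ 2 * fst (fst x) = fst (snd x) /\ fst (snd x) <> 0)%Z).
  set (D2 := fun x : Z2 * Z2 => (online (fst x) (m' (fst x)) (snd x) /\ 2 * fst (fst x) = fst (snd x) /\ fst (snd x) = 0)%Z).
  set (D3 := fun x : Z2 * Z2 => (online (fst x) (m' (fst x)) (snd x) /\ 2 * snd (fst x) = snd (snd x) /\ snd (snd x) <> 0)%Z).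
  set (D4 := fun x : Z2 * Z2 => (online (fst x) (m' (fst x)) (snd x) /\ 2 * snd (fst x) = snd (snd x) /\ snd (snd x) = 0)%Z).
  apply (SB_le _ (fun x => A1 x + A2 x +
     (w (fst x) * w (snd x) * ind (D1 x) + w (fst x) * w (snd x) * ind (D2 x) +
     (w (fst x) * w (snd x) * ind (D3 x) + w (fst x) * w (snd x) * ind (D4 x))))).
  { intros x. fold (w (fst x)) (w (snd x)). fold (m' (fst x)). fold (E1 x).
    pose proof (Hw (fst x)). pose proof (Hw (snd x)). assert (0 <= w (fst x) * w (snd x)) by nra.
    unfold A1, A2.
    assert (P0 : forall P : Prop, 0 <= w (fst x) * w (snd x) * ind P)
      by (intros; apply Rmult_le_pos; auto; apply ind_bound).
    assert (P1 : forall P : Prop, 0 <= w (fst x) * (w (snd x) * ind P))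
      by (intros; rewrite <- Rmult_assoc; auto).
    pose proof (P0 (D1 x)). pose proof (P0 (D2 x)). pose proof (P0 (D3 x)). pose proof (P0 (D4 x)).
    pose proof (P1 (E1 x /\ snd x <> star (fst x))).
    pose proof (P0 (E1 x /\ snd x = star (fst x) /\ M (snd x) <> 0%Z)).
    destruct (classic (E1 x)) as [HE|HE].
    2:{ rewrite (ind_false (E1 x)) by assumption. rewrite Rmult_0_r. lra. }
    rewrite (ind_true (E1 x)) by assumption.
    destruct (classic (snd x = star (fst x))) as [Hs|Hs].
    2:{ rewrite (ind_true (E1 x /\ snd x <> star (fst x))) in * by tauto. lra. }
    destruct (classic (M (snd x) = 0%Z)) as [HM|HM].
    2:{ rewrite (ind_true (E1 x /\ snd x = star (fst x) /\ _)) in * by tauto. lra. }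
    destruct HE as [_ HE]. pose proof (Hhyp _ _ HE) as Hh. rewrite HM in Hh. unfold onhyp in Hh.
    apply Z.mul_eq_0 in Hh. destruct Hh as [Hh|Hh].
    - destruct (Z.eq_dec (fst (snd x)) 0).
      + rewrite (ind_true (D2 x)) in * by (unfold D2; repeat split; auto; lia). lra.
      + rewrite (ind_true (D1 x)) in * by (unfold D1; repeat split; auto; lia). lra.
    - destruct (Z.eq_dec (snd (snd x)) 0).
      + rewrite (ind_true (D4 x)) in * by (unfold D4; repeat split; auto; lia). lra.
      + rewrite (ind_true (D3 x)) in * by (unfold D3; repeat split; auto; lia). lra. }
  apply SB_plus; [apply SB_plus|].
  - eapply SB_le with (g := fun x : Z2 * Z2 => w (fst x) * (w (snd x) * ind (E1 (fst x, snd x) /\ snd x <> star (fst x)))).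
    { intros [k P]. unfold A1. simpl. lra. }
    apply (SB_prod (fun k P => w k * (w P * ind (E1 (k, P) /\ P <> star k)))
             (fun k => K1 * (w k * rpow (J (prim k)) (- a) * ind (k <> (0,0)%Z)))).
    + intros. repeat apply Rmult_le_pos; auto. apply ind_bound.
    + intros k. destruct (classic (k = (0,0)%Z)) as [E|E].
      * rewrite (ind_false (k <> _)) by tauto. rewrite !Rmult_0_r. apply SB_zero. intros P.
        rewrite ind_false by (unfold E1; simpl; tauto). lra.
      * rewrite (ind_true (k <> _)) by tauto.
        replace (K1 * (w k * rpow (J (prim k)) (- a) * 1)) with (w k * (K1 * rpow (J (prim k)) (- a))) by ring.
        apply SB_scal; auto. eapply SB_le; [|apply (Hst k E)]. intros P. simpl.
        apply Rmult_le_compat_l; auto.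
        destruct (classic (online k (m' k) P /\ P <> star k)).
        -- rewrite (ind_true (online k _ P /\ P <> star k)) by assumption. apply ind_bound.
        -- rewrite !ind_false by (unfold E1; simpl; tauto). lra.
    + apply SB_scal; auto. apply HK3.
  (* Cauchy-Schwarz with the weight of the first point split as [(a - eta) + eta]. In [u] the first
     point determines the pair; in [v] the second point is free and the first runs over a
     hyperbola. *)
  - set (u := fun x : Z2 * Z2 => rpow (J (zadd n (fst x))) (- (a - eta)) * ind (E1 x /\ snd x = star (fst x) /\ M (snd x) <> 0%Z)).
    set (v := fun x : Z2 * Z2 => rpow (J (zadd n (fst x))) (- eta) * w (snd x) * ind (E1 x /\ snd x = star (fst x) /\ M (snd x) <> 0%Z)).
    apply (SB_le _ (fun x => u x * v x)).
    { intros x. unfold A2, u, v, w.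
      replace (- a) with (- (a - eta) + - eta) at 1 by ring. rewrite rpow_plus.
      set (i := ind _). assert (i = i * i) as Hi.
      { unfold i, ind. destruct (excluded_middle_informative _); ring. }
      rewrite Hi. right. rewrite Hi at 1. ring_simplify. rewrite Hi at 1. unfold i.
      unfold ind. destruct (excluded_middle_informative _); ring. }
    apply SB_half_sq.
    + apply (SB_inj fst _ (fun P => rpow (J (zadd n P)) (- (2 * (a - eta))))).
      * intros; apply rpow_nonneg.
      * intros x _. unfold u. rewrite <- rpow_sq. set (r := rpow _ _).
        assert (0 <= r) by apply rpow_nonneg.
        match goal with |- context [ind ?P] => pose proof (ind_bound P) end.
        set (i := ind _) in *. apply Rmult_le_compat; nra.
      * intros [P Q] [P' Q'] H H' E. unfold u in H, H'. rewrite <- !Rmult_assoc in H, H'.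
        apply ind_nz in H, H'. simpl in *. subst. destruct H as (_ & -> & _), H' as (_ & -> & _). reflexivity.
      * apply (SB_shift (fun P => rpow (J P) (- (2 * (a - eta))))); auto using rpow_nonneg.
    + apply (SB_inj (fun x : Z2 * Z2 => (snd x, fst x)) _ (fun x => rpow (J (zadd n (fst x))) (- (2 * a)) *
         (rpow (J (zadd n (snd x))) (- (2 * eta)) * ind (M (fst x) <> 0%Z /\ onhyp (fst (fst x)) (snd (fst x)) (M (fst x)) (snd x))))).
      * intros. repeat apply Rmult_le_pos; try apply rpow_nonneg. apply ind_bound.
      * intros [P Q] H. unfold v in *. rewrite <- !Rmult_assoc in H. apply ind_nz in H. simpl in *.
        rewrite !ind_true; [|split; [tauto|apply Hhyp, (proj2 (proj1 H))]|assumption].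
        unfold w. rewrite <- !rpow_sq. right. ring.
      * intros [P Q] [P' Q'] _ _ E. simpl in E. congruence.
      * apply (SB_prod (fun P Q => rpow (J (zadd n P)) (- (2 * a)) *
           (rpow (J (zadd n Q)) (- (2 * eta)) * ind (M P <> 0%Z /\ onhyp (fst P) (snd P) (M P) Q)))
           (fun P => K4 * rpow (J (zadd n P)) (- (2 * a)))).
        -- intros. repeat apply Rmult_le_pos; try apply rpow_nonneg. apply ind_bound.
        -- intros P. rewrite (Rmult_comm K4). apply SB_scal; [apply rpow_nonneg|].
           destruct (Z.eq_dec (M P) 0) as [E|E].
           ++ apply SB_weaken with 0; [|assumption]. apply SB_zero. intros Q. rewrite ind_false by tauto. lra.
           ++ eapply SB_le; [|apply (HH n (fst P) (snd P) (M P) E)]. intros Q. simpl.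
              apply Rmult_le_compat_l; [apply rpow_nonneg|].
              destruct (classic (onhyp (fst P) (snd P) (M P) Q)); [rewrite !ind_true by tauto|rewrite !ind_false by tauto]; lra.
        -- rewrite (Rmult_comm K2). apply SB_scal; [assumption|].
           apply (SB_shift (fun P => rpow (J P) (- (2 * a)))); auto using rpow_nonneg.
  - apply SB_plus; apply SB_plus.
    + apply (SB_degenerate D1 (fun x => (snd (zadd n (fst x)), fst (zadd n (snd x))))); auto; simpl; auto.
      intros [[x1 y1] [x2 y2]] [[x1' y1'] [x2' y2']] H H' E. unfold D1, online, m' in *. cbn [fst snd] in *.
      injection E as Ey Ex. assert (y1 = y1') by lia. assert (x2 = x2') by lia. assert (x1 = x1') by lia. subst.
      assert (y2 = y2'); [|congruence]. nia.
    + apply (SB_degenerate D2 (fun x => (snd (zadd n (fst x)), snd (zadd n (snd x))))); auto; simpl; auto.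
      intros [[x1 y1] [x2 y2]] [[x1' y1'] [x2' y2']] H H' E. unfold D2 in *. cbn [fst snd] in *.
      injection E as Ey Ex. repeat f_equal; lia.
    + apply (SB_degenerate D3 (fun x => (fst (zadd n (fst x)), snd (zadd n (snd x))))); auto; simpl; auto.
      intros [[x1 y1] [x2 y2]] [[x1' y1'] [x2' y2']] H H' E. unfold D3, online, m' in *. cbn [fst snd] in *.
      injection E as Ey Ex. assert (x1 = x1') by lia. assert (y2 = y2') by lia. assert (y1 = y1') by lia. subst.
      assert (x2 = x2'); [|congruence]. nia.
    + apply (SB_degenerate D4 (fun x => (fst (zadd n (fst x)), fst (zadd n (snd x))))); auto; simpl; auto.
      intros [[x1 y1] [x2 y2]] [[x1' y1'] [x2' y2']] H H' E. unfold D4 in *. cbn [fst snd] in *.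
      injection E as Ey Ex. repeat f_equal; lia.
Qed.

(** * The phase of an interaction in characteristic coordinates *)

Definition qz (n : Z2) : Z := (fst n * fst n - snd n * snd n)%Z.

(** The conjugated frequency [n2], from [n = n1 - n2 + n3]. *)
Definition third (n n1 n3 : Z2) : Z2 := (fst n1 + fst n3 - fst n, snd n1 + snd n3 - snd n)%Z.

Definition phase (n n1 n3 : Z2) : Z := (qz n - qz n1 + qz (third n n1 n3) - qz n3)%Z.

(** Characteristic coordinates: [qz P] is the product of the two coordinates of [nu P]. *)
Definition nu (P : Z2) : Z2 := (fst P + snd P, fst P - snd P)%Z.

Definition zsub (P Q : Z2) : Z2 := (fst P - fst Q, snd P - snd Q)%Z.

Lemma jbr_ge1 n : 1 <= jbr n.
Proof.
  unfold jbr. rewrite <- sqrt_1 at 1. apply sqrt_le_1_alt.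
  pose proof (pow2_ge_0 (IZR (fst n))). pose proof (pow2_ge_0 (IZR (snd n))). lra.
Qed.

Lemma jbr_ge_fst n : Rabs (IZR (fst n)) <= jbr n.
Proof.
  unfold jbr. rewrite <- sqrt_Rsqr_abs. apply sqrt_le_1_alt. unfold Rsqr.
  pose proof (pow2_ge_0 (IZR (snd n))). simpl in *. lra.
Qed.

Lemma jbr_ge_snd n : Rabs (IZR (snd n)) <= jbr n.
Proof.
  unfold jbr. rewrite <- sqrt_Rsqr_abs. apply sqrt_le_1_alt. unfold Rsqr.
  pose proof (pow2_ge_0 (IZR (fst n))). simpl in *. lra.
Qed.

Lemma J_nu_le n : J (nu n) <= 3 * jbr n.
Proof.
  pose proof (jbr_ge1 n). pose proof (jbr_ge_fst n). pose proof (jbr_ge_snd n).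
  assert (1 + nrm (nu n) <= 1 + Z.abs (fst n) + Z.abs (snd n))%Z by (destruct n as [x y]; unfold nrm, nu; cbn [fst snd]; clear; lia).
  apply IZR_le in H2. rewrite !plus_IZR, !abs_IZR in H2. unfold J. rewrite plus_IZR. lra.
Qed.

Lemma jbr_weight a n : 0 <= a -> rpow (jbr n) (- a) <= rpow (/ 3) (- a) * rpow (J (nu n)) (- a).
Proof.
  intros Ha. pose proof (J_ge1 (nu n)). pose proof (J_nu_le n). rewrite <- rpow_mult by lra.
  apply rpow_neg_le; [assumption|]. lra.
Qed.

Lemma nu_inj P Q : nu P = nu Q -> P = Q.
Proof. destruct P, Q. unfold nu. simpl. intros E. injection E. intros. f_equal; lia. Qed.

Definition nonres (n n1 n3 : Z2) : Prop := n1 <> n /\ n3 <> n.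

(** Let [B] be the polar form in [online], and measure frequencies from [n] in the coordinates [nu].
    The phase is [B(k1, k3)] in the offsets of [n1] and [n3]. Expressing one of these through the
    offset of [n2] subtracts twice the product of the coordinates of the other, which is the
    quadratic term in [two_point_sum_12]. *)
Lemma counting a : 1 < a -> exists K, forall n m,
  SB (fun x : Z2 * Z2 => rpow (jbr (fst x)) (- a) * rpow (jbr (snd x)) (- a) *
      ind (nonres n (fst x) (snd x) /\ phase n (fst x) (snd x) = m)) K /\
  SB (fun x : Z2 * Z2 => rpow (jbr (third n (fst x) (snd x))) (- a) * rpow (jbr (snd x)) (- a) *
      ind (nonres n (fst x) (snd x) /\ phase n (fst x) (snd x) = m)) K /\
  SB (fun x : Z2 * Z2 => rpow (jbr (fst x)) (- a) * rpow (jbr (third n (fst x) (snd x))) (- a) *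
      ind (nonres n (fst x) (snd x) /\ phase n (fst x) (snd x) = m)) K.
Proof.
  intros Ha. destruct (two_point_sum_13 a Ha) as [K1 H1]. destruct (two_point_sum_12 a Ha) as [K2 H2].
  set (c := rpow (/ 3) (- a)). assert (Hc : 0 <= c) by apply rpow_nonneg.
  exists (c * c * Rmax K1 K2). intros n m.
  assert (Hsub : forall P, zadd (nu n) (zsub (nu P) (nu n)) = nu P).
  { intros P. unfold zadd, zsub, nu. simpl. f_equal; ring. }
  assert (Hne : forall P, P <> n -> zsub (nu P) (nu n) <> (0,0)%Z).
  { intros P HP E. apply HP, nu_inj. unfold zsub in E. injection E as E1 E2.
    destruct P, n; unfold nu in *; cbn [fst snd] in *; f_equal; lia. }
  assert (Hinj : forall P Q, zsub (nu P) (nu n) = zsub (nu Q) (nu n) -> P = Q).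
  { intros P Q E. apply nu_inj. rewrite <- (Hsub P), <- (Hsub Q), E. reflexivity. }
  assert (W : forall P Q, rpow (jbr P) (- a) * rpow (jbr Q) (- a) <=
     c * c * (rpow (J (nu P)) (- a) * rpow (J (nu Q)) (- a))).
  { intros P Q. replace (c * c * (rpow (J (nu P)) (- a) * rpow (J (nu Q)) (- a)))
      with ((c * rpow (J (nu P)) (- a)) * (c * rpow (J (nu Q)) (- a))) by ring.
    apply Rmult_le_compat; try apply rpow_nonneg; apply jbr_weight; lra. }
  assert (G : forall (pr : Z2 * Z2 -> Z2 * Z2) (Q : Z2 * Z2 -> Prop) K,
     (forall x, nonres n (fst x) (snd x) /\ phase n (fst x) (snd x) = m ->
        Q (zsub (nu (fst (pr x))) (nu n), zsub (nu (snd (pr x))) (nu n))) ->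
     (forall x y, pr x = pr y -> x = y) -> K <= Rmax K1 K2 ->
     SB (fun x => rpow (J (zadd (nu n) (fst x))) (- a) * rpow (J (zadd (nu n) (snd x))) (- a) * ind (Q x)) K ->
     SB (fun x => rpow (jbr (fst (pr x))) (- a) * rpow (jbr (snd (pr x))) (- a) *
       ind (nonres n (fst x) (snd x) /\ phase n (fst x) (snd x) = m)) (c * c * Rmax K1 K2)).
  { intros pr Q K HQ Hpr HK HS.
    apply SB_weaken with (c * c * K); [|apply Rmult_le_compat_l; nra].
    apply (SB_inj (fun x => (zsub (nu (fst (pr x))) (nu n), zsub (nu (snd (pr x))) (nu n))) _
      (fun x => c * c * (rpow (J (zadd (nu n) (fst x))) (- a) * rpow (J (zadd (nu n) (snd x))) (- a) * ind (Q x)))).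
    - intros. repeat apply Rmult_le_pos; auto; try apply rpow_nonneg. apply ind_bound.
    - intros x Hx. apply ind_nz in Hx. rewrite !ind_true by auto. rewrite !Rmult_1_r. cbn [fst snd].
      rewrite !Hsub. apply W.
    - intros x y _ _ E. apply Hpr.
      assert (fst (pr x) = fst (pr y)) by (apply Hinj; apply (f_equal fst) in E; exact E).
      assert (snd (pr x) = snd (pr y)) by (apply Hinj; apply (f_equal snd) in E; exact E).
      destruct (pr x), (pr y); simpl in *; congruence.
    - apply SB_scal; [nra|assumption]. }
  split; [|split].
  - apply (G (fun x => x) (fun x => fst x <> (0,0)%Z /\ snd x <> (0,0)%Z /\ online (snd x) m (fst x)) K1); auto.
    + intros [P Q] [[HP HQ] E]. cbn [fst snd] in *. split; [|split]; auto.
      rewrite <- E. unfold online, zsub, nu, phase, qz, third. cbn [fst snd]. ring.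
    + apply Rmax_l.
  - apply (G (fun x => (third n (fst x) (snd x), snd x))
       (fun x => snd x <> (0,0)%Z /\ online (snd x) (m + 2 * (fst (snd x) * snd (snd x))) (fst x)) K2).
    + intros [P Q] [[HP HQ] E]. cbn [fst snd] in *. split; auto.
      rewrite <- E. unfold online, zsub, nu, phase, qz, third. cbn [fst snd]. ring.
    + intros [[a1 b1] [c1 d1]] [[a2 b2] [c2 d2]]. unfold third. cbn [fst snd]. intros E. injection E. intros.
      repeat f_equal; lia.
    + apply Rmax_r.
    + specialize (H2 (nu n) m).
      apply (SB_inj (fun x : Z2 * Z2 => (snd x, fst x)) _ _ _) with (4 := H2).
      * intros. repeat apply Rmult_le_pos; try apply rpow_nonneg. apply ind_bound.
      * intros [P Q] _. simpl. lra.
      * intros [P Q] [P' Q'] _ _ E. simpl in E. congruence.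
  - apply (G (fun x => (fst x, third n (fst x) (snd x)))
       (fun x => fst x <> (0,0)%Z /\ online (fst x) (m + 2 * (fst (fst x) * snd (fst x))) (snd x)) K2).
    + intros [P Q] [[HP HQ] E]. cbn [fst snd] in *. split; auto.
      rewrite <- E. unfold online, zsub, nu, phase, qz, third. cbn [fst snd]. ring.
    + intros [[a1 b1] [c1 d1]] [[a2 b2] [c2 d2]]. unfold third. cbn [fst snd]. intros E. injection E. intros.
      repeat f_equal; lia.
    + apply Rmax_r.
    + apply H2.
Qed.

(** * Trilinear estimates in Fourier space-time *)

Definition mode : Type := (Z2 * Z)%type.

(** Equals [1 - 1_{n1 = n} - 1_{n3 = n}]: removing both resonant families takes the interaction
    [n1 = n3 = n] away twice, which leaves it with the sign -1. *)
Definition sg (n n1 n3 : Z2) : R :=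
  if ceq n1 n then (if ceq n3 n then -1 else 0) else (if ceq n3 n then 0 else 1).

Definition active (n n1 n3 : Z2) : Prop := nonres n n1 n3 \/ (n1 = n /\ n3 = n).

Lemma sg_abs n n1 n3 : Rabs (sg n n1 n3) = ind (active n n1 n3).
Proof.
  unfold sg, active, nonres.
  destruct (ceq n1 n), (ceq n3 n); [rewrite ind_true by tauto|rewrite ind_false by tauto
    |rewrite ind_false by tauto|rewrite ind_true by tauto]; rewrite ?Rabs_R1, ?Rabs_R0; trivial.
  rewrite Rabs_left; lra.
Qed.

(** The time frequency of the conjugated factor is forced: the oscillation at frequency [phase] and
    the three time frequencies must combine to that of [xi]. *)
Definition mode2 (xi xi1 xi3 : mode) : mode :=
  (third (fst xi) (fst xi1) (fst xi3), phase (fst xi) (fst xi1) (fst xi3) + snd xi1 + snd xi3 - snd xi)%Z.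

Definition tri_term (F1 F2 F3 : mode -> C) (xi : mode) (x : mode * mode) : C :=
  (RtoC (sg (fst xi) (fst (fst x)) (fst (snd x))) *
   (F1 (fst x) * Cconj (F2 (mode2 xi (fst x) (snd x))) * F3 (snd x)))%C.

(** The space-time Fourier coefficients of the gauged nonlinearity; evaluating them at time [t]
    gives [GN t], see [val_equation]. *)
Definition MN (F1 F2 F3 : mode -> C) (xi : mode) : C := csum (tri_term F1 F2 F3 xi).

Lemma tri_term_mod F1 F2 F3 xi x : Cmod (tri_term F1 F2 F3 xi x) =
  Cmod (F1 (fst x)) * Cmod (F2 (mode2 xi (fst x) (snd x))) * Cmod (F3 (snd x)) *
  ind (active (fst xi) (fst (fst x)) (fst (snd x))).
Proof. unfold tri_term. rewrite !Cmod_mult, Cmod_R, sg_abs, Cmod_conj. ring. Qed.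

Definition jz (k : Z) : R := 1 + Rabs (IZR k).

Lemma jz_ge1 k : 1 <= jz k.
Proof. apply Rabs1_pos. Qed.

Definition conj_exp (p : R) : R := p / (p - 1).

Definition bexp (p : R) : R := 1 - / (2 * p).

Lemma conj_exp_gt1 p : 1 < p -> 1 < conj_exp p.
Proof.
  intros Hp. unfold conj_exp. replace (p / (p - 1)) with (1 + / (p - 1)) by (field; lra).
  pose proof (Rinv_0_lt_compat (p - 1)). lra.
Qed.

Lemma conj_exp_inv p : 1 < p -> / p + / conj_exp p = 1.
Proof. intros Hp. unfold conj_exp. field. lra. Qed.

Lemma bexp_conj p : 1 < p -> 1 < bexp p * conj_exp p.
Proof.
  intros Hp. unfold bexp, conj_exp.
  replace ((1 - / (2 * p)) * (p / (p - 1))) with (1 + / (2 * (p - 1))) by (field; lra).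
  pose proof (Rinv_0_lt_compat (2 * (p - 1))). lra.
Qed.

Lemma bexp_bounds p : 1 < p -> 0 < bexp p < 1.
Proof.
  intros Hp. unfold bexp. pose proof (Rinv_0_lt_compat (2 * p)).
  assert (/ (2 * p) < 1) by (rewrite <- Rinv_1; apply Rinv_lt_contravar; lra). lra.
Qed.

(** All three time frequencies are taken as independent variables. Once they are fixed the phase is
    fixed too, so the spatial sum is at most [K], and each of the three time sums converges since
    [beta > 1]. *)
Lemma kernel_time (W : Z2 -> Z2 -> Z2 -> R) K beta xi : 1 < beta -> (forall n n1 n3, 0 <= W n n1 n3) ->
  (forall n m, SB (fun y : Z2 * Z2 => W n (fst y) (snd y) *
      ind (active n (fst y) (snd y) /\ phase n (fst y) (snd y) = m)) K) ->
  SB (fun x : mode * mode => W (fst xi) (fst (fst x)) (fst (snd x)) *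
      ind (active (fst xi) (fst (fst x)) (fst (snd x))) *
      (rpow (jz (snd (fst x))) (- beta) * rpow (jz (snd (mode2 xi (fst x) (snd x)))) (- beta) *
       rpow (jz (snd (snd x))) (- beta)))
     ((2 * (1 + / (beta - 1))) ^ 3 * K).
Proof.
  intros Hb HW HK. pose proof (sum_Z_bound beta Hb) as HZ. set (c := 2 * (1 + / (beta - 1))) in *.
  set (v := fun k => rpow (jz k) (- beta)).
  assert (Hv : forall k, 0 <= v k) by (intros; apply rpow_nonneg).
  assert (HK0 : 0 <= K) by (eapply SB_nonneg; apply (HK (0,0)%Z 0%Z)).
  assert (H3 : SB (fun z : (Z * Z) * Z => v (fst (fst z)) * v (snd (fst z)) * v (snd z)) (c * c * c)).
  { apply (SB_mul_prod (fun z : Z * Z => v (fst z) * v (snd z)) v); auto.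
    - intros; apply Rmult_le_pos; auto.
    - apply SB_mul_prod; auto. }
  set (n := fst xi).
  apply (SB_inj (fun x : mode * mode => (((snd (fst x), snd (snd x)), snd (mode2 xi (fst x) (snd x))), (fst (fst x), fst (snd x)))) _
    (fun z : ((Z * Z) * Z) * (Z2 * Z2) => v (fst (fst (fst z))) * v (snd (fst (fst z))) * v (snd (fst z)) *
       (W n (fst (snd z)) (snd (snd z)) * ind (active n (fst (snd z)) (snd (snd z)) /\
        phase n (fst (snd z)) (snd (snd z)) = (snd (fst z) - fst (fst (fst z)) - snd (fst (fst z)) + snd xi)%Z)))).
  - intros. repeat apply Rmult_le_pos; auto. apply ind_bound.
  - intros [[n1 k1] [n3 k3]] _. cbn [fst snd]. fold n. unfold v.
    destruct (classic (active n n1 n3)) as [Ha|Ha].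
    + rewrite !ind_true; auto; [right; ring|]. split; [assumption|]. unfold mode2. cbn [fst snd]. fold n. ring.
    + rewrite (ind_false (active n n1 n3)), (ind_false (_ /\ _)) by tauto. right. ring.
  - intros [[n1 k1] [n3 k3]] [[n1' k1'] [n3' k3']] _ _ E. cbn [fst snd] in E. injection E. intros. subst. reflexivity.
  - replace (c ^ 3 * K) with (K * (c * c * c)) by ring.
    apply (SB_prod (fun (z : (Z * Z) * Z) (y : Z2 * Z2) => v (fst (fst z)) * v (snd (fst z)) * v (snd z) *
       (W n (fst y) (snd y) * ind (active n (fst y) (snd y) /\
        phase n (fst y) (snd y) = (snd z - fst (fst z) - snd (fst z) + snd xi)%Z)))
       (fun z => K * (v (fst (fst z)) * v (snd (fst z)) * v (snd z)))).
    + intros. repeat apply Rmult_le_pos; auto. apply ind_bound.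
    + intros z. rewrite (Rmult_comm K). apply SB_scal; [repeat apply Rmult_le_pos; auto|]. apply HK.
    + apply SB_scal; assumption.
Qed.

Definition wmod (w : Z2 -> R) (b : R) (F : mode -> C) (xi : mode) : R :=
  w (fst xi) * rpow (jz (snd xi)) b * Cmod (F xi).

Lemma wmod_nonneg w b F xi : (forall n, 0 < w n) -> 0 <= wmod w b F xi.
Proof.
  intros Hw. unfold wmod. specialize (Hw (fst xi)). pose proof (rpow_nonneg (jz (snd xi)) b).
  pose proof (Cmod_ge_0 (F xi)). apply Rmult_le_pos; nra.
Qed.

Definition kernel_const (p K : R) : R :=
  rpow ((2 * (1 + / (bexp p * conj_exp p - 1))) ^ 3 * K) (/ conj_exp p).

(** Hölder in the inner sum: the weights go to the [p'] factor, which [kernel_time] bounds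
    uniformly, and the functions to the [p] factor, summed together with the outer index. The map
    [e] covers both outer sums that occur, over all modes and over the time frequencies at a fixed
    [n]. *)
Lemma tri_general {I : Type} (e : I -> mode) (p : R) (w0 w1 w2 w3 : Z2 -> R) K R0 F1 F2 F3 :
  1 < p -> (forall n, 0 < w0 n) -> (forall n, 0 < w1 n) -> (forall n, 0 < w2 n) -> (forall n, 0 < w3 n) ->
  (forall n m, SB (fun y : Z2 * Z2 =>
      rpow (w0 n * / (w1 (fst y) * w2 (third n (fst y) (snd y)) * w3 (snd y))) (conj_exp p) *
      ind (active n (fst y) (snd y) /\ phase n (fst y) (snd y) = m)) K) ->
  0 <= R0 ->
  SB (fun ix : I * (mode * mode) => rpow (wmod w1 (bexp p) F1 (fst (snd ix)) *
      wmod w2 (bexp p) F2 (mode2 (e (fst ix)) (fst (snd ix)) (snd (snd ix))) *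
      wmod w3 (bexp p) F3 (snd (snd ix))) p *
      ind (active (fst (e (fst ix))) (fst (fst (snd ix))) (fst (snd (snd ix))))) (rpow R0 p) ->
  (forall i, exists B, SB (fun x => Cmod (tri_term F1 F2 F3 (e i) x)) B) /\
  SB (fun i => rpow (w0 (fst (e i)) * Cmod (MN F1 F2 F3 (e i))) p) (rpow (kernel_const p K * R0) p).
Proof.
  intros Hp H0 H1 H2 H3 HK HR HS.
  pose proof (bexp_conj p Hp) as Hb. pose proof (conj_exp_gt1 p Hp) as Hp'.
  set (p' := conj_exp p) in *. set (b := bexp p) in *.
  set (act := fun i (x : mode * mode) => active (fst (e i)) (fst (fst x)) (fst (snd x))).
  set (T := fun i x => wmod w1 b F1 (fst x) * wmod w2 b F2 (mode2 (e i) (fst x) (snd x)) * wmod w3 b F3 (snd x)).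
  assert (HT : forall i x, 0 <= T i x) by (intros; unfold T; apply Rmult_le_pos; [apply Rmult_le_pos|]; apply wmod_nonneg; auto).
  destruct (SB_prod_inv (fun i x => rpow (T i x) p * ind (act i x)) (rpow R0 p)) as [HB1 HB2].
  { intros; apply Rmult_le_pos; [apply rpow_nonneg|apply ind_bound]. }
  { exact HS. }
  set (KK := (2 * (1 + / (b * p' - 1))) ^ 3 * K).
  assert (P : forall i, SB (fun x => w0 (fst (e i)) * Cmod (tri_term F1 F2 F3 (e i) x))
     (rpow KK (/ p') * rpow (tsum (fun x => rpow (T i x) p * ind (act i x))) (/ p))).
  { intros i. set (xi := e i).
    set (V := fun x : mode * mode => w0 (fst xi) * / (w1 (fst (fst x)) * w2 (third (fst xi) (fst (fst x)) (fst (snd x))) * w3 (fst (snd x)))).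
    set (tt := fun x : mode * mode => rpow (jz (snd (fst x))) (- b) * rpow (jz (snd (mode2 xi (fst x) (snd x)))) (- b) * rpow (jz (snd (snd x))) (- b)).
    assert (HV : forall x, 0 <= V x).
    { intros x. unfold V. left. apply Rmult_lt_0_compat; [auto|]. apply Rinv_0_lt_compat.
      repeat apply Rmult_lt_0_compat; auto. }
    assert (Htt : forall x, 0 <= tt x) by (intros; unfold tt; repeat apply Rmult_le_pos; apply rpow_nonneg).
    apply (SB_le _ (fun x => (V x * ind (act i x) * tt x) * (T i x * ind (act i x)))).
    - intros x. rewrite tri_term_mod. right. unfold T, wmod, V, tt.
      set (z2 := mode2 xi (fst x) (snd x)).
      assert (X : forall k, rpow (jz k) b <> 0).
      { intros k. pose proof (jz_ge1 k). pose proof (rpow_gt0 (jz k) b). lra. }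
      assert (Y : forall n, w1 n <> 0 /\ w2 n <> 0 /\ w3 n <> 0).
      { intros n. specialize (H1 n). specialize (H2 n). specialize (H3 n). lra. }
      rewrite !rpow_opp. change (mode2 (e i) (fst x) (snd x)) with z2.
      change (third (fst xi) (fst (fst x)) (fst (snd x))) with (fst z2).
      change (ind (active (fst xi) (fst (fst x)) (fst (snd x)))) with (ind (act i x)).
      assert (Ei : ind (act i x) = ind (act i x) * ind (act i x)).
      { unfold ind. destruct (excluded_middle_informative _); ring. }
      rewrite Ei at 1. field. repeat split; auto; apply Y.
    - apply SB_holder with (p := p) (p' := p'); auto.
      + intros x. apply Rmult_le_pos; [apply Rmult_le_pos; [apply HV|apply ind_bound]|apply Htt].
      + intros x. apply Rmult_le_pos; auto. apply ind_bound.
      + apply conj_exp_inv, Hp.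
      + eapply SB_le; [|apply (kernel_time (fun n n1 n3 => rpow (w0 n * / (w1 n1 * w2 (third n n1 n3) * w3 n3)) p') K (b * p') xi); auto using rpow_nonneg].
        intros x. cbn beta. fold (V x). fold (act i x).
        assert (Ei : rpow (ind (act i x)) p' = ind (act i x)).
        { unfold ind. destruct (excluded_middle_informative _); [apply rpow_one|apply rpow_0]. }
        pose proof (ind_bound (act i x)).
        rewrite !rpow_mult; auto; try (apply Rmult_le_pos; auto; tauto); try tauto.
        rewrite Ei. right. f_equal. unfold tt.
        rewrite !rpow_mult by (repeat apply Rmult_le_pos; apply rpow_nonneg).
        rewrite !rpow_rpow. replace (- b * p') with (- (b * p')) by ring. reflexivity.
      + apply (SB_le _ (fun x => rpow (T i x) p * ind (act i x))); [|eapply tsum_SB, HB1].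
        intros x. pose proof (ind_bound (act i x)). rewrite rpow_mult by (auto; tauto).
        assert (Ei : rpow (ind (act i x)) p = ind (act i x)).
        { unfold ind. destruct (excluded_middle_informative _); [apply rpow_one|apply rpow_0]. }
        rewrite Ei. lra. }
  assert (P' : forall i, SB (fun x => Cmod (tri_term F1 F2 F3 (e i) x))
     (/ w0 (fst (e i)) * (rpow KK (/ p') * rpow (tsum (fun x => rpow (T i x) p * ind (act i x))) (/ p)))).
  { intros i. pose proof (H0 (fst (e i))).
    apply (SB_le _ (fun x => / w0 (fst (e i)) * (w0 (fst (e i)) * Cmod (tri_term F1 F2 F3 (e i) x)))).
    - intros x. right. field. lra.
    - apply SB_scal; [left; apply Rinv_0_lt_compat; assumption|apply P]. }
  split; [intros i; eauto|].
  set (c := kernel_const p K). assert (Hc : 0 <= c) by apply rpow_nonneg.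
  rewrite rpow_mult by assumption.
  apply (SB_le _ (fun i => rpow c p * tsum (fun x => rpow (T i x) p * ind (act i x)))).
  - intros i. pose proof (csum_bound _ _ (P' i)) as L. fold (MN F1 F2 F3 (e i)) in L.
    pose proof (H0 (fst (e i))) as Hw.
    assert (Ht : 0 <= tsum (fun x => rpow (T i x) p * ind (act i x))) by (eapply tsum_nonneg, HB1).
    apply Rle_trans with (rpow (c * rpow (tsum (fun x => rpow (T i x) p * ind (act i x))) (/ p)) p).
    + apply rpow_le; [lra|]. split; [apply Rmult_le_pos; [lra|apply Cmod_ge_0]|].
      apply Rmult_le_compat_l with (r := w0 (fst (e i))) in L; [|lra].
      rewrite <- Rmult_assoc, Rinv_r, Rmult_1_l in L by lra. exact L.
    + rewrite rpow_mult by (auto; apply rpow_nonneg). rewrite rpow_inv_l by lra. lra.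
  - apply SB_scal; [apply rpow_nonneg|exact HB2].
Qed.

(** * Spatial weights and the kernel sums *)

Lemma jbr_third_le n n1 n3 : jbr n <= 3 * (jbr n1 + jbr (third n n1 n3) + jbr n3).
Proof.
  set (n2 := third n n1 n3).
  assert (T : forall (x y : R), 0 <= x -> 0 <= y -> sqrt (1 + x ^ 2 + y ^ 2) <= 1 + x + y).
  { intros x y Hx Hy. rewrite <- (sqrt_pow2 (1 + x + y)) by lra. apply sqrt_le_1_alt. simpl. nra. }
  assert (A : forall z z1 z2 z3 : Z, (z2 = z1 + z3 - z)%Z ->
     Rabs (IZR z) <= Rabs (IZR z1) + Rabs (IZR z2) + Rabs (IZR z3)).
  { intros z z1 z2 z3 E. rewrite <- !abs_IZR, <- !plus_IZR. apply IZR_le. lia. }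
  pose proof (A (fst n) (fst n1) (fst n2) (fst n3) eq_refl).
  pose proof (A (snd n) (snd n1) (snd n2) (snd n3) eq_refl).
  pose proof (T (Rabs (IZR (fst n))) (Rabs (IZR (snd n))) (Rabs_pos _) (Rabs_pos _)) as L.
  rewrite !pow2_abs in L. fold (jbr n) in L.
  pose proof (jbr_ge1 n1). pose proof (jbr_ge_fst n1). pose proof (jbr_ge_snd n1).
  pose proof (jbr_ge1 n2). pose proof (jbr_ge_fst n2). pose proof (jbr_ge_snd n2).
  pose proof (jbr_ge1 n3). pose proof (jbr_ge_fst n3). pose proof (jbr_ge_snd n3). lra.
Qed.

Definition wt (s : R) (n : Z2) : R := rpow (jbr n) s.

Definition w1 (n : Z2) : R := 1.

Lemma wt_pos s n : 0 < wt s n.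
Proof. apply rpow_gt0. pose proof (jbr_ge1 n). lra. Qed.

Lemma w1_pos n : 0 < w1 n.
Proof. unfold w1. lra. Qed.

Lemma wt_inv s n a : rpow (/ wt s n) a = rpow (jbr n) (- (s * a)).
Proof.
  unfold wt. rewrite <- rpow_opp, rpow_rpow. f_equal. ring.
Qed.

Lemma SB_diag n : SB (fun y : Z2 * Z2 => ind (fst y = n /\ snd y = n)) 1.
Proof.
  apply (SB_inj (fun _ => tt) _ (fun _ : unit => 1)).
  - intros; lra.
  - intros; apply ind_bound.
  - intros x y Hx Hy _.
    assert (X : fst x = n /\ snd x = n) by (apply NNPP; intros N; apply Hx, ind_false, N).
    assert (Y : fst y = n /\ snd y = n) by (apply NNPP; intros N; apply Hy, ind_false, N).
    destruct x, y; simpl in *. destruct X, Y; subst. reflexivity.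
  - intros l Hl. destruct l as [|[] [|[] l]]; simpl; try lra.
    inversion Hl as [|? ? X _]; subst. exfalso; apply X; left; reflexivity.
Qed.

(** The diagonal interaction [n1 = n3 = n] escapes the counting, but it is a single term of size at
    most 1. *)
Lemma kernel_split (f g : Z2 -> Z2 * Z2 -> R) K :
  (forall n y, 0 <= f n y) -> (forall n y, f n y <= g n y) -> (forall n, f n (n, n) <= 1) ->
  (forall n m, SB (fun y => g n y * ind (nonres n (fst y) (snd y) /\ phase n (fst y) (snd y) = m)) K) ->
  forall n m, SB (fun y => f n y * ind (active n (fst y) (snd y) /\ phase n (fst y) (snd y) = m)) (K + 1).
Proof.
  intros H0 Hfg H1 HK n m.
  eapply SB_le; [|apply SB_plus; [apply (HK n m)|apply (SB_diag n)]].
  intros [n1 n3]. cbn [fst snd]. specialize (H0 n (n1, n3)). specialize (Hfg n (n1, n3)). specialize (H1 n).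
  pose proof (ind_bound (nonres n n1 n3 /\ phase n n1 n3 = m)). pose proof (ind_bound (n1 = n /\ n3 = n)).
  destruct (classic (n1 = n /\ n3 = n)) as [[E1 E3]|N].
  - rewrite (ind_true (n1 = n /\ n3 = n)) by tauto. subst.
    pose proof (ind_bound (active n n n /\ phase n n n = m)). nra.
  - destruct (classic (active n n1 n3 /\ phase n n1 n3 = m)) as [[[A|A] B]|A].
    + rewrite (ind_true (active n n1 n3 /\ _)), (ind_true (nonres n n1 n3 /\ _)) by (unfold active; tauto).
      lra.
    + contradiction.
    + rewrite (ind_false (active n n1 n3 /\ _)) by assumption. nra.
Qed.

(** By the triangle inequality the outer weight is absorbed by the largest of the three inner ones,
    and two remain. In the other three bounds the weakly measured factor carries [w1], and two
    weights remain from the start. All four thus reduce to [counting]. *)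
Lemma kernel_bounds s p : 1 < s * conj_exp p -> 0 < s -> 0 < conj_exp p -> exists K, 0 <= K /\ forall n m,
  SB (fun y : Z2 * Z2 => rpow (wt s n * / (wt s (fst y) * wt s (third n (fst y) (snd y)) * wt s (snd y))) (conj_exp p) *
      ind (active n (fst y) (snd y) /\ phase n (fst y) (snd y) = m)) K /\
  SB (fun y : Z2 * Z2 => rpow (w1 n * / (w1 (fst y) * wt s (third n (fst y) (snd y)) * wt s (snd y))) (conj_exp p) *
      ind (active n (fst y) (snd y) /\ phase n (fst y) (snd y) = m)) K /\
  SB (fun y : Z2 * Z2 => rpow (w1 n * / (wt s (fst y) * w1 (third n (fst y) (snd y)) * wt s (snd y))) (conj_exp p) *
      ind (active n (fst y) (snd y) /\ phase n (fst y) (snd y) = m)) K /\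
  SB (fun y : Z2 * Z2 => rpow (w1 n * / (wt s (fst y) * wt s (third n (fst y) (snd y)) * w1 (snd y))) (conj_exp p) *
      ind (active n (fst y) (snd y) /\ phase n (fst y) (snd y) = m)) K.
Proof.
  intros Ha Hs Hp'. set (p' := conj_exp p) in *. set (a := s * p') in *.
  destruct (counting a Ha) as [K0 HK0].
  assert (HK00 : 0 <= K0) by (eapply SB_nonneg; apply (HK0 (0,0)%Z 0%Z)).
  (* A factor 3 comes from [jbr_third_le] and another from bounding a sum of three terms by its
     maximum. *)
  set (c := rpow 9 a). assert (Hc : 1 <= c).
  { unfold c. rewrite <- (rpow_x0 9) by lra. apply rpow_exp_le; lra. }
  set (v := fun n => rpow (jbr n) (- a)).
  assert (Hv : forall n, 0 < v n) by (intros n; apply rpow_gt0; pose proof (jbr_ge1 n); lra).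
  assert (Hv1 : forall n, v n <= 1).
  { intros n. unfold v. rewrite <- (rpow_one (- a)). apply rpow_neg_le; [lra|]. pose proof (jbr_ge1 n). lra. }
  assert (E1 : forall n, rpow (/ wt s n) p' = v n) by (intros; apply wt_inv).
  assert (Hi : forall n, 0 < / wt s n) by (intros; apply Rinv_0_lt_compat, wt_pos).
  assert (G : forall (f : Z2 -> Z2 * Z2 -> R),
    (forall n y, 0 <= f n y) ->
    (forall n y, f n y <= c * (v (third n (fst y) (snd y)) * v (snd y) + v (fst y) * v (snd y) + v (fst y) * v (third n (fst y) (snd y)))) ->
    (forall n, f n (n, n) <= 1) ->
    forall n m, SB (fun y => f n y * ind (active n (fst y) (snd y) /\ phase n (fst y) (snd y) = m)) (c * (K0 + K0 + K0) + 1)).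
  { intros f H0 H1 H2. eapply kernel_split; [assumption|exact H1|assumption|].
    intros n m. destruct (HK0 n m) as (A & B & D).
    eapply SB_le; [|apply (SB_scal c); [lra|apply SB_plus; [apply SB_plus; [exact B|exact A]|exact D]]].
    intros y. cbn beta. right. unfold v. ring. }
  exists (c * (K0 + K0 + K0) + 1). split; [nra|]. intros n m.
  assert (V3 : forall x y z, 0 < v x * v y /\ 0 < v y * v z /\ 0 < v x * v z).
  { intros x y z. repeat split; apply Rmult_lt_0_compat; auto. }
  split; [|split; [|split]].
  - apply (G (fun n y => rpow (wt s n * / (wt s (fst y) * wt s (third n (fst y) (snd y)) * wt s (snd y))) p')).
    + intros; apply rpow_nonneg.
    + intros n0 [n1 n3]. cbn [fst snd]. set (n2 := third n0 n1 n3).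
      rewrite rpow_mult by (try (left; apply Rinv_0_lt_compat; repeat apply Rmult_lt_0_compat); try (left; apply wt_pos); apply wt_pos).
      rewrite !Rinv_mult. rewrite !rpow_mult by (repeat apply Rmult_le_pos; left; apply Hi). rewrite !E1.
      unfold wt. rewrite rpow_rpow. fold a.
      set (j := jbr n1 + jbr n2 + jbr n3).
      pose proof (jbr_third_le n0 n1 n3) as L. fold n2 in L. fold j in L.
      set (mx := Rmax (jbr n1) (Rmax (jbr n2) (jbr n3))).
      pose proof (jbr_ge1 n0). pose proof (jbr_ge1 n1). pose proof (jbr_ge1 n2). pose proof (jbr_ge1 n3).
      assert (j <= 3 * mx).
      { unfold j, mx. pose proof (Rmax_l (jbr n1) (Rmax (jbr n2) (jbr n3))).
        pose proof (Rmax_r (jbr n1) (Rmax (jbr n2) (jbr n3))).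
        pose proof (Rmax_l (jbr n2) (jbr n3)). pose proof (Rmax_r (jbr n2) (jbr n3)). lra. }
      assert (Hj : rpow (jbr n0) a <= c * rpow mx a).
      { unfold c. rewrite <- rpow_mult by lra. apply rpow_le; lra. }
      assert (X : forall x, rpow (jbr x) a * v x = 1).
      { intros x. unfold v. rewrite <- rpow_plus, Rplus_opp_r. apply rpow_x0. pose proof (jbr_ge1 x). lra. }
      destruct (V3 n1 n2 n3) as (P1 & P2 & P3).
      assert (Hm : rpow mx a * (v n1 * v n2 * v n3) <= v n2 * v n3 + v n1 * v n3 + v n1 * v n2).
      { unfold mx. destruct (Rmax_case_strong (jbr n1) (Rmax (jbr n2) (jbr n3)) (fun m => m = jbr n1 \/ m = jbr n2 \/ m = jbr n3)) as [-> |[-> | ->]].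
        - auto.
        - intros _. right. unfold Rmax. destruct (Rle_dec _ _); auto.
        - replace (rpow (jbr n1) a * (v n1 * v n2 * v n3)) with ((rpow (jbr n1) a * v n1) * (v n2 * v n3)) by ring. rewrite X. lra.
        - replace (rpow (jbr n2) a * (v n1 * v n2 * v n3)) with ((rpow (jbr n2) a * v n2) * (v n1 * v n3)) by ring. rewrite X. lra.
        - replace (rpow (jbr n3) a * (v n1 * v n2 * v n3)) with ((rpow (jbr n3) a * v n3) * (v n1 * v n2)) by ring. rewrite X. lra. }
      apply Rle_trans with ((c * rpow mx a) * (v n1 * v n2 * v n3)).
      * apply Rmult_le_compat_r; [|assumption]. pose proof (Hv n3). nra.
      * rewrite Rmult_assoc. apply Rmult_le_compat_l; lra.
    + intros n0. cbn [fst snd].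
      assert (E : third n0 n0 n0 = n0) by (unfold third; destruct n0; simpl; f_equal; ring).
      rewrite E. pose proof (wt_pos s n0).
      replace (wt s n0 * / (wt s n0 * wt s n0 * wt s n0)) with (/ wt s n0 * / wt s n0) by (field; lra).
      rewrite rpow_mult by (left; auto). rewrite E1. pose proof (Hv n0). pose proof (Hv1 n0). nra.
  - apply (G (fun n y => rpow (w1 n * / (w1 (fst y) * wt s (third n (fst y) (snd y)) * wt s (snd y))) p')).
    + intros; apply rpow_nonneg.
    + intros n0 [n1 n3]. unfold w1. cbn [fst snd]. rewrite !Rmult_1_l, Rinv_mult, rpow_mult by (left; auto). rewrite !E1.
      destruct (V3 n1 (third n0 n1 n3) n3) as (P1 & P2 & P3). nra.
    + intros n0. unfold w1. cbn [fst snd]. rewrite !Rmult_1_l, Rinv_mult, rpow_mult by (left; auto). rewrite !E1.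
      pose proof (Hv n0). pose proof (Hv1 n0). pose proof (Hv (third n0 n0 n0)). pose proof (Hv1 (third n0 n0 n0)). nra.
  - apply (G (fun n y => rpow (w1 n * / (wt s (fst y) * w1 (third n (fst y) (snd y)) * wt s (snd y))) p')).
    + intros; apply rpow_nonneg.
    + intros n0 [n1 n3]. unfold w1. cbn [fst snd]. rewrite !Rmult_1_l, !Rmult_1_r, Rinv_mult, rpow_mult by (left; auto). rewrite !E1.
      destruct (V3 n1 (third n0 n1 n3) n3) as (P1 & P2 & P3). nra.
    + intros n0. unfold w1. cbn [fst snd]. rewrite !Rmult_1_l, !Rmult_1_r, Rinv_mult, rpow_mult by (left; auto). rewrite !E1.
      pose proof (Hv n0). pose proof (Hv1 n0). nra.
  - apply (G (fun n y => rpow (w1 n * / (wt s (fst y) * wt s (third n (fst y) (snd y)) * w1 (snd y))) p')).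
    + intros; apply rpow_nonneg.
    + intros n0 [n1 n3]. unfold w1. cbn [fst snd]. rewrite !Rmult_1_l, !Rmult_1_r, Rinv_mult, rpow_mult by (left; auto). rewrite !E1.
      destruct (V3 n1 (third n0 n1 n3) n3) as (P1 & P2 & P3). nra.
    + intros n0. unfold w1. cbn [fst snd]. rewrite !Rmult_1_l, !Rmult_1_r, Rinv_mult, rpow_mult by (left; auto). rewrite !E1.
      pose proof (Hv n0). pose proof (Hv1 n0). pose proof (Hv (third n0 n0 n0)). pose proof (Hv1 (third n0 n0 n0)). nra.
Qed.

(** Norms appear as predicates with an explicit bound. [XN] is the strong norm, [YN] the weak one, a
    supremum over [n] of weighted [l^p] in [k]. [XN0] and [YN0] omit the time weight: this is what
    the nonlinearity satisfies before integration. *)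
Definition XN (s p : R) (F : mode -> C) (A : R) : Prop :=
  0 <= A /\ SB (fun xi => rpow (wmod (wt s) (bexp p) F xi) p) (rpow A p).

Definition YN (p : R) (F : mode -> C) (A : R) : Prop :=
  0 <= A /\ forall n, SB (fun k => rpow (wmod w1 (bexp p) F (n, k)) p) (rpow A p).

Definition XN0 (s p : R) (F : mode -> C) (A : R) : Prop :=
  0 <= A /\ SB (fun xi => rpow (wt s (fst xi) * Cmod (F xi)) p) (rpow A p).

Definition YN0 (p : R) (F : mode -> C) (A : R) : Prop :=
  0 <= A /\ forall n, SB (fun k => rpow (Cmod (F (n, k))) p) (rpow A p).

Lemma third_inj1 n a b c d : third n a b = c -> third n d b = c -> a = d.
Proof.
  destruct n, a, b, c, d. unfold third. cbn [fst snd]. intros E1 E2. injection E1. injection E2. intros.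
  f_equal; lia.
Qed.

Lemma third_inj3 n a b c d : third n a b = c -> third n a d = c -> b = d.
Proof.
  destruct n, a, b, c, d. unfold third. cbn [fst snd]. intros E1 E2. injection E1. injection E2. intros.
  f_equal; lia.
Qed.

Lemma third_inj0 n m a b : third n a b = third m a b -> n = m.
Proof.
  destruct n, a, b, m. unfold third. cbn [fst snd]. intros E1. injection E1. intros.
  f_equal; lia.
Qed.

Lemma rpow_mult3 x y z p : 0 <= x -> 0 <= y -> 0 <= z -> rpow (x * y * z) p = rpow x p * rpow y p * rpow z p.
Proof. intros. rewrite !rpow_mult; auto. apply Rmult_le_pos; assumption. Qed.

Lemma mul_ind_le x P : 0 <= x -> x * ind P <= x.
Proof. intros. pose proof (ind_bound P). nra. Qed.

(** For the strong bound the output mode and the inner modes correspond injectively to three free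
    modes, so the sum of [p]-th powers factorises. For the weak bounds [n] is fixed: the two
    strongly measured factors range freely and fix the spatial frequency of the weak one, whose sum
    in time frequency is bounded uniformly. *)
Lemma tri_bounds s p : 1 < p -> 0 < s -> 1 < s * conj_exp p -> exists c, 0 <= c /\
  (forall F1 F2 F3 A1 A2 A3, XN s p F1 A1 -> XN s p F2 A2 -> XN s p F3 A3 ->
     (forall xi, exists B, SB (fun x => Cmod (tri_term F1 F2 F3 xi x)) B) /\
     XN0 s p (MN F1 F2 F3) (c * (A1 * A2 * A3))) /\
  (forall F1 F2 F3 A1 A2 A3, YN p F1 A1 -> XN s p F2 A2 -> XN s p F3 A3 ->
     YN0 p (MN F1 F2 F3) (c * (A1 * A2 * A3))) /\
  (forall F1 F2 F3 A1 A2 A3, XN s p F1 A1 -> YN p F2 A2 -> XN s p F3 A3 ->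
     YN0 p (MN F1 F2 F3) (c * (A1 * A2 * A3))) /\
  (forall F1 F2 F3 A1 A2 A3, XN s p F1 A1 -> XN s p F2 A2 -> YN p F3 A3 ->
     YN0 p (MN F1 F2 F3) (c * (A1 * A2 * A3))).
Proof.
  intros Hp Hs Ha.
  destruct (kernel_bounds s p Ha Hs) as (K & HK & HKer).
  { pose proof (conj_exp_gt1 p Hp). lra. }
  exists (kernel_const p K). split; [apply rpow_nonneg|].
  assert (W : forall s F xi, 0 <= wmod (wt s) (bexp p) F xi) by (intros; apply wmod_nonneg, wt_pos).
  assert (W1 : forall F xi, 0 <= wmod w1 (bexp p) F xi) by (intros; apply wmod_nonneg, w1_pos).
  assert (A3 : forall x y z, 0 <= x -> 0 <= y -> 0 <= z -> 0 <= x * y * z).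
  { intros. apply Rmult_le_pos; [apply Rmult_le_pos|]; assumption. }
  pose proof (rpow_nonneg ((2 * (1 + / (bexp p * conj_exp p - 1))) ^ 3 * K) (/ conj_exp p)) as Hc.
  fold (kernel_const p K) in Hc.
  split; [|split; [|split]]; intros F1 F2 F3 B1 B2 B3 [P1 N1] [P2 N2] [P3 N3];
    pose proof (A3 _ _ _ P1 P2 P3) as P123.
  - destruct (tri_general (fun xi : mode => xi) p (wt s) (wt s) (wt s) (wt s) K (B1 * B2 * B3) F1 F2 F3) as [T1 T2];
      auto using wt_pos.
    + intros n m. apply (HKer n m).
    + rewrite rpow_mult3 by assumption.
      apply (SB_inj (fun ix : mode * (mode * mode) => ((fst (snd ix), mode2 (fst ix) (fst (snd ix)) (snd (snd ix))), snd (snd ix))) _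
        (fun z : (mode * mode) * mode => rpow (wmod (wt s) (bexp p) F1 (fst (fst z))) p * rpow (wmod (wt s) (bexp p) F2 (snd (fst z))) p *
           rpow (wmod (wt s) (bexp p) F3 (snd z)) p)).
      * intros. apply A3; apply rpow_nonneg.
      * intros x _. cbn [fst snd]. rewrite rpow_mult3 by auto. apply mul_ind_le. apply A3; apply rpow_nonneg.
      * intros [[n k] [[n1 k1] [n3 k3]]] [[n' k'] [[n1' k1'] [n3' k3']]] _ _ E. unfold mode2 in E. cbn [fst snd] in E.
        injection E as E1 E2 E3 E4 E5 E6 E7. subst.
        assert (n = n') by (apply (third_inj0 n n' n1' n3'); unfold third; f_equal; assumption). subst.
        repeat f_equal. lia.
      * apply (SB_mul_prod (fun z : mode * mode => rpow (wmod (wt s) (bexp p) F1 (fst z)) p * rpow (wmod (wt s) (bexp p) F2 (snd z)) p)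
          (fun z => rpow (wmod (wt s) (bexp p) F3 z) p)); auto using rpow_nonneg.
        -- intros; apply Rmult_le_pos; apply rpow_nonneg.
        -- apply (SB_mul_prod (fun z => rpow (wmod (wt s) (bexp p) F1 z) p) (fun z => rpow (wmod (wt s) (bexp p) F2 z) p)); auto using rpow_nonneg.
    + split; [exact T1|]. split; [apply Rmult_le_pos; assumption|exact T2].
  - split; [apply Rmult_le_pos; assumption|]. intros n.
    destruct (tri_general (fun k : Z => (n, k)) p w1 w1 (wt s) (wt s) K (B1 * B2 * B3) F1 F2 F3) as [_ T2];
      auto using wt_pos, w1_pos.
    + intros n0 m. apply (HKer n0 m).
    + rewrite rpow_mult3 by assumption.
      apply (SB_inj (fun ix : Z * (mode * mode) => ((mode2 (n, fst ix) (fst (snd ix)) (snd (snd ix)), snd (snd ix)), snd (fst (snd ix)))) _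
        (fun z : (mode * mode) * Z => rpow (wmod (wt s) (bexp p) F2 (fst (fst z))) p * rpow (wmod (wt s) (bexp p) F3 (snd (fst z))) p *
           rpow (wmod w1 (bexp p) F1 (zsub (zadd (fst (fst (fst z))) n) (fst (snd (fst z))), snd z)) p)).
      * intros. apply A3; apply rpow_nonneg.
      * intros [k [[n1 k1] [n3 k3]]] _. cbn [fst snd]. rewrite rpow_mult3 by auto.
        eapply Rle_trans; [apply mul_ind_le; apply A3; apply rpow_nonneg|]. right.
        replace (zsub (zadd (fst (mode2 (n, k) (n1, k1) (n3, k3))) n) n3) with n1; [ring|].
        destruct n, n1, n3. unfold mode2, zsub, zadd, third. cbn [fst snd]. f_equal; ring.
      * intros [k [[n1 k1] [n3 k3]]] [k' [[n1' k1'] [n3' k3']]] _ _ E. unfold mode2 in E. cbn [fst snd] in E.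
        injection E as E1 E2 E3 E4 E5 E6. subst.
        assert (n1 = n1') by (apply (third_inj1 n n1 n3' (third n n1' n3')); [unfold third; f_equal; assumption|reflexivity]).
        subst. repeat f_equal. lia.
      * apply (SB_prod (fun (z : mode * mode) (k : Z) => rpow (wmod (wt s) (bexp p) F2 (fst z)) p * rpow (wmod (wt s) (bexp p) F3 (snd z)) p *
           rpow (wmod w1 (bexp p) F1 (zsub (zadd (fst (fst z)) n) (fst (snd z)), k)) p)
          (fun z => rpow B1 p * (rpow (wmod (wt s) (bexp p) F2 (fst z)) p * rpow (wmod (wt s) (bexp p) F3 (snd z)) p))).
        -- intros; apply A3; apply rpow_nonneg.
        -- intros z. rewrite (Rmult_comm (rpow B1 p)). apply SB_scal; [apply Rmult_le_pos; apply rpow_nonneg|apply N1].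
        -- rewrite Rmult_assoc. apply SB_scal; [apply rpow_nonneg|].
           apply (SB_mul_prod (fun z => rpow (wmod (wt s) (bexp p) F2 z) p) (fun z => rpow (wmod (wt s) (bexp p) F3 z) p)); auto using rpow_nonneg.
    + eapply SB_le; [|exact T2]. intros k. cbn [fst]. unfold w1 at 1. rewrite Rmult_1_l. lra.
  - split; [apply Rmult_le_pos; assumption|]. intros n.
    destruct (tri_general (fun k : Z => (n, k)) p w1 (wt s) w1 (wt s) K (B1 * B2 * B3) F1 F2 F3) as [_ T2];
      auto using wt_pos, w1_pos.
    + intros n0 m. apply (HKer n0 m).
    + rewrite rpow_mult3 by assumption.
      apply (SB_inj (fun ix : Z * (mode * mode) => ((fst (snd ix), snd (snd ix)), snd (mode2 (n, fst ix) (fst (snd ix)) (snd (snd ix))))) _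
        (fun z : (mode * mode) * Z => rpow (wmod (wt s) (bexp p) F1 (fst (fst z))) p * rpow (wmod (wt s) (bexp p) F3 (snd (fst z))) p *
           rpow (wmod w1 (bexp p) F2 (third n (fst (fst (fst z))) (fst (snd (fst z))), snd z)) p)).
      * intros. apply A3; apply rpow_nonneg.
      * intros [k [[n1 k1] [n3 k3]]] _. cbn [fst snd]. rewrite rpow_mult3 by auto.
        eapply Rle_trans; [apply mul_ind_le; apply A3; apply rpow_nonneg|]. right.
        unfold mode2. cbn [fst snd]. ring.
      * intros [k [[n1 k1] [n3 k3]]] [k' [[n1' k1'] [n3' k3']]] _ _ E. unfold mode2 in E. cbn [fst snd] in E.
        injection E as E1 E2 E3 E4 E5. subst. repeat f_equal. lia.
      * apply (SB_prod (fun (z : mode * mode) (k : Z) => rpow (wmod (wt s) (bexp p) F1 (fst z)) p * rpow (wmod (wt s) (bexp p) F3 (snd z)) p *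
           rpow (wmod w1 (bexp p) F2 (third n (fst (fst z)) (fst (snd z)), k)) p)
          (fun z => rpow B2 p * (rpow (wmod (wt s) (bexp p) F1 (fst z)) p * rpow (wmod (wt s) (bexp p) F3 (snd z)) p))).
        -- intros; apply A3; apply rpow_nonneg.
        -- intros z. rewrite (Rmult_comm (rpow B2 p)). apply SB_scal; [apply Rmult_le_pos; apply rpow_nonneg|apply N2].
        -- replace (rpow B1 p * rpow B2 p * rpow B3 p) with (rpow B2 p * (rpow B1 p * rpow B3 p)) by ring. apply SB_scal; [apply rpow_nonneg|].
           apply (SB_mul_prod (fun z => rpow (wmod (wt s) (bexp p) F1 z) p) (fun z => rpow (wmod (wt s) (bexp p) F3 z) p)); auto using rpow_nonneg.
    + eapply SB_le; [|exact T2]. intros k. cbn [fst]. unfold w1 at 1. rewrite Rmult_1_l. lra.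
  - split; [apply Rmult_le_pos; assumption|]. intros n.
    destruct (tri_general (fun k : Z => (n, k)) p w1 (wt s) (wt s) w1 K (B1 * B2 * B3) F1 F2 F3) as [_ T2];
      auto using wt_pos, w1_pos.
    + intros n0 m. apply (HKer n0 m).
    + rewrite rpow_mult3 by assumption.
      apply (SB_inj (fun ix : Z * (mode * mode) => ((fst (snd ix), mode2 (n, fst ix) (fst (snd ix)) (snd (snd ix))), snd (snd (snd ix)))) _
        (fun z : (mode * mode) * Z => rpow (wmod (wt s) (bexp p) F1 (fst (fst z))) p * rpow (wmod (wt s) (bexp p) F2 (snd (fst z))) p *
           rpow (wmod w1 (bexp p) F3 (zsub (zadd (fst (snd (fst z))) n) (fst (fst (fst z))), snd z)) p)).
      * intros. apply A3; apply rpow_nonneg.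
      * intros [k [[n1 k1] [n3 k3]]] _. cbn [fst snd]. rewrite rpow_mult3 by auto.
        eapply Rle_trans; [apply mul_ind_le; apply A3; apply rpow_nonneg|]. right.
        replace (zsub (zadd (fst (mode2 (n, k) (n1, k1) (n3, k3))) n) n1) with n3; [ring|].
        destruct n, n1, n3. unfold mode2, zsub, zadd, third. cbn [fst snd]. f_equal; ring.
      * intros [k [[n1 k1] [n3 k3]]] [k' [[n1' k1'] [n3' k3']]] _ _ E. unfold mode2 in E. cbn [fst snd] in E.
        injection E as E1 E2 E3 E4 E5 E6. subst.
        assert (n3 = n3') by (apply (third_inj3 n n1' n3 (third n n1' n3')); [unfold third; f_equal; assumption|reflexivity]).
        subst. repeat f_equal. lia.
      * apply (SB_prod (fun (z : mode * mode) (k : Z) => rpow (wmod (wt s) (bexp p) F1 (fst z)) p * rpow (wmod (wt s) (bexp p) F2 (snd z)) p *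
           rpow (wmod w1 (bexp p) F3 (zsub (zadd (fst (snd z)) n) (fst (fst z)), k)) p)
          (fun z => rpow B3 p * (rpow (wmod (wt s) (bexp p) F1 (fst z)) p * rpow (wmod (wt s) (bexp p) F2 (snd z)) p))).
        -- intros; apply A3; apply rpow_nonneg.
        -- intros z. rewrite (Rmult_comm (rpow B3 p)). apply SB_scal; [apply Rmult_le_pos; apply rpow_nonneg|apply N3].
        -- rewrite (Rmult_comm _ (rpow B3 p)). apply SB_scal; [apply rpow_nonneg|].
           apply (SB_mul_prod (fun z => rpow (wmod (wt s) (bexp p) F1 z) p) (fun z => rpow (wmod (wt s) (bexp p) F2 z) p)); auto using rpow_nonneg.
    + eapply SB_le; [|exact T2]. intros k. cbn [fst]. unfold w1 at 1. rewrite Rmult_1_l. lra.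
Qed.

(** * Oscillating exponentials *)

Lemma cis_plus x y : cis (x + y) = (cis x * cis y)%C.
Proof. unfold cis, Cmult. simpl. rewrite cos_plus, sin_plus. f_equal; ring. Qed.

Lemma cis_0 : cis 0 = RtoC 1.
Proof. unfold cis. rewrite cos_0, sin_0. reflexivity. Qed.

Lemma cis_mod x : Cmod (cis x) = 1.
Proof.
  unfold Cmod, cis. simpl. rewrite !Rmult_1_r. rewrite <- sqrt_1. f_equal.
  pose proof (sin2_cos2 x) as H. unfold Rsqr in H. lra.
Qed.

Lemma cis_conj x : Cconj (cis x) = cis (- x).
Proof. unfold cis, Cconj. simpl. rewrite cos_neg, sin_neg. reflexivity. Qed.

Lemma cis_opp_l x : (cis (- x) * cis x)%C = RtoC 1.
Proof. rewrite <- cis_plus, Rplus_opp_l. apply cis_0. Qed.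

Lemma is_derive_continuity (f : R -> R) x l : is_derive f x l -> continuity_pt f x.
Proof. intros H. apply derivable_continuous_pt. exists l. apply is_derive_Reals, H. Qed.

Lemma sin_abs_le x : Rabs (sin x) <= Rabs x.
Proof.
  destruct (Req_dec x 0) as [->|Hx].
  - rewrite sin_0. lra.
  - destruct (MVT_gen sin 0 x cos) as (c & _ & E).
    + intros y _. auto_derive; [trivial|ring].
    + intros y _. apply continuity_sin.
    + rewrite sin_0, !Rminus_0_r in E. rewrite E, Rabs_mult.
      pose proof (COS_bound c). pose proof (Rabs_pos x).
      assert (Rabs (cos c) <= 1) by (apply Rabs_le; lra). nra.
Qed.

Lemma cos_sub1_abs x : 0 <= 1 - cos x <= Rmin (Rabs x) (x * x / 2).
Proof.
  assert (E : 1 - cos x = 2 * (sin (x / 2) * sin (x / 2))).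
  { replace x with (2 * (x / 2)) at 1 by field. rewrite cos_2a_sin. ring. }
  pose proof (sin_abs_le (x / 2)) as H.
  assert (H1 : Rabs (sin (x / 2)) <= 1) by (apply Rabs_le; pose proof (SIN_bound (x / 2)); lra).
  assert (E2 : sin (x / 2) * sin (x / 2) = Rabs (sin (x / 2)) * Rabs (sin (x / 2))).
  { rewrite <- Rabs_mult. symmetry. apply Rabs_pos_eq. nra. }
  assert (E3 : Rabs (x / 2) = Rabs x / 2) by (unfold Rdiv; rewrite Rabs_mult, (Rabs_pos_eq (/ 2)); lra).
  assert (E4 : Rabs x * Rabs x = x * x) by (rewrite <- Rabs_mult; apply Rabs_pos_eq; nra).
  pose proof (Rabs_pos (sin (x / 2))). rewrite E3 in H. rewrite E, E2.
  split; [nra|]. apply Rmin_glb; nra.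
Qed.

Lemma sin_sub_abs x : Rabs (sin x - x) <= x * x.
Proof.
  destruct (MVT_gen (fun y => sin y - y) 0 x (fun y => cos y - 1)) as (c & Hc & E).
  - intros y _. auto_derive; [trivial|ring].
  - intros y _. apply (is_derive_continuity (fun y => sin y - y) y (cos y - 1)). auto_derive; [trivial|ring].
  - rewrite sin_0, !Rminus_0_r in E. rewrite E, Rabs_mult.
    pose proof (cos_sub1_abs c) as [H1 H2]. pose proof (Rmin_l (Rabs c) (c * c / 2)).
    rewrite Rabs_minus_sym, (Rabs_pos_eq (1 - cos c)) by assumption.
    assert (Rabs c <= Rabs x).
    { unfold Rmin, Rmax in Hc. destruct (Rle_dec 0 x).
      - rewrite !Rabs_pos_eq; lra.
      - rewrite !Rabs_left1; lra. }
    assert (E4 : Rabs x * Rabs x = x * x) by (rewrite <- Rabs_mult; apply Rabs_pos_eq; nra).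
    pose proof (Rabs_pos x). nra.
Qed.

Lemma Cmod_le_sum (z : C) : Cmod z <= Rabs (fst z) + Rabs (snd z).
Proof.
  destruct z as [x y]. unfold Cmod. simpl.
  pose proof (Rabs_pos x). pose proof (Rabs_pos y).
  rewrite <- (sqrt_pow2 (Rabs x + Rabs y)) by lra. apply sqrt_le_1_alt.
  assert (Rabs x * Rabs x = x * x) by (rewrite <- Rabs_mult; apply Rabs_pos_eq; nra).
  assert (Rabs y * Rabs y = y * y) by (rewrite <- Rabs_mult; apply Rabs_pos_eq; nra).
  simpl. nra.
Qed.

Lemma cis_sub1_le x : Cmod (cis x - 1) <= 2 * Rabs x.
Proof.
  eapply Rle_trans; [apply Cmod_le_sum|]. unfold cis. simpl.
  pose proof (sin_abs_le x). pose proof (cos_sub1_abs x) as [H1 H2].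
  pose proof (Rmin_l (Rabs x) (x * x / 2)).
  replace (cos x + - (1)) with (- (1 - cos x)) by ring.
  rewrite Rabs_Ropp, Rabs_pos_eq by assumption. rewrite Ropp_0, Rplus_0_r. lra.
Qed.

Lemma cis_taylor x : Cmod (cis x - 1 - Ci * RtoC x) <= 2 * (x * x).
Proof.
  eapply Rle_trans; [apply Cmod_le_sum|]. unfold cis. simpl.
  pose proof (sin_sub_abs x). pose proof (cos_sub1_abs x) as [H1 H2].
  pose proof (Rmin_r (Rabs x) (x * x / 2)).
  replace (cos x + - (1) + - (0 * x - 1 * 0)) with (- (1 - cos x)) by ring.
  replace (sin x + - 0 + - (0 * 0 + 1 * x)) with (sin x - x) by ring.
  rewrite Rabs_Ropp, Rabs_pos_eq by assumption. nra.
Qed.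

(** * A cosine series for [t^2] and an expansion of 1 without constant term *)

Lemma is_derive_sumL (c w : nat -> R) l t :
  is_derive (fun x => sumL (fun j => c j * cos (w j * x)) l) t
    (sumL (fun j => - (c j * w j) * sin (w j * t)) l).
Proof.
  induction l as [|j l IH]; simpl.
  - apply (is_derive_const 0).
  - apply (is_derive_plus (fun x => c j * cos (w j * x)) (fun x => sumL (fun j => c j * cos (w j * x)) l)); [|exact IH].
    auto_derive; [trivial|ring].
Qed.

Lemma is_derive_sumL_sin (c w : nat -> R) l t :
  is_derive (fun x => sumL (fun j => c j * sin (w j * x)) l) t
    (sumL (fun j => c j * w j * cos (w j * t)) l).
Proof.
  induction l as [|j l IH]; simpl.
  - apply (is_derive_const 0).
  - apply (is_derive_plus (fun x => c j * sin (w j * x)) (fun x => sumL (fun j => c j * sin (w j * x)) l)); [|exact IH].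
    auto_derive; [trivial|ring].
Qed.

(** The Dirichlet kernel shifted by half a period; multiplication by [2 cos (t/2)] makes the sum
    telescope. *)
Lemma dirichlet_alt N t :
  2 * cos (t / 2) * sumL (fun j => (-1) ^ j * cos (INR j * t)) (seq 1 N) =
  - cos (t / 2) + (-1) ^ N * cos ((INR N + / 2) * t).
Proof.
  induction N as [|N IH].
  - simpl. replace ((0 + / 2) * t) with (t / 2) by field. ring.
  - rewrite seq_S, sumL_app, Rmult_plus_distr_l, IH. cbn [sumL Nat.add].
    rewrite S_INR. rewrite Rplus_0_r.
    assert (E : 2 * cos (t / 2) * cos ((INR N + 1) * t) =
       cos ((INR N + 1 + / 2) * t) + cos ((INR N + / 2) * t)).
    { replace ((INR N + 1 + / 2) * t) with ((INR N + 1) * t + t / 2) by field.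
      replace ((INR N + / 2) * t) with ((INR N + 1) * t - t / 2) by field.
      rewrite cos_plus, cos_minus. ring. }
    replace (2 * cos (t / 2) * ((-1) ^ S N * cos ((INR N + 1) * t)))
      with ((-1) ^ S N * (2 * cos (t / 2) * cos ((INR N + 1) * t))) by ring.
    rewrite E. simpl pow. ring.
Qed.

Lemma cos_half_lb t : Rabs t <= 1 -> / 2 <= cos (t / 2).
Proof.
  intros Ht. pose proof (cos_sub1_abs (t / 2)) as [_ H]. pose proof (Rmin_l (Rabs (t / 2)) (t / 2 * (t / 2) / 2)).
  unfold Rdiv in *. rewrite Rabs_mult, (Rabs_pos_eq (/ 2)) in * by lra. lra.
Qed.

(* The partial sums [S_N] of [sum_j (-1)^j cos (j t) / j^2] satisfy
   [S_N'' = 1/2 - (-1)^N cos ((N + 1/2) t) / (2 cos (t / 2))]; integrating the oscillating term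
   by parts shows that [S_N - t^2/4] is affine up to O(1/N). *)
Lemma alt_sum_derivative N x y : Rabs x <= 1 -> Rabs y <= 1 ->
  Rabs ((sumL (fun j => - ((-1) ^ j / (INR j * INR j) * INR j) * sin (INR j * x)) (seq 1 N) - x / 2) -
        (sumL (fun j => - ((-1) ^ j / (INR j * INR j) * INR j) * sin (INR j * y)) (seq 1 N) - y / 2))
  <= 4 / (INR N + / 2).
Proof.
  intros Hx Hy. set (om := INR N + / 2).
  assert (Hom : 0 < om) by (unfold om; pose proof (pos_INR N); lra).
  set (D := fun t => sumL (fun j => - ((-1) ^ j / (INR j * INR j) * INR j) * sin (INR j * t)) (seq 1 N)).
  set (w := fun t => / (2 * cos (t / 2))).
  (* The boundary term of the integration by parts: adding it to [D - t/2] leaves a derivative of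
     order [1/om]. *)
  set (E := fun t => (-1) ^ N * sin (om * t) * w t / om).
  assert (Hpow : Rabs ((-1) ^ N) = 1) by apply pow_1_abs.
  assert (HE : forall t, Rabs t <= 1 -> Rabs (E t) <= 1 / om).
  { intros t Ht. unfold E, w, Rdiv. rewrite !Rabs_mult, Hpow, Rmult_1_l.
    rewrite (Rabs_pos_eq (/ om)) by (left; apply Rinv_0_lt_compat; assumption).
    apply Rmult_le_compat_r; [left; apply Rinv_0_lt_compat; assumption|].
    pose proof (cos_half_lb t Ht). unfold Rdiv in H. rewrite (Rabs_pos_eq (/ _)) by (left; apply Rinv_0_lt_compat; lra).
    assert (Rabs (sin (om * t)) <= 1) by (apply Rabs_le; pose proof (SIN_bound (om * t)); lra).
    assert (/ (2 * cos (t * / 2)) <= 1).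
    { rewrite <- Rinv_1. apply Rinv_le_contravar; lra. }
    pose proof (Rabs_pos (sin (om * t))).
    assert (0 < / (2 * cos (t * / 2))) by (apply Rinv_0_lt_compat; lra). nra. }
  set (G := fun t => D t - t / 2 + E t).
  assert (HG : Rabs (G y - G x) <= 2 / om).
  { assert (HI : forall t, Rmin x y <= t <= Rmax x y -> Rabs t <= 1).
    { intros t Ht. apply Rabs_le. apply Rabs_le_between in Hx. apply Rabs_le_between in Hy.
      unfold Rmin, Rmax in Ht. destruct (Rle_dec x y); lra. }
    assert (HD : forall t, Rabs t <= 1 -> is_derive G t ((-1) ^ N * sin (om * t) / om * (sin (t / 2) / (4 * (cos (t / 2) * cos (t / 2)))))).
    { intros t Ht. pose proof (cos_half_lb t Ht) as Hc.
      assert (D1 : is_derive D t (sumL (fun j => - ((-1) ^ j / (INR j * INR j) * INR j) * INR j * cos (INR j * t)) (seq 1 N)))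
        by apply is_derive_sumL_sin.
      assert (EQ : sumL (fun j => - ((-1) ^ j / (INR j * INR j) * INR j) * INR j * cos (INR j * t)) (seq 1 N)
           = / 2 - (-1) ^ N * cos (om * t) * w t).
      { rewrite (sumL_ext _ (fun j => -1 * ((-1) ^ j * cos (INR j * t)))).
        - rewrite sumL_scal. pose proof (dirichlet_alt N t) as DA. fold om in DA.
          set (X := sumL (fun j => (-1) ^ j * cos (INR j * t)) (seq 1 N)) in *. unfold w.
          apply Rmult_eq_reg_l with (2 * cos (t / 2)); [|lra].
          transitivity (- (2 * cos (t / 2) * X)); [ring|]. rewrite DA. field. lra.
        - intros j Hj. apply in_seq in Hj. assert (INR j <> 0) by (apply not_0_INR; lia). field. assumption. }
      rewrite EQ in D1. unfold G, E, w.
      evar_last.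
      - apply (is_derive_plus (fun t => D t - t / 2)).
        + apply (is_derive_minus D (fun t => t / 2)); [exact D1|]. auto_derive; [trivial|reflexivity].
        + auto_derive; [|reflexivity]. lra.
      - unfold minus, plus, opp; simpl. unfold w. change (t * / 2) with (t / 2). field. lra. }
    destruct (MVT_gen G x y (fun t => (-1) ^ N * sin (om * t) / om * (sin (t / 2) / (4 * (cos (t / 2) * cos (t / 2)))))) as (c & Hc & EE).
    - intros t Ht. apply HD, HI. lra.
    - intros t Ht. eapply (is_derive_continuity G). apply HD, HI, Ht.
    - rewrite EE. specialize (HI c Hc). pose proof (cos_half_lb c HI).
      unfold Rdiv at 1 2. rewrite !Rabs_mult, Hpow, Rmult_1_l.
      rewrite (Rabs_pos_eq (/ om)) by (left; apply Rinv_0_lt_compat; assumption).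
      assert (Rabs (sin (om * c)) <= 1) by (apply Rabs_le; pose proof (SIN_bound (om * c)); lra).
      assert (B2 : Rabs (sin (c / 2) * / (4 * (cos (c / 2) * cos (c / 2)))) <= 1).
      { rewrite Rabs_mult. rewrite (Rabs_pos_eq (/ _)) by (left; apply Rinv_0_lt_compat; nra).
        assert (Rabs (sin (c / 2)) <= 1) by (apply Rabs_le; pose proof (SIN_bound (c / 2)); lra).
        assert (/ (4 * (cos (c / 2) * cos (c / 2))) <= 1) by (rewrite <- Rinv_1; apply Rinv_le_contravar; nra).
        assert (0 < / (4 * (cos (c / 2) * cos (c / 2)))) by (apply Rinv_0_lt_compat; nra).
        pose proof (Rabs_pos (sin (c / 2))). nra. }
      assert (B3 : Rabs (y - x) <= 2).
      { apply Rabs_le. apply Rabs_le_between in Hx. apply Rabs_le_between in Hy. lra. }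
      rewrite Rabs_mult in B2. pose proof (Rinv_0_lt_compat om Hom).
      pose proof (Rabs_pos (sin (om * c))). pose proof (Rabs_pos (y - x)).
      set (u := Rabs (sin (om * c))) in *. set (v := Rabs (sin (c / 2)) * _) in *.
      assert (0 <= v) by (apply Rmult_le_pos; apply Rabs_pos).
      assert (u * / om * v <= / om).
      { apply Rle_trans with (1 * / om * 1); [|lra]. apply Rmult_le_compat; nra. }
      assert (0 <= u * / om * v) by (apply Rmult_le_pos; nra).
      unfold Rdiv. nra. }
  change (Rabs ((D x - x / 2) - (D y - y / 2)) <= 4 / om).
  pose proof (HE x Hx). pose proof (HE y Hy). unfold G in HG.
  apply Rabs_le_between in H. apply Rabs_le_between in H0. apply Rabs_le_between in HG.
  unfold Rdiv in *. apply Rabs_le. lra.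
Qed.

(** A second difference with step 1/2 removes the affine part left undetermined by
    [alt_sum_derivative] and turns [t^2/4] into the constant [1/8], while every cosine keeps its
    frequency. For [|t| <= 1/2] the shifted arguments stay in [[-1, 1]]. *)
Lemma alt_sum_second_difference N t : Rabs t <= / 2 ->
  Rabs (sumL (fun j => 2 * ((-1) ^ j / (INR j * INR j)) * (cos (INR j / 2) - 1) * cos (INR j * t)) (seq 1 N) - / 8)
  <= 2 / (INR N + / 2).
Proof.
  intros Ht. set (om := INR N + / 2).
  set (Hf := fun x => sumL (fun j => (-1) ^ j / (INR j * INR j) * cos (INR j * x)) (seq 1 N) - x * x / 4).
  set (D := fun x => sumL (fun j => - ((-1) ^ j / (INR j * INR j) * INR j) * sin (INR j * x)) (seq 1 N) - x / 2).
  assert (HD : forall x, is_derive Hf x (D x)).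
  { intros x. unfold Hf, D.
    apply (is_derive_minus (fun x => sumL (fun j => (-1) ^ j / (INR j * INR j) * cos (INR j * x)) (seq 1 N)) (fun x => x * x / 4)).
    - apply (is_derive_sumL (fun j => (-1) ^ j / (INR j * INR j)) INR).
    - auto_derive; [trivial|field]. }
  apply Rabs_le_between in Ht.
  destruct (MVT_gen (fun x => Hf (x + / 2) - Hf x) (t - / 2) t (fun x => D (x + / 2) - D x)) as (c & Hc & E).
  - intros x _. apply (is_derive_minus (fun x => Hf (x + / 2)) Hf); [|apply HD].
    evar_last.
    + apply (is_derive_comp Hf (fun x => x + / 2)); [apply HD|]. auto_derive; [trivial|reflexivity].
    + unfold scal; simpl; unfold mult; simpl. ring.
  - intros x _. eapply (is_derive_continuity (fun x => Hf (x + / 2) - Hf x)).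
    apply (is_derive_minus (fun x => Hf (x + / 2)) Hf); [|apply HD].
    apply (is_derive_comp Hf (fun x => x + / 2)); [apply HD|]. auto_derive; [trivial|reflexivity].
  - unfold Rmin, Rmax in Hc. destruct (Rle_dec (t - / 2) t); [|lra].
    assert (A : Rabs (D (c + / 2) - D c) <= 4 / om).
    { apply alt_sum_derivative; apply Rabs_le; lra. }
    replace (t - / 2 + / 2) with t in E by ring.
    assert (E2 : Hf (t + / 2) - Hf t - (Hf t - Hf (t - / 2)) =
      sumL (fun j => 2 * ((-1) ^ j / (INR j * INR j)) * (cos (INR j / 2) - 1) * cos (INR j * t)) (seq 1 N) - / 8).
    { unfold Hf.
      rewrite (sumL_ext (fun j => 2 * ((-1) ^ j / (INR j * INR j)) * (cos (INR j / 2) - 1) * cos (INR j * t))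
        (fun j => ((-1) ^ j / (INR j * INR j) * cos (INR j * (t + / 2)) + -1 * ((-1) ^ j / (INR j * INR j) * cos (INR j * t))) +
           (-1 * ((-1) ^ j / (INR j * INR j) * cos (INR j * t)) + (-1) ^ j / (INR j * INR j) * cos (INR j * (t - / 2))))).
      - rewrite !sumL_plus, !sumL_scal. field.
      - intros j _. replace (INR j * (t + / 2)) with (INR j * t + INR j / 2) by field.
        replace (INR j * (t - / 2)) with (INR j * t - INR j / 2) by field.
        rewrite cos_plus, cos_minus. ring. }
    rewrite <- E2, E. replace (t - (t - / 2)) with (/ 2) by ring.
    rewrite Rabs_mult, (Rabs_pos_eq (/ 2)) by lra. unfold Rdiv in *. lra.
Qed.

(** Fourier coefficients of the constant 1 on [|t| <= 1/2], with none at frequency 0; the factor 8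
    undoes the value [1/8] of the second difference. *)
Definition unit_coef (j : Z) : R :=
  8 * ((-1) ^ Z.abs_nat j / (IZR j * IZR j)) * (cos (IZR j / 2) - 1) * ind (j <> 0%Z).

Lemma unit_coef_0 : unit_coef 0 = 0.
Proof. unfold unit_coef. rewrite ind_false by tauto. ring. Qed.

Lemma unit_coef_opp j : unit_coef (- j) = unit_coef j.
Proof.
  unfold unit_coef. replace (Z.abs_nat (- j)) with (Z.abs_nat j) by lia. rewrite opp_IZR.
  replace (- IZR j / 2) with (- (IZR j / 2)) by field. rewrite cos_neg.
  replace (- IZR j * - IZR j) with (IZR j * IZR j) by ring. f_equal.
  destruct (Z.eq_dec j 0) as [->|H]; [rewrite !ind_false by tauto; reflexivity|].
  rewrite !ind_true; auto; lia.
Qed.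

Lemma unit_coef_bound j : Rabs (unit_coef j) <= 64 * rpow (jz j) (- (2)).
Proof.
  destruct (Z.eq_dec j 0) as [->|H].
  - rewrite unit_coef_0, Rabs_R0. apply Rmult_le_pos; [lra|apply rpow_nonneg].
  - unfold unit_coef. rewrite ind_true, Rmult_1_r by assumption.
    assert (Hj : 1 <= Rabs (IZR j)) by (rewrite <- abs_IZR; apply IZR_le; lia).
    assert (E : IZR j * IZR j = Rabs (IZR j) * Rabs (IZR j)) by (rewrite <- Rabs_mult; symmetry; apply Rabs_pos_eq; nra).
    rewrite rpow_opp, rpow_2 by (pose proof (jz_ge1 j); lra).
    assert (Hp : Rabs ((-1) ^ Z.abs_nat j) = 1) by apply pow_1_abs.
    unfold Rdiv at 1. rewrite !Rabs_mult, Hp, (Rabs_pos_eq 8), Rmult_1_l by lra.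
    rewrite (Rabs_pos_eq (/ _)) by (left; apply Rinv_0_lt_compat; nra).
    assert (Hc : Rabs (cos (IZR j / 2) - 1) <= 2) by (apply Rabs_le; pose proof (COS_bound (IZR j / 2)); lra).
    assert (Hi : / (IZR j * IZR j) <= 4 * / (jz j * jz j)).
    { rewrite E. unfold jz. apply Rmult_le_reg_r with (Rabs (IZR j) * Rabs (IZR j)); [nra|].
      rewrite Rinv_l by nra. apply Rmult_le_reg_r with ((1 + Rabs (IZR j)) * (1 + Rabs (IZR j))); [nra|].
      field_simplify; nra. }
    assert (0 < / (IZR j * IZR j)) by (apply Rinv_0_lt_compat; nra).
    pose proof (Rabs_pos (cos (IZR j / 2) - 1)). nra.
Qed.

Lemma unit_coef_summable r : 1 <= r -> SB (fun j => rpow (Rabs (unit_coef j)) r) (rpow 64 r * (2 * (1 + / (2 * r - 1)))).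
Proof.
  intros Hr. pose proof (sum_Z_bound (2 * r) ltac:(lra)) as H.
  eapply SB_le; [|apply (SB_scal (rpow 64 r) _ _ (rpow_nonneg _ _) H)].
  intros j. cbn beta. fold (jz j).
  eapply Rle_trans; [apply rpow_le; [lra|split; [apply Rabs_pos|apply unit_coef_bound]]|].
  rewrite rpow_mult by (try apply rpow_nonneg; lra). rewrite rpow_rpow.
  right. f_equal. f_equal. ring.
Qed.

Definition zint (N : nat) : list Z := 0%Z :: map Z.of_nat (seq 1 N) ++ map (fun j => (- Z.of_nat j)%Z) (seq 1 N).

Lemma zint_In N k : In k (zint N) <-> (Z.abs k <= Z.of_nat N)%Z.
Proof.
  unfold zint. simpl. rewrite in_app_iff, !in_map_iff. split.
  - intros [<-|[(j & <- & Hj)|(j & <- & Hj)]]; try apply in_seq in Hj; lia.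
  - intros H. destruct (Z.lt_trichotomy k 0) as [Hk|[Hk|Hk]]; [right; right|left; lia|right; left];
      exists (Z.abs_nat k); (split; [lia|apply in_seq; lia]).
Qed.

Lemma zint_NoDup N : NoDup (zint N).
Proof.
  unfold zint. constructor.
  - rewrite in_app_iff, !in_map_iff. intros [(j & E & Hj)|(j & E & Hj)]; apply in_seq in Hj; lia.
  - apply NoDup_app.
    + apply FinFun.Injective_map_NoDup; [intros x y; lia|apply seq_NoDup].
    + apply FinFun.Injective_map_NoDup; [intros x y; lia|apply seq_NoDup].
    + intros k Hk Hk'. apply in_map_iff in Hk as (j & <- & Hj). apply in_map_iff in Hk' as (j' & E & Hj').
      apply in_seq in Hj, Hj'. lia.
Qed.

Lemma zint_exhaust (l : list Z) : exists N0, forall N, (N0 <= N)%nat -> incl l (zint N).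
Proof.
  induction l as [|k l [N0 IH]].
  - exists 0%nat. intros N _ x [].
  - exists (Nat.max N0 (Z.abs_nat k)). intros N HN x [<-|Hx].
    + apply zint_In. lia.
    + apply IH; [lia|assumption].
Qed.

Lemma unit_expansion t : Rabs t <= / 2 ->
  HasSum (fun j => (RtoC (unit_coef j) * cis (IZR j * t))%C) (RtoC 1).
Proof.
  intros Ht.
  assert (HS : SB (fun j => Cmod (RtoC (unit_coef j) * cis (IZR j * t))) (64 * (2 * (1 + / (2 * 1 - 1))))).
  { pose proof (unit_coef_summable 1 (Rle_refl _)) as H. rewrite rpow_1 in H by lra.
    eapply SB_le; [|exact H]. intros j. rewrite Cmod_mult, Cmod_R, cis_mod, rpow_1 by apply Rabs_pos. lra. }
  pose proof (csum_HasSum _ _ HS) as H.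
  replace (RtoC 1) with (csum (fun j => (RtoC (unit_coef j) * cis (IZR j * t))%C)); [exact H|].
  apply Ceq_eps. intros eps He.
  destruct (H (eps / 2) ltac:(lra)) as [l0 H0].
  destruct (zint_exhaust l0) as [N0 HN0].
  destruct (INR_unbounded (32 / eps)) as [N1 HN1].
  set (N := Nat.max N0 N1). specialize (H0 (zint N) (zint_NoDup N) (HN0 N (Nat.le_max_l _ _))).
  set (S := csum _) in *.
  assert (E : sumC (fun j => (RtoC (unit_coef j) * cis (IZR j * t))%C) (zint N) =
     RtoC (8 * sumL (fun j => 2 * ((-1) ^ j / (INR j * INR j)) * (cos (INR j / 2) - 1) * cos (INR j * t)) (seq 1 N))).
  { unfold zint. simpl. rewrite unit_coef_0, sumC_app, !sumC_map, Cmult_0_l, Cplus_0_l.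
    rewrite <- sumC_plus, <- sumL_scal, <- sumC_RtoC. apply sumC_ext. intros j Hj. apply in_seq in Hj.
    rewrite unit_coef_opp, opp_IZR. unfold unit_coef. rewrite Zabs2Nat.id, <- INR_IZR_INZ.
    rewrite ind_true by lia. unfold cis, RtoC, Cmult, Cplus. simpl.
    replace (- INR j * t) with (- (INR j * t)) by ring. rewrite cos_neg, sin_neg. f_equal; ring. }
  rewrite E in H0.
  pose proof (alt_sum_second_difference N t Ht) as A. set (X := sumL _ _) in *.
  assert (B : 2 / (INR N + / 2) <= eps / 16).
  { assert (INR N1 <= INR N) by (apply le_INR; unfold N; lia).
    assert (0 < INR N) by (apply Rlt_le_trans with (INR N1); [|assumption]; apply Rlt_trans with (32 / eps); [apply Rdiv_lt_0_compat; lra|assumption]).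
    apply Rmult_le_reg_r with (INR N + / 2); [lra|].
    unfold Rdiv at 1. rewrite Rmult_assoc, Rinv_l, Rmult_1_r by lra.
    assert (32 <= eps * INR N1).
    { apply Rmult_le_reg_r with (/ eps); [apply Rinv_0_lt_compat; assumption|].
      unfold Rdiv in HN1. replace (eps * INR N1 * / eps) with (INR N1) by (field; lra). lra. }
    nra. }
  replace (S - 1)%C with ((S - RtoC (8 * X)) + RtoC (8 * (X - / 8)))%C.
  2:{ rewrite Rmult_minus_distr_l, RtoC_minus. replace (8 * / 8) with 1 by field. ring. }
  eapply Rle_trans; [apply Cmod_triangle|]. rewrite Cmod_sub_swap, Cmod_R, Rabs_mult, (Rabs_pos_eq 8) by lra. lra.
Qed.

(** * Integration in time *)

(** Differentiability relative to the closed interval, one-sided at its end points. *)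
Definition wder (a c : R) (f g : R -> C) : Prop :=
  forall t, a <= t <= c -> forall eps, 0 < eps -> exists delta, 0 < delta /\
    forall t', a <= t' <= c -> Rabs (t' - t) < delta ->
      Cmod (f t' - f t - RtoC (t' - t) * g t) <= eps * Rabs (t' - t).

Lemma SB_cmod_scal {A} (f g : A -> C) K : (forall a, Cmod (g a) <= 1) -> SB (fun a => Cmod (f a)) K ->
  SB (fun a => Cmod (f a * g a)) K.
Proof.
  intros Hg H. eapply SB_le; [|exact H]. intros a. rewrite Cmod_mult.
  pose proof (Cmod_ge_0 (f a)). specialize (Hg a). nra.
Qed.

Lemma SB_cis {A} (f : A -> C) (w : A -> R) K : SB (fun a => Cmod (f a)) K ->
  SB (fun a => Cmod (f a * cis (w a))) K.
Proof. apply SB_cmod_scal. intros. rewrite cis_mod. lra. Qed.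

Lemma Rinv_IZR_abs_le (k : Z) : Rabs (/ IZR k) <= 1.
Proof.
  destruct (Z.eq_dec k 0) as [->|H].
  - rewrite Rinv_0, Rabs_R0. lra.
  - rewrite Rabs_inv, <- abs_IZR.
    rewrite <- Rinv_1. apply Rinv_le_contravar; [lra|]. apply IZR_le. lia.
Qed.

(** The first-order remainder of the [k]-th term is at most [3 |h| |H k|] uniformly in [k], which
    controls the tail; on finitely many frequencies the Taylor bound gives [O(h^2)]. At [k = 0]
    everything vanishes through [H 0 = 0]. *)
Lemma exp_series_wder (H : Z -> C) K a c : SB (fun k => Cmod (H k)) K -> H 0%Z = RtoC 0 ->
  wder a c (fun t => csum (fun k => (H k * RtoC (/ IZR k) * cis (IZR k * t))%C))
           (fun t => (Ci * csum (fun k => (H k * cis (IZR k * t))%C))%C).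
Proof.
  intros HK H0 t _ eps He.
  assert (HK' : SB (fun k => Cmod (H k * RtoC (/ IZR k))) K).
  { apply SB_cmod_scal; [|assumption]. intros k. rewrite Cmod_R. apply Rinv_IZR_abs_le. }
  destruct (SB_tail (fun k => Cmod (H k)) K (eps / 8)) as (l0 & _ & Htail); auto; [intros; apply Cmod_ge_0|lra|].
  assert (HKn : 0 <= K) by (eapply SB_nonneg; eauto).
  destruct (zint_exhaust l0) as [N0 HN0]. specialize (HN0 N0 (le_n _)).
  set (B := 2 * INR N0 * K + 1).
  assert (HB : 0 < B) by (unfold B; pose proof (pos_INR N0); nra).
  exists (eps / (2 * B)). split; [apply Rdiv_lt_0_compat; lra|].
  intros t' _ Ht'. set (h := t' - t) in *.
  set (f := fun k => (H k * (RtoC (/ IZR k) * (cis (IZR k * h) - 1) - Ci * RtoC h) * cis (IZR k * t))%C).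
  assert (E : (csum (fun k => H k * RtoC (/ IZR k) * cis (IZR k * t')) - csum (fun k => H k * RtoC (/ IZR k) * cis (IZR k * t))
     - RtoC h * (Ci * csum (fun k => H k * cis (IZR k * t))))%C = csum f).
  { rewrite Cmult_assoc. rewrite <- (csum_scal (RtoC h * Ci)%C _ K) by (apply SB_cis; assumption).
    rewrite <- (csum_minus _ _ K K) by (apply SB_cis; assumption).
    rewrite <- (csum_minus _ _ (K + K) (Cmod (RtoC h * Ci) * K)).
    - apply csum_ext. intros k. unfold f. replace t' with (h + t) by (unfold h; ring).
      rewrite Rmult_plus_distr_l, cis_plus. ring.
    - eapply SB_le; [|apply SB_plus; [apply (SB_cis _ (fun k => IZR k * t') _ HK')|apply (SB_cis _ (fun k => IZR k * t) _ HK')]].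
      intros k. cbn beta. unfold Cminus. eapply Rle_trans; [apply Cmod_triangle|]. rewrite Cmod_opp. lra.
    - eapply SB_le; [|apply (SB_scal (Cmod (RtoC h * Ci)) _ _ (Cmod_ge_0 _) HK)].
      intros k. rewrite !Cmod_mult, cis_mod. lra. }
  rewrite E. clear E.
  apply Rle_trans with (Rabs h * (2 * INR N0 * Rabs h * K + 4 * (eps / 8))).
  - apply csum_bound.
    apply (SB_le _ (fun k => Rabs h * (2 * INR N0 * Rabs h * Cmod (H k) + 4 * (if in_dec ceq k l0 then 0 else Cmod (H k))))).
    2:{ apply SB_scal; [apply Rabs_pos|]. apply SB_plus.
        - apply SB_scal; [|assumption]. pose proof (Rabs_pos h). pose proof (pos_INR N0). nra.
        - apply SB_scal; [lra|assumption]. }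
    intros k. unfold f. rewrite !Cmod_mult, cis_mod, Rmult_1_r.
    pose proof (Cmod_ge_0 (H k)) as Hk0. pose proof (Rabs_pos h) as Hh0. pose proof (pos_INR N0) as HN.
    destruct (Z.eq_dec k 0) as [->|Hk].
    { rewrite H0, Cmod_0, Rmult_0_l. destruct (in_dec ceq 0%Z l0); rewrite ?Rmult_0_r, Rplus_0_r, Rmult_0_r; lra. }
    assert (HkR : IZR k <> 0) by (apply not_0_IZR; assumption).
    assert (Hik : 0 < Rabs (/ IZR k)) by (apply Rabs_pos_lt, Rinv_neq_0_compat; assumption).
    assert (Hkk : Rabs (/ IZR k) * Rabs (IZR k) = 1) by (rewrite <- Rabs_mult, Rinv_l, Rabs_R1 by assumption; reflexivity).
    destruct (in_dec ceq k l0) as [Hin|Hin].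
    + assert (L : Cmod (RtoC (/ IZR k) * (cis (IZR k * h) - 1) - Ci * RtoC h) <= 2 * INR N0 * Rabs h * Rabs h).
      { replace (RtoC (/ IZR k) * (cis (IZR k * h) - 1) - Ci * RtoC h)%C
          with (RtoC (/ IZR k) * (cis (IZR k * h) - 1 - Ci * RtoC (IZR k * h)))%C.
        2:{ rewrite RtoC_mult.
            replace (RtoC h) with (RtoC (/ IZR k) * RtoC (IZR k) * RtoC h)%C at 2; [ring|].
            rewrite <- RtoC_mult, Rinv_l by assumption. ring. }
        rewrite Cmod_mult, Cmod_R. pose proof (cis_taylor (IZR k * h)) as T.
        apply Rle_trans with (Rabs (/ IZR k) * (2 * (IZR k * h * (IZR k * h)))); [apply Rmult_le_compat_l; lra|].
        assert (E1 : IZR k * h * (IZR k * h) = (Rabs (IZR k) * Rabs (IZR k)) * (Rabs h * Rabs h)).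
        { rewrite <- !Rabs_mult, Rabs_pos_eq; [ring|]. apply Rmult_le_pos; apply Rle_0_sqr. }
        rewrite E1. apply HN0, zint_In in Hin. apply IZR_le in Hin. rewrite abs_IZR, <- INR_IZR_INZ in Hin.
        replace (Rabs (/ IZR k) * (2 * (Rabs (IZR k) * Rabs (IZR k) * (Rabs h * Rabs h))))
          with ((Rabs (/ IZR k) * Rabs (IZR k)) * (2 * Rabs (IZR k) * (Rabs h * Rabs h))) by ring.
        rewrite Hkk. assert (0 <= Rabs h * Rabs h) by nra. nra. }
      rewrite Rmult_0_r, Rplus_0_r. nra.
    + assert (L : Cmod (RtoC (/ IZR k) * (cis (IZR k * h) - 1) - Ci * RtoC h) <= 3 * Rabs h).
      { unfold Cminus at 1. eapply Rle_trans; [apply Cmod_triangle|].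
        rewrite Cmod_opp, !Cmod_mult, !Cmod_R.
        assert (Cmod Ci = 1) by (transitivity (sqrt 1); [unfold Ci, Cmod; simpl; f_equal; ring|apply sqrt_1]).
        rewrite H1. pose proof (cis_sub1_le (IZR k * h)) as T. rewrite Rabs_mult in T. nra. }
      assert (0 <= 2 * INR N0 * Rabs h * Cmod (H k)) by (repeat apply Rmult_le_pos; lra).
      nra.
  - rewrite Rmult_comm. apply Rmult_le_compat_r; [apply Rabs_pos|].
    assert (2 * INR N0 * Rabs h * K <= eps / 2).
    { pose proof (Rabs_pos h). pose proof (pos_INR N0).
      assert (Rabs h * B <= eps / 2).
      { apply Rle_trans with (eps / (2 * B) * B); [apply Rmult_le_compat_r; lra|]. right; field; lra. }
      unfold B in H3. nra. }
    lra.
Qed.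

(** A spare power of the time weight: [(b - theta) p' > 1] still holds, so [<k>^theta F] is summable
    in [k] and evaluation in time is Hölder continuous of order [theta]. *)
Definition thexp (p : R) : R := / (4 * p).

Definition l1_const (p : R) : R := rpow (2 * (1 + / ((bexp p - thexp p) * conj_exp p - 1))) (/ conj_exp p).

Lemma thexp_pos p : 1 < p -> 0 < thexp p.
Proof. intros. apply Rinv_0_lt_compat. lra. Qed.

Lemma l1_of_weighted p G A : 1 < p -> 0 <= A ->
  SB (fun k : Z => rpow (rpow (jz k) (bexp p) * Cmod (G k)) p) (rpow A p) ->
  SB (fun k => rpow (jz k) (thexp p) * Cmod (G k)) (l1_const p * A) /\ SB (fun k => Cmod (G k)) (l1_const p * A).
Proof.
  intros Hp HA H.
  assert (Hg : 1 < (bexp p - thexp p) * conj_exp p).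
  { unfold bexp, thexp, conj_exp.
    replace ((1 - / (2 * p) - / (4 * p)) * (p / (p - 1))) with (1 + / (4 * (p - 1))) by (field; lra).
    pose proof (Rinv_0_lt_compat (4 * (p - 1))). lra. }
  pose proof (thexp_pos p Hp) as Hth. pose proof (conj_exp_gt1 p Hp) as Hp'.
  assert (M : SB (fun k => rpow (jz k) (thexp p) * Cmod (G k)) (l1_const p * A)).
  { replace A with (rpow (rpow A p) (/ p)) by (apply rpow_inv_r; lra).
    apply (SB_le _ (fun k => rpow (jz k) (- (bexp p - thexp p)) * (rpow (jz k) (bexp p) * Cmod (G k)))).
    - intros k. rewrite <- Rmult_assoc, <- rpow_plus. right. f_equal. f_equal. ring.
    - apply SB_holder with (p := p) (p' := conj_exp p); auto using rpow_nonneg.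
      + intros. apply Rmult_le_pos; [apply rpow_nonneg|apply Cmod_ge_0].
      + apply conj_exp_inv, Hp.
      + eapply SB_le; [|apply (sum_Z_bound _ Hg)]. intros k. rewrite rpow_rpow. fold (jz k).
        right. f_equal. ring. }
  split; [exact M|]. eapply SB_le; [|exact M]. intros k.
  assert (1 <= rpow (jz k) (thexp p)).
  { pose proof (jz_ge1 k). rewrite <- (rpow_x0 (jz k)) by lra. apply rpow_exp_le; lra. }
  pose proof (Cmod_ge_0 (G k)). nra.
Qed.

(** * Moving low time frequencies beyond [L], and integrating *)

Definition blk (L k : Z) : Z := ((k + L) / (2 * L))%Z.

Definition res (L k : Z) : Z := (k - 2 * L * blk L k)%Z.

Lemma res_range L k : (0 < L)%Z -> (- L <= res L k < L)%Z.
Proof.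
  intros HL. unfold res, blk. pose proof (Z.div_mod (k + L) (2 * L) ltac:(lia)).
  pose proof (Z.mod_pos_bound (k + L) (2 * L) ltac:(lia)). lia.
Qed.

Lemma blk_res L j r : (0 < L)%Z -> (- L <= r < L)%Z -> blk L (2 * L * j + r) = j.
Proof.
  intros HL Hr. unfold blk. symmetry. apply (Z.div_unique _ _ _ (r + L)); [left; lia|ring].
Qed.

Lemma blk_low L k : (0 < L)%Z -> (blk L k = 0 <-> - L <= k < L)%Z.
Proof.
  intros HL. split; intros H.
  - pose proof (res_range L k HL). unfold res in H0. rewrite H in H0. lia.
  - pose proof (blk_res L 0 k HL H). rewrite Z.mul_0_r in H0. exact H0.
Qed.

(** A frequency [r] in [[-L, L)] is spread over the frequencies [2 L j + r], [j <> 0], with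
    coefficients [d j]. The new series has no frequency in [[-L, L)] and the same values wherever
    the series of [d] equals 1. *)
Definition Ntil (L : Z) (d N : Z -> C) (k : Z) : C :=
  if Z.eq_dec (blk L k) 0 then RtoC 0 else (N k + d (blk L k) * N (res L k))%C.

Definition Gop (L : Z) (d N : Z -> C) (k : Z) : C := (Ntil L d N k * RtoC (/ IZR k))%C.

(* A right inverse of [-i d/dt] on the interval where [d] represents the constant 1; since every
   frequency it produces besides 0 has size at least [L], it is small when [L] is large. *)
Definition Lop (L : Z) (d : Z -> C) (s : R) (N : Z -> C) (k : Z) : C :=
  (Gop L d N k + (if Z.eq_dec k 0 then - csum (fun k' => Gop L d N k' * cis (IZR k' * s)) else RtoC 0))%C.

Definition unit_on (a c : R) (L : Z) (d : Z -> C) : Prop :=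
  (0 < L)%Z /\ (forall j, Cmod (d j) <= Rabs (unit_coef j)) /\
  forall t, a <= t <= c -> HasSum (fun j => (d j * cis (IZR j * (2 * IZR L * t)))%C) (RtoC 1).

(** [t |-> 2 L (t - a) - 1/2] maps the interval onto [[-1/2, 1/2]], the range of [unit_expansion];
    the shift goes into the phases of the coefficients. *)
Lemma unit_on_exists a L : (0 < L)%Z -> exists d, unit_on a (a + / (2 * IZR L)) L d.
Proof.
  intros HL. assert (HL' : 0 < IZR L) by (apply IZR_lt; assumption).
  exists (fun j => (RtoC (unit_coef j) * cis (- (IZR j * (2 * IZR L * a + / 2))))%C).
  split; [assumption|]. split.
  - intros j. rewrite Cmod_mult, Cmod_R, cis_mod. lra.
  - intros t Ht.
    apply (HasSum_ext (fun j => (RtoC (unit_coef j) * cis (IZR j * (2 * IZR L * (t - a) - / 2)))%C)).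
    + intros j. rewrite <- Cmult_assoc, <- cis_plus. f_equal. f_equal. ring.
    + apply unit_expansion. apply Rabs_le.
      assert (0 <= 2 * IZR L * (t - a)) by (apply Rmult_le_pos; lra).
      assert (2 * IZR L * (t - a) <= 2 * IZR L * / (2 * IZR L)) by (apply Rmult_le_compat_l; lra).
      rewrite Rinv_r in H0 by lra. lra.
Qed.

Lemma unit_on_d0 a c L d : unit_on a c L d -> d 0%Z = RtoC 0.
Proof.
  intros (_ & H & _). specialize (H 0%Z). rewrite unit_coef_0, Rabs_R0 in H.
  apply Cmod_eq_0. pose proof (Cmod_ge_0 (d 0%Z)). lra.
Qed.

Lemma Ntil_0 L d N : (0 < L)%Z -> Ntil L d N 0 = RtoC 0.
Proof.
  intros HL. unfold Ntil. destruct (Z.eq_dec (blk L 0) 0) as [|H]; [reflexivity|].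
  exfalso. apply H. apply blk_low; lia.
Qed.

Definition dsum (r : R) : R := rpow 64 r * (2 * (1 + / (2 * r - 1))).

Lemma folded_sum a c L d (f : Z -> R) K r : unit_on a c L d -> 1 <= r -> (forall k, 0 <= f k) -> SB f K ->
  SB (fun k => rpow (Cmod (d (blk L k))) r * f (res L k)) (dsum r * K).
Proof.
  intros (HL & Hd & _) Hr Hf HK.
  apply (SB_inj (fun k => (blk L k, res L k)) _ (fun x => rpow (Rabs (unit_coef (fst x))) r * f (snd x))).
  - intros; apply Rmult_le_pos; auto using rpow_nonneg.
  - intros k _. cbn [fst snd]. apply Rmult_le_compat_r; auto. apply rpow_le; [lra|].
    split; [apply Cmod_ge_0|apply Hd].
  - intros k k' _ _ E. injection E as E1 E2. unfold res in E2. rewrite E1 in E2. lia.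
  - apply (SB_mul_prod (fun j => rpow (Rabs (unit_coef j)) r) f); auto using rpow_nonneg.
    apply unit_coef_summable, Hr.
Qed.

Lemma Ntil_mod_le L d N k : Cmod (Ntil L d N k) <= Cmod (N k) + Cmod (d (blk L k)) * Cmod (N (res L k)).
Proof.
  unfold Ntil. destruct (Z.eq_dec (blk L k) 0).
  - rewrite Cmod_0. pose proof (Cmod_ge_0 (N k)). pose proof (Cmod_ge_0 (d (blk L k))).
    pose proof (Cmod_ge_0 (N (res L k))). nra.
  - eapply Rle_trans; [apply Cmod_triangle|]. rewrite Cmod_mult. lra.
Qed.

Lemma Ntil_summable a c L d N K : unit_on a c L d -> SB (fun k => Cmod (N k)) K ->
  SB (fun k => Cmod (Ntil L d N k)) (K + dsum 1 * K).
Proof.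
  intros HU HK. eapply SB_le; [apply Ntil_mod_le|]. apply SB_plus; [assumption|].
  eapply SB_le; [|apply (folded_sum a c L d (fun k => Cmod (N k)) K 1 HU); auto; [lra|intros; apply Cmod_ge_0]].
  intros k. cbn beta. rewrite rpow_1 by apply Cmod_ge_0. lra.
Qed.

(** Only the low frequencies change. Their copies are indexed by the pairs [(res, blk)], and summing
    over [blk] first gives the factor 1. *)
Lemma Ntil_evaluation a c L d N K t : unit_on a c L d -> SB (fun k => Cmod (N k)) K -> a <= t <= c ->
  csum (fun k => (Ntil L d N k * cis (IZR k * t))%C) = csum (fun k => (N k * cis (IZR k * t))%C).
Proof.
  intros HU HK Ht. pose proof HU as (HL & Hd & Hsum). pose proof (unit_on_d0 _ _ _ _ HU) as Hd0.
  set (low := fun k => if Z.eq_dec (blk L k) 0 then N k else RtoC 0).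
  set (high := fun k => if Z.eq_dec (blk L k) 0 then RtoC 0 else N k).
  assert (Hlow : SB (fun k => Cmod (low k)) K).
  { eapply SB_le; [|exact HK]. intros k. unfold low. destruct (Z.eq_dec _ _); [lra|]. rewrite Cmod_0. apply Cmod_ge_0. }
  assert (Hhigh : SB (fun k => Cmod (high k)) K).
  { eapply SB_le; [|exact HK]. intros k. unfold high. destruct (Z.eq_dec _ _); [|lra]. rewrite Cmod_0. apply Cmod_ge_0. }
  set (B := fun k => (d (blk L k) * N (res L k))%C).
  assert (HB : SB (fun k => Cmod (B k)) (dsum 1 * K)).
  { eapply SB_le; [|apply (folded_sum a c L d (fun k => Cmod (N k)) K 1 HU); auto; [lra|intros; apply Cmod_ge_0]].
    intros k. cbn beta. unfold B. rewrite Cmod_mult, rpow_1 by apply Cmod_ge_0. lra. }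
  rewrite (csum_ext _ (fun k => (high k * cis (IZR k * t) + B k * cis (IZR k * t))%C)).
  2:{ intros k. unfold Ntil, high, B. destruct (Z.eq_dec (blk L k) 0) as [E|E]; [rewrite E, Hd0|]; ring. }
  rewrite (csum_plus _ _ _ _ (SB_cis _ _ _ Hhigh) (SB_cis _ _ _ HB)).
  rewrite (csum_ext (fun k => (N k * cis (IZR k * t))%C) (fun k => (high k * cis (IZR k * t) + low k * cis (IZR k * t))%C)).
  2:{ intros k. unfold low, high. destruct (Z.eq_dec (blk L k) 0); ring. }
  rewrite (csum_plus _ _ _ _ (SB_cis _ _ _ Hhigh) (SB_cis _ _ _ Hlow)). f_equal.
  set (g := fun (r j : Z) => (low r * cis (IZR r * t) * (d j * cis (IZR j * (2 * IZR L * t))))%C).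
  assert (Hdj : SB (fun j => Cmod (d j * cis (IZR j * (2 * IZR L * t)))) (dsum 1)).
  { apply SB_cis. eapply SB_le; [|apply (unit_coef_summable 1); lra]. intros j. cbn beta.
    rewrite rpow_1 by apply Rabs_pos. apply Hd. }
  assert (Hg : SB (fun x => Cmod (g (fst x) (snd x))) (K * dsum 1)).
  { eapply SB_le; [|apply (SB_mul_prod _ _ _ _ (fun r => Cmod_ge_0 _) (fun j => Cmod_ge_0 _) Hlow Hdj)].
    intros [r j]. unfold g. cbn [fst snd]. rewrite (Cmod_mult (low r * _)), (Cmod_mult (low r)), cis_mod. lra. }
  transitivity (csum (fun x => g (fst x) (snd x))).
  - rewrite <- (csum_inj (fun k => (res L k, blk L k)) (fun x => g (fst x) (snd x)) (K * dsum 1)); auto.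
    + apply csum_ext. intros k. cbn [fst snd]. unfold g, B, low.
      pose proof (res_range L k HL). destruct (Z.eq_dec (blk L (res L k)) 0) as [E|E].
      2:{ exfalso. apply E. apply blk_low; auto. }
      replace (cis (IZR k * t)) with (cis (IZR (res L k) * t) * cis (IZR (blk L k) * (2 * IZR L * t)))%C; [ring|].
      rewrite <- cis_plus. f_equal.
      replace k with (2 * L * blk L k + res L k)%Z at 3 by (unfold res; ring).
      rewrite plus_IZR, !mult_IZR. ring.
    + intros k k' E. injection E as E1 E2. unfold res in E1. rewrite E2 in E1. lia.
    + intros [r j] Hne. exists (2 * L * j + r)%Z. cbn [fst snd] in *.
      assert (Hr : (- L <= r < L)%Z).
      { apply blk_low; [assumption|]. destruct (Z.eq_dec (blk L r) 0) as [|E]; [assumption|].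
        exfalso. apply Hne. unfold g, low. destruct (Z.eq_dec (blk L r) 0); [contradiction|ring]. }
      unfold res. rewrite !blk_res by assumption. f_equal. ring.
  - rewrite (csum_fubini g _ Hg). apply csum_ext. intros r. unfold g.
    rewrite (csum_scal _ _ _ Hdj). rewrite (csum_eq _ _ (Hsum t Ht)). ring.
Qed.

Definition lop_const (p : R) : R := 2 * (1 + rpow (dsum p) (/ p)) * (1 + l1_const p).

Lemma lop_const_pos p : 1 < p -> 0 < lop_const p.
Proof.
  intros Hp. unfold lop_const. pose proof (rpow_nonneg (dsum p) (/ p)).
  assert (0 <= l1_const p) by apply rpow_nonneg. nra.
Qed.

(** [Ntil] costs a constant in [l^p] and lives on [|k| >= L], where [<k>^b / |k| <= 2 L^(b-1)]. *)
Lemma Gop_bound p a c L d N A : 1 < p -> unit_on a c L d -> 0 <= A ->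
  SB (fun k => rpow (Cmod (N k)) p) (rpow A p) ->
  SB (fun k => rpow (rpow (jz k) (bexp p) * Cmod (Gop L d N k)) p)
     (rpow (2 * (1 + rpow (dsum p) (/ p)) * rpow (IZR L) (bexp p - 1) * A) p).
Proof.
  intros Hp HU HA HN. pose proof HU as (HL & _ & _).
  assert (HL1 : 1 <= IZR L) by (apply IZR_le; lia).
  pose proof (bexp_bounds p Hp) as Hb.
  set (D := rpow (dsum p) (/ p)). assert (HD : 0 <= D) by apply rpow_nonneg.
  assert (HDp : rpow D p = dsum p).
  { unfold D. apply rpow_inv_l; [|lra]. unfold dsum. apply Rmult_le_pos; [apply rpow_nonneg|].
    pose proof (Rinv_0_lt_compat (2 * p - 1)). lra. }
  assert (HT : SB (fun k => rpow (Cmod (Ntil L d N k)) p) (rpow ((1 + D) * A) p)).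
  { replace ((1 + D) * A) with (A + D * A) by ring.
    eapply SB_le; [|apply (SB_minkowski (fun k => Cmod (N k)) (fun k => Cmod (d (blk L k)) * Cmod (N (res L k))) A (D * A) p); auto].
    - intros k. cbn beta. apply rpow_le; [lra|]. split; [apply Cmod_ge_0|apply Ntil_mod_le].
    - intros; apply Cmod_ge_0.
    - intros; apply Rmult_le_pos; apply Cmod_ge_0.
    - apply Rmult_le_pos; assumption.
    - rewrite rpow_mult, HDp by assumption.
      eapply SB_le; [|apply (folded_sum a c L d (fun k => rpow (Cmod (N k)) p) _ p HU); auto using rpow_nonneg; lra].
      intros k. cbn beta. rewrite rpow_mult by apply Cmod_ge_0. lra. }
  replace (2 * (1 + D) * rpow (IZR L) (bexp p - 1) * A) with (2 * rpow (IZR L) (bexp p - 1) * ((1 + D) * A)) by ring.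
  assert (Hc : 0 <= 2 * rpow (IZR L) (bexp p - 1)) by (pose proof (rpow_nonneg (IZR L) (bexp p - 1)); lra).
  rewrite rpow_mult by (auto; apply Rmult_le_pos; lra).
  eapply SB_le; [|apply (SB_scal _ _ _ (rpow_nonneg _ _) HT)].
  intros k. cbn beta. rewrite <- rpow_mult by (auto; apply Cmod_ge_0).
  apply rpow_le; [lra|]. split; [apply Rmult_le_pos; [apply rpow_nonneg|apply Cmod_ge_0]|].
  unfold Gop. rewrite Cmod_mult, Cmod_R.
  destruct (Z.eq_dec (blk L k) 0) as [E|E].
  { unfold Ntil. destruct (Z.eq_dec (blk L k) 0); [|contradiction]. rewrite Cmod_0. lra. }
  assert (Hk : (L <= Z.abs k)%Z).
  { destruct (Z_lt_le_dec (Z.abs k) L); [|assumption]. exfalso. apply E, blk_low; lia. }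
  apply IZR_le in Hk. rewrite abs_IZR in Hk.
  assert (Hj : jz k <= 2 * Rabs (IZR k)) by (unfold jz; lra).
  assert (Hj1 : IZR L <= jz k) by (unfold jz; lra).
  assert (Hinv : Rabs (/ IZR k) <= 2 * / jz k).
  { rewrite Rabs_inv. apply Rmult_le_reg_r with (Rabs (IZR k) * jz k); [nra|].
    replace (/ Rabs (IZR k) * (Rabs (IZR k) * jz k)) with (jz k) by (field; lra).
    replace (2 * / jz k * (Rabs (IZR k) * jz k)) with (2 * Rabs (IZR k)) by (field; lra). assumption. }
  assert (Hw : rpow (jz k) (bexp p) * / jz k <= rpow (IZR L) (bexp p - 1)).
  { replace (/ jz k) with (rpow (jz k) (- (1))) by (rewrite rpow_opp, rpow_1; lra).
    rewrite <- rpow_plus. replace (bexp p + - (1)) with (- (1 - bexp p)) by ring.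
    replace (bexp p - 1) with (- (1 - bexp p)) by ring. apply rpow_neg_le; lra. }
  pose proof (Cmod_ge_0 (Ntil L d N k)) as Hn. pose proof (rpow_nonneg (jz k) (bexp p)).
  apply Rle_trans with (rpow (jz k) (bexp p) * (Cmod (Ntil L d N k) * (2 * / jz k))).
  - apply Rmult_le_compat_l; [assumption|]. apply Rmult_le_compat_l; assumption.
  - replace (rpow (jz k) (bexp p) * (Cmod (Ntil L d N k) * (2 * / jz k)))
      with (2 * (rpow (jz k) (bexp p) * / jz k) * Cmod (Ntil L d N k)) by ring.
    apply Rmult_le_compat_r; [assumption|]. lra.
Qed.

Lemma SB_point {A} (f : A -> R) a0 x : (forall a, a <> a0 -> f a <= 0) -> (forall a, 0 <= f a) -> f a0 <= x -> SB f x.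
Proof.
  intros H Hp Hx. apply (SB_inj (fun _ => tt) _ (fun _ : unit => x)).
  - intros _. specialize (Hp a0). lra.
  - intros a Ha. destruct (classic (a = a0)) as [->|N]; [assumption|]. specialize (H a N). specialize (Hp a). lra.
  - intros a a' Ha Ha' _.
    assert (a = a0) by (apply NNPP; intros N; specialize (H a N); specialize (Hp a); lra).
    assert (a' = a0) by (apply NNPP; intros N; specialize (H a' N); specialize (Hp a'); lra). congruence.
  - intros l Hl. specialize (Hp a0). destruct l as [|[] [|[] l]]; simpl; try lra.
    inversion Hl as [|? ? X _]; subst. exfalso; apply X; left; reflexivity.
Qed.

(** The constant of integration sits at time frequency 0, where the weight is 1, and is at most the
    [l^1] norm of the primitive, which Hölder controls. *)
Lemma Lop_bound p a c L d s N A : 1 < p -> unit_on a c L d -> 0 <= A ->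
  SB (fun k => rpow (Cmod (N k)) p) (rpow A p) ->
  SB (fun k => rpow (rpow (jz k) (bexp p) * Cmod (Lop L d s N k)) p)
     (rpow (lop_const p * rpow (IZR L) (bexp p - 1) * A) p) /\
  SB (fun k => Cmod (Gop L d N k)) (lop_const p * rpow (IZR L) (bexp p - 1) * A).
Proof.
  intros Hp HU HA HN.
  pose proof (Gop_bound p a c L d N A Hp HU HA HN) as HG.
  set (B := 2 * (1 + rpow (dsum p) (/ p)) * rpow (IZR L) (bexp p - 1) * A) in *.
  assert (HB : 0 <= B).
  { unfold B. repeat apply Rmult_le_pos; auto using rpow_nonneg; try lra. pose proof (rpow_nonneg (dsum p) (/ p)). lra. }
  assert (Hl : 0 <= l1_const p) by apply rpow_nonneg.
  destruct (l1_of_weighted p (Gop L d N) B Hp HB HG) as [_ H1].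
  replace (lop_const p * rpow (IZR L) (bexp p - 1) * A) with (B + l1_const p * B) by (unfold B, lop_const; ring).
  split; [|eapply SB_weaken; [exact H1|lra]].
  set (z := csum (fun k' => (Gop L d N k' * cis (IZR k' * s))%C)).
  assert (Hz : Cmod z <= l1_const p * B) by (apply csum_bound, SB_cis, H1).
  eapply SB_le; [|apply (SB_minkowski (fun k => rpow (jz k) (bexp p) * Cmod (Gop L d N k))
     (fun k => if Z.eq_dec k 0 then Cmod z else 0) B (l1_const p * B) p); auto].
  - intros k. cbn beta. apply rpow_le; [lra|].
    split; [apply Rmult_le_pos; [apply rpow_nonneg|apply Cmod_ge_0]|].
    unfold Lop. fold z. pose proof (rpow_nonneg (jz k) (bexp p)).
    destruct (Z.eq_dec k 0) as [->|Hk].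
    + assert (E : rpow (jz 0) (bexp p) = 1) by (unfold jz; rewrite Rabs_R0, Rplus_0_r; apply rpow_one).
      rewrite E, !Rmult_1_l. eapply Rle_trans; [apply Cmod_triangle|]. rewrite Cmod_opp. lra.
    + rewrite Cplus_0_r. lra.
  - intros k. apply Rmult_le_pos; [apply rpow_nonneg|apply Cmod_ge_0].
  - intros k. destruct (Z.eq_dec k 0); [apply Cmod_ge_0|lra].
  - apply Rmult_le_pos; assumption.
  - apply (SB_point _ 0%Z).
    + intros k Hk. destruct (Z.eq_dec k 0); [contradiction|]. rewrite rpow_0. lra.
    + intros; apply rpow_nonneg.
    + destruct (Z.eq_dec 0 0); [|contradiction]. apply rpow_le; [lra|]. split; [apply Cmod_ge_0|assumption].
Qed.

Lemma Cminus_diag (z : C) : (z - z)%C = RtoC 0.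
Proof. ring. Qed.

(** * The fixed point problem in Fourier space-time *)

Lemma rpow_closed x A p : 0 < p -> 0 <= A -> (forall eta, 0 < eta -> x <= rpow (A + eta) p) -> x <= rpow A p.
Proof.
  intros Hp HA H. apply Rnot_lt_le. intros Hlt.
  pose proof (rpow_nonneg A p).
  set (B := rpow x (/ p)).
  assert (HB : rpow B p = x) by (apply rpow_inv_l; lra).
  assert (HB0 : 0 <= B) by apply rpow_nonneg.
  assert (HAB : A < B).
  { apply Rnot_le_lt. intros Hle. assert (rpow B p <= rpow A p) by (apply rpow_le; lra). lra. }
  specialize (H ((B - A) / 2) ltac:(lra)).
  assert (rpow (A + (B - A) / 2) p < rpow B p) by (apply rpow_lt; lra). lra.
Qed.

Definition msub (F G : mode -> C) : mode -> C := fun xi => (F xi - G xi)%C.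

Definition madd (F G : mode -> C) : mode -> C := fun xi => (F xi + G xi)%C.

Lemma wmod_add w b F G xi : (forall n, 0 < w n) -> wmod w b (madd F G) xi <= wmod w b F xi + wmod w b G xi.
Proof.
  intros Hw. unfold wmod, madd. rewrite <- Rmult_plus_distr_l. apply Rmult_le_compat_l; [|apply Cmod_triangle].
  apply Rmult_le_pos; [left; apply Hw|apply rpow_nonneg].
Qed.

Lemma XN_add s p F G A B : 1 < p -> XN s p F A -> XN s p G B -> XN s p (madd F G) (A + B).
Proof.
  intros Hp [HA HF] [HB HG]. split; [lra|].
  eapply SB_le; [|apply (SB_minkowski _ _ A B p (fun xi => wmod_nonneg (wt s) (bexp p) F xi (wt_pos s)) (fun xi => wmod_nonneg (wt s) (bexp p) G xi (wt_pos s))); auto].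
  intros xi. apply rpow_le; [lra|]. split; [apply wmod_nonneg, wt_pos|apply wmod_add, wt_pos].
Qed.

Lemma YN_add p F G A B : 1 < p -> YN p F A -> YN p G B -> YN p (madd F G) (A + B).
Proof.
  intros Hp [HA HF] [HB HG]. split; [lra|]. intros n.
  eapply SB_le; [|apply (SB_minkowski _ _ A B p (fun k => wmod_nonneg w1 (bexp p) F (n, k) w1_pos) (fun k => wmod_nonneg w1 (bexp p) G (n, k) w1_pos)); auto].
  intros k. apply rpow_le; [lra|]. split; [apply wmod_nonneg, w1_pos|apply wmod_add, w1_pos].
Qed.

Lemma wmod_ext w b F G xi : Cmod (F xi) = Cmod (G xi) -> wmod w b F xi = wmod w b G xi.
Proof. intros H. unfold wmod. rewrite H. reflexivity. Qed.

Lemma XN_ext s p F G A : (forall xi, Cmod (F xi) = Cmod (G xi)) -> XN s p F A -> XN s p G A.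
Proof.
  intros H [HA HF]. split; [assumption|]. eapply SB_le; [|exact HF]. intros xi.
  cbn beta. rewrite (wmod_ext _ _ F G) by auto. lra.
Qed.

Lemma YN_ext p F G A : (forall xi, Cmod (F xi) = Cmod (G xi)) -> YN p F A -> YN p G A.
Proof.
  intros H [HA HF]. split; [assumption|]. intros n. eapply SB_le; [|exact (HF n)]. intros k.
  cbn beta. rewrite (wmod_ext _ _ F G) by auto. lra.
Qed.

Definition mopp (F : mode -> C) : mode -> C := fun xi => (- F xi)%C.

Lemma XN_sub s p F G A B : 1 < p -> XN s p F A -> XN s p G B -> XN s p (msub F G) (A + B).
Proof.
  intros Hp HF HG. apply (XN_ext s p (madd F (mopp G))).
  - intros xi. reflexivity.
  - apply XN_add; auto. eapply XN_ext; [|exact HG]. intros xi. unfold mopp. rewrite Cmod_opp. reflexivity.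
Qed.

Lemma XN_weaken s p F A B : 1 < p -> XN s p F A -> A <= B -> XN s p F B.
Proof.
  intros Hp [HA HF] H. split; [lra|]. eapply SB_weaken; [exact HF|]. apply rpow_le; lra.
Qed.

Lemma YN_weaken p F A B : 1 < p -> YN p F A -> A <= B -> YN p F B.
Proof.
  intros Hp [HA HF] H. split; [lra|]. intros n. eapply SB_weaken; [exact (HF n)|]. apply rpow_le; lra.
Qed.

Lemma XN_closed s p F A : 1 < p -> 0 <= A -> (forall eta, 0 < eta -> XN s p F (A + eta)) -> XN s p F A.
Proof.
  intros Hp HA H. split; [assumption|]. intros l Hl. apply rpow_closed; [lra|assumption|].
  intros eta He. destruct (H eta He) as [_ HS]. apply HS, Hl.
Qed.

Lemma YN_closed p F A : 1 < p -> 0 <= A -> (forall eta, 0 < eta -> YN p F (A + eta)) -> YN p F A.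
Proof.
  intros Hp HA H. split; [assumption|]. intros n l Hl. apply rpow_closed; [lra|assumption|].
  intros eta He. destruct (H eta He) as [_ HS]. apply HS, Hl.
Qed.

Lemma wt_ge1 s n : 0 < s -> 1 <= wt s n.
Proof.
  intros Hs. unfold wt. pose proof (jbr_ge1 n). rewrite <- (rpow_x0 (jbr n)) by lra. apply rpow_exp_le; lra.
Qed.

Lemma jzb_ge1 p k : 1 < p -> 1 <= rpow (jz k) (bexp p).
Proof.
  intros Hp. pose proof (bexp_bounds p Hp). pose proof (jz_ge1 k).
  rewrite <- (rpow_x0 (jz k)) by lra. apply rpow_exp_le; lra.
Qed.

Lemma XN_pointwise s p F A xi : 1 < p -> 0 < s -> XN s p F A -> Cmod (F xi) <= A.
Proof.
  intros Hp Hs [HA HF]. pose proof (SB_term _ _ xi HF) as H. cbn beta in H.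
  apply rpow_le_inv in H; [|lra|apply wmod_nonneg, wt_pos|assumption].
  unfold wmod in H. pose proof (wt_ge1 s (fst xi) Hs). pose proof (jzb_ge1 p (snd xi) Hp).
  pose proof (Cmod_ge_0 (F xi)).
  assert (1 <= wt s (fst xi) * rpow (jz (snd xi)) (bexp p)) by nra. nra.
Qed.

Lemma XN_YN s p F A : 1 < p -> 0 < s -> XN s p F A -> YN p F A.
Proof.
  intros Hp Hs [HA HF]. split; [assumption|]. intros n.
  apply (SB_inj (fun k => (n, k)) _ (fun xi => rpow (wmod (wt s) (bexp p) F xi) p)); auto using rpow_nonneg.
  - intros k _. apply rpow_le; [lra|]. split; [apply wmod_nonneg, w1_pos|].
    unfold wmod. apply Rmult_le_compat_r; [apply Cmod_ge_0|]. apply Rmult_le_compat_r; [apply rpow_nonneg|].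
    unfold w1. apply wt_ge1, Hs.
  - congruence.
Qed.

Definition pointwise_limit (Fm : nat -> mode -> C) (F : mode -> C) : Prop :=
  forall xi eps, 0 < eps -> exists M, forall m, (M <= m)%nat -> Cmod (Fm m xi - F xi) <= eps.

Lemma pointwise_limit_list Fm F l eps : pointwise_limit Fm F -> 0 < eps ->
  exists M, forall m xi, (M <= m)%nat -> In xi l -> Cmod (Fm m xi - F xi) <= eps.
Proof.
  intros H He. induction l as [|x l [M IH]].
  - exists 0%nat. intros m xi _ [].
  - destruct (H x eps He) as [M' HM']. exists (Nat.max M M'). intros m xi Hm [<-|Hin]; [apply HM'; lia|apply IH; auto; lia].
Qed.

(** Lower semicontinuity, as in Fatou's lemma: on a finite list the difference from a late [Fm m] is
    as small as desired, and Minkowski adds it to the bound [A]. *)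
Lemma XN_limit s p Fm F A M0 : 1 < p -> 0 <= A -> pointwise_limit Fm F ->
  (forall m, (M0 <= m)%nat -> XN s p (Fm m) A) -> XN s p F A.
Proof.
  intros Hp HA HL HX. split; [assumption|]. intros l Hl. apply rpow_closed; [lra|assumption|].
  intros eta He.
  set (S := sumL (fun xi => rpow (wt s (fst xi) * rpow (jz (snd xi)) (bexp p)) p) l).
  assert (HS : 0 <= S) by (apply sumL_nonneg; intros; apply rpow_nonneg).
  (* An error of size [e] in each coefficient of the list then has weighted [l^p] norm at most
     [eta]. *)
  set (e := eta * rpow (/ (S + 1)) (/ p)).
  assert (Hi : 0 < / (S + 1)) by (apply Rinv_0_lt_compat; lra).
  assert (He' : 0 < e) by (apply Rmult_lt_0_compat; [assumption|apply rpow_gt0; assumption]).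
  destruct (pointwise_limit_list Fm F l e HL He') as [M HM].
  set (m := Nat.max M M0).
  set (g := fun xi => if in_dec ceq xi l then wmod (wt s) (bexp p) (msub F (Fm m)) xi else 0).
  assert (Hg : forall xi, 0 <= g xi) by (intros; unfold g; destruct (in_dec ceq xi l); [apply wmod_nonneg, wt_pos|lra]).
  assert (SG : SB (fun xi => rpow (g xi) p) (rpow eta p)).
  { intros l' Hl'.
    apply Rle_trans with (rpow e p * S).
    - unfold S. rewrite <- sumL_scal.
      set (t := fun xi => if in_dec ceq xi l then true else false).
      rewrite <- (sumL_filter (fun xi => rpow (g xi) p) t).
      2:{ intros xi. unfold t, g. destruct (in_dec ceq xi l); [discriminate|]. intros _. apply rpow_0. }
      eapply Rle_trans; [|apply (sumL_incl _ (filter t l') l)].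
      + apply sumL_le. intros xi Hxi. apply filter_In in Hxi as [_ Hxi]. unfold t in Hxi. unfold g.
        destruct (in_dec ceq xi l) as [Hin|]; [|discriminate].
        rewrite <- rpow_mult; [|lra|apply Rmult_le_pos; [left; apply wt_pos|apply rpow_nonneg]].
        apply rpow_le; [lra|]. split; [apply wmod_nonneg, wt_pos|].
        unfold wmod, msub. rewrite (Rmult_comm e). apply Rmult_le_compat_l.
        * apply Rmult_le_pos; [left; apply wt_pos|apply rpow_nonneg].
        * rewrite Cmod_sub_swap. apply HM; [unfold m; lia|assumption].
      + intros; apply Rmult_le_pos; apply rpow_nonneg.
      + apply NoDup_filter, Hl'.
      + intros xi Hxi. apply filter_In in Hxi as [_ Hxi]. unfold t in Hxi.
        destruct (in_dec ceq xi l); [assumption|discriminate].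
    - unfold e. rewrite rpow_mult by (try apply rpow_nonneg; lra). rewrite rpow_inv_l by lra.
      rewrite Rmult_assoc. rewrite <- (Rmult_1_r (rpow eta p)) at 2.
      apply Rmult_le_compat_l; [apply rpow_nonneg|].
      apply Rmult_le_reg_l with (S + 1); [lra|]. rewrite <- Rmult_assoc, Rinv_r; lra. }
  destruct (HX m ltac:(unfold m; lia)) as [_ HXm].
  pose proof (SB_minkowski _ g A eta p (fun xi => wmod_nonneg (wt s) (bexp p) (Fm m) xi (wt_pos s)) Hg Hp HA ltac:(lra) HXm SG l Hl) as HF.
  eapply Rle_trans; [|exact HF]. apply sumL_le. intros xi Hxi. apply rpow_le; [lra|].
  split; [apply wmod_nonneg, wt_pos|]. unfold g. destruct (in_dec ceq xi l); [|contradiction].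
  eapply Rle_trans; [|apply wmod_add, wt_pos]. right. apply wmod_ext. f_equal. unfold madd, msub. ring.
Qed.

Definition LopM (L : Z) (d : Z -> C) (s0 : R) (N : mode -> C) (xi : mode) : C :=
  Lop L d s0 (fun k => N (fst xi, k)) (snd xi).

(** Provides [l^p] bounds in [k] at each fixed [n], so that one-dimensional statements in time apply
    slice by slice and can be summed in [n] again. *)
Lemma XN0_slices s p N A : 1 < p -> XN0 s p N A -> exists An : Z2 -> R, (forall n, 0 <= An n) /\
  (forall n, SB (fun k => rpow (Cmod (N (n, k))) p) (rpow (An n) p)) /\
  SB (fun n => rpow (wt s n * An n) p) (rpow A p).
Proof.
  intros Hp [HA HN].
  destruct (SB_prod_inv (fun n k => rpow (wt s n * Cmod (N (n, k))) p) (rpow A p)) as [H1 H2].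
  { intros; apply rpow_nonneg. }
  { eapply SB_le; [|exact HN]. intros [n k]. cbn. lra. }
  set (T := fun n => tsum (fun k => rpow (wt s n * Cmod (N (n, k))) p)).
  assert (HT : forall n, 0 <= T n) by (intros n; eapply tsum_nonneg, H1).
  exists (fun n => / wt s n * rpow (T n) (/ p)).
  assert (Hw : forall n, 0 < / wt s n) by (intros; apply Rinv_0_lt_compat, wt_pos).
  split; [intros n; apply Rmult_le_pos; [left; apply Hw|apply rpow_nonneg]|]. split.
  - intros n. rewrite rpow_mult by (try apply rpow_nonneg; left; apply Hw).
    rewrite rpow_inv_l by (auto; lra).
    apply (SB_le _ (fun k => rpow (/ wt s n) p * rpow (wt s n * Cmod (N (n, k))) p)).
    + intros k. rewrite <- rpow_mult.
      * rewrite <- Rmult_assoc, Rinv_l, Rmult_1_l by (pose proof (wt_pos s n); lra). lra.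
      * left; apply Hw.
      * apply Rmult_le_pos; [left; apply wt_pos|apply Cmod_ge_0].
    + apply SB_scal; [apply rpow_nonneg|]. eapply tsum_SB, H1.
  - eapply SB_le; [|exact H2]. intros n. fold (T n).
    rewrite <- Rmult_assoc, Rinv_r, Rmult_1_l by (pose proof (wt_pos s n); lra).
    rewrite rpow_inv_l by (auto; lra). apply Rle_refl.
Qed.

Lemma LopM_X s p a c L d s0 N A : 1 < p -> unit_on a c L d -> XN0 s p N A ->
  XN s p (LopM L d s0 N) (lop_const p * rpow (IZR L) (bexp p - 1) * A) /\
  forall n, exists B, SB (fun k => Cmod (Gop L d (fun k => N (n, k)) k)) B.
Proof.
  intros Hp HU HN. destruct (XN0_slices s p N A Hp HN) as (An & HAn & HS & HT). destruct HN as [HA _].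
  set (e := lop_const p * rpow (IZR L) (bexp p - 1)).
  assert (He : 0 <= e) by (apply Rmult_le_pos; [left; apply lop_const_pos, Hp|apply rpow_nonneg]).
  split.
  - split; [apply Rmult_le_pos; assumption|].
    rewrite rpow_mult by assumption.
    apply (SB_le _ (fun xi => rpow (wt s (fst xi)) p * rpow (rpow (jz (snd xi)) (bexp p) *
             Cmod (Lop L d s0 (fun k => N (fst xi, k)) (snd xi))) p)).
    + intros xi. unfold wmod. rewrite Rmult_assoc, rpow_mult; [apply Rle_refl|left; apply wt_pos|].
      apply Rmult_le_pos; [apply rpow_nonneg|apply Cmod_ge_0].
    + apply (SB_prod (fun n k => rpow (wt s n) p * rpow (rpow (jz k) (bexp p) *
             Cmod (Lop L d s0 (fun k => N (n, k)) k)) p) (fun n => rpow e p * rpow (wt s n * An n) p)).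
      * intros; apply Rmult_le_pos; apply rpow_nonneg.
      * intros n. replace (rpow e p * rpow (wt s n * An n) p) with (rpow (wt s n) p * rpow (e * An n) p).
        2:{ rewrite !rpow_mult; auto; [ring|left; apply wt_pos]. }
        apply SB_scal; [apply rpow_nonneg|]. apply (Lop_bound p a c L d s0 (fun k => N (n, k)) (An n)); auto.
      * apply SB_scal; [apply rpow_nonneg|assumption].
  - intros n. eexists. apply (Lop_bound p a c L d s0 (fun k => N (n, k)) (An n)); auto.
Qed.

Lemma LopM_Y p a c L d s0 N A : 1 < p -> unit_on a c L d -> YN0 p N A ->
  YN p (LopM L d s0 N) (lop_const p * rpow (IZR L) (bexp p - 1) * A).
Proof.
  intros Hp HU [HA HN]. split.
  - apply Rmult_le_pos; [apply Rmult_le_pos; [left; apply lop_const_pos, Hp|apply rpow_nonneg]|assumption].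
  - intros n. destruct (Lop_bound p a c L d s0 (fun k => N (n, k)) A Hp HU HA (HN n)) as [H _].
    eapply SB_le; [|exact H]. intros k. unfold wmod, w1, LopM. cbn [fst snd]. rewrite Rmult_1_l. lra.
Qed.

Lemma Gop_sub L d N1 N2 k : Gop L d (fun k => (N1 k - N2 k)%C) k = (Gop L d N1 k - Gop L d N2 k)%C.
Proof. unfold Gop, Ntil. destruct (Z.eq_dec (blk L k) 0); ring. Qed.

Lemma Lop_sub L d s0 N1 N2 B1 B2 k : SB (fun k => Cmod (Gop L d N1 k)) B1 -> SB (fun k => Cmod (Gop L d N2 k)) B2 ->
  Lop L d s0 (fun k => (N1 k - N2 k)%C) k = (Lop L d s0 N1 k - Lop L d s0 N2 k)%C.
Proof.
  intros H1 H2. unfold Lop. rewrite Gop_sub. destruct (Z.eq_dec k 0); [|ring].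
  rewrite (csum_ext _ (fun k' => (Gop L d N1 k' * cis (IZR k' * s0) - Gop L d N2 k' * cis (IZR k' * s0))%C)).
  - rewrite (csum_minus _ _ B1 B2) by (apply SB_cis; assumption). ring.
  - intros k'. rewrite Gop_sub. ring.
Qed.

Lemma MN_sub1 F G F2 F3 xi B B' : SB (fun x => Cmod (tri_term F F2 F3 xi x)) B ->
  SB (fun x => Cmod (tri_term G F2 F3 xi x)) B' -> MN (msub F G) F2 F3 xi = (MN F F2 F3 xi - MN G F2 F3 xi)%C.
Proof.
  intros H H'. unfold MN. rewrite <- (csum_minus _ _ _ _ H H'). apply csum_ext. intros x. unfold tri_term, msub. ring.
Qed.

Lemma MN_sub2 F1 F G F3 xi B B' : SB (fun x => Cmod (tri_term F1 F F3 xi x)) B ->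
  SB (fun x => Cmod (tri_term F1 G F3 xi x)) B' -> MN F1 (msub F G) F3 xi = (MN F1 F F3 xi - MN F1 G F3 xi)%C.
Proof.
  intros H H'. unfold MN. rewrite <- (csum_minus _ _ _ _ H H'). apply csum_ext. intros x. unfold tri_term, msub.
  rewrite Cminus_conj. ring.
Qed.

Lemma MN_sub3 F1 F2 F G xi B B' : SB (fun x => Cmod (tri_term F1 F2 F xi x)) B ->
  SB (fun x => Cmod (tri_term F1 F2 G xi x)) B' -> MN F1 F2 (msub F G) xi = (MN F1 F2 F xi - MN F1 F2 G xi)%C.
Proof.
  intros H H'. unfold MN. rewrite <- (csum_minus _ _ _ _ H H'). apply csum_ext. intros x. unfold tri_term, msub. ring.
Qed.

Lemma XN0_add s p F G A B : 1 < p -> XN0 s p F A -> XN0 s p G B -> XN0 s p (madd F G) (A + B).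
Proof.
  intros Hp [HA HF] [HB HG]. split; [lra|].
  assert (P : forall F (xi : mode), 0 <= wt s (fst xi) * Cmod (F xi))
    by (intros; apply Rmult_le_pos; [left; apply wt_pos|apply Cmod_ge_0]).
  eapply SB_le; [|apply (SB_minkowski _ _ A B p (P F) (P G)); auto].
  intros xi. apply rpow_le; [lra|]. split; [apply P|]. rewrite <- Rmult_plus_distr_l.
  apply Rmult_le_compat_l; [left; apply wt_pos|apply Cmod_triangle].
Qed.

Lemma YN0_add p F G A B : 1 < p -> YN0 p F A -> YN0 p G B -> YN0 p (madd F G) (A + B).
Proof.
  intros Hp [HA HF] [HB HG]. split; [lra|]. intros n.
  eapply SB_le; [|apply (SB_minkowski _ _ A B p (fun k => Cmod_ge_0 (F (n, k))) (fun k => Cmod_ge_0 (G (n, k)))); auto].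
  intros k. apply rpow_le; [lra|]. split; [apply Cmod_ge_0|apply Cmod_triangle].
Qed.

Definition MN3 (F : mode -> C) : mode -> C := MN F F F.

Definition tri_conclusion (s p c : R) : Prop :=
  0 <= c /\
  (forall F1 F2 F3 A1 A2 A3, XN s p F1 A1 -> XN s p F2 A2 -> XN s p F3 A3 ->
     (forall xi, exists B, SB (fun x => Cmod (tri_term F1 F2 F3 xi x)) B) /\
     XN0 s p (MN F1 F2 F3) (c * (A1 * A2 * A3))) /\
  (forall F1 F2 F3 A1 A2 A3, YN p F1 A1 -> XN s p F2 A2 -> XN s p F3 A3 ->
     YN0 p (MN F1 F2 F3) (c * (A1 * A2 * A3))) /\
  (forall F1 F2 F3 A1 A2 A3, XN s p F1 A1 -> YN p F2 A2 -> XN s p F3 A3 ->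
     YN0 p (MN F1 F2 F3) (c * (A1 * A2 * A3))) /\
  (forall F1 F2 F3 A1 A2 A3, XN s p F1 A1 -> XN s p F2 A2 -> YN p F3 A3 ->
     YN0 p (MN F1 F2 F3) (c * (A1 * A2 * A3))).

Lemma MN3_sub s p c F G A B xi : tri_conclusion s p c -> XN s p F A -> XN s p G B ->
  msub (MN3 F) (MN3 G) xi = madd (madd (MN (msub F G) F F) (MN G (msub F G) F)) (MN G G (msub F G)) xi.
Proof.
  intros (_ & T & _) HF HG. unfold MN3, msub at 1, madd.
  destruct (proj1 (T F F F _ _ _ HF HF HF) xi) as [B1 H1].
  destruct (proj1 (T G F F _ _ _ HG HF HF) xi) as [B2 H2].
  destruct (proj1 (T G G F _ _ _ HG HG HF) xi) as [B3 H3].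
  destruct (proj1 (T G G G _ _ _ HG HG HG) xi) as [B4 H4].
  rewrite (MN_sub1 F G F F xi _ _ H1 H2), (MN_sub2 G F G F xi _ _ H2 H3), (MN_sub3 G G F G xi _ _ H3 H4). ring.
Qed.

Lemma MN3_diff_X s p c F G rho B : 1 < p -> tri_conclusion s p c -> XN s p F rho -> XN s p G rho ->
  XN s p (msub F G) B -> XN0 s p (msub (MN3 F) (MN3 G)) (c * (3 * (rho * rho) * B)).
Proof.
  intros Hp HT HF HG HD. pose proof HT as (_ & T & _).
  replace (c * (3 * (rho * rho) * B)) with ((c * (B * rho * rho) + c * (rho * B * rho)) + c * (rho * rho * B)) by ring.
  pose proof (XN0_add s p _ _ _ _ Hp (XN0_add s p _ _ _ _ Hp (proj2 (T _ _ _ _ _ _ HD HF HF))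
     (proj2 (T _ _ _ _ _ _ HG HD HF))) (proj2 (T _ _ _ _ _ _ HG HG HD))) as H.
  destruct H as [H0 H]. split; [assumption|]. eapply SB_le; [|exact H]. intros xi.
  rewrite (MN3_sub s p c F G rho rho xi HT HF HG). lra.
Qed.

Lemma MN3_diff_Y s p c F G rho B : 1 < p -> tri_conclusion s p c -> XN s p F rho -> XN s p G rho ->
  YN p (msub F G) B -> YN0 p (msub (MN3 F) (MN3 G)) (c * (3 * (rho * rho) * B)).
Proof.
  intros Hp HT HF HG HD. pose proof HT as (_ & _ & T1 & T2 & T3).
  replace (c * (3 * (rho * rho) * B)) with ((c * (B * rho * rho) + c * (rho * B * rho)) + c * (rho * rho * B)) by ring.
  pose proof (YN0_add p _ _ _ _ Hp (YN0_add p _ _ _ _ Hp (T1 _ _ _ _ _ _ HD HF HF)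
     (T2 _ _ _ _ _ _ HG HD HF)) (T3 _ _ _ _ _ _ HG HG HD)) as H.
  destruct H as [H0 H]. split; [assumption|]. intros n. eapply SB_le; [|exact (H n)]. intros k.
  rewrite (MN3_sub s p c F G rho rho (n, k) HT HF HG). lra.
Qed.

(** * Initial data and solutions as space-time coefficients *)

Definition FLb (s p : R) (a : Z2 -> C) (A : R) : Prop :=
  0 <= A /\ SB (fun n => rpow (wt s n * Cmod (a n)) p) (rpow A p).

(** The coefficients of the function of time that is constantly [al]. *)
Definition base (al : Z2 -> C) (xi : mode) : C := if Z.eq_dec (snd xi) 0 then al (fst xi) else RtoC 0.

Lemma jz0_rpow b : rpow (jz 0) b = 1.
Proof. unfold jz. rewrite Rabs_R0, Rplus_0_r. apply rpow_one. Qed.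

Lemma base_X s p al A : 1 < p -> FLb s p al A -> XN s p (base al) A.
Proof.
  intros Hp [HA H]. split; [assumption|].
  apply (SB_inj fst _ (fun n => rpow (wt s n * Cmod (al n)) p)); auto using rpow_nonneg.
  - intros [n k] _. unfold wmod, base. cbn [fst snd]. destruct (Z.eq_dec k 0) as [->|].
    + rewrite jz0_rpow, Rmult_1_r. lra.
    + rewrite Cmod_0, Rmult_0_r, rpow_0. apply rpow_nonneg.
  - assert (K0 : forall xi, rpow (wmod (wt s) (bexp p) (base al) xi) p <> 0 -> snd xi = 0%Z).
    { intros xi Hx. apply NNPP. intros N. apply Hx. unfold wmod, base. destruct (Z.eq_dec (snd xi) 0); [contradiction|].
      rewrite Cmod_0, Rmult_0_r. apply rpow_0. }
    intros [n k] [n' k'] H1 H2 E. apply K0 in H1, H2. cbn in *. congruence.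
Qed.

Lemma base_Y p al A : 1 < p -> 0 <= A -> (forall n, Cmod (al n) <= A) -> YN p (base al) A.
Proof.
  intros Hp HA H. split; [assumption|]. intros n. apply (SB_point _ 0%Z).
  - intros k Hk. unfold wmod, base. cbn [fst snd]. destruct (Z.eq_dec k 0); [contradiction|].
    rewrite Cmod_0, Rmult_0_r, rpow_0. lra.
  - intros; apply rpow_nonneg.
  - unfold wmod, base, w1. cbn [fst snd]. rewrite jz0_rpow, !Rmult_1_l. destruct (Z.eq_dec 0 0); [|contradiction].
    apply rpow_le; [lra|]. split; [apply Cmod_ge_0|apply H].
Qed.

(* [F] satisfies the integrated equation at all nonzero time frequencies; its coefficients at
   time frequency 0 are free and encode the data at any chosen time. *)
Definition Xsol (L : Z) (d : Z -> C) (F : mode -> C) : Prop :=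
  forall n k, k <> 0%Z -> F (n, k) = Gop L d (fun k' => MN3 F (n, k')) k.

Definition val (F : mode -> C) (t : R) (n : Z2) : C := csum (fun k => (F (n, k) * cis (IZR k * t))%C).

Lemma XN_slices s p F A : 1 < p -> XN s p F A -> exists An : Z2 -> R, (forall n, 0 <= An n) /\
  (forall n, SB (fun k => rpow (rpow (jz k) (bexp p) * Cmod (F (n, k))) p) (rpow (An n) p)) /\
  SB (fun n => rpow (wt s n * An n) p) (rpow A p).
Proof.
  intros Hp [HA HF].
  destruct (XN0_slices s p (fun xi => RtoC (rpow (jz (snd xi)) (bexp p) * Cmod (F xi))) A Hp) as (An & H1 & H2 & H3).
  { split; [assumption|]. eapply SB_le; [|exact HF]. intros xi. unfold wmod.
    rewrite Cmod_R, Rabs_pos_eq, Rmult_assoc; [apply Rle_refl|]. apply Rmult_le_pos; [apply rpow_nonneg|apply Cmod_ge_0]. }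
  exists An. split; [assumption|]. split; [|assumption]. intros n. eapply SB_le; [|exact (H2 n)].
  intros k. cbn [snd]. rewrite Cmod_R, Rabs_pos_eq; [apply Rle_refl|]. apply Rmult_le_pos; [apply rpow_nonneg|apply Cmod_ge_0].
Qed.

Lemma YN_l1 p F A n : 1 < p -> YN p F A -> SB (fun k => Cmod (F (n, k))) (l1_const p * A).
Proof.
  intros Hp [HA HF]. apply (l1_of_weighted p (fun k => F (n, k)) A Hp HA).
  eapply SB_le; [|exact (HF n)]. intros k. unfold wmod, w1. cbn [fst snd]. rewrite Rmult_1_l. lra.
Qed.

(** [Xsol] mentions no base time: a primitive is fixed up to a constant, so the same [F] solves the
    integral equation based at every [s0]. Solutions can therefore be compared through their values
    at any chosen time. *)
Lemma Xsol_fixpoint s p c a c0 L d F rho s0 n k : 1 < p -> 0 < s -> tri_conclusion s p c -> unit_on a c0 L d ->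
  XN s p F rho -> Xsol L d F ->
  F (n, k) = (base (val F s0) (n, k) + LopM L d s0 (MN3 F) (n, k))%C.
Proof.
  intros Hp Hs (Hc & T & _) HU HF HX.
  destruct (LopM_X s p a c0 L d s0 (MN3 F) _ Hp HU (proj2 (T F F F _ _ _ HF HF HF))) as [_ HB].
  destruct (HB n) as [B HBn].
  unfold base, LopM, Lop. cbn [fst snd]. destruct (Z.eq_dec k 0) as [->|Hk].
  - assert (G0 : Gop L d (fun k => MN3 F (n, k)) 0 = RtoC 0).
    { unfold Gop. rewrite Ntil_0; [ring|apply HU]. }
    rewrite G0. unfold val.
    rewrite (csum_ext (fun k => (F (n, k) * cis (IZR k * s0))%C)
      (fun k => ((if Z.eq_dec k 0 then F (n, 0%Z) else RtoC 0) + Gop L d (fun k => MN3 F (n, k)) k * cis (IZR k * s0))%C)).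
    + rewrite (csum_plus _ _ (Cmod (F (n, 0%Z))) B).
      * rewrite (csum_single (fun k => if Z.eq_dec k 0 then F (n, 0%Z) else RtoC 0) 0%Z).
        -- destruct (Z.eq_dec 0 0); [|contradiction]. ring.
        -- intros k Hk. destruct (Z.eq_dec k 0); [contradiction|reflexivity].
      * apply (SB_point _ 0%Z).
        -- intros k Hk. destruct (Z.eq_dec k 0); [contradiction|]. rewrite Cmod_0. lra.
        -- intros; apply Cmod_ge_0.
        -- destruct (Z.eq_dec 0 0); [lra|contradiction].
      * apply SB_cis, HBn.
    + intros k. destruct (Z.eq_dec k 0) as [->|Hk].
      * rewrite G0, Rmult_0_l, cis_0. ring.
      * rewrite HX by assumption. ring.
  - rewrite HX by assumption. ring.
Qed.

(** The norm of integration times the trilinear constant. Under the recurring condition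
    [6 small_const rho^2 <= 1] the ball is preserved, since [small_const rho^3 <= rho / 2], and
    differences are halved, since [3 small_const rho^2 B <= B / 2]. *)
Definition small_const (p c : R) (L : Z) : R := lop_const p * rpow (IZR L) (bexp p - 1) * c.

(** Norms are known only through bounds, so the contraction inequality [B <= A + B / 2] is iterated
    from the a priori bound [B0] instead of being solved for [B]. *)
Lemma halving (P : R -> Prop) A B0 : 0 <= A -> 0 <= B0 -> P B0 -> (forall B, 0 <= B -> P B -> P (A + / 2 * B)) ->
  (forall B B', P B -> B <= B' -> P B') -> ((forall eta, 0 < eta -> P (2 * A + eta)) -> P (2 * A)) -> P (2 * A).
Proof.
  intros HA HB0 H0 HS HM HC. apply HC. intros eta He.
  assert (G : forall m, P (2 * A + (/ 2) ^ m * B0)).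
  { induction m as [|m IH].
    - apply (HM B0); [assumption|]. simpl. lra.
    - assert (0 <= (/ 2) ^ m) by (apply pow_le; lra).
      apply (HM (A + / 2 * (2 * A + (/ 2) ^ m * B0))).
      + apply HS; [nra|assumption].
      + simpl. lra. }
  destruct (pow_lt_1_zero (/ 2) ltac:(rewrite Rabs_pos_eq; lra) (eta / (B0 + 1))) as [N HN].
  { apply Rdiv_lt_0_compat; lra. }
  specialize (HN N (le_n _)). rewrite Rabs_pos_eq in HN by (apply pow_le; lra).
  apply (HM _ _ (G N)). apply Rplus_le_compat_l.
  apply Rle_trans with (eta / (B0 + 1) * (B0 + 1)); [|right; field; lra].
  assert (0 <= (/ 2) ^ N) by (apply pow_le; lra). apply Rmult_le_compat; lra.
Qed.

Lemma Xsol_diff s p c a c0 L d F G rho s0 xi : 1 < p -> 0 < s -> tri_conclusion s p c -> unit_on a c0 L d ->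
  XN s p F rho -> XN s p G rho -> Xsol L d F -> Xsol L d G ->
  msub F G xi = madd (base (fun n => (val F s0 n - val G s0 n)%C)) (LopM L d s0 (msub (MN3 F) (MN3 G))) xi.
Proof.
  intros Hp Hs HT HU HF HG HFX HGX. destruct xi as [n k]. pose proof HT as (Hc & T & _).
  destruct (LopM_X s p a c0 L d s0 (MN3 F) _ Hp HU (proj2 (T F F F _ _ _ HF HF HF))) as [_ HB].
  destruct (LopM_X s p a c0 L d s0 (MN3 G) _ Hp HU (proj2 (T G G G _ _ _ HG HG HG))) as [_ HB'].
  destruct (HB n) as [B HBn]. destruct (HB' n) as [B' HBn'].
  unfold msub at 1. rewrite (Xsol_fixpoint s p c a c0 L d F rho s0 n k), (Xsol_fixpoint s p c a c0 L d G rho s0 n k) by assumption.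
  unfold madd, LopM. cbn [fst snd].
  change (fun k0 : Z => msub (MN3 F) (MN3 G) (n, k0)) with (fun k0 : Z => (MN3 F (n, k0) - MN3 G (n, k0))%C).
  rewrite (Lop_sub L d s0 _ _ _ _ k HBn HBn'). unfold base. cbn [fst snd]. destruct (Z.eq_dec k 0); ring.
Qed.

Lemma Xsol_lipschitz_X s p c a c0 L d F G rho s0 A : 1 < p -> 0 < s -> tri_conclusion s p c -> unit_on a c0 L d ->
  6 * (small_const p c L * (rho * rho)) <= 1 ->
  XN s p F rho -> XN s p G rho -> Xsol L d F -> Xsol L d G ->
  FLb s p (fun n => (val F s0 n - val G s0 n)%C) A -> XN s p (msub F G) (2 * A).
Proof.
  intros Hp Hs HT HU Hsm HF HG HFX HGX HA.
  assert (Hr : 0 <= rho) by apply HF.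
  apply (halving (XN s p (msub F G)) A (rho + rho)).
  - apply HA.
  - lra.
  - apply XN_sub; assumption.
  - intros B HB HXB.
    apply (XN_ext s p (madd (base (fun n => (val F s0 n - val G s0 n)%C)) (LopM L d s0 (msub (MN3 F) (MN3 G))))).
    { intros xi. f_equal. symmetry. apply (Xsol_diff s p c a c0 L d F G rho s0 xi); assumption. }
    apply XN_add; [assumption|apply base_X; assumption|].
    destruct (LopM_X s p a c0 L d s0 _ _ Hp HU (MN3_diff_X s p c F G rho B Hp HT HF HG HXB)) as [H _].
    eapply XN_weaken; [assumption|exact H|]. unfold small_const in Hsm. nra.
  - intros B B' H1 H2. eapply XN_weaken; eauto.
  - intros H. apply XN_closed; auto. destruct HA. lra.
Qed.

(** The trilinear constant is the same as in the strong norm, so smallness in [XN] alone makes the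
    flow Lipschitz for data compared in [sup_n]. The iteration starts from the strong bound. *)
Lemma Xsol_lipschitz_Y s p c a c0 L d F G rho s0 A : 1 < p -> 0 < s -> tri_conclusion s p c -> unit_on a c0 L d ->
  6 * (small_const p c L * (rho * rho)) <= 1 ->
  XN s p F rho -> XN s p G rho -> Xsol L d F -> Xsol L d G ->
  0 <= A -> (forall n, Cmod (val F s0 n - val G s0 n) <= A) -> YN p (msub F G) (2 * A).
Proof.
  intros Hp Hs HT HU Hsm HF HG HFX HGX HA HAn.
  assert (Hr : 0 <= rho) by apply HF.
  apply (halving (YN p (msub F G)) A (rho + rho)).
  - assumption.
  - lra.
  - apply (XN_YN s); auto. apply XN_sub; assumption.
  - intros B HB HXB.
    apply (YN_ext p (madd (base (fun n => (val F s0 n - val G s0 n)%C)) (LopM L d s0 (msub (MN3 F) (MN3 G))))).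
    { intros xi. f_equal. symmetry. apply (Xsol_diff s p c a c0 L d F G rho s0 xi); assumption. }
    apply YN_add; [assumption|apply base_Y; assumption|].
    pose proof (LopM_Y p a c0 L d s0 _ _ Hp HU (MN3_diff_Y s p c F G rho B Hp HT HF HG HXB)) as H.
    eapply YN_weaken; [assumption|exact H|]. unfold small_const in Hsm. nra.
  - intros B B' H1 H2. eapply YN_weaken; eauto.
  - intros H. apply YN_closed; auto. lra.
Qed.

Lemma XN_zero s p A : 0 <= A -> XN s p (fun _ => RtoC 0) A.
Proof.
  intros HA. split; [assumption|]. apply SB_weaken with 0; [|apply rpow_nonneg]. apply SB_zero. intros xi.
  unfold wmod. rewrite Cmod_0, Rmult_0_r, rpow_0. lra.
Qed.

Lemma sum_half_pow : SB (fun m : nat => (/ 2) ^ m) 2.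
Proof.
  intros l Hl. set (N := list_max l).
  apply Rle_trans with (sumL (fun m => (/ 2) ^ m) (seq 0 (S N))).
  - apply sumL_incl; auto; [intros; apply pow_le; lra|]. intros x Hx. apply in_seq.
    pose proof (proj1 (list_max_le l (list_max l)) (le_n _)) as F. rewrite Forall_forall in F.
    specialize (F x Hx). fold N in F. lia.
  - assert (E : forall M, sumL (fun m => (/ 2) ^ m) (seq 0 M) = 2 - 2 * (/ 2) ^ M).
    { induction M as [|M IH]; [simpl; ring|]. rewrite seq_S, sumL_app, IH. simpl. field. }
    rewrite E. assert (0 <= (/ 2) ^ S N) by (apply pow_le; lra). lra.
Qed.

Lemma half_pow_small eps K : 0 < eps -> 0 <= K -> exists N, K * (/ 2) ^ N <= eps.
Proof.
  intros He HK.
  destruct (pow_lt_1_zero (/ 2) ltac:(rewrite Rabs_pos_eq; lra) (eps / (K + 1))) as [N HN].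
  { apply Rdiv_lt_0_compat; lra. }
  exists N. specialize (HN N (le_n _)). rewrite Rabs_pos_eq in HN by (apply pow_le; lra).
  assert (0 <= (/ 2) ^ N) by (apply pow_le; lra).
  apply Rle_trans with ((K + 1) * (eps / (K + 1))); [apply Rmult_le_compat; lra|right; field; lra].
Qed.

(** Picard iteration. The limit is taken coefficient by coefficient, where the increments are at
    most [rho 2^(-m)], and [XN_limit] returns it to the ball. *)
Lemma Xsol_exists s p c a c0 L d rho s0 al : 1 < p -> 0 < s -> tri_conclusion s p c -> unit_on a c0 L d ->
  6 * (small_const p c L * (rho * rho)) <= 1 -> FLb s p al (rho / 2) ->
  exists F, XN s p F rho /\ Xsol L d F /\ forall n, val F s0 n = al n.
Proof.
  intros Hp Hs HT HU Hsm Hal. pose proof HT as (Hc & T & _).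
  assert (Hr : 0 <= rho) by (destruct Hal; lra).
  set (Psi := fun F => madd (base al) (LopM L d s0 (MN3 F))).
  set (Fm := fix Fm (m : nat) : mode -> C := match m with O => (fun _ => RtoC 0) | S m' => Psi (Fm m') end).
  assert (HPsi : forall F, XN s p F rho -> XN s p (Psi F) rho).
  { intros F HF. unfold Psi.
    destruct (LopM_X s p a c0 L d s0 _ _ Hp HU (proj2 (T _ _ _ _ _ _ HF HF HF))) as [H _].
    eapply XN_weaken; [assumption|apply XN_add; [assumption|apply base_X; eassumption|exact H]|].
    unfold small_const in Hsm. nra. }
  assert (HFm : forall m, XN s p (Fm m) rho).
  { induction m as [|m IH]; [apply XN_zero, Hr|]. apply HPsi, IH. }
  assert (HPd : forall F G B, XN s p F rho -> XN s p G rho -> XN s p (msub F G) B ->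
     XN s p (msub (Psi F) (Psi G)) (/ 2 * B)).
  { intros F G B HF HG HB.
    destruct (LopM_X s p a c0 L d s0 _ _ Hp HU (proj2 (T _ _ _ _ _ _ HF HF HF))) as [_ HBF].
    destruct (LopM_X s p a c0 L d s0 _ _ Hp HU (proj2 (T _ _ _ _ _ _ HG HG HG))) as [_ HBG].
    apply (XN_ext s p (LopM L d s0 (msub (MN3 F) (MN3 G)))).
    - intros [n k]. destruct (HBF n) as [B1 H1]. destruct (HBG n) as [B2 H2]. f_equal.
      unfold Psi, madd, msub at 2, LopM. cbn [fst snd].
      change (fun k0 : Z => msub (MN3 F) (MN3 G) (n, k0)) with (fun k0 : Z => (MN F F F (n, k0) - MN G G G (n, k0))%C).
      change (fun k0 : Z => MN3 F (n, k0)) with (fun k0 : Z => MN F F F (n, k0)).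
      change (fun k0 : Z => MN3 G (n, k0)) with (fun k0 : Z => MN G G G (n, k0)).
      rewrite (Lop_sub L d s0 _ _ _ _ k H1 H2). ring.
    - destruct (LopM_X s p a c0 L d s0 _ _ Hp HU (MN3_diff_X s p c F G rho B Hp HT HF HG HB)) as [H _].
      eapply XN_weaken; [assumption|exact H|]. assert (0 <= B) by apply HB. unfold small_const in Hsm. nra. }
  assert (HD : forall m, XN s p (msub (Fm (S m)) (Fm m)) (rho * (/ 2) ^ m)).
  { induction m as [|m IH].
    - apply (XN_ext s p (Fm 1%nat)); [|rewrite Rmult_1_r; apply HFm]. intros xi. unfold msub. f_equal.
      change (Fm 0%nat xi) with (RtoC 0). ring.
    - replace (rho * (/ 2) ^ S m) with (/ 2 * (rho * (/ 2) ^ m)) by (simpl; ring).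
      apply (HPd (Fm (S m)) (Fm m)); auto. }
  set (F := fun xi => csum (fun m => msub (Fm (S m)) (Fm m) xi)).
  assert (HSD : forall xi, SB (fun m => Cmod (msub (Fm (S m)) (Fm m) xi)) (rho * 2)).
  { intros xi. eapply SB_le; [|apply (SB_scal rho _ _ Hr sum_half_pow)].
    intros m. apply (XN_pointwise s p _ _ xi Hp Hs (HD m)). }
  assert (HFl : pointwise_limit Fm F).
  { intros xi eps He. destruct (csum_HasSum _ _ (HSD xi) eps He) as [l0 H0].
    exists (S (list_max l0)). intros m Hm. specialize (H0 (seq 0 m) (seq_NoDup _ _)).
    assert (E : sumC (fun m => msub (Fm (S m)) (Fm m) xi) (seq 0 m) = Fm m xi).
    { clear. induction m as [|m IH]; [reflexivity|]. rewrite seq_S, sumC_app, IH. cbn [sumC Nat.add].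
      unfold msub. ring. }
    rewrite E in H0. apply H0. intros x Hx. apply in_seq.
    pose proof (proj1 (list_max_le l0 (list_max l0)) (le_n _)) as X. rewrite Forall_forall in X.
    specialize (X x Hx). lia. }
  assert (HXF : XN s p F rho) by (apply (XN_limit s p Fm F rho 0); auto).
  assert (HDm : forall m i, XN s p (msub (Fm (m + i)%nat) (Fm m)) (2 * rho * (/ 2) ^ m)).
  { intros m i. apply XN_weaken with (2 * rho * (/ 2) ^ m - 2 * rho * (/ 2) ^ (m + i)); [assumption| |].
    2:{ assert (0 <= (/ 2) ^ (m + i)) by (apply pow_le; lra). nra. }
    induction i as [|i IH].
    - rewrite Nat.add_0_r. replace (2 * rho * (/ 2) ^ m - 2 * rho * (/ 2) ^ m) with 0 by ring.
      apply (XN_ext s p (fun _ => RtoC 0)); [|apply XN_zero; lra]. intros xi. unfold msub. f_equal. ring.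
    - apply (XN_ext s p (madd (msub (Fm (S (m + i))) (Fm (m + i)%nat)) (msub (Fm (m + i)%nat) (Fm m)))).
      + intros xi. rewrite Nat.add_succ_r. unfold madd, msub. f_equal. ring.
      + eapply XN_weaken; [assumption|apply XN_add; [assumption|apply HD|apply IH]|].
        rewrite Nat.add_succ_r. simpl. lra. }
  assert (HFd : forall m, XN s p (msub F (Fm m)) (2 * rho * (/ 2) ^ m)).
  { intros m. assert (0 <= (/ 2) ^ m) by (apply pow_le; lra).
    apply (XN_limit s p (fun i => msub (Fm (m + i)%nat) (Fm m)) _ _ 0); auto; [nra|].
    intros xi eps He. destruct (HFl xi eps He) as [M HM]. exists M. intros i Hi.
    replace (msub (Fm (m + i)%nat) (Fm m) xi - msub F (Fm m) xi)%C with (Fm (m + i)%nat xi - F xi)%C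
      by (unfold msub; ring). apply HM. lia. }
  assert (Hfix : forall xi, F xi = Psi F xi).
  { intros xi. apply Ceq_eps. intros eps He.
    destruct (half_pow_small eps (2 * rho) He ltac:(lra)) as [m Hm].
    apply Rle_trans with (2 * rho * (/ 2) ^ m); [|exact Hm].
    assert (H0 : 0 <= (/ 2) ^ m) by (apply pow_le; lra).
    pose proof (XN_pointwise s p _ _ xi Hp Hs (HFd (S m))) as H1.
    pose proof (XN_pointwise s p _ _ xi Hp Hs (HPd F (Fm m) _ HXF (HFm m) (HFd m))) as H2.
    unfold msub in H1, H2. change (Fm (S m) xi) with (Psi (Fm m) xi) in H1.
    eapply Rle_trans; [apply (Cmod_sub_tri _ (Psi (Fm m) xi))|].
    rewrite (Cmod_sub_swap (Psi (Fm m) xi)). simpl in H1. lra. }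
  exists F. split; [assumption|]. split.
  - intros n k Hk. rewrite Hfix. unfold Psi, madd, base, LopM, Lop. cbn [fst snd].
    destruct (Z.eq_dec k 0); [contradiction|]. ring.
  - intros n. destruct (LopM_X s p a c0 L d s0 _ _ Hp HU (proj2 (T _ _ _ _ _ _ HXF HXF HXF))) as [_ HB].
    destruct (HB n) as [B HBn]. set (G := Gop L d (fun k => MN3 F (n, k))) in *.
    set (z := csum (fun k => (G k * cis (IZR k * s0))%C)).
    unfold val. rewrite (csum_ext _ (fun k => ((if Z.eq_dec k 0 then al n - z else RtoC 0) + G k * cis (IZR k * s0))%C)).
    + rewrite (csum_plus _ _ (Cmod (al n - z)) B).
      * rewrite (csum_single (fun k => if Z.eq_dec k 0 then (al n - z)%C else RtoC 0) 0%Z).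
        -- fold z. destruct (Z.eq_dec 0 0); [|contradiction]. ring.
        -- intros k Hk. destruct (Z.eq_dec k 0); [contradiction|reflexivity].
      * apply (SB_point _ 0%Z).
        -- intros k Hk. destruct (Z.eq_dec k 0); [contradiction|]. rewrite Cmod_0. lra.
        -- intros; apply Cmod_ge_0.
        -- destruct (Z.eq_dec 0 0); [lra|contradiction].
      * apply SB_cis, HBn.
    + intros k. rewrite Hfix. unfold Psi, madd, base, LopM, Lop. cbn [fst snd]. fold G. fold z.
      destruct (Z.eq_dec k 0) as [->|]; [|ring]. rewrite Rmult_0_l, cis_0. ring.
Qed.

(** * Embedding and the cubic nonlinearity *)

Lemma jbr_sum_bound g : 2 < g -> exists K, SB (fun n => rpow (jbr n) (- g)) K.
Proof.
  intros Hg. destruct (sum_Z2_bound g Hg) as [K HK]. exists (rpow (/ 3) (- g) * K).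
  apply (SB_inj nu _ (fun P => rpow (/ 3) (- g) * rpow (J P) (- g))).
  - intros; apply Rmult_le_pos; apply rpow_nonneg.
  - intros n _. apply jbr_weight. lra.
  - intros n m _ _. apply nu_inj.
  - apply SB_scal; [apply rpow_nonneg|assumption].
Qed.

(** For [p <= 3/2] this is the inclusion of [l^p] in [l^(3/2)]. Otherwise Hölder with exponents
    [2p/3] and [2p/(2p-3)] asks that [<n>^(-s (3/2) r')] be summable on the lattice, which is
    exactly [s > 4/3 - 2/p]. *)
Lemma embedding s p : 1 < p -> 0 < s -> s > 4 / 3 - 2 / p -> exists ce, 0 <= ce /\
  forall (f : Z2 -> R) A, (forall n, 0 <= f n) -> 0 <= A ->
    SB (fun n => rpow (wt s n * f n) p) (rpow A p) -> SB (fun n => rpow (f n) (3 / 2)) (rpow (ce * A) (3 / 2)).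
Proof.
  intros Hp Hs Hsp. destruct (Rle_lt_dec p (3 / 2)) as [Hp2|Hp2].
  - exists 1. split; [lra|]. intros f A Hf HA H. rewrite Rmult_1_l.
    assert (Hb : forall n, f n <= A).
    { intros n. pose proof (SB_term _ _ n H) as Hn. cbn beta in Hn.
      pose proof (wt_ge1 s n Hs). specialize (Hf n).
      apply rpow_le_inv in Hn; [nra|lra|nra|assumption]. }
    destruct HA as [HA|<-].
    + apply (SB_le _ (fun n => rpow A (3 / 2 - p) * rpow (wt s n * f n) p)).
      * intros n. specialize (Hf n). specialize (Hb n). pose proof (wt_ge1 s n Hs).
        replace (3 / 2) with ((3 / 2 - p) + p) at 1 by ring. rewrite rpow_plus.
        apply Rmult_le_compat; try apply rpow_nonneg; apply rpow_le; try lra. split; nra.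
      * replace (rpow A (3 / 2)) with (rpow A (3 / 2 - p) * rpow A p) by (rewrite <- rpow_plus; f_equal; ring).
        apply SB_scal; [apply rpow_nonneg|assumption].
    + apply SB_weaken with 0; [|apply rpow_nonneg]. apply SB_zero. intros n.
      specialize (Hf n). specialize (Hb n). replace (f n) with 0 by lra. rewrite rpow_0. lra.
  - set (r := 2 * p / 3). set (r' := 2 * p / (2 * p - 3)).
    assert (Hr : 1 < r) by (unfold r; lra).
    assert (Hr' : 1 < r').
    { unfold r'. replace (2 * p / (2 * p - 3)) with (1 + 3 / (2 * p - 3)) by (field; lra).
      assert (0 < 3 / (2 * p - 3)) by (apply Rdiv_lt_0_compat; lra). lra. }
    assert (Hrr : / r + / r' = 1) by (unfold r, r'; field; lra).
    assert (Hg : 2 < s * (3 / 2) * r').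
    { unfold r'. apply Rmult_lt_reg_r with (2 * p - 3); [lra|].
      replace (s * (3 / 2) * (2 * p / (2 * p - 3)) * (2 * p - 3)) with (3 * (s * p)) by (field; lra).
      assert (4 / 3 * p - 2 < s * p).
      { replace (4 / 3 * p - 2) with ((4 / 3 - 2 / p) * p) by (field; lra). apply Rmult_lt_compat_r; lra. }
      lra. }
    destruct (jbr_sum_bound _ Hg) as [K HK].
    assert (HK0 : 0 <= K) by (eapply SB_nonneg; eauto).
    exists (rpow (rpow K (/ r')) (2 / 3)). split; [apply rpow_nonneg|].
    intros f A Hf HA H.
    rewrite rpow_mult by (auto; apply rpow_nonneg). rewrite (rpow_rpow (rpow K (/ r'))).
    replace (2 / 3 * (3 / 2)) with 1 by field. rewrite (rpow_1 (rpow K _)) by apply rpow_nonneg.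
    replace (rpow A (3 / 2)) with (rpow (rpow A p) (/ r)).
    2:{ rewrite rpow_rpow. f_equal. unfold r. field. lra. }
    apply (SB_le _ (fun n => rpow (jbr n) (- (s * (3 / 2))) * rpow (wt s n * f n) (3 / 2))).
    + intros n. rewrite rpow_mult by (auto; left; apply wt_pos). unfold wt. rewrite rpow_rpow, <- Rmult_assoc, <- rpow_plus.
      replace (- (s * (3 / 2)) + s * (3 / 2)) with 0 by ring.
      rewrite rpow_x0 by (pose proof (jbr_ge1 n); lra). lra.
    + apply SB_holder with (p := r) (p' := r'); auto using rpow_nonneg.
      * eapply SB_le; [|exact HK]. intros n. rewrite rpow_rpow. right. f_equal. ring.
      * eapply SB_le; [|exact H]. intros n. rewrite rpow_rpow. right. f_equal. unfold r. field.
Qed.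

Lemma amgm3 x y z : 0 <= x -> 0 <= y -> 0 <= z ->
  rpow x (/ 3) * rpow y (/ 3) * rpow z (/ 3) <= / 3 * (x + y + z).
Proof.
  intros Hx Hy Hz.
  pose proof (weighted_amgm x y (/ 2) Hx Hy ltac:(lra)) as H1. replace (1 - / 2) with (/ 2) in H1 by lra.
  set (m := rpow x (/ 2) * rpow y (/ 2)) in *.
  assert (Hm : 0 <= m) by (apply Rmult_le_pos; apply rpow_nonneg).
  pose proof (weighted_amgm m z (2 / 3) Hm Hz ltac:(lra)) as H2. replace (1 - 2 / 3) with (/ 3) in H2 by lra.
  assert (E : rpow m (2 / 3) = rpow x (/ 3) * rpow y (/ 3)).
  { unfold m. rewrite rpow_mult, !rpow_rpow by apply rpow_nonneg. replace (/ 2 * (2 / 3)) with (/ 3) by field. reflexivity. }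
  rewrite E in H2. lra.
Qed.

(** After normalisation each term is the geometric mean of the three pairwise products of the
    [f^(3/2)]. For fixed [n] any two of the frequencies determine the third, so each pairwise sum
    factorises. *)
Lemma young_cubic (f1 f2 f3 : Z2 -> R) B1 B2 B3 n :
  (forall n, 0 <= f1 n) -> (forall n, 0 <= f2 n) -> (forall n, 0 <= f3 n) -> 0 <= B1 -> 0 <= B2 -> 0 <= B3 ->
  SB (fun n => rpow (f1 n) (3 / 2)) (rpow B1 (3 / 2)) -> SB (fun n => rpow (f2 n) (3 / 2)) (rpow B2 (3 / 2)) ->
  SB (fun n => rpow (f3 n) (3 / 2)) (rpow B3 (3 / 2)) ->
  SB (fun y : Z2 * Z2 => f1 (fst y) * f2 (third n (fst y) (snd y)) * f3 (snd y)) (B1 * B2 * B3).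
Proof.
  intros H1 H2 H3 HB1 HB2 HB3 S1 S2 S3.
  assert (Z : forall f, (forall n, 0 <= f n) -> SB (fun n : Z2 => rpow (f n) (3 / 2)) (rpow 0 (3 / 2)) -> forall n, f n = 0).
  { intros f Hf HS m. pose proof (SB_term _ _ m HS) as Hm. cbn beta in Hm. rewrite rpow_0 in Hm.
    apply (rpow_eq0 _ (3 / 2)); auto. pose proof (rpow_nonneg (f m) (3 / 2)). lra. }
  destruct HB1 as [HB1|<-].
  2:{ rewrite !Rmult_0_l. apply SB_zero. intros y. rewrite (Z f1); auto. lra. }
  destruct HB2 as [HB2|<-].
  2:{ rewrite Rmult_0_r, !Rmult_0_l. apply SB_zero. intros y. rewrite (Z f2); auto. lra. }
  destruct HB3 as [HB3|<-].
  2:{ rewrite Rmult_0_r. apply SB_zero. intros y. rewrite (Z f3); auto. lra. }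
  set (u := fun (f : Z2 -> R) B n => rpow (/ B) (3 / 2) * rpow (f n) (3 / 2)).
  assert (Hu : forall f B n, 0 <= u f B n) by (intros; apply Rmult_le_pos; apply rpow_nonneg).
  assert (HuS : forall f B, 0 < B -> SB (fun n => rpow (f n) (3 / 2)) (rpow B (3 / 2)) -> SB (u f B) 1).
  { intros f B HB HS. replace 1 with (rpow (/ B) (3 / 2) * rpow B (3 / 2)).
    - apply SB_scal; [apply rpow_nonneg|assumption].
    - pose proof (Rinv_0_lt_compat B HB). rewrite <- rpow_mult, Rinv_l by lra. apply rpow_one. }
  pose proof (HuS _ _ HB1 S1) as U1. pose proof (HuS _ _ HB2 S2) as U2. pose proof (HuS _ _ HB3 S3) as U3.
  set (u1 := u f1 B1) in *. set (u2 := u f2 B2) in *. set (u3 := u f3 B3) in *.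
  replace (B1 * B2 * B3) with (B1 * B2 * B3 * (/ 3 * (1 * 1 + 1 * 1 + 1 * 1))) by field.
  assert (HBB : 0 <= B1 * B2 * B3) by (repeat apply Rmult_le_pos; lra).
  eapply SB_le; [|apply (SB_scal (B1 * B2 * B3)); [exact HBB|apply SB_scal; [|apply SB_plus; [apply SB_plus|]]]].
  - intros y. cbn beta.
    apply Rle_trans with (B1 * B2 * B3 * (/ 3 * (u1 (fst y) * u2 (third n (fst y) (snd y)) +
       u2 (third n (fst y) (snd y)) * u3 (snd y) + u1 (fst y) * u3 (snd y)))); [|apply Rle_refl].
    set (a := f1 (fst y)). set (b := f2 _). set (c := f3 (snd y)).
    assert (Ha : 0 <= a) by apply H1. assert (Hb : 0 <= b) by apply H2. assert (Hc : 0 <= c) by apply H3.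
    replace (a * b * c) with (B1 * B2 * B3 * ((/ B1 * a) * (/ B2 * b) * (/ B3 * c))) by (field; lra).
    apply Rmult_le_compat_l; [assumption|].
    eapply Rle_trans; [|apply amgm3; apply Rmult_le_pos; apply Hu].
    assert (Ei : forall f B m, 0 < B -> (forall n, 0 <= f n) -> u f B m = rpow (/ B * f m) (3 / 2)).
    { intros f B m HB Hf. unfold u. rewrite rpow_mult; auto. left; apply Rinv_0_lt_compat, HB. }
    unfold u1, u2, u3. rewrite !Ei by assumption. fold a b c.
    assert (Pa : 0 <= / B1 * a) by (apply Rmult_le_pos; [left; apply Rinv_0_lt_compat|]; assumption).
    assert (Pb : 0 <= / B2 * b) by (apply Rmult_le_pos; [left; apply Rinv_0_lt_compat|]; assumption).
    assert (Pc : 0 <= / B3 * c) by (apply Rmult_le_pos; [left; apply Rinv_0_lt_compat|]; assumption).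
    set (x := / B1 * a) in *. set (y' := / B2 * b) in *. set (z := / B3 * c) in *.
    rewrite !(fun w v => rpow_mult (rpow w (3 / 2)) (rpow v (3 / 2))) by apply rpow_nonneg. rewrite !rpow_rpow.
    replace (3 / 2 * / 3) with (/ 2) by field.
    assert (Eh : forall w, 0 <= w -> rpow w (/ 2) * rpow w (/ 2) = w).
    { intros w Hw. rewrite <- rpow_plus. replace (/ 2 + / 2) with 1 by field. apply rpow_1, Hw. }
    rewrite <- (Eh x), <- (Eh y'), <- (Eh z) at 1 by assumption. right. ring.
  - lra.
  - apply (SB_inj (fun y : Z2 * Z2 => (fst y, third n (fst y) (snd y))) _ (fun z => u1 (fst z) * u2 (snd z))).
    + intros; apply Rmult_le_pos; apply Hu.
    + intros; cbn [fst snd]; lra.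
    + intros [a b] [a' b'] _ _ E. cbn [fst snd] in E. injection E as E1 E2 E3. subst a'.
      f_equal. apply (third_inj3 n a b (third n a b')); [unfold third; f_equal; assumption|reflexivity].
    + apply SB_mul_prod; auto; intros; apply Hu.
  - apply (SB_inj (fun y : Z2 * Z2 => (third n (fst y) (snd y), snd y)) _ (fun z => u2 (fst z) * u3 (snd z))).
    + intros; apply Rmult_le_pos; apply Hu.
    + intros; cbn [fst snd]; lra.
    + intros [a b] [a' b'] _ _ E. cbn [fst snd] in E. injection E as E1 E2 E3. subst b'.
      f_equal. apply (third_inj1 n a b (third n a' b)); [unfold third; f_equal; assumption|reflexivity].
    + apply SB_mul_prod; auto; intros; apply Hu.
  - apply (SB_inj (fun y : Z2 * Z2 => y) _ (fun z => u1 (fst z) * u3 (snd z))).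
    + intros; apply Rmult_le_pos; apply Hu.
    + intros; lra.
    + intros y y' _ _ E. exact E.
    + apply SB_mul_prod; auto; intros; apply Hu.
Qed.

Definition cubic_conclusion (s p ce : R) : Prop := 0 <= ce /\
  forall (f1 f2 f3 : Z2 -> R) A1 A2 A3 n, (forall n, 0 <= f1 n) -> (forall n, 0 <= f2 n) -> (forall n, 0 <= f3 n) ->
  0 <= A1 -> 0 <= A2 -> 0 <= A3 ->
  SB (fun n => rpow (wt s n * f1 n) p) (rpow A1 p) -> SB (fun n => rpow (wt s n * f2 n) p) (rpow A2 p) ->
  SB (fun n => rpow (wt s n * f3 n) p) (rpow A3 p) ->
  SB (fun y : Z2 * Z2 => f1 (fst y) * f2 (third n (fst y) (snd y)) * f3 (snd y)) (ce * (A1 * A2 * A3)).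

Lemma cubic_bound s p : 1 < p -> 0 < s -> s > 4 / 3 - 2 / p -> exists ce, cubic_conclusion s p ce.
Proof.
  intros Hp Hs Hsp. destruct (embedding s p Hp Hs Hsp) as (ce & Hce & HE).
  exists (ce * ce * ce). split; [apply Rmult_le_pos; [apply Rmult_le_pos|]; assumption|].
  intros f1 f2 f3 A1 A2 A3 n H1 H2 H3 HA1 HA2 HA3 S1 S2 S3.
  replace (ce * ce * ce * (A1 * A2 * A3)) with ((ce * A1) * (ce * A2) * (ce * A3)) by ring.
  apply young_cubic; auto; apply Rmult_le_pos; assumption.
Qed.

(** The nonlinearity in the interaction picture: conjugation by the linear group produces the factor
    [e^(i t phase)]. *)
Definition gn_term (t : R) (a b c : Z2 -> C) (n : Z2) (y : Z2 * Z2) : C :=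
  (RtoC (sg n (fst y) (snd y)) * cis (t * IZR (phase n (fst y) (snd y))) *
   (a (fst y) * Cconj (b (third n (fst y) (snd y))) * c (snd y)))%C.

Definition GN (t : R) (a : Z2 -> C) (n : Z2) : C := csum (gn_term t a a a n).

Lemma sg_abs_le1 n n1 n3 : Rabs (sg n n1 n3) <= 1.
Proof. rewrite sg_abs. apply ind_bound. Qed.

Lemma gn_term_mod t a b c n y : Cmod (gn_term t a b c n y) <=
  Cmod (a (fst y)) * Cmod (b (third n (fst y) (snd y))) * Cmod (c (snd y)).
Proof.
  unfold gn_term. rewrite !Cmod_mult, Cmod_R, cis_mod, Cmod_conj, Rmult_1_r.
  set (m := Cmod (a (fst y)) * _ * _).
  assert (0 <= m) by (unfold m; repeat apply Rmult_le_pos; apply Cmod_ge_0).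
  pose proof (sg_abs_le1 n (fst y) (snd y)). pose proof (Rabs_pos (sg n (fst y) (snd y))). nra.
Qed.

Lemma gn_summable s p ce t a b c A1 A2 A3 n : cubic_conclusion s p ce -> FLb s p a A1 -> FLb s p b A2 -> FLb s p c A3 ->
  SB (fun y => Cmod (gn_term t a b c n y)) (ce * (A1 * A2 * A3)).
Proof.
  intros [_ HC] [HA1 S1] [HA2 S2] [HA3 S3]. eapply SB_le; [apply gn_term_mod|].
  apply (HC (fun n => Cmod (a n)) (fun n => Cmod (b n)) (fun n => Cmod (c n))); auto; intros; apply Cmod_ge_0.
Qed.

Lemma GN_diff s p ce t a b R0 B n : cubic_conclusion s p ce -> FLb s p a R0 -> FLb s p b R0 ->
  FLb s p (fun n => (a n - b n)%C) B -> Cmod (GN t a n - GN t b n) <= 3 * ce * (R0 * R0) * B.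
Proof.
  intros HC Ha Hb HB. unfold GN.
  rewrite <- (csum_minus _ _ _ _ (gn_summable s p ce t a a a _ _ _ n HC Ha Ha Ha) (gn_summable s p ce t b b b _ _ _ n HC Hb Hb Hb)).
  set (D := fun n => (a n - b n)%C) in *.
  apply csum_bound.
  replace (3 * ce * (R0 * R0) * B) with (ce * (B * R0 * R0) + ce * (R0 * B * R0) + ce * (R0 * R0 * B)) by ring.
  eapply SB_le; [|apply SB_plus; [apply SB_plus; [apply (gn_summable s p ce t D a a _ _ _ n HC HB Ha Ha)|apply (gn_summable s p ce t b D a _ _ _ n HC Hb HB Ha)]|
    apply (gn_summable s p ce t b b D _ _ _ n HC Hb Hb HB)]].
  intros y. cbn beta.
  replace (gn_term t a a a n y - gn_term t b b b n y)%C
    with (gn_term t D a a n y + gn_term t b D a n y + gn_term t b b D n y)%C.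
  - eapply Rle_trans; [apply Cmod_triangle|]. apply Rplus_le_compat_r, Cmod_triangle.
  - unfold gn_term, D. rewrite Cminus_conj. ring.
Qed.

(** * Functions of time with prescribed Fourier coefficients *)

Lemma val_FLb s p F A t : 1 < p -> XN s p F A -> FLb s p (val F t) (l1_const p * A).
Proof.
  intros Hp HF. destruct (XN_slices s p F A Hp HF) as (An & H1 & H2 & H3). destruct HF as [HA _].
  assert (Hl : 0 <= l1_const p) by apply rpow_nonneg.
  split; [apply Rmult_le_pos; assumption|]. rewrite rpow_mult by assumption.
  eapply SB_le; [|apply (SB_scal _ _ _ (rpow_nonneg (l1_const p) p) H3)]. intros n. cbn beta.
  rewrite <- rpow_mult; auto. 2:{ apply Rmult_le_pos; [left; apply wt_pos|apply H1]. }
  apply rpow_le; [lra|]. split; [apply Rmult_le_pos; [left; apply wt_pos|apply Cmod_ge_0]|].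
  replace (l1_const p * (wt s n * An n)) with (wt s n * (l1_const p * An n)) by ring.
  apply Rmult_le_compat_l; [left; apply wt_pos|].
  apply csum_bound, SB_cis. apply (l1_of_weighted p (fun k => F (n, k)) (An n)); auto.
Qed.

(** Interpolates between the Lipschitz bound and the trivial bound 2. *)
Lemma cis_diff_holder x y th : 0 < th < 1 -> Cmod (cis x - cis y) <= 2 * rpow (Rabs (x - y)) th.
Proof.
  intros Hth. replace (cis x - cis y)%C with ((cis (x - y) - 1) * cis y)%C.
  2:{ replace x with ((x - y) + y) at 2 by ring. rewrite cis_plus. ring. }
  rewrite Cmod_mult, cis_mod, Rmult_1_r.
  destruct (Rle_lt_dec (Rabs (x - y)) 1) as [H|H].
  - eapply Rle_trans; [apply cis_sub1_le|]. apply Rmult_le_compat_l; [lra|].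
    pose proof (Rabs_pos (x - y)) as [P|P].
    + rewrite <- (rpow_1 (Rabs (x - y))) at 1 by lra.
      rewrite !rpow_pos_eq by assumption. unfold Rpower.
      assert (L : ln (Rabs (x - y)) <= 0) by (pose proof (ln_le_sub1 _ P); lra).
      assert (1 * ln (Rabs (x - y)) <= th * ln (Rabs (x - y))) as [E|E] by nra;
        [left; apply exp_increasing, E|rewrite E; lra].
    + rewrite <- P, rpow_0. lra.
  - assert (1 <= rpow (Rabs (x - y)) th).
    { rewrite <- (rpow_one th). apply rpow_le; lra. }
    unfold Cminus. eapply Rle_trans; [apply Cmod_triangle|]. rewrite cis_mod, Cmod_opp, Cmod_1. lra.
Qed.

Lemma thexp_lt1 p : 1 < p -> thexp p < 1.
Proof. intros. unfold thexp. rewrite <- Rinv_1. apply Rinv_lt_contravar; lra. Qed.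

Lemma val_holder s p F A t t' : 1 < p -> XN s p F A ->
  FLb s p (fun n => (val F t n - val F t' n)%C) (2 * l1_const p * rpow (Rabs (t - t')) (thexp p) * A).
Proof.
  intros Hp HF. destruct (XN_slices s p F A Hp HF) as (An & H1 & H2 & H3). destruct HF as [HA _].
  pose proof (thexp_pos p Hp) as Ht0. pose proof (thexp_lt1 p Hp) as Ht1.
  set (h := rpow (Rabs (t - t')) (thexp p)). assert (Hh : 0 <= h) by apply rpow_nonneg.
  assert (Hl : 0 <= l1_const p) by apply rpow_nonneg.
  assert (Hc : 0 <= 2 * l1_const p * h) by (apply Rmult_le_pos; lra).
  split; [apply Rmult_le_pos; assumption|]. rewrite rpow_mult by assumption.
  eapply SB_le; [|apply (SB_scal _ _ _ (rpow_nonneg (2 * l1_const p * h) p) H3)]. intros n. cbn beta.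
  rewrite <- rpow_mult; auto. 2:{ apply Rmult_le_pos; [left; apply wt_pos|apply H1]. }
  apply rpow_le; [lra|]. split; [apply Rmult_le_pos; [left; apply wt_pos|apply Cmod_ge_0]|].
  replace (2 * l1_const p * h * (wt s n * An n)) with (wt s n * (2 * h * (l1_const p * An n))) by ring.
  apply Rmult_le_compat_l; [left; apply wt_pos|].
  destruct (l1_of_weighted p (fun k => F (n, k)) (An n) Hp (H1 n) (H2 n)) as [L1 L2].
  unfold val. rewrite <- (csum_minus _ _ _ _ (SB_cis _ _ _ L2) (SB_cis _ _ _ L2)).
  apply csum_bound. eapply SB_le; [|apply (SB_scal (2 * h)); [lra|exact L1]].
  intros k. cbn beta.
  replace (F (n, k) * cis (IZR k * t) - F (n, k) * cis (IZR k * t'))%C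
    with (F (n, k) * (cis (IZR k * t) - cis (IZR k * t')))%C by ring.
  rewrite Cmod_mult. pose proof (Cmod_ge_0 (F (n, k))).
  pose proof (cis_diff_holder (IZR k * t) (IZR k * t') (thexp p) ltac:(lra)) as D.
  replace (IZR k * t - IZR k * t') with (IZR k * (t - t')) in D by ring.
  rewrite Rabs_mult, rpow_mult in D by apply Rabs_pos. fold h in D.
  assert (rpow (Rabs (IZR k)) (thexp p) <= rpow (jz k) (thexp p)).
  { apply rpow_le; [lra|]. unfold jz. pose proof (Rabs_pos (IZR k)). lra. }
  rewrite Rmult_comm.
  apply Rle_trans with ((2 * (rpow (jz k) (thexp p) * h)) * Cmod (F (n, k))); [|right; ring].
  apply Rmult_le_compat_r; [assumption|]. eapply Rle_trans; [exact D|]. nra.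
Qed.

Lemma val_sub s p F G A B t n : 1 < p -> 0 < s -> XN s p F A -> XN s p G B ->
  (val F t n - val G t n)%C = val (msub F G) t n.
Proof.
  intros Hp Hs HF HG. unfold val.
  pose proof (YN_l1 p F A n Hp (XN_YN s p F A Hp Hs HF)) as H1.
  pose proof (YN_l1 p G B n Hp (XN_YN s p G B Hp Hs HG)) as H2.
  rewrite <- (csum_minus _ _ _ _ (SB_cis _ _ _ H1) (SB_cis _ _ _ H2)).
  apply csum_ext. intros k. unfold msub. ring.
Qed.

Lemma val_Y p F A t n : 1 < p -> YN p F A -> Cmod (val F t n) <= l1_const p * A.
Proof. intros Hp HF. apply csum_bound, SB_cis, YN_l1; assumption. Qed.

Lemma csum_mul {A B} (f : A -> C) (g : B -> C) K K' : SB (fun a => Cmod (f a)) K -> SB (fun b => Cmod (g b)) K' ->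
  (csum f * csum g)%C = csum (fun x => (f (fst x) * g (snd x))%C).
Proof.
  intros Hf Hg.
  rewrite (csum_fubini (fun a b => (f a * g b)%C) (K * K')).
  - rewrite Cmult_comm. rewrite <- (csum_scal _ _ _ Hf). apply csum_ext. intros a.
    rewrite (csum_scal _ _ _ Hg). ring.
  - eapply SB_le; [|apply (SB_mul_prod _ _ _ _ (fun a => Cmod_ge_0 _) (fun b => Cmod_ge_0 _) Hf Hg)].
    intros x. rewrite Cmod_mult. lra.
Qed.

(** The three time series are multiplied out. At given spatial frequencies, prescribing [k1], [k3]
    and the output [k] is the same as prescribing [k1], [k3] and [k2]; absolute convergence of the
    whole sum is the cubic bound applied to the [l^1] norms in time. *)
Lemma val_equation s p ce F A t n : 1 < p -> cubic_conclusion s p ce -> XN s p F A ->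
  (exists B, SB (fun k => Cmod (MN3 F (n, k))) B) /\
  GN t (val F t) n = csum (fun k => (MN3 F (n, k) * cis (IZR k * t))%C).
Proof.
  intros Hp [_ HC] HF. destruct (XN_slices s p F A Hp HF) as (An & H1 & H2 & H3). destruct HF as [HA HF].
  set (f := fun n => l1_const p * An n).
  assert (Hl : 0 <= l1_const p) by apply rpow_nonneg.
  assert (Hf : forall n, 0 <= f n) by (intros; apply Rmult_le_pos; auto).
  assert (HfS : forall n, SB (fun k => Cmod (F (n, k))) (f n)).
  { intros m. apply (l1_of_weighted p (fun k => F (m, k)) (An m)); auto. }
  assert (HfF : SB (fun n => rpow (wt s n * f n) p) (rpow (l1_const p * A) p)).
  { rewrite rpow_mult by assumption. eapply SB_le; [|apply (SB_scal _ _ _ (rpow_nonneg (l1_const p) p) H3)].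
    intros m. cbn beta. rewrite <- rpow_mult; auto.
    - unfold f. right. f_equal. ring.
    - apply Rmult_le_pos; [left; apply wt_pos|apply H1]. }
  pose proof (HC f f f _ _ _ n Hf Hf Hf (Rmult_le_pos _ _ Hl HA) (Rmult_le_pos _ _ Hl HA) (Rmult_le_pos _ _ Hl HA) HfF HfF HfF) as HT.
  set (K := ce * (l1_const p * A * (l1_const p * A) * (l1_const p * A))) in *.
  set (n2 := fun y : Z2 * Z2 => third n (fst y) (snd y)).
  set (g := fun (y : Z2 * Z2) (ks : (Z * Z) * Z) =>
    (RtoC (sg n (fst y) (snd y)) * cis (t * IZR (phase n (fst y) (snd y))) *
     ((F (fst y, fst (fst ks)) * cis (IZR (fst (fst ks)) * t)) *
      (F (snd y, snd (fst ks)) * cis (IZR (snd (fst ks)) * t)) *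
      Cconj (F (n2 y, snd ks) * cis (IZR (snd ks) * t))))%C).
  assert (Hin : forall y, SB (fun ks : (Z * Z) * Z => Cmod (F (fst y, fst (fst ks)) * cis (IZR (fst (fst ks)) * t)) *
      Cmod (F (snd y, snd (fst ks)) * cis (IZR (snd (fst ks)) * t)) *
      Cmod (Cconj (F (n2 y, snd ks) * cis (IZR (snd ks) * t)))) (f (fst y) * f (snd y) * f (n2 y))).
  { intros y.
    apply (SB_mul_prod (fun ks : Z * Z => Cmod (F (fst y, fst ks) * cis (IZR (fst ks) * t)) * Cmod (F (snd y, snd ks) * cis (IZR (snd ks) * t)))
      (fun k => Cmod (Cconj (F (n2 y, k) * cis (IZR k * t))))).
    - intros; apply Rmult_le_pos; apply Cmod_ge_0.
    - intros; apply Cmod_ge_0.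
    - apply (SB_mul_prod (fun k => Cmod (F (fst y, k) * cis (IZR k * t))) (fun k => Cmod (F (snd y, k) * cis (IZR k * t))));
        try (intros; apply Cmod_ge_0); apply SB_cis, HfS.
    - eapply SB_le; [intros k; rewrite Cmod_conj; apply Rle_refl|]. apply SB_cis, HfS. }
  assert (Hg : SB (fun x => Cmod (g (fst x) (snd x))) K).
  { apply (SB_prod (fun y ks => Cmod (g y ks)) (fun y => f (fst y) * f (n2 y) * f (snd y))).
    - intros; apply Cmod_ge_0.
    - intros y. replace (f (fst y) * f (n2 y) * f (snd y)) with (f (fst y) * f (snd y) * f (n2 y)) by ring.
      eapply SB_le; [|apply Hin]. intros ks. unfold g.
      rewrite (Cmod_mult (_ * _)), (Cmod_mult (RtoC _)), Cmod_R, cis_mod, Rmult_1_r, !(Cmod_mult _ (Cconj _)), (Cmod_mult (_ * _) (_ * _)).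
      set (m := Cmod _ * Cmod _ * Cmod _). assert (0 <= m) by (unfold m; repeat apply Rmult_le_pos; apply Cmod_ge_0).
      pose proof (sg_abs_le1 n (fst y) (snd y)). pose proof (Rabs_pos (sg n (fst y) (snd y))). nra.
    - exact HT. }
  set (phi := fun x : Z * (mode * mode) => ((fst (fst (snd x)), fst (snd (snd x))),
      ((snd (fst (snd x)), snd (snd (snd x))), snd (mode2 (n, fst x) (fst (snd x)) (snd (snd x)))))).
  assert (Hphi : forall x x', phi x = phi x' -> x = x').
  { intros [k [[n1 k1] [n3 k3]]] [k' [[n1' k1'] [n3' k3']]] E. unfold phi, mode2 in E. cbn [fst snd] in E.
    injection E as E1 E2 E3 E4 E5. subst. repeat f_equal. lia. }
  assert (Hterm : forall x, g (fst (phi x)) (snd (phi x)) = (cis (IZR (fst x) * t) * tri_term F F F (n, fst x) (snd x))%C).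
  { intros [k [[n1 k1] [n3 k3]]]. unfold phi, g, tri_term, mode2, n2. cbn [fst snd].
    set (k2 := (phase n n1 n3 + k1 + k3 - k)%Z).
    replace (cis (IZR k * t)) with (cis (t * IZR (phase n n1 n3)) * cis (IZR k1 * t) * cis (IZR k3 * t) * Cconj (cis (IZR k2 * t)))%C.
    - rewrite Cmult_conj. ring.
    - rewrite cis_conj, <- !cis_plus. f_equal. unfold k2. rewrite minus_IZR, !plus_IZR. ring. }
  assert (Htri : SB (fun x : Z * (mode * mode) => Cmod (cis (IZR (fst x) * t) * tri_term F F F (n, fst x) (snd x))) K).
  { apply (SB_inj phi _ (fun x => Cmod (g (fst x) (snd x)))); auto.
    - intros; apply Cmod_ge_0.
    - intros x _. rewrite Hterm. lra. }
  destruct (SB_prod_inv (fun k x => Cmod (cis (IZR k * t) * tri_term F F F (n, k) x)) K) as [HA1 HA2]; [intros; apply Cmod_ge_0|exact Htri|].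
  assert (HA1' : forall k, SB (fun x => Cmod (tri_term F F F (n, k) x)) K).
  { intros k. eapply SB_le; [|exact (HA1 k)]. intros x. cbn beta. rewrite Cmod_mult, cis_mod. lra. }
  split.
  - exists K. eapply SB_le; [|exact HA2]. intros k. unfold MN3, MN. apply csum_bound.
    eapply SB_le; [|eapply tsum_SB, (HA1 k)]. intros x. cbn beta. rewrite Cmod_mult, cis_mod. lra.
  - transitivity (csum (fun x => g (fst x) (snd x))).
    + rewrite (csum_fubini g K Hg). unfold GN. apply csum_ext. intros y. unfold gn_term, g.
      rewrite (csum_scal _ _ (f (fst y) * f (snd y) * f (n2 y))).
      2:{ eapply SB_le; [|apply (Hin y)]. intros ks. rewrite !(Cmod_mult _ (Cconj _)), (Cmod_mult (_ * _) (_ * _)). lra. }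
      f_equal. unfold val.
      rewrite <- (csum_conj _ _ (SB_cis _ _ _ (HfS (n2 y)))).
      assert (HSc : SB (fun k => Cmod (Cconj (F (n2 y, k) * cis (IZR k * t)))) (f (n2 y))).
      { eapply SB_le; [intros k; rewrite Cmod_conj; apply Rle_refl|]. apply SB_cis, HfS. }
      assert (HS13 : SB (fun x : Z * Z => Cmod (F (fst y, fst x) * cis (IZR (fst x) * t) * (F (snd y, snd x) * cis (IZR (snd x) * t)))) (f (fst y) * f (snd y))).
      { eapply SB_le; [|apply (SB_mul_prod (fun k => Cmod (F (fst y, k) * cis (IZR k * t))) (fun k => Cmod (F (snd y, k) * cis (IZR k * t))));
          try (intros; apply Cmod_ge_0); apply SB_cis, HfS]. intros x. rewrite (Cmod_mult (_ * _) (_ * _)). lra. }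
      rewrite <- Cmult_assoc, (Cmult_comm (csum (fun k => Cconj _))), Cmult_assoc.
      rewrite (csum_mul _ _ _ _ (SB_cis _ _ _ (HfS (fst y))) (SB_cis _ _ _ (HfS (snd y)))).
      rewrite (csum_mul _ _ _ _ HS13 HSc). reflexivity.
    + rewrite <- (csum_inj phi (fun x => g (fst x) (snd x)) K); auto.
      * rewrite (csum_ext _ _ Hterm). rewrite (csum_fubini (fun k x => (cis (IZR k * t) * tri_term F F F (n, k) x)%C) K Htri).
        apply csum_ext. intros k. rewrite (csum_scal _ _ _ (HA1' k)). unfold MN3, MN. ring.
      * intros [[n1 n3] [[k1 k3] k2]] _. exists ((phase n n1 n3 + k1 + k3 - k2)%Z, ((n1, k1), (n3, k3))).
        unfold phi, mode2. cbn [fst snd]. repeat f_equal. ring.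
Qed.

(** * The gauged equation *)

(** The supremum of the points reached from [a] is itself reached and can be passed, as in Cousin's
    lemma. This is the compactness argument behind boundedness, Lipschitz bounds and local constancy
    below. *)
Lemma cousin (Q : R -> R -> Prop) a c : a <= c ->
  (forall x y z, a <= x -> x <= y -> y <= z -> z <= c -> Q x y -> Q y z -> Q x z) ->
  (forall t, a <= t <= c -> exists delta, 0 < delta /\
     forall x y, a <= x <= t -> t <= y <= c -> t - x < delta -> y - t < delta -> Q x y) ->
  Q a c.
Proof.
  intros Hac HT HL.
  set (E := fun x => a <= x <= c /\ Q a x).
  assert (Ea : E a).
  { split; [lra|]. destruct (HL a ltac:(lra)) as (d & Hd & H). apply H; lra. }
  destruct (completeness E) as [u [Hu1 Hu2]].
  { exists c. intros x [Hx _]. lra. }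
  { exists a. exact Ea. }
  assert (Hua : a <= u) by (apply Hu1, Ea).
  assert (Huc : u <= c) by (apply Hu2; intros x [Hx _]; lra).
  destruct (HL u ltac:(lra)) as (d & Hd & H).
  assert (exists x, E x /\ u - d < x) as (x & [Hx HQx] & Hxu).
  { apply NNPP. intros N. assert (u <= u - d); [|lra]. apply Hu2. intros x Hx.
    apply Rnot_lt_le. intros Hlt. apply N. exists x. split; [assumption|lra]. }
  assert (Hxu' : x <= u) by (apply Hu1; split; assumption).
  set (y := Rmin (u + d / 2) c).
  assert (Hy1 : u <= y) by (unfold y; apply Rmin_glb; lra).
  assert (Hy2 : y <= c) by apply Rmin_r.
  assert (Hy3 : y <= u + d / 2) by apply Rmin_l.
  assert (HQ : Q a y).
  { apply (HT a x y); try lra; [assumption|]. apply H; lra. }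
  assert (y <= u) by (apply Hu1; split; [lra|assumption]).
  replace c with y; [assumption|]. unfold y in *. unfold Rmin in *. destruct (Rle_dec (u + d / 2) c); lra.
Qed.

Lemma local_lipschitz_global (f : R -> C) a c M : a <= c -> 0 <= M ->
  (forall t, a <= t <= c -> exists delta, 0 < delta /\
     forall t', a <= t' <= c -> Rabs (t' - t) < delta -> Cmod (f t' - f t) <= M * Rabs (t' - t)) ->
  Cmod (f c - f a) <= M * (c - a).
Proof.
  intros Hac HM H.
  apply (cousin (fun x y => Cmod (f y - f x) <= M * (y - x)) a c Hac).
  - intros x y z _ Hxy Hyz _ H1 H2. eapply Rle_trans; [apply (Cmod_sub_tri _ (f y))|]. lra.
  - intros t Ht. destruct (H t Ht) as (d & Hd & Hl). exists d. split; [assumption|].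
    intros x y Hx Hy Hxd Hyd.
    pose proof (Hl x ltac:(lra) ltac:(rewrite Rabs_left1; lra)) as H1.
    pose proof (Hl y ltac:(lra) ltac:(rewrite Rabs_pos_eq; lra)) as H2.
    rewrite Rabs_left1 in H1 by lra. rewrite Rabs_pos_eq in H2 by lra.
    eapply Rle_trans; [apply (Cmod_sub_tri _ (f t))|]. rewrite (Cmod_sub_swap (f t)). lra.
Qed.

Lemma local_constant (f : R -> C) a c : a <= c ->
  (forall t, a <= t <= c -> forall eps, 0 < eps -> exists delta, 0 < delta /\
     forall t', a <= t' <= c -> Rabs (t' - t) < delta -> Cmod (f t' - f t) <= eps * Rabs (t' - t)) ->
  f c = f a.
Proof.
  intros Hac H. apply Ceq_eps. intros eps He.
  apply Rle_trans with (eps / (c - a + 1) * (c - a)).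
  - assert (0 < eps / (c - a + 1)) by (apply Rdiv_lt_0_compat; lra).
    apply local_lipschitz_global; [assumption|lra|]. intros t Ht. apply H; assumption.
  - apply Rle_trans with (eps / (c - a + 1) * (c - a + 1)); [|right; field; lra].
    apply Rmult_le_compat_l; [|lra]. left. apply Rdiv_lt_0_compat; lra.
Qed.

Lemma wder_restrict a c a' c' f g : a <= a' -> c' <= c -> wder a c f g -> wder a' c' f g.
Proof.
  intros Ha Hc H t Ht eps He. destruct (H t ltac:(lra) eps He) as (d & Hd & Hl).
  exists d. split; [assumption|]. intros t' Ht'. apply Hl. lra.
Qed.

Lemma wder_sub a c f f' g g' : wder a c f g -> wder a c f' g' ->
  wder a c (fun t => (f t - f' t)%C) (fun t => (g t - g' t)%C).
Proof.
  intros H H' t Ht eps He.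
  destruct (H t Ht (eps / 2) ltac:(lra)) as (d & Hd & Hl). destruct (H' t Ht (eps / 2) ltac:(lra)) as (d' & Hd' & Hl').
  exists (Rmin d d'). split; [apply Rmin_glb_lt; assumption|]. intros t' Ht' Htd.
  specialize (Hl t' Ht' (Rlt_le_trans _ _ _ Htd (Rmin_l _ _))).
  specialize (Hl' t' Ht' (Rlt_le_trans _ _ _ Htd (Rmin_r _ _))).
  replace (f t' - f' t' - (f t - f' t) - RtoC (t' - t) * (g t - g' t))%C
    with ((f t' - f t - RtoC (t' - t) * g t) - (f' t' - f' t - RtoC (t' - t) * g' t))%C by ring.
  unfold Cminus at 1. eapply Rle_trans; [apply Cmod_triangle|]. rewrite Cmod_opp. lra.
Qed.

Lemma wder_bound a c f g M : a <= c -> 0 <= M -> wder a c f g -> (forall t, a <= t <= c -> Cmod (g t) <= M) ->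
  Cmod (f c - f a) <= M * (c - a).
Proof.
  intros Hac HM H Hg. apply le_epsilon. intros eps He.
  apply Rle_trans with ((M + eps / (c - a + 1)) * (c - a)).
  - assert (He' : 0 < eps / (c - a + 1)) by (apply Rdiv_lt_0_compat; lra).
    apply local_lipschitz_global; [assumption|lra|]. intros t Ht.
    destruct (H t Ht _ He') as (d & Hd & Hl). exists d. split; [assumption|]. intros t' Ht' Htd.
    specialize (Hl t' Ht' Htd).
    replace (f t' - f t)%C with ((f t' - f t - RtoC (t' - t) * g t) + RtoC (t' - t) * g t)%C by ring.
    eapply Rle_trans; [apply Cmod_triangle|]. rewrite Cmod_mult, Cmod_R.
    specialize (Hg t Ht). pose proof (Rabs_pos (t' - t)). nra.
  - rewrite Rmult_plus_distr_r. apply Rplus_le_compat_l.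
    apply Rle_trans with (eps / (c - a + 1) * (c - a + 1)); [|right; field; lra].
    apply Rmult_le_compat_l; [|lra]. left. apply Rdiv_lt_0_compat; lra.
Qed.

(** * Continuous curves in the Fourier-Lebesgue space *)

Lemma FLb_add s p u v A B : 1 < p -> FLb s p u A -> FLb s p v B -> FLb s p (fun n => (u n + v n)%C) (A + B).
Proof.
  intros Hp [HA HF] [HB HG]. split; [lra|].
  assert (P : forall (u : Z2 -> C) n, 0 <= wt s n * Cmod (u n))
    by (intros; apply Rmult_le_pos; [left; apply wt_pos|apply Cmod_ge_0]).
  eapply SB_le; [|apply (SB_minkowski _ _ A B p (P u) (P v)); auto].
  intros n. apply rpow_le; [lra|]. split; [apply (P (fun n => (u n + v n)%C))|]. rewrite <- Rmult_plus_distr_l.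
  apply Rmult_le_compat_l; [left; apply wt_pos|apply Cmod_triangle].
Qed.

Lemma FLb_le s p u v A : 1 < p -> (forall n, Cmod (v n) <= Cmod (u n)) -> FLb s p u A -> FLb s p v A.
Proof.
  intros Hp H [HA HF]. split; [assumption|]. eapply SB_le; [|exact HF]. intros n.
  apply rpow_le; [lra|]. split; [apply Rmult_le_pos; [left; apply wt_pos|apply Cmod_ge_0]|].
  apply Rmult_le_compat_l; [left; apply wt_pos|apply H].
Qed.

Lemma FLb_weaken s p u A B : 1 < p -> FLb s p u A -> A <= B -> FLb s p u B.
Proof.
  intros Hp [HA HF] H. split; [lra|]. eapply SB_weaken; [exact HF|]. apply rpow_le; lra.
Qed.

Lemma FLb_swap s p (u v : Z2 -> C) A : 1 < p -> FLb s p (fun n => (u n - v n)%C) A -> FLb s p (fun n => (v n - u n)%C) A.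
Proof. intros Hp. apply FLb_le; [assumption|]. intros n. rewrite Cmod_sub_swap. lra. Qed.

Lemma FLb_tri s p (u v w : Z2 -> C) A B : 1 < p -> FLb s p (fun n => (u n - v n)%C) A ->
  FLb s p (fun n => (v n - w n)%C) B -> FLb s p (fun n => (u n - w n)%C) (A + B).
Proof.
  intros Hp HA HB. eapply FLb_le; [assumption| |apply FLb_add; [assumption|exact HA|exact HB]].
  intros n. right. cbn beta. f_equal. ring.
Qed.

Definition FLcont (s p a c : R) (V : R -> Z2 -> C) : Prop :=
  (forall t, a <= t <= c -> exists A, FLb s p (V t) A) /\
  (forall t, a <= t <= c -> forall eps, 0 < eps -> exists delta, 0 < delta /\
     forall t', a <= t' <= c -> Rabs (t' - t) < delta -> FLb s p (fun n => (V t' n - V t n)%C) eps).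

(** The gauged equation in a weak form: continuity in [FL^(s,p)], and the differential equation for
    each coefficient separately. *)
Definition Gsol (s p a c : R) (V : R -> Z2 -> C) : Prop :=
  FLcont s p a c V /\ forall n, wder a c (fun t => V t n) (fun t => (Ci * GN t (V t) n)%C).

Lemma Gsol_restrict s p a c a' c' V : a <= a' -> c' <= c -> Gsol s p a c V -> Gsol s p a' c' V.
Proof.
  intros Ha Hc ((H1 & H2) & H3). split; [split|].
  - intros t Ht. apply H1. lra.
  - intros t Ht eps He. destruct (H2 t ltac:(lra) eps He) as (d & Hd & Hl). exists d. split; [assumption|].
    intros t' Ht'. apply Hl. lra.
  - intros n. apply (wder_restrict a c); auto.
Qed.

Lemma FLcont_bounded s p a c V : 1 < p -> a <= c -> FLcont s p a c V ->
  exists R0, 0 <= R0 /\ forall t, a <= t <= c -> FLb s p (V t) R0.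
Proof.
  intros Hp Hac [H1 H2].
  apply (cousin (fun x y => exists R0, 0 <= R0 /\ forall t, x <= t <= y -> FLb s p (V t) R0) a c Hac).
  - intros x y z _ _ _ _ (R1 & P1 & B1) (R2 & P2 & B2). exists (Rmax R1 R2).
    split; [apply Rle_trans with R1; [assumption|apply Rmax_l]|]. intros t Ht.
    destruct (Rle_lt_dec t y).
    + eapply FLb_weaken; [assumption|apply B1; lra|apply Rmax_l].
    + eapply FLb_weaken; [assumption|apply B2; lra|apply Rmax_r].
  - intros t Ht. destruct (H1 t Ht) as [A HA]. destruct (H2 t Ht 1 ltac:(lra)) as (d & Hd & Hl).
    exists d. split; [assumption|]. intros x y Hx Hy Hxd Hyd. exists (1 + A).
    split; [destruct HA; lra|]. intros t' Ht'.
    eapply FLb_le; [assumption| |apply (FLb_add s p _ _ _ _ Hp (Hl t' ltac:(lra) ltac:(apply Rabs_def1; lra)) HA)].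
    intros n. right. f_equal. ring.
Qed.

Lemma val_split L d F n t B : (0 < L)%Z -> Xsol L d F -> SB (fun k => Cmod (F (n, k))) B ->
  val F t n = (F (n, 0%Z) + csum (fun k => Gop L d (fun k' => MN3 F (n, k')) k * cis (IZR k * t)))%C.
Proof.
  intros HL HX HB. unfold val.
  assert (G0 : Gop L d (fun k => MN3 F (n, k)) 0 = RtoC 0).
  { unfold Gop. rewrite Ntil_0; [ring|assumption]. }
  assert (HG : SB (fun k => Cmod (Gop L d (fun k' => MN3 F (n, k')) k)) B).
  { eapply SB_le; [|exact HB]. intros k. destruct (Z.eq_dec k 0) as [->|Hk].
    - rewrite G0, Cmod_0. apply Cmod_ge_0.
    - rewrite <- HX by assumption. lra. }
  rewrite (csum_ext _ (fun k => ((if Z.eq_dec k 0 then F (n, 0%Z) else RtoC 0) + Gop L d (fun k => MN3 F (n, k)) k * cis (IZR k * t))%C)).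
  - rewrite (csum_plus _ _ (Cmod (F (n, 0%Z))) B).
    + f_equal. rewrite (csum_single (fun k => if Z.eq_dec k 0 then F (n, 0%Z) else RtoC 0) 0%Z).
      * reflexivity.
      * intros k Hk. destruct (Z.eq_dec k 0); [contradiction|reflexivity].
    + apply (SB_point _ 0%Z).
      * intros k Hk. destruct (Z.eq_dec k 0); [contradiction|]. rewrite Cmod_0. lra.
      * intros; apply Cmod_ge_0.
      * destruct (Z.eq_dec 0 0); [lra|contradiction].
    + apply SB_cis, HG.
  - intros k. destruct (Z.eq_dec k 0) as [->|Hk].
    + rewrite G0, Rmult_0_l, cis_0. ring.
    + rewrite HX by assumption. ring.
Qed.

(** On the interval [Ntil] and the nonlinearity have the same values, so differentiating the
    primitive term by term returns [GN]. *)
Lemma Xsol_Gsol s p ce a c L d F rho : 1 < p -> 0 < s -> cubic_conclusion s p ce -> unit_on a c L d ->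
  XN s p F rho -> Xsol L d F -> Gsol s p a c (val F).
Proof.
  intros Hp Hs HC HU HF HX. split; [split|].
  - intros t _. eexists. apply (val_FLb s p F rho t Hp HF).
  - intros t _ eps He.
    pose proof (thexp_pos p Hp) as Hth. assert (Hrho : 0 <= rho) by apply HF.
    assert (Hl : 0 <= l1_const p) by apply rpow_nonneg.
    set (K := 2 * l1_const p * rho + 1).
    assert (HK : 0 < K) by (unfold K; assert (0 <= l1_const p * rho) by (apply Rmult_le_pos; assumption); nra).
    exists (rpow (eps / K) (/ thexp p)). assert (He' : 0 < eps / K) by (apply Rdiv_lt_0_compat; assumption).
    split; [apply rpow_gt0; assumption|]. intros t' _ Ht'.
    eapply FLb_weaken; [assumption|apply (val_holder s p F rho t' t Hp HF)|].
    assert (H1 : rpow (Rabs (t' - t)) (thexp p) <= eps / K).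
    { rewrite <- (rpow_inv_l (eps / K) (thexp p)) by lra. apply rpow_le; [lra|]. split; [apply Rabs_pos|lra]. }
    pose proof (rpow_nonneg (Rabs (t' - t)) (thexp p)).
    apply Rle_trans with (K * (eps / K)); [|right; field; lra].
    replace (2 * l1_const p * rpow (Rabs (t' - t)) (thexp p) * rho) with ((2 * l1_const p * rho) * rpow (Rabs (t' - t)) (thexp p)) by ring.
    apply Rmult_le_compat; [|assumption|unfold K; lra|assumption].
    apply Rmult_le_pos; [apply Rmult_le_pos|]; lra.
  - intros n. destruct (val_equation s p ce F rho 0 n Hp HC HF) as [[B HB] _].
    pose proof (YN_l1 p F rho n Hp (XN_YN s p F rho Hp Hs HF)) as HFl.
    pose proof HU as (HL & _).
    pose proof (Ntil_summable a c L d (fun k => MN3 F (n, k)) B HU HB) as HNt.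
    intros t Ht eps He.
    destruct (exp_series_wder (Ntil L d (fun k => MN3 F (n, k))) _ a c HNt (Ntil_0 _ _ _ HL) t Ht eps He) as (del & Hd & Hl).
    exists del. split; [assumption|]. intros t' Ht' Htd. specialize (Hl t' Ht' Htd).
    rewrite (Ntil_evaluation a c L d _ B t HU HB Ht) in Hl.
    destruct (val_equation s p ce F rho t n Hp HC HF) as [_ E]. rewrite E.
    rewrite !(val_split L d F n _ _ HL HX HFl). unfold Gop.
    match goal with |- Cmod ?x <= _ => match type of Hl with Cmod ?y <= _ => replace x with y; [exact Hl|ring] end end.
Qed.

(* Uniqueness without auxiliary spaces: let [y_s] be the constructed solution through [(s, V s)].
   The flow is Lipschitz in the weak norm [sup_n], in which the nonlinearity is bounded, and the
   rough solution [V] agrees with [y_s] to first order near [s] in that norm. Hence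
   [s |-> y_s(t)] has zero derivative, and [V t = y_t(t) = y_a(t)]. *)
Lemma Gsol_is_Xsol s p c ce a b L d V rho : 1 < p -> 0 < s -> tri_conclusion s p c -> cubic_conclusion s p ce ->
  unit_on a b L d -> 6 * (small_const p c L * (rho * rho)) <= 1 -> a <= b ->
  Gsol s p a b V -> (forall t, a <= t <= b -> FLb s p (V t) (rho / 2)) ->
  exists F, XN s p F rho /\ Xsol L d F /\ forall t n, a <= t <= b -> V t n = val F t n.
Proof.
  intros Hp Hs HT HC HU Hsm Hab HV HVb.
  set (Fs := fun s0 => epsilon (inhabits (fun _ : mode => RtoC 0)) (fun F =>
     XN s p F rho /\ Xsol L d F /\ forall n, val F s0 n = V s0 n)).
  assert (HFs : forall s0, a <= s0 <= b -> XN s p (Fs s0) rho /\ Xsol L d (Fs s0) /\ forall n, val (Fs s0) s0 n = V s0 n).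
  { intros s0 Hs0. unfold Fs. apply epsilon_spec. apply (Xsol_exists s p c a b L d rho s0 (V s0)); auto. }
  destruct (HFs a ltac:(lra)) as (HX & HXs & HVa).
  exists (Fs a). split; [assumption|]. split; [assumption|].
  intros t n Ht. destruct (HFs t Ht) as (_ & _ & Et). rewrite <- Et.
  assert (Hrho : 0 <= rho) by apply HX.
  assert (Hl : 0 <= l1_const p) by apply rpow_nonneg.
  pose proof (proj1 HC) as Hce. pose proof (thexp_pos p Hp) as Hth.
  apply (local_constant (fun s0 => val (Fs s0) t n) a t ltac:(lra)).
  intros s0 Hs0 eps He.
  (* Bounds both curves in [FL^(s,p)]: [l1_const p * rho] for the constructed solutions and
     [rho / 2] for [V]. *)
  set (R0 := (l1_const p + / 2) * rho).
  assert (HR0 : 0 <= R0) by (apply Rmult_le_pos; lra).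
  (* Collects the chain of constants: 3 from [GN_diff], 2 from the weak Lipschitz bound and
     [l1_const p] from evaluation at [t]. *)
  set (K := 6 * l1_const p * ce * (R0 * R0)).
  assert (HK : 0 <= K) by (unfold K; repeat apply Rmult_le_pos; lra).
  set (eta := eps / (K + 1)). assert (Heta : 0 < eta) by (apply Rdiv_lt_0_compat; lra).
  destruct (proj2 (proj1 HV) s0 ltac:(lra) (eta / 3) ltac:(lra)) as (d1 & Hd1 & HVc).
  set (K2 := 2 * l1_const p * rho + 1).
  assert (HK2 : 0 < K2) by (unfold K2; assert (0 <= l1_const p * rho) by (apply Rmult_le_pos; assumption); nra).
  assert (He2 : 0 < eta / 3 / K2) by (repeat apply Rdiv_lt_0_compat; lra).
  set (d2 := rpow (eta / 3 / K2) (/ thexp p)).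
  assert (Hd2 : 0 < d2) by (apply rpow_gt0; assumption).
  exists (Rmin d1 d2). split; [apply Rmin_glb_lt; assumption|].
  intros s1 Hs1 Hs01.
  (* With one of the two times equal to [s0], this covers both sides of [s0] while the comparison
     always runs forward from [lo]. *)
  assert (G : forall lo hi, a <= lo -> lo <= hi -> hi <= t -> lo = s0 \/ hi = s0 -> hi - lo < Rmin d1 d2 ->
     Cmod (val (Fs hi) t n - val (Fs lo) t n) <= eps * (hi - lo)).
  { intros lo hi Hlo Hlh Hhi Hor Hd.
    destruct (HFs lo ltac:(lra)) as (X1 & X2 & X3). destruct (HFs hi ltac:(lra)) as (Y1 & Y2 & Y3).
    assert (Hd1' : hi - lo < d1) by (eapply Rlt_le_trans; [exact Hd|apply Rmin_l]).
    assert (Hd2' : hi - lo < d2) by (eapply Rlt_le_trans; [exact Hd|apply Rmin_r]).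
    (* Three short moves: along the constructed solution from [tau] back to [lo], then along [V]
       from [lo] to [s0] and from [s0] to [tau]. *)
    assert (HB : forall tau, lo <= tau <= hi -> FLb s p (fun n => (val (Fs lo) tau n - V tau n)%C) eta).
    { intros tau Htau.
      assert (B1 : FLb s p (fun n => (val (Fs lo) tau n - val (Fs lo) lo n)%C) (eta / 3)).
      { eapply FLb_weaken; [assumption|apply (val_holder s p _ rho tau lo Hp X1)|].
        assert (H1 : rpow (Rabs (tau - lo)) (thexp p) <= eta / 3 / K2).
        { rewrite <- (rpow_inv_l (eta / 3 / K2) (thexp p)) by lra. apply rpow_le; [lra|].
          split; [apply Rabs_pos|]. rewrite Rabs_pos_eq by lra. fold d2. lra. }
        pose proof (rpow_nonneg (Rabs (tau - lo)) (thexp p)).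
        apply Rle_trans with (K2 * (eta / 3 / K2)); [|right; field; lra].
        replace (2 * l1_const p * rpow (Rabs (tau - lo)) (thexp p) * rho) with ((2 * l1_const p * rho) * rpow (Rabs (tau - lo)) (thexp p)) by ring.
        apply Rmult_le_compat; [|assumption|unfold K2; lra|assumption].
        apply Rmult_le_pos; [apply Rmult_le_pos|]; lra. }
      assert (B2 : FLb s p (fun n => (val (Fs lo) lo n - V s0 n)%C) (eta / 3)).
      { eapply FLb_le; [assumption| |apply (HVc lo ltac:(lra))].
        - intros n0. rewrite X3. lra.
        - destruct Hor as [-> | ->]; [rewrite Rminus_diag, Rabs_R0; assumption|rewrite Rabs_left1; lra]. }
      assert (B3 : FLb s p (fun n => (V s0 n - V tau n)%C) (eta / 3)).
      { apply FLb_swap; [assumption|]. apply HVc; [lra|].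
        destruct Hor as [-> | ->]; [rewrite Rabs_pos_eq; lra|rewrite Rabs_left1; lra]. }
      eapply FLb_weaken; [assumption|apply (FLb_tri s p _ _ _ _ _ Hp B1 (FLb_tri s p _ _ _ _ _ Hp B2 B3))|lra]. }
    assert (HM0 : 0 <= 3 * ce * (R0 * R0) * eta) by (apply Rmult_le_pos; [apply Rmult_le_pos; [lra|nra]|lra]).
    assert (HM : forall n0, Cmod (val (Fs lo) hi n0 - val (Fs hi) hi n0) <= 3 * ce * (R0 * R0) * eta * (hi - lo)).
    { intros n0. rewrite Y3.
      assert (W1 : wder lo hi (fun t => val (Fs lo) t n0) (fun t => (Ci * GN t (val (Fs lo) t) n0)%C)).
      { apply (wder_restrict a b); [lra|lra|]. apply (proj2 (Xsol_Gsol s p ce a b L d (Fs lo) rho Hp Hs HC HU X1 X2)). }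
      assert (W2 : wder lo hi (fun t => V t n0) (fun t => (Ci * GN t (V t) n0)%C)).
      { apply (wder_restrict a b); [lra|lra|]. apply (proj2 HV). }
      pose proof (wder_bound lo hi _ _ (3 * ce * (R0 * R0) * eta) Hlh HM0 (wder_sub _ _ _ _ _ _ W1 W2)) as WB.
      cbn beta in WB.
      replace (val (Fs lo) hi n0 - V hi n0)%C with (val (Fs lo) hi n0 - V hi n0 - (val (Fs lo) lo n0 - V lo n0))%C.
      2:{ rewrite X3. ring. }
      apply WB. intros tau Htau.
      replace (Ci * GN tau (val (Fs lo) tau) n0 - Ci * GN tau (V tau) n0)%C
        with (Ci * (GN tau (val (Fs lo) tau) n0 - GN tau (V tau) n0))%C by ring.
      rewrite Cmod_mult.
      assert (E1 : Cmod Ci = 1) by (transitivity (sqrt 1); [unfold Ci, Cmod; simpl; f_equal; ring|apply sqrt_1]).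
      rewrite E1, Rmult_1_l.
      apply (GN_diff s p ce tau _ _ R0 eta n0 HC).
      - eapply FLb_weaken; [assumption|apply (val_FLb s p _ rho tau Hp X1)|]. unfold R0. nra.
      - eapply FLb_weaken; [assumption|apply HVb; lra|]. unfold R0. nra.
      - apply HB, Htau. }
    set (A := 3 * ce * (R0 * R0) * eta * (hi - lo)) in *.
    assert (HA : 0 <= A) by (unfold A; apply Rmult_le_pos; [exact HM0|lra]).
    pose proof (Xsol_lipschitz_Y s p c a b L d _ _ rho hi A Hp Hs HT HU Hsm X1 Y1 X2 Y2 HA HM) as HY.
    rewrite Cmod_sub_swap, (val_sub s p _ _ rho rho t n Hp Hs X1 Y1).
    eapply Rle_trans; [apply (val_Y p _ _ t n Hp HY)|].
    replace (l1_const p * (2 * A)) with (K * eta * (hi - lo)) by (unfold A, K; ring).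
    apply Rmult_le_compat_r; [lra|]. unfold eta.
    apply Rle_trans with ((K + 1) * (eps / (K + 1))); [apply Rmult_le_compat_r; [left; exact Heta|lra]|right; field; lra]. }
  destruct (Rle_lt_dec s0 s1) as [H01|H01].
  - rewrite Rabs_pos_eq in Hs01 |- * by lra. apply (G s0 s1); [lra|lra|lra|left; reflexivity|exact Hs01].
  - rewrite Rabs_left in Hs01 |- * by lra. rewrite Cmod_sub_swap.
    replace (- (s1 - s0)) with (s0 - s1) in Hs01 |- * by ring.
    apply (G s1 s0); [lra|lra|lra|right; reflexivity|exact Hs01].
Qed.

Lemma small_const_exists p c rho : 1 < p -> 0 <= c -> 0 <= rho -> exists L, (0 < L)%Z /\ 6 * (small_const p c L * (rho * rho)) <= 1.
Proof.
  intros Hp Hc Hr. pose proof (bexp_bounds p Hp) as Hb. pose proof (lop_const_pos p Hp) as Hl.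
  set (K := 6 * lop_const p * c * (rho * rho) + 1).
  assert (HK : 1 <= K).
  { unfold K. assert (0 <= 6 * lop_const p * c * (rho * rho)); [|lra]. apply Rmult_le_pos; [|nra]. apply Rmult_le_pos; lra. }
  destruct (INR_unbounded (rpow K (/ (1 - bexp p)))) as [N HN].
  exists (Z.of_nat N + 1)%Z. split; [lia|].
  unfold small_const. rewrite plus_IZR, <- INR_IZR_INZ.
  pose proof (rpow_gt0 K (/ (1 - bexp p)) ltac:(lra)) as HP.
  assert (H1 : rpow (INR N + 1) (bexp p - 1) <= / K).
  { replace (bexp p - 1) with (- (1 - bexp p)) by ring. rewrite rpow_opp. apply Rinv_le_contravar; [lra|].
    rewrite <- (rpow_inv_l K (1 - bexp p)) by lra. apply rpow_le; lra. }
  assert (0 < / K) by (apply Rinv_0_lt_compat; lra).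
  apply Rle_trans with ((6 * lop_const p * c * (rho * rho)) * / K).
  - replace (6 * (lop_const p * rpow (INR N + 1) (bexp p - 1) * c * (rho * rho)))
      with ((6 * lop_const p * c * (rho * rho)) * rpow (INR N + 1) (bexp p - 1)) by ring.
    apply Rmult_le_compat_l; [unfold K in HK; lra|assumption].
  - apply Rmult_le_reg_r with K; [lra|]. rewrite Rmult_assoc, Rinv_l by lra. unfold K. lra.
Qed.

Lemma unit_on_restrict a c a' c' L d : a <= a' -> c' <= c -> unit_on a c L d -> unit_on a' c' L d.
Proof. intros Ha Hc (H1 & H2 & H3). split; [assumption|]. split; [assumption|]. intros t Ht. apply H3. lra. Qed.

(** The step length [1/(2L)] depends only on a bound for both solutions on all of [[0, T]], so
    finitely many steps cover the interval. *)
Lemma Gsol_unique s p c ce T V W : 1 < p -> 0 < s -> tri_conclusion s p c -> cubic_conclusion s p ce -> 0 <= T ->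
  Gsol s p 0 T V -> Gsol s p 0 T W -> (forall n, V 0 n = W 0 n) -> forall t n, 0 <= t <= T -> V t n = W t n.
Proof.
  intros Hp Hs HT HC HT0 HV HW H0.
  destruct (FLcont_bounded s p 0 T V Hp HT0 (proj1 HV)) as (R1 & P1 & B1).
  destruct (FLcont_bounded s p 0 T W Hp HT0 (proj1 HW)) as (R2 & P2 & B2).
  set (rho := 2 * (R1 + R2)).
  destruct (small_const_exists p c rho Hp (proj1 HT) ltac:(unfold rho; lra)) as (L & HL & Hsm).
  assert (HLR : 0 < / (2 * IZR L)) by (apply Rinv_0_lt_compat; assert (0 < IZR L) by (apply IZR_lt; assumption); lra).
  set (h := / (2 * IZR L)) in *.
  assert (G : forall N t n, 0 <= t <= T -> t <= INR N * h -> V t n = W t n).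
  { induction N as [|N IH]; intros t n Ht HtN.
    - simpl in HtN. replace t with 0 by lra. apply H0.
    - destruct (Rle_lt_dec t (INR N * h)) as [Hle|Hlt]; [apply IH; assumption|].
      rewrite S_INR in HtN. set (a := INR N * h) in *.
      assert (Ha : 0 <= a) by (apply Rmult_le_pos; [apply pos_INR|lra]).
      destruct (unit_on_exists a L HL) as (d & HU). fold h in HU.
      assert (Hta : t <= a + h) by (unfold a; lra).
      apply (unit_on_restrict a (a + h) a t L d (Rle_refl a) Hta) in HU.
      destruct (Gsol_is_Xsol s p c ce a t L d V rho Hp Hs HT HC HU Hsm ltac:(lra)) as (F & F1 & F2 & F3).
      { apply (Gsol_restrict s p 0 T); [lra|lra|assumption]. }
      { intros t' Ht'. eapply FLb_weaken; [assumption|apply B1; lra|unfold rho; lra]. }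
      destruct (Gsol_is_Xsol s p c ce a t L d W rho Hp Hs HT HC HU Hsm ltac:(lra)) as (G & G1 & G2 & G3).
      { apply (Gsol_restrict s p 0 T); [lra|lra|assumption]. }
      { intros t' Ht'. eapply FLb_weaken; [assumption|apply B2; lra|unfold rho; lra]. }
      rewrite F3, G3 by lra.
      pose proof (Xsol_lipschitz_Y s p c a t L d F G rho a 0 Hp Hs HT HU Hsm F1 G1 F2 G2 ltac:(lra)) as HY.
      assert (HYY : YN p (msub F G) (2 * 0)).
      { apply HY. intros m. rewrite <- F3, <- G3 by lra. rewrite (IH a m) by lra. rewrite Cminus_diag, Cmod_0. lra. }
      apply Ceq_eps. intros eps He. rewrite (val_sub s p F G rho rho t n Hp Hs F1 G1).
      eapply Rle_trans; [apply (val_Y p _ _ t n Hp HYY)|]. lra. }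
  intros t n Ht. destruct (INR_unbounded (t / h)) as [N HN]. apply (G N); [assumption|].
  apply Rmult_le_reg_r with (/ h); [apply Rinv_0_lt_compat; assumption|].
  rewrite Rmult_assoc, Rinv_r, Rmult_1_r by lra. unfold Rdiv in HN. lra.
Qed.

(** [L], and hence [T], is chosen from [rho] alone. [K] serves twice: [l1_const p * rho] bounds the
    solution, and [2 l1_const p] is the Lipschitz constant. *)
Lemma Gsol_wellposed s p c ce rho : 1 < p -> 0 < s -> tri_conclusion s p c -> cubic_conclusion s p ce -> 0 <= rho ->
  exists T K, 0 < T /\ 0 <= K /\
  (forall al, FLb s p al (rho / 2) -> exists V, Gsol s p 0 T V /\ forall n, V 0 n = al n) /\
  (forall V W A, Gsol s p 0 T V -> Gsol s p 0 T W -> FLb s p (V 0) (rho / 2) -> FLb s p (W 0) (rho / 2) ->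
     FLb s p (fun n => (V 0 n - W 0 n)%C) A ->
     forall t, 0 <= t <= T -> FLb s p (V t) K /\ FLb s p (fun n => (V t n - W t n)%C) (K * A)).
Proof.
  intros Hp Hs HT HC Hr.
  destruct (small_const_exists p c rho Hp (proj1 HT) Hr) as (L & HL & Hsm).
  assert (HLR : 0 < / (2 * IZR L)) by (apply Rinv_0_lt_compat; assert (0 < IZR L) by (apply IZR_lt; assumption); lra).
  destruct (unit_on_exists 0 L HL) as (d & HU). rewrite Rplus_0_l in HU.
  assert (Hl : 0 <= l1_const p) by apply rpow_nonneg.
  exists (/ (2 * IZR L)), (l1_const p * (rho + 2)). split; [assumption|]. split; [apply Rmult_le_pos; lra|]. split.
  - intros al Hal. destruct (Xsol_exists s p c 0 _ L d rho 0 al Hp Hs HT HU Hsm Hal) as (F & F1 & F2 & F3).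
    exists (val F). split; [apply (Xsol_Gsol s p ce _ _ L d F rho); assumption|assumption].
  - intros V W A HV HW HV0 HW0 HA t Ht.
    (* A solution is not known in advance to stay in the ball, so it is identified with the
       constructed one through [Gsol_unique] rather than [Gsol_is_Xsol]. *)
    assert (X : forall V, Gsol s p 0 (/ (2 * IZR L)) V -> FLb s p (V 0) (rho / 2) ->
       exists F, XN s p F rho /\ Xsol L d F /\ forall t n, 0 <= t <= / (2 * IZR L) -> V t n = val F t n).
    { clear V W HV HW HV0 HW0 HA. intros V HV HV0.
      destruct (Xsol_exists s p c 0 _ L d rho 0 (V 0) Hp Hs HT HU Hsm HV0) as (F & F1 & F2 & F3).
      exists F. split; [assumption|]. split; [assumption|]. intros t' n Ht'.
      apply (Gsol_unique s p c ce (/ (2 * IZR L)) V (val F)); auto; [lra|].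
      apply (Xsol_Gsol s p ce _ _ L d F rho); assumption. }
    destruct (X V HV HV0) as (F & F1 & F2 & F3). destruct (X W HW HW0) as (G & G1 & G2 & G3).
    assert (HA0 : 0 <= A) by apply HA.
    split.
    + eapply FLb_le; [assumption|intros n; rewrite (F3 t n Ht); apply Rle_refl|].
      eapply FLb_weaken; [assumption|apply (val_FLb s p F rho t Hp F1)|]. nra.
    + assert (HD : XN s p (msub F G) (2 * A)).
      { apply (Xsol_lipschitz_X s p c 0 _ L d F G rho 0 A Hp Hs HT HU Hsm F1 G1 F2 G2).
        eapply FLb_le; [assumption| |exact HA]. intros n. rewrite <- (F3 0 n), <- (G3 0 n) by lra. lra. }
      eapply FLb_le; [assumption|intros n; rewrite (F3 t n Ht), (G3 t n Ht), (val_sub s p F G rho rho t n Hp Hs F1 G1); apply Rle_refl|].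
      eapply FLb_weaken; [assumption|apply (val_FLb s p _ _ t Hp HD)|].
      assert (0 <= l1_const p * rho * A) by (repeat apply Rmult_le_pos; assumption). nra.
Qed.

(** * Box sums *)

Definition box_list (N : nat) : list Z2 :=
  map (fun x : nat * nat => (Z.of_nat (fst x) - Z.of_nat N, Z.of_nat (snd x) - Z.of_nat N)%Z)
    (list_prod (seq 0 (S (2 * N))) (seq 0 (S (2 * N)))).

Lemma box_list_NoDup N : NoDup (box_list N).
Proof.
  unfold box_list. apply NoDup_map_on.
  - apply NoDup_list_prod; apply seq_NoDup.
  - intros [i j] [i' j'] _ _ E. cbn [fst snd] in E. injection E as E1 E2. f_equal; lia.
Qed.

Lemma box_list_In N n : In n (box_list N) <-> in_box N n = true.
Proof.
  unfold box_list, in_box. rewrite in_map_iff, Bool.andb_true_iff, !Z.leb_le. split.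
  - intros ([i j] & <- & H). apply in_prod_iff in H as [Hi Hj]. apply in_seq in Hi, Hj. cbn [fst snd]. lia.
  - destruct n as [x y]. cbn [fst snd]. intros [Hx Hy].
    exists (Z.to_nat (x + Z.of_nat N), Z.to_nat (y + Z.of_nat N)). cbn [fst snd]. split.
    + f_equal; lia.
    + apply in_prod_iff. split; apply in_seq; lia.
Qed.

Lemma box_list_exhaust (l : list Z2) : exists N0, forall N n, (N0 <= N)%nat -> In n l -> In n (box_list N).
Proof.
  induction l as [|x l [N0 IH]].
  - exists 0%nat. intros N n _ [].
  - exists (Nat.max N0 (Z.to_nat (nrm x))). intros N n HN [<-|Hn].
    + apply box_list_In. unfold in_box. apply Bool.andb_true_iff. rewrite !Z.leb_le. unfold nrm in HN. lia.
    + apply IH; [lia|assumption].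
Qed.

Lemma sum_n_sumL (f : nat -> R) N : sum_n f N = sumL f (seq 0 (S N)).
Proof.
  induction N as [|N IH].
  - rewrite sum_O. simpl. ring.
  - rewrite sum_Sn, IH, (seq_S (S N)), sumL_app. unfold plus; simpl. ring.
Qed.

Lemma sum_n_sumC (f : nat -> C) N : sum_n f N = sumC f (seq 0 (S N)).
Proof.
  induction N as [|N IH].
  - rewrite sum_O. symmetry. apply Cplus_0_r.
  - rewrite sum_Sn, IH, (seq_S (S N)), sumC_app. change (0 + S N)%nat with (S N).
    symmetry. exact (f_equal (Cplus (sumC f (seq 0 (S N)))) (Cplus_0_r (f (S N)))).
Qed.

Lemma box_sum_sumL N (f : Z2 -> R) : box_sum N f = sumL f (box_list N).
Proof.
  unfold box_sum, box_list. rewrite sumL_map, sumL_list_prod. rewrite sum_n_sumL. apply sumL_ext.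
  intros i _. rewrite sum_n_sumL. reflexivity.
Qed.

Lemma box_sum_sumC N (f : Z2 -> C) : box_sum N f = sumC f (box_list N).
Proof.
  unfold box_sum, box_list. rewrite sumC_map, sumC_list_prod.
  transitivity (sumC (fun i => sum_n (fun j => f ((Z.of_nat i - Z.of_nat N)%Z, (Z.of_nat j - Z.of_nat N)%Z)) (2 * N)) (seq 0 (S (2 * N)))).
  - apply (sum_n_sumC (fun i => sum_n (fun j => f ((Z.of_nat i - Z.of_nat N)%Z, (Z.of_nat j - Z.of_nat N)%Z)) (2 * N))).
  - apply sumC_ext. intros i _. apply (sum_n_sumC (fun j => f ((Z.of_nat i - Z.of_nat N)%Z, (Z.of_nat j - Z.of_nat N)%Z))).
Qed.

(** * Fourier-Lebesgue norms *)

Lemma FL_term_eq s p a n : FL_term s p a n = rpow (wt s n * Cmod (a n)) p.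
Proof. unfold FL_term, wt. rewrite (rpow_pos_eq (jbr n)); [reflexivity|]. pose proof (jbr_ge1 n). lra. Qed.

Lemma FL_partial_eq s p a N : FL_partial s p a N = sumL (fun n => rpow (wt s n * Cmod (a n)) p) (box_list N).
Proof. unfold FL_partial. rewrite box_sum_sumL. apply sumL_ext. intros; apply FL_term_eq. Qed.

Lemma FL_partial_incr s p a N : FL_partial s p a N <= FL_partial s p a (S N).
Proof.
  rewrite !FL_partial_eq. apply sumL_incl; [intros; apply rpow_nonneg|apply box_list_NoDup|].
  intros n Hn. apply box_list_In in Hn. apply box_list_In. unfold in_box in *.
  rewrite Bool.andb_true_iff, !Z.leb_le in *. lia.
Qed.

Lemma FLb_inFL s p a A : 1 < p -> FLb s p a A -> inFL s p a /\ FLnorm s p a <= A.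
Proof.
  intros Hp [HA HS].
  assert (HB : forall N, FL_partial s p a N <= rpow A p).
  { intros N. rewrite FL_partial_eq. apply HS, box_list_NoDup. }
  assert (HE : ex_finite_lim_seq (FL_partial s p a)).
  { apply ex_finite_lim_seq_incr with (rpow A p); [apply FL_partial_incr|assumption]. }
  split; [exact HE|].
  destruct HE as [l Hl]. unfold FLnorm. rewrite (is_lim_seq_unique _ _ Hl). simpl.
  assert (L1 : l <= rpow A p).
  { apply (is_lim_seq_le (FL_partial s p a) (fun _ => rpow A p) l (rpow A p)); [assumption|assumption|apply is_lim_seq_const]. }
  assert (L0 : 0 <= l).
  { apply (is_lim_seq_le (fun _ => 0) (FL_partial s p a) 0 l); [|apply is_lim_seq_const|assumption].
    intros N. rewrite FL_partial_eq. apply sumL_nonneg. intros; apply rpow_nonneg. }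
  rewrite <- (rpow_inv_r A p) by lra. apply rpow_le; [|lra]. left; apply Rinv_0_lt_compat; lra.
Qed.

(** Every finite set of frequencies lies in some box, so the limit over boxes bounds all finite
    sums. *)
Lemma inFL_FLb s p a : 1 < p -> inFL s p a -> FLb s p a (FLnorm s p a).
Proof.
  intros Hp [l Hl]. split; [apply rpow_nonneg|].
  unfold FLnorm. rewrite (is_lim_seq_unique _ _ Hl). simpl.
  assert (HB : forall N, FL_partial s p a N <= l).
  { intros N. apply (is_lim_seq_incr_compare _ _ Hl (FL_partial_incr s p a)). }
  assert (L0 : 0 <= l).
  { eapply Rle_trans; [|apply (HB 0%nat)]. rewrite FL_partial_eq. apply sumL_nonneg. intros; apply rpow_nonneg. }
  rewrite rpow_inv_l by lra.
  intros m Hm. destruct (box_list_exhaust m) as [N HN].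
  eapply Rle_trans; [|apply (HB N)]. rewrite FL_partial_eq.
  apply sumL_incl; [intros; apply rpow_nonneg|assumption|]. intros n Hn. apply HN; auto.
Qed.

Lemma FLb_pointwise s p a A n : 1 < p -> 0 < s -> FLb s p a A -> Cmod (a n) <= A.
Proof.
  intros Hp Hs [HA HS]. pose proof (SB_term _ _ n HS) as H. cbn beta in H.
  pose proof (wt_ge1 s n Hs). pose proof (Cmod_ge_0 (a n)).
  apply rpow_le_inv in H; [nra|lra|nra|assumption].
Qed.

(** * Mass and the full cubic nonlinearity *)

Definition mass (a : Z2 -> C) : R := tsum (fun n => Cmod (a n) * Cmod (a n)).

(** The trilinear bound with a point mass at the origin as first factor: for [n = n1 = 0] the other
    two frequencies coincide, which leaves an [l^2] pairing. *)
Lemma l2_product s p ce (f g : Z2 -> R) A B : 1 < p -> cubic_conclusion s p ce ->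
  (forall n, 0 <= f n) -> (forall n, 0 <= g n) -> 0 <= A -> 0 <= B ->
  SB (fun n => rpow (wt s n * f n) p) (rpow A p) -> SB (fun n => rpow (wt s n * g n) p) (rpow B p) ->
  SB (fun n => f n * g n) (ce * (A * B)).
Proof.
  intros Hp [_ HC] Hf Hg HA HB HfS HgS.
  set (o := (0, 0)%Z : Z2).
  assert (Ho : SB (fun n => rpow (wt s n * ind (n = o)) p) (rpow 1 p)).
  { apply (SB_point _ o).
    - intros n Hn. rewrite ind_false, Rmult_0_r, rpow_0 by assumption. lra.
    - intros; apply rpow_nonneg.
    - rewrite ind_true by reflexivity. apply rpow_le; [lra|]. rewrite Rmult_1_r. split; [left; apply wt_pos|].
      unfold wt, o, jbr. simpl. replace (1 + 0 * (0 * 1) + 0 * (0 * 1)) with 1 by ring. rewrite sqrt_1, rpow_one. lra. }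
  replace (ce * (A * B)) with (ce * (1 * A * B)) by ring.
  apply (SB_inj (fun n => (o, n)) _ (fun y => ind (fst y = o) * f (third o (fst y) (snd y)) * g (snd y))).
  - intros y. repeat apply Rmult_le_pos; auto. apply ind_bound.
  - intros n _. cbn [fst snd]. rewrite ind_true by reflexivity.
    assert (E : third o o n = n) by (destruct n; unfold third, o; cbn [fst snd]; f_equal; ring).
    rewrite E. lra.
  - congruence.
  - apply (HC (fun n => ind (n = o)) f g 1 A B o); auto; try lra. intros; apply ind_bound.
Qed.

Lemma mass_summable s p ce a A : 1 < p -> cubic_conclusion s p ce -> FLb s p a A ->
  SB (fun n => Cmod (a n) * Cmod (a n)) (ce * (A * A)).
Proof. intros Hp HC [HA HS]. apply (l2_product s p); auto; intros; apply Cmod_ge_0. Qed.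

Lemma tsum_diff {A} (f g h : A -> R) K K' B : SB f K -> SB g K' -> SB h B ->
  (forall a, f a - g a <= h a) -> tsum f - tsum g <= B.
Proof.
  intros Hf Hg Hh H. apply Rle_minus_l. apply tsum_le. rewrite Rplus_comm.
  eapply SB_le; [|apply SB_plus; [exact (tsum_SB _ _ Hg)|exact Hh]]. intros a. cbn beta. specialize (H a). lra.
Qed.

(** [|a|^2 - |b|^2] is at most [|a - b| (|a| + |b|)], a product to which [l2_product] applies. *)
Lemma mass_diff s p ce a b A B D : 1 < p -> cubic_conclusion s p ce -> FLb s p a A -> FLb s p b B ->
  FLb s p (fun n => (a n - b n)%C) D -> Rabs (mass a - mass b) <= ce * (D * (A + B)).
Proof.
  intros Hp HC Ha Hb HD.
  pose proof (mass_summable s p ce a A Hp HC Ha) as Sa. pose proof (mass_summable s p ce b B Hp HC Hb) as Sb.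
  assert (SH : SB (fun n => Cmod (a n - b n) * (Cmod (a n) + Cmod (b n))) (ce * (D * (A + B)))).
  { destruct HD as [HD0 HD], Ha as [HA0 Ha], Hb as [HB0 Hb].
    apply (l2_product s p ce (fun n => Cmod (a n - b n)) (fun n => Cmod (a n) + Cmod (b n))); auto; try lra.
    - intros; apply Cmod_ge_0.
    - intros n. pose proof (Cmod_ge_0 (a n)). pose proof (Cmod_ge_0 (b n)). lra.
    - eapply SB_le; [|apply (SB_minkowski (fun n => wt s n * Cmod (a n)) (fun n => wt s n * Cmod (b n)) A B p); auto].
      + intros n. rewrite Rmult_plus_distr_l. lra.
      + intros; apply Rmult_le_pos; [left; apply wt_pos|apply Cmod_ge_0].
      + intros; apply Rmult_le_pos; [left; apply wt_pos|apply Cmod_ge_0]. }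
  assert (P : forall n, Cmod (a n) <= Cmod (a n - b n) + Cmod (b n)).
  { intros n. replace (a n) with ((a n - b n) + b n)%C at 1 by ring. apply Cmod_triangle. }
  assert (Q : forall n, Cmod (b n) <= Cmod (a n - b n) + Cmod (a n)).
  { intros n. rewrite Cmod_sub_swap. replace (b n) with ((b n - a n) + a n)%C at 1 by ring. apply Cmod_triangle. }
  apply Rabs_le. unfold mass. split.
  - assert (tsum (fun n => Cmod (b n) * Cmod (b n)) - tsum (fun n => Cmod (a n) * Cmod (a n)) <= ce * (D * (A + B))); [|lra].
    eapply tsum_diff; eauto. intros n. cbn beta. specialize (Q n). pose proof (Cmod_ge_0 (a n)). pose proof (Cmod_ge_0 (b n)). nra.
  - eapply tsum_diff; eauto. intros n. cbn beta. specialize (P n). pose proof (Cmod_ge_0 (a n)). pose proof (Cmod_ge_0 (b n)). nra.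
Qed.

Lemma mass_ext a b : (forall n, Cmod (a n) = Cmod (b n)) -> mass a = mass b.
Proof. intros H. unfold mass. f_equal. apply functional_extensionality. intros n. rewrite H. reflexivity. Qed.

(** * The full cubic sum and its box truncations *)

Definition full_term (a : Z2 -> C) (n : Z2) (y : Z2 * Z2) : C :=
  (a (fst y) * Cconj (a (third n (fst y) (snd y))) * a (snd y))%C.

Definition FC (a : Z2 -> C) (n : Z2) : C := csum (full_term a n).

Lemma full_summable s p ce a A n : cubic_conclusion s p ce -> FLb s p a A ->
  SB (fun y => Cmod (full_term a n y)) (ce * (A * A * A)).
Proof.
  intros [_ HC] [HA HS].
  eapply SB_le; [|apply (HC (fun n => Cmod (a n)) (fun n => Cmod (a n)) (fun n => Cmod (a n)) A A A n); auto; intros; apply Cmod_ge_0].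
  intros y. unfold full_term. rewrite !Cmod_mult, Cmod_conj. lra.
Qed.

Lemma Cmult_conj_self z : (z * Cconj z)%C = RtoC (Cmod z * Cmod z).
Proof.
  destruct z as [x y]. unfold Cmod. rewrite sqrt_def.
  - unfold Cmult, Cconj, RtoC. simpl. f_equal; ring.
  - simpl. pose proof (Rle_0_sqr x). pose proof (Rle_0_sqr y). unfold Rsqr in *. lra.
Qed.

Lemma mass_csum s p ce a A : 1 < p -> cubic_conclusion s p ce -> FLb s p a A ->
  csum (fun n => (a n * Cconj (a n))%C) = RtoC (mass a).
Proof.
  intros Hp HC Ha. apply csum_eq. apply (HasSum_ext (fun n => RtoC (Cmod (a n) * Cmod (a n)))).
  - intros n. rewrite Cmult_conj_self. reflexivity.
  - eapply HasSum_tsum; [|apply (mass_summable s p ce a A); auto].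
    intros n. apply Rmult_le_pos; apply Cmod_ge_0.
Qed.

Lemma csum_point_family {A B} (emb : A -> B) (f : B -> C) (g : A -> C) K :
  (forall a a', emb a = emb a' -> a = a') -> SB (fun b => Cmod (f b)) K ->
  (forall b, f b <> RtoC 0 -> exists a, emb a = b) -> (forall a, f (emb a) = g a) -> csum f = csum g.
Proof.
  intros Hi HK Hs Hg. rewrite <- (csum_inj emb f K Hi Hs HK). apply csum_ext, Hg.
Qed.

(* [1 = sg + 1_{n1 = n} + 1_{n3 = n}]: each of the last two terms is the mass times the solution. *)
Lemma FC_decomposition s p ce a A n : 1 < p -> cubic_conclusion s p ce -> FLb s p a A ->
  FC a n = (GN 0 a n + RtoC (2 * mass a) * a n)%C.
Proof.
  intros Hp HC Ha.
  pose proof (full_summable s p ce a A n HC Ha) as HF. set (K := ce * (A * A * A)) in *.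
  set (f1 := fun y : Z2 * Z2 => (RtoC (ind (fst y = n)) * full_term a n y)%C).
  set (f3 := fun y : Z2 * Z2 => (RtoC (ind (snd y = n)) * full_term a n y)%C).
  assert (Hind : forall P z, Cmod (RtoC (ind P) * z) <= Cmod z).
  { intros P z. rewrite Cmod_mult, Cmod_R. pose proof (ind_bound P). rewrite Rabs_pos_eq by tauto.
    pose proof (Cmod_ge_0 z). nra. }
  assert (H1 : SB (fun y => Cmod (f1 y)) K) by (eapply SB_le; [intros y; apply Hind|exact HF]).
  assert (H3 : SB (fun y => Cmod (f3 y)) K) by (eapply SB_le; [intros y; apply Hind|exact HF]).
  assert (Hz : forall P (z : C), (RtoC (ind P) * z)%C <> RtoC 0 -> P).
  { intros P z H. apply NNPP. intros N. apply H. rewrite ind_false by assumption. ring. }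
  pose proof (mass_csum s p ce a A Hp HC Ha) as HM.
  pose proof (mass_summable s p ce a A Hp HC Ha) as HMS.
  assert (HMS' : SB (fun n => Cmod (a n * Cconj (a n))) (ce * (A * A))).
  { eapply SB_le; [|exact HMS]. intros m. rewrite Cmod_mult, Cmod_conj. lra. }
  assert (E1 : csum f1 = (a n * RtoC (mass a))%C).
  { rewrite (csum_point_family (fun m : Z2 => (n, m)) f1 (fun m => (a n * (a m * Cconj (a m)))%C) K); auto.
    - rewrite (csum_scal _ _ _ HMS'), HM. reflexivity.
    - congruence.
    - intros [x y] Hne. apply Hz in Hne. cbn in Hne. exists y. congruence.
    - intros m. unfold f1, full_term. cbn [fst snd]. rewrite ind_true by reflexivity.
      replace (third n n m) with m by (destruct n, m; unfold third; cbn [fst snd]; f_equal; ring). ring. }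
  assert (E3 : csum f3 = (a n * RtoC (mass a))%C).
  { rewrite (csum_point_family (fun m : Z2 => (m, n)) f3 (fun m => (a n * (a m * Cconj (a m)))%C) K); auto.
    - rewrite (csum_scal _ _ _ HMS'), HM. reflexivity.
    - congruence.
    - intros [x y] Hne. apply Hz in Hne. cbn in Hne. exists x. congruence.
    - intros m. unfold f3, full_term. cbn [fst snd]. rewrite ind_true by reflexivity.
      replace (third n m n) with m by (destruct n, m; unfold third; cbn [fst snd]; f_equal; ring). ring. }
  pose proof (gn_summable s p ce 0 a a a A A A n HC Ha Ha Ha) as HG.
  unfold FC, GN.
  rewrite (csum_ext (full_term a n) (fun y => (gn_term 0 a a a n y + (f1 y + f3 y))%C)).
  - rewrite (csum_plus _ _ _ (K + K) HG).
    + rewrite (csum_plus _ _ _ _ H1 H3), E1, E3. rewrite RtoC_mult. ring.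
    + eapply SB_le; [|apply SB_plus; [exact H1|exact H3]]. intros y. cbn beta. apply Cmod_triangle.
  - intros y. unfold gn_term, f1, f3, full_term. rewrite Rmult_0_l, cis_0.
    assert (E : RtoC (sg n (fst y) (snd y)) = (RtoC 1 - RtoC (ind (fst y = n)) - RtoC (ind (snd y = n)))%C).
    { rewrite <- !RtoC_minus. f_equal. unfold sg.
      destruct (ceq (fst y) n), (ceq (snd y) n).
      - rewrite !ind_true by assumption. ring.
      - rewrite ind_true, ind_false by assumption. ring.
      - rewrite ind_false, ind_true by assumption. ring.
      - rewrite !ind_false by assumption. ring. }
    rewrite E. ring.
Qed.

(** The truncation runs over [(n1, n2)]; with [third n1 n n2] in the role of [n3] it becomes a
    finite partial sum of [FC]. *)
Lemma cubic_trunc_eq a N n : cubic_trunc a N n =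
  sumC (full_term a n) (map (fun x : Z2 * Z2 => (fst x, third (fst x) n (snd x)))
    (filter (fun x : Z2 * Z2 => in_box N (third (fst x) n (snd x))) (list_prod (box_list N) (box_list N)))).
Proof.
  unfold cubic_trunc. rewrite sumC_map.
  set (g := fun x : Z2 * Z2 => if in_box N (third (fst x) n (snd x)) then
     (a (fst x) * Cconj (a (snd x)) * a (third (fst x) n (snd x)))%C else RtoC 0).
  transitivity (sumC g (list_prod (box_list N) (box_list N))).
  - rewrite sumC_list_prod.
    transitivity (sumC (fun n1 => box_sum N (fun n2 => g (n1, n2))) (box_list N)).
    + rewrite <- box_sum_sumC. f_equal. apply functional_extensionality. intros n1. f_equal.
      apply functional_extensionality. intros n2. unfold g. cbn [fst snd].
      replace ((fst n - fst n1 + fst n2)%Z, (snd n - snd n1 + snd n2)%Z) with (third n1 n n2); [reflexivity|].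
      unfold third. f_equal; ring.
    + apply sumC_ext. intros n1 _. apply box_sum_sumC.
  - rewrite <- (sumC_filter g (fun x => in_box N (third (fst x) n (snd x)))).
    2:{ intros x E. unfold g. rewrite E. reflexivity. }
    apply sumC_ext. intros x Hx. apply filter_In in Hx as [_ Hx]. unfold g, full_term. rewrite Hx. cbn [fst snd].
    replace (third n (fst x) (third (fst x) n (snd x))) with (snd x); [reflexivity|].
    destruct x as [[x1 y1] [x2 y2]], n. unfold third. cbn [fst snd]. f_equal; ring.
Qed.

(** Unconditional convergence: the lists of interactions kept by the truncation are duplicate-free
    and eventually contain any prescribed finite set. *)
Lemma cubic_trunc_limit s p ce a A n eps : cubic_conclusion s p ce -> FLb s p a A -> 0 < eps ->
  exists N0, forall N, (N0 <= N)%nat -> Cmod (cubic_trunc a N n - FC a n) <= eps.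
Proof.
  intros HC Ha He.
  destruct (csum_HasSum _ _ (full_summable s p ce a A n HC Ha) eps He) as [l0 H0].
  destruct (box_list_exhaust (map fst l0 ++ map snd l0 ++ map (fun y => third n (fst y) (snd y)) l0)) as [N0 HN0].
  exists N0. intros N HN. rewrite cubic_trunc_eq. apply H0.
  - apply NoDup_map_on.
    + apply NoDup_filter, NoDup_list_prod; apply box_list_NoDup.
    + intros [x y] [x' y'] _ _ E. cbn [fst snd] in E. injection E as E1 E2 E3. subst x'. f_equal.
      apply (third_inj3 x n y (third x n y')); [unfold third; f_equal; assumption|reflexivity].
  - intros [n1 n3] Hy. apply in_map_iff. exists (n1, third n n1 n3). cbn [fst snd].
    assert (E : third n1 n (third n n1 n3) = n3).
    { destruct n, n1, n3. unfold third. cbn [fst snd]. f_equal; ring. }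
    split; [rewrite E; reflexivity|]. apply filter_In. cbn [fst snd]. split.
    + apply in_prod; apply (HN0 N _ HN); rewrite !in_app_iff.
      * left. apply (in_map fst _ _ Hy).
      * right; right. apply (in_map (fun y => third n (fst y) (snd y)) _ _ Hy).
    + rewrite E. apply box_list_In. apply (HN0 N _ HN). rewrite !in_app_iff. right; left. apply (in_map snd _ _ Hy).
Qed.

Lemma cubic_coef_FC s p ce a A n : cubic_conclusion s p ce -> FLb s p a A -> cubic_coef a n (FC a n).
Proof.
  intros HC Ha P [eps HP].
  destruct (cubic_trunc_limit s p ce a A n (eps / 2) HC Ha) as [N0 HN0]; [destruct eps; simpl; lra|].
  exists N0. intros N HN. apply HP. specialize (HN0 N HN).
  assert (Hlt : Cmod (cubic_trunc a N n - FC a n) < eps) by (destruct eps as [e He]; simpl in *; lra).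
  pose proof (Rmax_Cmod (cubic_trunc a N n - FC a n)%C) as M.
  split; (eapply Rle_lt_trans; [|exact Hlt]); (eapply Rle_trans; [|exact M]);
    [eapply Rle_trans; [|apply Rmax_l]|eapply Rle_trans; [|apply Rmax_r]]; apply Rle_refl.
Qed.

Lemma cubic_coef_unique s p ce a A n z : cubic_conclusion s p ce -> FLb s p a A -> cubic_coef a n z -> z = FC a n.
Proof.
  intros HC Ha Hz. apply Ceq_eps. intros eps He.
  destruct (cubic_trunc_limit s p ce a A n (eps / 2) HC Ha) as [N0 HN0]; [lra|].
  assert (He4 : 0 < eps / 4) by lra.
  assert (HL : locally (z : C_UniformSpace) (ball (M := C_UniformSpace) z (mkposreal _ He4))) by (exists (mkposreal _ He4); intros; assumption).
  destruct (Hz _ HL) as [N1 HN1].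
  set (N := Nat.max N0 N1). specialize (HN0 N (Nat.le_max_l _ _)). specialize (HN1 N (Nat.le_max_r _ _)).
  destruct HN1 as [B1 B2].
  eapply Rle_trans; [apply (Cmod_sub_tri _ (cubic_trunc a N n))|].
  assert (Cmod (z - cubic_trunc a N n) <= eps / 2); [|lra].
  rewrite Cmod_sub_swap. eapply Rle_trans; [apply Cmod_le_sum|].
  change (Rabs (fst (cubic_trunc a N n) - fst z) < eps / 4) in B1.
  change (Rabs (snd (cubic_trunc a N n) - snd z) < eps / 4) in B2.
  change (fst (cubic_trunc a N n - z)%C) with (fst (cubic_trunc a N n) - fst z).
  change (snd (cubic_trunc a N n - z)%C) with (snd (cubic_trunc a N n) - snd z). lra.
Qed.

(** * Calculus on a closed interval *)

Definition wcont (a c : R) (g : R -> C) : Prop :=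
  forall t, a <= t <= c -> forall eps, 0 < eps -> exists delta, 0 < delta /\
    forall t', a <= t' <= c -> Rabs (t' - t) < delta -> Cmod (g t' - g t) <= eps.

Lemma wder_lipschitz_at a c f g t : wder a c f g -> a <= t <= c -> exists delta, 0 < delta /\
  forall t', a <= t' <= c -> Rabs (t' - t) < delta -> Cmod (f t' - f t) <= (Cmod (g t) + 1) * Rabs (t' - t).
Proof.
  intros H Ht. destruct (H t Ht 1 ltac:(lra)) as (d & Hd & Hl). exists d. split; [assumption|].
  intros t' Ht' Htd. specialize (Hl t' Ht' Htd).
  replace (f t' - f t)%C with ((f t' - f t - RtoC (t' - t) * g t) + RtoC (t' - t) * g t)%C by ring.
  eapply Rle_trans; [apply Cmod_triangle|]. rewrite Cmod_mult, Cmod_R. lra.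
Qed.

Lemma wder_wcont a c f g : wder a c f g -> wcont a c f.
Proof.
  intros H t Ht eps He. destruct (wder_lipschitz_at a c f g t H Ht) as (d & Hd & Hl).
  pose proof (Cmod_ge_0 (g t)) as Hg.
  exists (Rmin d (eps / (Cmod (g t) + 1))). split; [apply Rmin_glb_lt; [assumption|apply Rdiv_lt_0_compat; lra]|].
  intros t' Ht' Htd. specialize (Hl t' Ht' (Rlt_le_trans _ _ _ Htd (Rmin_l _ _))).
  pose proof (Rlt_le_trans _ _ _ Htd (Rmin_r _ _)) as H2.
  eapply Rle_trans; [exact Hl|]. apply Rle_trans with ((Cmod (g t) + 1) * (eps / (Cmod (g t) + 1))).
  - apply Rmult_le_compat_l; lra.
  - right. field. lra.
Qed.

Lemma wcont_add a c f g : wcont a c f -> wcont a c g -> wcont a c (fun t => (f t + g t)%C).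
Proof.
  intros Hf Hg t Ht eps He.
  destruct (Hf t Ht (eps / 2) ltac:(lra)) as (d & Hd & Hl). destruct (Hg t Ht (eps / 2) ltac:(lra)) as (d' & Hd' & Hl').
  exists (Rmin d d'). split; [apply Rmin_glb_lt; assumption|]. intros t' Ht' Htd.
  specialize (Hl t' Ht' (Rlt_le_trans _ _ _ Htd (Rmin_l _ _))).
  specialize (Hl' t' Ht' (Rlt_le_trans _ _ _ Htd (Rmin_r _ _))).
  replace (f t' + g t' - (f t + g t))%C with ((f t' - f t) + (g t' - g t))%C by ring.
  eapply Rle_trans; [apply Cmod_triangle|]. lra.
Qed.

Lemma wcont_mul a c f g : wcont a c f -> wcont a c g -> wcont a c (fun t => (f t * g t)%C).
Proof.
  intros Hf Hg t Ht eps He.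
  set (M := Cmod (f t) + Cmod (g t) + 1).
  pose proof (Cmod_ge_0 (f t)) as Hf0. pose proof (Cmod_ge_0 (g t)) as Hg0.
  set (e := Rmin 1 (eps / (2 * M))).
  assert (He1 : 0 < e) by (apply Rmin_glb_lt; [lra|apply Rdiv_lt_0_compat; unfold M; lra]).
  destruct (Hf t Ht e He1) as (d & Hd & Hl). destruct (Hg t Ht e He1) as (d' & Hd' & Hl').
  exists (Rmin d d'). split; [apply Rmin_glb_lt; assumption|]. intros t' Ht' Htd.
  specialize (Hl t' Ht' (Rlt_le_trans _ _ _ Htd (Rmin_l _ _))).
  specialize (Hl' t' Ht' (Rlt_le_trans _ _ _ Htd (Rmin_r _ _))).
  replace (f t' * g t' - f t * g t)%C with ((f t' - f t) * (g t' - g t) + f t * (g t' - g t) + (f t' - f t) * g t)%C by ring.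
  eapply Rle_trans; [apply Cmod_triangle|]. eapply Rle_trans; [apply Rplus_le_compat_r, Cmod_triangle|].
  rewrite !Cmod_mult.
  assert (E1 : e <= 1) by apply Rmin_l. assert (E2 : e <= eps / (2 * M)) by apply Rmin_r.
  assert (E3 : e * (2 * M) <= eps).
  { apply Rle_trans with (eps / (2 * M) * (2 * M)); [|right; field; unfold M; lra].
    apply Rmult_le_compat_r; [unfold M; lra|assumption]. }
  pose proof (Cmod_ge_0 (f t' - f t)). pose proof (Cmod_ge_0 (g t' - g t)). unfold M in *. nra.
Qed.

Lemma wder_mul a c f f' g g' : wder a c f f' -> wder a c g g' ->
  wder a c (fun t => (f t * g t)%C) (fun t => (f' t * g t + f t * g' t)%C).
Proof.
  intros Hf Hg t Ht eps He.
  pose proof (Cmod_ge_0 (f t)) as Hf0. pose proof (Cmod_ge_0 (g t)) as Hg0. pose proof (Cmod_ge_0 (g' t)) as Hg1.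
  set (M := Cmod (f t) + Cmod (g t) + Cmod (g' t) + 2).
  set (e := Rmin 1 (eps / M)).
  assert (HM : 0 < M) by (unfold M; lra).
  assert (He1 : 0 < e) by (apply Rmin_glb_lt; [lra|apply Rdiv_lt_0_compat; lra]).
  destruct (Hf t Ht e He1) as (d & Hd & Hl). destruct (Hg t Ht e He1) as (d' & Hd' & Hl').
  destruct (wder_wcont _ _ _ _ Hf t Ht e He1) as (d2 & Hd2 & Hl2).
  exists (Rmin (Rmin d d') d2). split; [repeat apply Rmin_glb_lt; assumption|]. intros t' Ht' Htd.
  pose proof (Rlt_le_trans _ _ _ Htd (Rmin_l _ _)) as Htd1.
  specialize (Hl t' Ht' (Rlt_le_trans _ _ _ Htd1 (Rmin_l _ _))).
  specialize (Hl' t' Ht' (Rlt_le_trans _ _ _ Htd1 (Rmin_r _ _))).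
  specialize (Hl2 t' Ht' (Rlt_le_trans _ _ _ Htd (Rmin_r _ _))).
  replace (f t' * g t' - f t * g t - RtoC (t' - t) * (f' t * g t + f t * g' t))%C
    with (((f t' - f t) + f t) * (g t' - g t - RtoC (t' - t) * g' t) + (f t' - f t - RtoC (t' - t) * f' t) * g t
          + RtoC (t' - t) * ((f t' - f t) * g' t))%C by ring.
  eapply Rle_trans; [apply Cmod_triangle|]. eapply Rle_trans; [apply Rplus_le_compat_r, Cmod_triangle|].
  rewrite !Cmod_mult, Cmod_R.
  pose proof (Cmod_triangle (f t' - f t) (f t)) as H3.
  assert (E1 : e <= 1) by apply Rmin_l. assert (E2 : e <= eps / M) by apply Rmin_r.
  assert (E3 : e * M <= eps).
  { apply Rle_trans with (eps / M * M); [|right; field; lra].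
    apply Rmult_le_compat_r; lra. }
  set (h := Rabs (t' - t)) in *. assert (Hh : 0 <= h) by apply Rabs_pos.
  apply Rle_trans with ((1 + Cmod (f t)) * (e * h) + (e * h) * Cmod (g t) + h * (e * Cmod (g' t))).
  - apply Rplus_le_compat; [apply Rplus_le_compat|].
    + apply Rmult_le_compat; [apply Cmod_ge_0|apply Cmod_ge_0|lra|assumption].
    + apply Rmult_le_compat_r; assumption.
    + apply Rmult_le_compat_l; [assumption|]. apply Rmult_le_compat_r; assumption.
  - apply Rle_trans with (e * M * h); [|apply Rmult_le_compat_r; assumption]. unfold M. nra.
Qed.

Lemma wder_ext a c f f1 g g1 : (forall t, a <= t <= c -> f t = f1 t) -> (forall t, a <= t <= c -> g t = g1 t) ->
  wder a c f g -> wder a c f1 g1.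
Proof.
  intros Hf Hg H t Ht eps He. destruct (H t Ht eps He) as (d & Hd & Hl). exists d. split; [assumption|].
  intros t' Ht' Htd. rewrite <- !Hf, <- Hg by assumption. apply Hl; assumption.
Qed.

Lemma wcont_ext a c f f1 : (forall t, a <= t <= c -> f t = f1 t) -> wcont a c f -> wcont a c f1.
Proof.
  intros Hf H t Ht eps He. destruct (H t Ht eps He) as (d & Hd & Hl). exists d. split; [assumption|].
  intros t' Ht' Htd. rewrite <- !Hf by assumption. apply Hl; assumption.
Qed.

Lemma wder_cis a c k (th m : R -> R) : wder a c (fun t => RtoC (th t)) (fun t => RtoC (m t)) ->
  wder a c (fun t => cis (k * th t)) (fun t => (Ci * RtoC (k * m t) * cis (k * th t))%C).
Proof.
  intros H t Ht eps He.
  set (e := eps / (2 * (Rabs k + 1))). pose proof (Rabs_pos k) as Hk. pose proof (Rabs_pos (m t)) as Hm.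
  assert (He1 : 0 < e) by (apply Rdiv_lt_0_compat; lra).
  assert (Ee : Rabs k * e <= eps / 2).
  { apply Rle_trans with ((Rabs k + 1) * e); [nra|]. right. unfold e. field. lra. }
  destruct (H t Ht e He1) as (d & Hd & Hl). destruct (wder_lipschitz_at _ _ _ _ t H Ht) as (d' & Hd' & Hl').
  set (P := Rabs k * (Rabs (m t) + 1)). assert (HP : 0 <= P) by (apply Rmult_le_pos; lra).
  set (d2 := eps / (4 * (P * P + 1))).
  assert (Hd2 : 0 < d2) by (apply Rdiv_lt_0_compat; nra).
  exists (Rmin (Rmin d d') d2). split; [repeat apply Rmin_glb_lt; assumption|]. intros t' Ht' Htd.
  pose proof (Rlt_le_trans _ _ _ Htd (Rmin_l _ _)) as Htd1.
  specialize (Hl t' Ht' (Rlt_le_trans _ _ _ Htd1 (Rmin_l _ _))).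
  specialize (Hl' t' Ht' (Rlt_le_trans _ _ _ Htd1 (Rmin_r _ _))).
  pose proof (Rlt_le_trans _ _ _ Htd (Rmin_r _ _)) as Htd2.
  set (h := Rabs (t' - t)) in *. assert (Hh : 0 <= h) by apply Rabs_pos.
  rewrite <- !RtoC_minus, Cmod_R in Hl'. rewrite <- RtoC_mult, <- !RtoC_minus, Cmod_R in Hl. rewrite Cmod_R in Hl'.
  set (D := th t' - th t) in *.
  assert (HkD : Rabs (k * D) <= P * h).
  { rewrite Rabs_mult. unfold P. rewrite Rmult_assoc. apply Rmult_le_compat_l; assumption. }
  replace (k * th t') with (k * D + k * th t) by (unfold D; ring). rewrite cis_plus.
  replace (cis (k * D) * cis (k * th t) - cis (k * th t) - RtoC (t' - t) * (Ci * RtoC (k * m t) * cis (k * th t)))%C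
    with (((cis (k * D) - 1 - Ci * RtoC (k * D)) + Ci * RtoC (k * (D - (t' - t) * m t))) * cis (k * th t))%C.
  2:{ rewrite !RtoC_mult, !RtoC_minus, !RtoC_mult, !RtoC_minus. ring. }
  rewrite Cmod_mult, cis_mod, Rmult_1_r. eapply Rle_trans; [apply Cmod_triangle|].
  rewrite Cmod_mult, Cmod_R, Rabs_mult.
  assert (ECi : Cmod Ci = 1). { unfold Cmod, Ci. simpl. transitivity (sqrt 1); [f_equal; ring|apply sqrt_1]. }
  rewrite ECi, Rmult_1_l.
  pose proof (cis_taylor (k * D)) as HT.
  assert (E1 : 2 * (k * D * (k * D)) <= eps / 2 * h).
  { assert (k * D * (k * D) = Rabs (k * D) * Rabs (k * D)) as ->.
    { rewrite <- Rabs_mult. symmetry. apply Rabs_pos_eq. nra. }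
    assert (E : Rabs (k * D) * Rabs (k * D) <= P * h * (P * h)) by (apply Rmult_le_compat; auto; apply Rabs_pos).
    assert (E2 : P * P * h <= eps / 4).
    { apply Rle_trans with ((P * P + 1) * d2); [nra|]. right. unfold d2. field. nra. }
    apply Rle_trans with (2 * (P * P * h) * h); [lra|]. apply Rmult_le_compat_r; lra. }
  assert (E2 : Rabs k * Rabs (D - (t' - t) * m t) <= eps / 2 * h).
  { apply Rle_trans with (Rabs k * (e * h)); [apply Rmult_le_compat_l; assumption|].
    rewrite <- Rmult_assoc. apply Rmult_le_compat_r; assumption. }
  lra.
Qed.

Lemma wder_linear a c : wder a c (fun t => RtoC t) (fun _ => RtoC 1).
Proof.
  intros t Ht eps He. exists 1. split; [lra|]. intros t' _ _.
  replace (t' - t - RtoC (t' - t) * 1)%C with (RtoC 0) by (rewrite RtoC_minus; ring).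
  rewrite Cmod_0. apply Rmult_le_pos; [lra|apply Rabs_pos].
Qed.

Lemma wder_affine a c z k f g : wder a c f g -> wder a c (fun t => (z + k * f t)%C) (fun t => (k * g t)%C).
Proof.
  intros H t Ht eps He. pose proof (Cmod_ge_0 k) as Hk.
  assert (He1 : 0 < eps / (Cmod k + 1)) by (apply Rdiv_lt_0_compat; lra).
  destruct (H t Ht _ He1) as (d & Hd & Hl). exists d. split; [assumption|]. intros t' Ht' Htd.
  specialize (Hl t' Ht' Htd).
  replace (z + k * f t' - (z + k * f t) - RtoC (t' - t) * (k * g t))%C
    with (k * (f t' - f t - RtoC (t' - t) * g t))%C by ring.
  rewrite Cmod_mult. set (h := Rabs (t' - t)) in *. assert (Hh : 0 <= h) by apply Rabs_pos.
  apply Rle_trans with ((Cmod k + 1) * (eps / (Cmod k + 1) * h)).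
  - apply Rmult_le_compat; [lra|apply Cmod_ge_0|lra|assumption].
  - right. field. lra.
Qed.

(** The integrand is continuous only relative to [[0, T]]. Composition with the clamp [cl] extends
    it continuously to the line, where the fundamental theorem of calculus applies. *)
Lemma wint_real T (g : R -> R) : 0 <= T -> wcont 0 T (fun t => RtoC (g t)) ->
  exists J : R -> R, J 0 = 0 /\ wder 0 T (fun t => RtoC (J t)) (fun t => RtoC (g t)) /\
    forall t, 0 <= t <= T -> is_RInt g 0 t (J t).
Proof.
  intros HT Hg.
  set (cl := fun t => Rmax 0 (Rmin t T)).
  assert (Hcl : forall t, 0 <= cl t <= T).
  { intros t. unfold cl. split; [apply Rmax_l|]. apply Rmax_lub; [assumption|apply Rmin_r]. }
  assert (Hid : forall t, 0 <= t <= T -> cl t = t).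
  { intros t Ht. unfold cl. rewrite Rmin_left, Rmax_right; lra. }
  assert (Hlip : forall t t', Rabs (cl t' - cl t) <= Rabs (t' - t)).
  { intros t t'. unfold cl, Rmin. destruct (Rle_dec t T), (Rle_dec t' T);
      (unfold Rmax; repeat destruct (Rle_dec 0 _));
      (unfold Rabs; repeat destruct (Rcase_abs _)); lra. }
  set (f := fun t => g (cl t)).
  assert (Hcont : forall t, continuous f t).
  { intros t. apply continuity_pt_filterlim. intros eps He.
    destruct (Hg (cl t) (Hcl t) (eps / 2) ltac:(lra)) as (d & Hd & Hl). exists d. split; [assumption|].
    intros t' [_ Ht']. unfold dist in *. simpl in *. unfold Rdist in *.
    specialize (Hl (cl t') (Hcl t') (Rle_lt_trans _ _ _ (Hlip t t') Ht')).
    rewrite <- RtoC_minus, Cmod_R in Hl. unfold f. lra. }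
  assert (HI : forall t, is_RInt f 0 t (RInt f 0 t)).
  { intros t. apply (RInt_correct (V := R_CompleteNormedModule)), (ex_RInt_continuous (V := R_CompleteNormedModule)).
    intros z _. apply Hcont. }
  exists (fun t => RInt f 0 t). split; [|split].
  - apply (RInt_point (V := R_CompleteNormedModule)).
  - intros t Ht eps He.
    assert (HD : is_derive (fun t => RInt f 0 t) t (f t)).
    { apply (is_derive_RInt f (fun t => RInt f 0 t) 0 t); [|apply Hcont]. apply filter_forall. exact HI. }
    apply is_derive_Reals in HD. destruct (HD eps He) as [d Hd].
    exists d. split; [apply cond_pos|]. intros t' Ht' Htd.
    rewrite <- RtoC_mult, <- !RtoC_minus, Cmod_R.
    destruct (Req_dec t' t) as [->|Hne].
    { replace (RInt f 0 t - RInt f 0 t - (t - t) * g t) with 0 by ring.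
      replace (t - t) with 0 by ring. rewrite Rabs_R0. lra. }
    specialize (Hd (t' - t) ltac:(lra) Htd). replace (t + (t' - t)) with t' in Hd by ring.
    assert (E : RInt f 0 t' - RInt f 0 t - (t' - t) * g t = ((RInt f 0 t' - RInt f 0 t) / (t' - t) - f t) * (t' - t)).
    { assert (Ef : f t = g t) by (unfold f; rewrite Hid by assumption; reflexivity). rewrite Ef. field. lra. }
    rewrite E, Rabs_mult. apply Rmult_le_compat_r; [apply Rabs_pos|left; exact Hd].
  - intros t Ht. apply (is_RInt_ext f g); [|apply HI].
    intros x Hx. rewrite Rmin_left, Rmax_right in Hx by lra. unfold f. rewrite Hid by lra. reflexivity.
Qed.

Lemma wcont_re a c g : wcont a c g -> wcont a c (fun t => RtoC (fst (g t))).
Proof.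
  intros H t Ht eps He. destruct (H t Ht eps He) as (d & Hd & Hl). exists d. split; [assumption|].
  intros t' Ht' Htd. rewrite <- RtoC_minus, Cmod_R. eapply Rle_trans; [|apply (Hl t' Ht' Htd)].
  eapply Rle_trans; [|apply Rmax_Cmod]. apply Rmax_l.
Qed.

Lemma wcont_im a c g : wcont a c g -> wcont a c (fun t => RtoC (snd (g t))).
Proof.
  intros H t Ht eps He. destruct (H t Ht eps He) as (d & Hd & Hl). exists d. split; [assumption|].
  intros t' Ht' Htd. rewrite <- RtoC_minus, Cmod_R. eapply Rle_trans; [|apply (Hl t' Ht' Htd)].
  eapply Rle_trans; [|apply Rmax_Cmod]. apply Rmax_r.
Qed.

Lemma wint T (g : R -> C) : 0 <= T -> wcont 0 T g ->
  exists J : R -> C, J 0 = RtoC 0 /\ wder 0 T J g /\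
    forall t, 0 <= t <= T -> is_RInt (V := prod_NormedModule R_AbsRing R_NormedModule R_NormedModule) g 0 t (J t).
Proof.
  intros HT Hg.
  destruct (wint_real T (fun t => fst (g t)) HT (wcont_re _ _ _ Hg)) as (J1 & A1 & B1 & C1).
  destruct (wint_real T (fun t => snd (g t)) HT (wcont_im _ _ _ Hg)) as (J2 & A2 & B2 & C2).
  exists (fun t => (J1 t, J2 t)). split; [|split].
  - rewrite A1, A2. reflexivity.
  - intros t Ht eps He.
    destruct (B1 t Ht (eps / 2) ltac:(lra)) as (d & Hd & Hl). destruct (B2 t Ht (eps / 2) ltac:(lra)) as (d' & Hd' & Hl').
    exists (Rmin d d'). split; [apply Rmin_glb_lt; assumption|]. intros t' Ht' Htd.
    specialize (Hl t' Ht' (Rlt_le_trans _ _ _ Htd (Rmin_l _ _))).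
    specialize (Hl' t' Ht' (Rlt_le_trans _ _ _ Htd (Rmin_r _ _))).
    rewrite <- RtoC_mult, <- !RtoC_minus, Cmod_R in Hl, Hl'.
    eapply Rle_trans; [apply Cmod_le_sum|]. simpl.
    replace (J1 t' + - J1 t + - ((t' - t) * fst (g t) - 0 * snd (g t))) with (J1 t' - J1 t - (t' - t) * fst (g t)) by ring.
    replace (J2 t' + - J2 t + - ((t' - t) * snd (g t) + 0 * fst (g t))) with (J2 t' - J2 t - (t' - t) * snd (g t)) by ring.
    lra.
  - intros t Ht.
    apply (is_RInt_fct_extend_pair (U := R_NormedModule) (V := R_NormedModule) g 0 t (J1 t) (J2 t)); auto.
Qed.

Lemma is_RInt_C_unique (f g : R -> C) t (I J : C) : 0 <= t -> (forall x, 0 <= x <= t -> f x = g x) ->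
  is_RInt (V := prod_NormedModule R_AbsRing R_NormedModule R_NormedModule) f 0 t I ->
  is_RInt (V := prod_NormedModule R_AbsRing R_NormedModule R_NormedModule) g 0 t J -> I = J.
Proof.
  intros Ht E HI HJ.
  assert (HI' : is_RInt (V := prod_NormedModule R_AbsRing R_NormedModule R_NormedModule) g 0 t I).
  { apply (is_RInt_ext f g); [|assumption]. intros x Hx. rewrite Rmin_left, Rmax_right in Hx by lra. apply E. lra. }
  pose proof (is_RInt_fct_extend_fst _ _ _ _ HI') as I1. pose proof (is_RInt_fct_extend_snd _ _ _ _ HI') as I2.
  pose proof (is_RInt_fct_extend_fst _ _ _ _ HJ) as J1. pose proof (is_RInt_fct_extend_snd _ _ _ _ HJ) as J2.
  apply (is_RInt_unique (V := R_CompleteNormedModule)) in I1, I2, J1, J2.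
  apply injective_projections.
  - exact (eq_trans (eq_sym I1) J1).
  - exact (eq_trans (eq_sym I2) J2).
Qed.

Lemma is_RInt_C_scal (f : R -> C) a b (z I : C) :
  is_RInt (V := prod_NormedModule R_AbsRing R_NormedModule R_NormedModule) f a b I ->
  is_RInt (V := prod_NormedModule R_AbsRing R_NormedModule R_NormedModule) (fun t => (z * f t)%C) a b (z * I)%C.
Proof.
  intros H. pose proof (is_RInt_fct_extend_fst _ _ _ _ H) as H1. pose proof (is_RInt_fct_extend_snd _ _ _ _ H) as H2.
  destruct z as [x y], I as [I1 I2].
  apply (is_RInt_fct_extend_pair (U := R_NormedModule) (V := R_NormedModule) _ a b (x * I1 - y * I2) (x * I2 + y * I1)).
  - exact (is_RInt_minus _ _ _ _ _ _ (is_RInt_scal _ _ _ x _ H1) (is_RInt_scal _ _ _ y _ H2)).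
  - exact (is_RInt_plus _ _ _ _ _ _ (is_RInt_scal _ _ _ x _ H2) (is_RInt_scal _ _ _ y _ H1)).
Qed.

(** * The gauge transform *)

Lemma FLb_mult s p (om a : Z2 -> C) k A : 1 < p -> 0 <= k -> (forall n, Cmod (om n) <= k \/ a n = RtoC 0) -> FLb s p a A ->
  FLb s p (fun n => (om n * a n)%C) (k * A).
Proof.
  intros Hp Hk H [HA HS]. split; [apply Rmult_le_pos; assumption|].
  rewrite rpow_mult by assumption.
  eapply SB_le; [|apply SB_scal; [apply rpow_nonneg|exact HS]]. intros n. cbn beta.
  pose proof (wt_pos s n) as Hw. pose proof (Cmod_ge_0 (a n)) as Ha.
  rewrite <- rpow_mult; [|assumption|apply Rmult_le_pos; lra].
  apply rpow_le; [lra|]. rewrite Cmod_mult. pose proof (Cmod_ge_0 (om n)).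
  split; [apply Rmult_le_pos; [lra|apply Rmult_le_pos; assumption]|].
  destruct (H n) as [H'|H'].
  - replace (wt s n * (Cmod (om n) * Cmod (a n))) with (Cmod (om n) * (wt s n * Cmod (a n))) by ring.
    apply Rmult_le_compat_r; [apply Rmult_le_pos; lra|assumption].
  - rewrite H', Cmod_0. lra.
Qed.

(** For finite [p] all but finitely many frequencies of a fixed [a] have small total norm, so a
    bounded multiplier has to be small only on a finite list. *)
Lemma FLb_small_multiplier s p a A eps : 1 < p -> FLb s p a A -> 0 < eps ->
  exists (l0 : list Z2) eta, 0 < eta /\ forall om, (forall n, Cmod (om n) <= 2) -> (forall n, In n l0 -> Cmod (om n) <= eta) ->
    FLb s p (fun n => (om n * a n)%C) eps.
Proof.
  intros Hp Ha He. pose proof Ha as [HA HS].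
  destruct (SB_tail _ _ (rpow (eps / 4) p) (fun n => rpow_nonneg _ p) HS) as (l0 & _ & HT).
  { apply rpow_gt0. lra. }
  exists l0, (eps / (2 * (A + 1))). split; [apply Rdiv_lt_0_compat; lra|]. intros om H2 Hl.
  assert (HH : FLb s p (fun n => (om n * (if in_dec ceq n l0 then a n else RtoC 0))%C) (eps / (2 * (A + 1)) * A)).
  { apply FLb_mult; [assumption|left; apply Rdiv_lt_0_compat; lra| |].
    - intros n. destruct (in_dec ceq n l0); [left; auto|right; reflexivity].
    - eapply FLb_le; [assumption| |exact Ha]. intros n. destruct (in_dec ceq n l0); [lra|]. rewrite Cmod_0. apply Cmod_ge_0. }
  assert (HTl : FLb s p (fun n => (om n * (if in_dec ceq n l0 then RtoC 0 else a n))%C) (2 * (eps / 4))).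
  { apply FLb_mult; [assumption|lra|intros n; left; apply H2|]. split; [lra|]. eapply SB_le; [|exact HT].
    intros n. cbn beta. destruct (in_dec ceq n l0); [|lra]. rewrite Cmod_0, Rmult_0_r, rpow_0; lra. }
  eapply FLb_weaken; [assumption| |].
  - eapply FLb_le; [assumption| |exact (FLb_add _ _ _ _ _ _ Hp HH HTl)].
    intros n. right. cbn beta. f_equal. destruct (in_dec ceq n l0); ring.
  - assert (eps / (2 * (A + 1)) * A <= eps / 2); [|lra].
    apply Rle_trans with (eps / (2 * (A + 1)) * (A + 1)); [|right; field; lra].
    apply Rmult_le_compat_l; [left; apply Rdiv_lt_0_compat; lra|lra].
Qed.

Lemma wcont_finite {A} a c (f : A -> R -> C) (l : list A) t eps : (forall x, wcont a c (f x)) -> a <= t <= c -> 0 < eps ->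
  exists delta, 0 < delta /\ forall t', a <= t' <= c -> Rabs (t' - t) < delta -> forall x, In x l -> Cmod (f x t' - f x t) <= eps.
Proof.
  intros H Ht He. induction l as [|x l (d & Hd & IH)].
  - exists 1. split; [lra|]. intros t' _ _ x [].
  - destruct (H x t Ht eps He) as (d' & Hd' & Hl). exists (Rmin d d'). split; [apply Rmin_glb_lt; assumption|].
    intros t' Ht' Htd y [<-|Hy].
    + apply Hl; [assumption|]. eapply Rlt_le_trans; [exact Htd|apply Rmin_r].
    + apply IH; [assumption| |assumption]. eapply Rlt_le_trans; [exact Htd|apply Rmin_l].
Qed.

(** Phases such as [e^(i t q(n))] are not continuous in [t] uniformly in [n]. The product is
    continuous because the part with [u t' - u t] is small for any unimodular factor, while the rest
    multiplies the fixed [u t], where [FLb_small_multiplier] applies. *)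
Lemma FLcont_mult s p a c (om : R -> Z2 -> C) u : 1 < p -> FLcont s p a c u -> (forall n, wcont a c (fun t => om t n)) ->
  (forall t n, Cmod (om t n) = 1) -> FLcont s p a c (fun t n => (om t n * u t n)%C).
Proof.
  intros Hp [H1 H2] Hc Hm. split.
  - intros t Ht. destruct (H1 t Ht) as [A HA]. exists A. eapply FLb_le; [assumption| |exact HA].
    intros n. rewrite Cmod_mult, Hm. lra.
  - intros t Ht eps He. destruct (H1 t Ht) as [A HA].
    destruct (H2 t Ht (eps / 2) ltac:(lra)) as (d & Hd & Hl).
    destruct (FLb_small_multiplier s p (u t) A (eps / 2) Hp HA ltac:(lra)) as (l0 & eta & Heta & Hsm).
    destruct (wcont_finite a c (fun n t => om t n) l0 t eta Hc Ht Heta) as (d' & Hd' & Hl').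
    exists (Rmin d d'). split; [apply Rmin_glb_lt; assumption|]. intros t' Ht' Htd.
    specialize (Hl t' Ht' (Rlt_le_trans _ _ _ Htd (Rmin_l _ _))).
    specialize (Hl' t' Ht' (Rlt_le_trans _ _ _ Htd (Rmin_r _ _))).
    replace eps with (eps / 2 + eps / 2) by field.
    eapply FLb_le; [assumption| |apply FLb_add; [assumption| |apply (Hsm (fun n => (om t' n - om t n)%C))]].
    + intros n. right. f_equal. instantiate (1 := fun n => (om t' n * (u t' n - u t n))%C). cbn beta. ring.
    + eapply FLb_le; [assumption| |exact Hl]. intros n. rewrite Cmod_mult, Hm. lra.
    + intros n. unfold Cminus. eapply Rle_trans; [apply Cmod_triangle|]. rewrite Cmod_opp, !Hm. lra.
    + intros n Hn. apply Hl', Hn.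
Qed.

Lemma FLcont_functional s p a c u (Phi : (Z2 -> C) -> C) : 1 < p -> a <= c ->
  (forall R0, exists K, 0 <= K /\ forall f g B, FLb s p f R0 -> FLb s p g R0 -> FLb s p (fun n => (f n - g n)%C) B ->
     Cmod (Phi f - Phi g) <= K * B) ->
  FLcont s p a c u -> wcont a c (fun t => Phi (u t)).
Proof.
  intros Hp Hac HPhi Hu. destruct (FLcont_bounded s p a c u Hp Hac Hu) as (R0 & _ & HB).
  destruct (HPhi R0) as (K & HK & HL). intros t Ht eps He.
  destruct (proj2 Hu t Ht (eps / (K + 1))) as (d & Hd & Hl); [apply Rdiv_lt_0_compat; lra|].
  exists d. split; [assumption|]. intros t' Ht' Htd.
  eapply Rle_trans; [apply (HL _ _ (eps / (K + 1))); auto|].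
  apply Rle_trans with ((K + 1) * (eps / (K + 1))); [|right; field; lra].
  apply Rmult_le_compat_r; [left; apply Rdiv_lt_0_compat; lra|lra].
Qed.

Lemma coef_wcont s p a c u n : 1 < p -> 0 < s -> a <= c -> FLcont s p a c u -> wcont a c (fun t => u t n).
Proof.
  intros Hp Hs Hac. apply (FLcont_functional s p a c u (fun f => f n) Hp Hac). intros R0. exists 1. split; [lra|].
  intros f g B _ _ HB. rewrite Rmult_1_l. apply (FLb_pointwise s p (fun n => (f n - g n)%C)); assumption.
Qed.

Lemma mass_wcont s p ce a c u : 1 < p -> cubic_conclusion s p ce -> a <= c -> FLcont s p a c u ->
  wcont a c (fun t => RtoC (mass (u t))).
Proof.
  intros Hp HC Hac. apply (FLcont_functional s p a c u (fun f => RtoC (mass f)) Hp Hac). intros R0.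
  destruct (Rle_lt_dec 0 R0) as [HR|HR].
  - exists (ce * (2 * R0)). split; [apply Rmult_le_pos; [apply HC|lra]|]. intros f g B Hf Hg HB.
    rewrite <- RtoC_minus, Cmod_R. eapply Rle_trans; [apply (mass_diff s p ce f g R0 R0 B); assumption|]. right. ring.
  - exists 0. split; [lra|]. intros f g B [Hf _]. lra.
Qed.

Lemma GN0_wcont s p ce a c u n : 1 < p -> cubic_conclusion s p ce -> a <= c -> FLcont s p a c u ->
  wcont a c (fun t => GN 0 (u t) n).
Proof.
  intros Hp HC Hac. apply (FLcont_functional s p a c u (fun f => GN 0 f n) Hp Hac). intros R0.
  exists (3 * ce * (R0 * R0)). split.
  - apply Rmult_le_pos; [|nra]. apply Rmult_le_pos; [lra|apply HC].
  - intros f g B Hf Hg HB. apply (GN_diff s p); assumption.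
Qed.

(** Goes through [FC_decomposition], so that the Lipschitz bounds for [GN] and for the mass
    suffice. *)
Lemma FC_wcont s p ce a c u n : 1 < p -> 0 < s -> cubic_conclusion s p ce -> a <= c -> FLcont s p a c u ->
  wcont a c (fun t => FC (u t) n).
Proof.
  intros Hp Hs HC Hac Hu.
  apply (wcont_ext _ _ (fun t => (GN 0 (u t) n + RtoC (mass (u t)) * (u t n + u t n))%C)).
  - intros t Ht. destruct (proj1 Hu t Ht) as [A HA]. rewrite (FC_decomposition s p ce (u t) A n Hp HC HA).
    rewrite RtoC_mult. ring.
  - apply wcont_add; [apply (GN0_wcont s p ce); assumption|].
    apply wcont_mul; [apply (mass_wcont s p ce); assumption|].
    apply wcont_add; apply (coef_wcont s p); assumption.
Qed.

(** * Gauge covariance and Duhamel's formula *)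

Lemma q_qz n : q n = IZR (qz n).
Proof. unfold q, qz. rewrite minus_IZR, !mult_IZR. ring. Qed.

(** The phase common to all frequencies enters as [th - th + th], and the linear phases add up to
    [t (q(n) - phase)], which the oscillating factor completes to [t q(n)]. *)
Lemma GN_gauge s p ce A t th u n : cubic_conclusion s p ce -> FLb s p u A ->
  GN t (fun m => (cis (t * q m + th) * u m)%C) n = (cis (t * q n + th) * GN 0 u n)%C.
Proof.
  intros HC Hu. unfold GN. rewrite <- (csum_scal _ _ _ (gn_summable s p ce 0 u u u A A A n HC Hu Hu Hu)).
  apply csum_ext. intros [n1 n3]. unfold gn_term. cbn [fst snd]. rewrite Rmult_0_l, cis_0.
  set (n2 := third n n1 n3). rewrite Cmult_conj, cis_conj.
  assert (E : cis (t * q n + th) = (cis (t * IZR (phase n n1 n3)) * cis (t * q n1 + th) * cis (- (t * q n2 + th)) * cis (t * q n3 + th))%C).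
  { rewrite <- !cis_plus. f_equal. unfold phase. fold n2. rewrite minus_IZR, plus_IZR, minus_IZR, <- !q_qz. ring. }
  rewrite E. ring.
Qed.

Lemma wcont_phase a c x th m : wder a c (fun t => RtoC (th t)) (fun t => RtoC (m t)) -> forall k,
  wcont a c (fun t => cis (t * x + k * th t)).
Proof.
  intros H k. apply (wcont_ext _ _ (fun t => (cis (x * t) * cis (k * th t))%C)).
  - intros t _. rewrite <- cis_plus. f_equal. ring.
  - apply wcont_mul.
    + exact (wder_wcont _ _ _ _ (wder_cis a c x (fun t => t) (fun _ => 1) (wder_linear a c))).
    + exact (wder_wcont _ _ _ _ (wder_cis a c k th m H)).
Qed.

Lemma inFL_sub s p a b : 1 < p -> inFL s p a -> inFL s p b -> inFL s p (Csub_seq a b).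
Proof.
  intros Hp Ha Hb. apply (FLb_inFL s p _ (FLnorm s p a + FLnorm s p b) Hp).
  eapply FLb_le; [assumption| |apply (FLb_add s p a (fun n => (- b n)%C)); [assumption|apply inFL_FLb; assumption|]].
  - intros n. right. reflexivity.
  - eapply FLb_le; [assumption| |apply inFL_FLb; [assumption|exact Hb]]. intros n. rewrite Cmod_opp. lra.
Qed.

Lemma CFL_FLcont s p T u : 1 < p -> CFL s p T u <-> FLcont s p 0 T u.
Proof.
  intros Hp. split; intros [H1 H2]; split.
  - intros t Ht. exists (FLnorm s p (u t)). apply inFL_FLb; auto.
  - intros t Ht eps He. destruct (H2 t Ht eps He) as (d & Hd & Hl). exists d. split; [assumption|]. intros t' Ht' Htd.
    eapply FLb_weaken; [assumption|apply (inFL_FLb s p (Csub_seq (u t') (u t))); [assumption|apply inFL_sub; auto]|].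
    left. apply Hl; assumption.
  - intros t Ht. destruct (H1 t Ht) as [A HA]. apply (FLb_inFL s p _ A); assumption.
  - intros t Ht eps He. destruct (H2 t Ht (eps / 2) ltac:(lra)) as (d & Hd & Hl). exists d. split; [assumption|].
    intros t' Ht' Htd. destruct (FLb_inFL s p _ _ Hp (Hl t' Ht' Htd)) as [_ H]. unfold Csub_seq. lra.
Qed.

Lemma linear_group_wcont a c x : wcont a c (fun t => cis (t * x)).
Proof.
  apply (wcont_ext _ _ (fun t => cis (x * t))); [intros; f_equal; ring|].
  exact (wder_wcont _ _ _ _ (wder_cis a c x (fun t => t) (fun _ => 1) (wder_linear a c))).
Qed.

Lemma duhamel_integrand (t t' x : R) (z : C) : (cis (- ((t - t') * x)) * z)%C = (cis (- (t * x)) * (cis (t' * x) * z))%C.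
Proof. rewrite Cmult_assoc, <- cis_plus. do 2 f_equal. ring. Qed.

(** Once the group is pulled out of Duhamel's integral, the integrand is continuous and independent
    of the end point, so [e^(i t q(n)) u_n] is a primitive. *)
Lemma duhamel_profile s p ce T u0 u n : 1 < p -> 0 < s -> cubic_conclusion s p ce -> 0 <= T -> FL_solution s p T u0 u ->
  u 0 n = u0 n /\
  wder 0 T (fun t => (cis (t * q n) * u t n)%C) (fun t => (Ci * (cis (t * q n) * FC (u t) n))%C).
Proof.
  intros Hp Hs HC HT [Hu (NL & HNL & HD)]. apply CFL_FLcont in Hu; [|assumption].
  assert (EN : forall t, 0 <= t <= T -> NL t n = FC (u t) n).
  { intros t Ht. destruct (proj1 Hu t Ht) as [A HA]. apply (cubic_coef_unique s p ce (u t) A); auto. }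
  destruct (wint T (fun t => (cis (t * q n) * FC (u t) n)%C) HT) as (J & J0 & JD & JI).
  { apply wcont_mul; [apply linear_group_wcont|apply (FC_wcont s p ce); assumption]. }
  assert (E : forall t, 0 <= t <= T -> (u0 n + Ci * J t)%C = (cis (t * q n) * u t n)%C).
  { intros t Ht. destruct (HD t Ht n) as (I & HI & Eu). rewrite Eu.
    rewrite (is_RInt_C_unique _ _ t I (cis (- (t * q n)) * J t)%C (proj1 Ht)
      (fun x Hx => eq_refl) HI).
    - transitivity ((cis (- (t * q n)) * cis (t * q n)) * (u0 n + Ci * J t))%C; [rewrite cis_opp_l; ring|ring].
    - apply (is_RInt_ext (fun t' => (cis (- (t * q n)) * (cis (t' * q n) * FC (u t') n))%C)).
      + intros x Hx. rewrite Rmin_left, Rmax_right in Hx by lra. rewrite EN by lra. symmetry. apply duhamel_integrand.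
      + apply is_RInt_C_scal, JI, Ht. }
  split.
  - specialize (E 0 ltac:(lra)). rewrite J0, Rmult_0_l, cis_0 in E.
    replace (u 0 n) with (1 * u 0 n)%C by ring. rewrite <- E. ring.
  - eapply wder_ext; [exact E|reflexivity|]. apply wder_affine, JD.
Qed.

(* Removing the resonant part: [e^(i t q - 2 i th) u] with [th' = mass u] solves the equation with
   nonlinearity [GN], where the interactions with [n1 = n] or [n3 = n] survive only as [-|V_n|^2 V_n]. *)
Lemma solution_gauge s p ce T u0 u : 1 < p -> 0 < s -> cubic_conclusion s p ce -> 0 <= T -> FL_solution s p T u0 u ->
  u 0 = u0 /\ exists th, th 0 = 0 /\ wder 0 T (fun t => RtoC (th t)) (fun t => RtoC (mass (u t))) /\
  Gsol s p 0 T (fun t n => (cis (t * q n + -2 * th t) * u t n)%C).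
Proof.
  intros Hp Hs HC HT Hsol.
  assert (Hu : FLcont s p 0 T u) by (apply CFL_FLcont; [assumption|apply Hsol]).
  split; [apply functional_extensionality; intros n; apply (duhamel_profile s p ce T u0 u n); assumption|].
  destruct (wint_real T (fun t => mass (u t)) HT) as (th & th0 & Hth & _).
  { apply (mass_wcont s p ce); assumption. }
  exists th. split; [assumption|]. split; [assumption|]. split.
  - apply (FLcont_mult s p 0 T (fun t n => cis (t * q n + -2 * th t)) u Hp Hu).
    + intros n. apply (wcont_phase _ _ _ _ _ Hth).
    + intros; apply cis_mod.
  - intros n. destruct (duhamel_profile s p ce T u0 u n Hp Hs HC HT Hsol) as [_ Hw].
    eapply wder_ext; [| |exact (wder_mul _ _ _ _ _ _ (wder_cis _ _ (-2) _ _ Hth) Hw)].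
    + intros t _. cbn beta. rewrite cis_plus. ring.
    + intros t Ht. cbn beta. destruct (proj1 Hu t Ht) as [A HA].
      rewrite (GN_gauge s p ce A t _ (u t) n HC HA), (FC_decomposition s p ce (u t) A n Hp HC HA), cis_plus, !RtoC_mult. ring.
Qed.

(** The gauge preserves moduli, so the solution to be built has the mass of [V] and its phase can be
    defined from [V] beforehand. Duhamel's formula holds because [e^(2 i th) V_n] and its integral
    expression have equal derivatives and agree at time 0. *)
Lemma gauge_solution s p ce T V : 1 < p -> 0 < s -> cubic_conclusion s p ce -> 0 <= T -> Gsol s p 0 T V ->
  exists u, FL_solution s p T (V 0) u.
Proof.
  intros Hp Hs HC HT [HVc HVd].
  destruct (wint_real T (fun t => mass (V t)) HT) as (th & th0 & Hth & _).
  { apply (mass_wcont s p ce); assumption. }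
  set (u := fun t n => (cis (- (t * q n) + 2 * th t) * V t n)%C). exists u.
  assert (Hu : FLcont s p 0 T u).
  { apply FLcont_mult; [assumption|assumption| |intros; apply cis_mod]. intros n.
    apply (wcont_ext _ _ (fun t => cis (t * (- q n) + 2 * th t))); [intros; f_equal; ring|].
    apply (wcont_phase _ _ _ _ _ Hth). }
  assert (EV : forall t, V t = fun n => (cis (t * q n + -2 * th t) * u t n)%C).
  { intros t. apply functional_extensionality. intros n. unfold u. rewrite Cmult_assoc, <- cis_plus.
    replace (t * q n + -2 * th t + (- (t * q n) + 2 * th t)) with 0 by ring. rewrite cis_0. ring. }
  assert (EM : forall t, mass (V t) = mass (u t)).
  { intros t. apply mass_ext. intros n. unfold u. rewrite Cmod_mult, cis_mod. ring. }
  split; [apply CFL_FLcont; assumption|].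
  exists (fun t n => FC (u t) n). split.
  - intros t Ht n. destruct (proj1 Hu t Ht) as [A HA]. apply (cubic_coef_FC s p ce (u t) A); assumption.
  - intros t Ht n.
    destruct (wint T (fun t => (cis (t * q n) * FC (u t) n)%C) HT) as (J & J0 & JD & JI).
    { apply wcont_mul; [apply linear_group_wcont|apply (FC_wcont s p ce); assumption]. }
    exists (cis (- (t * q n)) * J t)%C. split.
    + apply (is_RInt_ext (fun t' => (cis (- (t * q n)) * (cis (t' * q n) * FC (u t') n))%C)).
      * intros x _. symmetry. apply duhamel_integrand.
      * apply is_RInt_C_scal, JI, Ht.
    + assert (Hw : wder 0 T (fun t => (cis (2 * th t) * V t n)%C) (fun t => (Ci * (cis (t * q n) * FC (u t) n))%C)).
      { eapply wder_ext; [reflexivity| |exact (wder_mul _ _ _ _ _ _ (wder_cis _ _ 2 _ _ Hth) (HVd n))].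
        intros t' Ht'. cbn beta. destruct (proj1 Hu t' Ht') as [A HA].
        rewrite (FC_decomposition s p ce (u t') A n Hp HC HA), EM.
        replace (GN t' (V t') n) with (cis (t' * q n + -2 * th t') * GN 0 (u t') n)%C.
        2:{ rewrite (EV t'). symmetry. apply (GN_gauge s p ce A); assumption. }
        assert (Eu : u t' n = (cis (- (t' * q n) + 2 * th t') * V t' n)%C) by reflexivity.
        rewrite Eu, !RtoC_mult. rewrite !cis_plus.
        replace (cis (-2 * th t')) with (cis (- (2 * th t'))) by (f_equal; ring).
        assert (E2 := cis_opp_l (2 * th t')). assert (E1 := cis_opp_l (t' * q n)).
        transitivity (Ci * (RtoC 2 * RtoC (mass (u t')) * cis (2 * th t') * V t' n) +
          Ci * cis (t' * q n) * (cis (- (2 * th t')) * cis (2 * th t')) * GN 0 (u t') n)%C; [ring|].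
        rewrite E2.
        transitivity (Ci * (RtoC 2 * RtoC (mass (u t')) * (cis (- (t' * q n)) * cis (t' * q n)) * cis (2 * th t') * V t' n) +
          Ci * cis (t' * q n) * GN 0 (u t') n)%C; [rewrite E1; ring|]. ring. }
      pose proof (wder_sub _ _ _ _ _ _ Hw (wder_affine 0 T (V 0 n) Ci _ _ JD)) as Hd.
      assert (E : (cis (2 * th t) * V t n - (V 0 n + Ci * J t) = cis (2 * th 0) * V 0 n - (V 0 n + Ci * J 0))%C).
      { apply (local_constant (fun t => (cis (2 * th t) * V t n - (V 0 n + Ci * J t))%C) 0 t); [lra|].
        intros t1 Ht1 eps He. destruct (Hd t1 ltac:(lra) eps He) as (d & Hd0 & Hl). exists d. split; [assumption|].
        intros t' Ht' Htd. specialize (Hl t' ltac:(lra) Htd). cbn beta in Hl.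
        match type of Hl with Cmod (?x - _) <= _ => replace x with (x - RtoC (t' - t1) * 0)%C by ring end.
        rewrite Cminus_diag in Hl. exact Hl. }
      rewrite th0, J0, Rmult_0_r, cis_0 in E.
      unfold u. rewrite cis_plus.
      transitivity (cis (- (t * q n)) * (cis (2 * th t) * V t n - (V 0 n + Ci * J t)) + cis (- (t * q n)) * (V 0 n + Ci * J t))%C; [ring|].
      rewrite E. ring.
Qed.

(** The two solutions are gauged by different phases. Their difference is the time integral of a
    difference of masses, hence at most [2 T ce K^2 A]; undoing the gauges costs four times this,
    multiplied by the size [K] of the solution. *)
Lemma solution_difference s p ce T K rho : 1 < p -> 0 < s -> cubic_conclusion s p ce -> 0 < T -> 0 <= K ->
  (forall V W A, Gsol s p 0 T V -> Gsol s p 0 T W -> FLb s p (V 0) rho -> FLb s p (W 0) rho ->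
     FLb s p (fun n => (V 0 n - W 0 n)%C) A ->
     forall t, 0 <= t <= T -> FLb s p (V t) K /\ FLb s p (fun n => (V t n - W t n)%C) (K * A)) ->
  forall v0 w0 v w A, FL_solution s p T v0 v -> FL_solution s p T w0 w -> FLb s p v0 rho -> FLb s p w0 rho ->
    FLb s p (fun n => (v0 n - w0 n)%C) A ->
    forall t, 0 <= t <= T -> FLb s p (fun n => (v t n - w t n)%C) ((K + 8 * T * ce * (K * K * K)) * A).
Proof.
  intros Hp Hs HC HT HK HG v0 w0 v w A Hv Hw Hv0 Hw0 HA t Ht.
  destruct (solution_gauge s p ce T v0 v Hp Hs HC ltac:(lra) Hv) as (Ev & th & th0 & Hth & HV).
  destruct (solution_gauge s p ce T w0 w Hp Hs HC ltac:(lra) Hw) as (Ew & ph & ph0 & Hph & HW).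
  set (V := fun t n => (cis (t * q n + -2 * th t) * v t n)%C) in *.
  set (W := fun t n => (cis (t * q n + -2 * ph t) * w t n)%C) in *.
  assert (HA0 : 0 <= A) by apply HA. pose proof (proj1 HC) as Hce.
  assert (EV0 : V 0 = v0).
  { apply functional_extensionality. intros n. unfold V. rewrite th0, Ev, Rmult_0_l, Rmult_0_r, Rplus_0_l, cis_0. ring. }
  assert (EW0 : W 0 = w0).
  { apply functional_extensionality. intros n. unfold W. rewrite ph0, Ew, Rmult_0_l, Rmult_0_r, Rplus_0_l, cis_0. ring. }
  assert (GVW : forall t, 0 <= t <= T -> FLb s p (V t) K /\ FLb s p (W t) K /\ FLb s p (fun n => (V t n - W t n)%C) (K * A)).
  { intros t' Ht'.
    destruct (HG V W A HV HW ltac:(rewrite EV0; assumption) ltac:(rewrite EW0; assumption) ltac:(rewrite EV0, EW0; assumption) t' Ht') as [B1 B2].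
    destruct (HG W V A HW HV ltac:(rewrite EW0; assumption) ltac:(rewrite EV0; assumption)
      ltac:(rewrite EV0, EW0; apply FLb_swap; assumption) t' Ht') as [B3 _]. auto. }
  assert (EMv : forall t, mass (v t) = mass (V t)).
  { intros t'. apply mass_ext. intros n. unfold V. rewrite Cmod_mult, cis_mod. ring. }
  assert (EMw : forall t, mass (w t) = mass (W t)).
  { intros t'. apply mass_ext. intros n. unfold W. rewrite Cmod_mult, cis_mod. ring. }
  set (M := ce * (K * A * (K + K))).
  assert (HM : 0 <= M) by (unfold M; repeat apply Rmult_le_pos; lra).
  assert (Hphase : Rabs (th t - ph t) <= M * T).
  { pose proof (wder_bound 0 t _ _ M (proj1 Ht) HM (wder_restrict 0 T 0 t _ _ ltac:(lra) (proj2 Ht) (wder_sub _ _ _ _ _ _ Hth Hph))) as HB.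
    cbn beta in HB. rewrite th0, ph0, <- !RtoC_minus, Cmod_R in HB.
    replace (th t - ph t - (0 - 0)) with (th t - ph t) in HB by ring.
    eapply Rle_trans; [apply HB|apply Rmult_le_compat_l; lra].
    intros t' Ht'. rewrite <- RtoC_minus, Cmod_R, EMv, EMw.
    destruct (GVW t' ltac:(lra)) as (B1 & B2 & B3). apply (mass_diff s p ce _ _ K K (K * A)); assumption. }
  destruct (GVW t Ht) as (B1 & B2 & B3).
  set (om := fun n : Z2 => (cis (- (t * q n) + 2 * th t) - cis (- (t * q n) + 2 * ph t))%C).
  assert (Hom : forall n, Cmod (om n) <= 4 * (M * T)).
  { intros n. unfold om. replace (- (t * q n) + 2 * th t) with ((- (t * q n) + 2 * ph t) + 2 * (th t - ph t)) by ring.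
    rewrite cis_plus.
    replace (cis (- (t * q n) + 2 * ph t) * cis (2 * (th t - ph t)) - cis (- (t * q n) + 2 * ph t))%C
      with (cis (- (t * q n) + 2 * ph t) * (cis (2 * (th t - ph t)) - 1))%C by ring.
    rewrite Cmod_mult, cis_mod, Rmult_1_l. eapply Rle_trans; [apply cis_sub1_le|].
    rewrite Rabs_mult, (Rabs_pos_eq 2) by lra. lra. }
  assert (inv : forall x (z : C), (cis (- x) * (cis x * z))%C = z).
  { intros x z. rewrite Cmult_assoc, cis_opp_l. ring. }
  replace ((K + 8 * T * ce * (K * K * K)) * A) with (1 * (K * A) + 4 * (M * T) * K) by (unfold M; ring).
  eapply FLb_le; [assumption| |apply FLb_add; [assumption| |apply (FLb_mult s p om (W t))]].
  - intros n. right. f_equal.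
    instantiate (1 := fun n => (cis (- (t * q n) + 2 * th t) * (V t n - W t n))%C). cbn beta.
    rewrite <- (inv (t * q n + -2 * th t) (v t n)), <- (inv (t * q n + -2 * ph t) (w t n)). fold (V t n) (W t n).
    unfold om.
    replace (- (t * q n + -2 * th t)) with (- (t * q n) + 2 * th t) by ring.
    replace (- (t * q n + -2 * ph t)) with (- (t * q n) + 2 * ph t) by ring. ring.
  - apply FLb_mult; [assumption|lra| |assumption]. intros n. left. rewrite cis_mod. lra.
  - assumption.
  - repeat apply Rmult_le_pos; lra.
  - intros n. left. apply Hom.
  - assumption.
Qed.

(** [(1 - 1/p) - (4/3 - 2/p) = 1/p - 1/3] changes sign at [p = 3], so in each range the assumed
    inequality is the stronger one. *)
Lemma exponent_conditions s p : 1 < p -> (p <= 3 /\ s > 1 - 1 / p) \/ (3 <= p /\ s > 4 / 3 - 2 / p) ->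
  0 < s /\ 1 < s * conj_exp p /\ s > 4 / 3 - 2 / p.
Proof.
  intros Hp H.
  assert (Hi : 0 < / p < 1) by (split; [apply Rinv_0_lt_compat; lra|rewrite <- Rinv_1; apply Rinv_lt_contravar; lra]).
  assert (E : / p * p = 1) by (field; lra).
  assert (Hs : s > 1 - / p /\ s > 4 / 3 - 2 * / p).
  { unfold Rdiv in H. destruct H as [[H3 H]|[H3 H]]; split; nra. }
  split; [lra|]. split; [|unfold Rdiv at 2; lra].
  unfold conj_exp. apply Rmult_lt_reg_r with ((p - 1) * / p); [nra|].
  replace (s * (p / (p - 1)) * ((p - 1) * / p)) with s by (field; lra).
  replace (1 * ((p - 1) * / p)) with (1 - / p) by (field; lra). lra.
Qed.

Theorem theorem1p2 (s p : R) (hp : 1 < p)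
  (hsp : (p <= 3 /\ s > 1 - 1 / p) \/ (3 <= p /\ s > 4 / 3 - 2 / p)) :
  forall u0 : Z2 -> C, inFL s p u0 ->
  exists T r : R, 0 < T /\ 0 < r /\
    (* existence for all data in the ball of radius r around u0 (in particular u0) *)
    (forall v0, inFL s p v0 -> FLnorm s p (Csub_seq v0 u0) < r ->
       exists v, FL_solution s p T v0 v) /\
    (* unconditional uniqueness in the whole class C([0,T]; FL^{s,p}) *)
    (forall v w, FL_solution s p T u0 v -> FL_solution s p T u0 w ->
       forall t, 0 <= t <= T -> v t = w t) /\
    (* continuous dependence on the data on that ball *)
    (forall v0, inFL s p v0 -> FLnorm s p (Csub_seq v0 u0) < r ->
       forall eps, 0 < eps -> exists eta, 0 < eta /\
         forall w0 v w, inFL s p w0 -> FLnorm s p (Csub_seq w0 u0) < r ->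
           FLnorm s p (Csub_seq w0 v0) < eta ->
           FL_solution s p T v0 v -> FL_solution s p T w0 w ->
           forall t, 0 <= t <= T -> FLnorm s p (Csub_seq (w t) (v t)) < eps).
Proof.
  intros u0 Hu0.
  destruct (exponent_conditions s p hp hsp) as (Hs & Hsp & Hs3).
  destruct (tri_bounds s p hp Hs Hsp) as (c & HT).
  destruct (cubic_bound s p hp Hs Hs3) as (ce & HC).
  pose proof (inFL_FLb s p u0 hp Hu0) as HN. set (N := FLnorm s p u0) in *.
  assert (HN0 : 0 <= N) by apply HN.
  (* Data within distance 1 of [u0] have norm at most [N + 1], half of this radius, so one [T]
     serves the whole ball. *)
  destruct (Gsol_wellposed s p c ce (2 * (N + 1)) hp Hs HT HC ltac:(lra)) as (T & K & HT0 & HK & HE & HD).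
  replace (2 * (N + 1) / 2) with (N + 1) in HE, HD by field.
  pose proof (solution_difference s p ce T K (N + 1) hp Hs HC HT0 HK HD) as HL.
  set (K' := K + 8 * T * ce * (K * K * K)) in *.
  assert (HK' : 0 <= K').
  { pose proof (proj1 HC). unfold K'. apply Rplus_le_le_0_compat; [assumption|]. repeat apply Rmult_le_pos; lra. }
  assert (Hball : forall v0, inFL s p v0 -> FLnorm s p (Csub_seq v0 u0) < 1 -> FLb s p v0 (N + 1)).
  { intros v0 Hv0 Hd.
    eapply FLb_le; [assumption| |apply (FLb_add s p u0 (Csub_seq v0 u0) N 1 hp HN)].
    - intros n. right. unfold Csub_seq. f_equal. ring.
    - eapply FLb_weaken; [assumption|apply inFL_FLb; [assumption|apply inFL_sub; assumption]|lra]. }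
  exists T, 1. split; [assumption|]. split; [lra|]. split; [|split].
  - intros v0 Hv0 Hd. destruct (HE v0 (Hball v0 Hv0 Hd)) as (V & HV & E0).
    apply functional_extensionality in E0. rewrite <- E0.
    apply (gauge_solution s p ce T V); auto. lra.
  - intros v w Hv Hw t Ht.
    assert (Hu1 : FLb s p u0 (N + 1)) by (eapply FLb_weaken; [assumption|exact HN|lra]).
    (* Uniqueness is the difference estimate for data at distance 0. *)
    assert (H0 : FLb s p (fun n => (u0 n - u0 n)%C) (0 * N)).
    { eapply FLb_le; [assumption| |apply (FLb_mult s p (fun _ => RtoC 0) u0 0 N hp (Rle_refl 0)); [|exact HN]].
      - intros n. right. f_equal. ring.
      - intros n. left. rewrite Cmod_0. lra. }
    pose proof (HL u0 u0 v w _ Hv Hw Hu1 Hu1 H0 t Ht) as H.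
    apply functional_extensionality. intros n. apply Ceq_eps. intros eps He.
    eapply Rle_trans; [exact (FLb_pointwise s p _ _ n hp Hs H)|]. lra.
  - intros v0 Hv0 Hvd eps He. exists (eps / (K' + 1)). split; [apply Rdiv_lt_0_compat; lra|].
    intros w0 v w Hw0 Hwd Hd Hv Hw t Ht.
    pose proof (inFL_FLb s p _ hp (inFL_sub s p w0 v0 hp Hw0 Hv0)) as HA.
    pose proof (HL w0 v0 w v _ Hw Hv (Hball w0 Hw0 Hwd) (Hball v0 Hv0 Hvd) HA t Ht) as H.
    destruct (FLb_inFL s p _ _ hp H) as [_ H']. eapply Rle_lt_trans; [exact H'|].
    apply Rle_lt_trans with (K' * (eps / (K' + 1))); [apply Rmult_le_compat_l; lra|].
    apply Rlt_le_trans with ((K' + 1) * (eps / (K' + 1))); [|right; field; lra].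
    apply Rmult_lt_compat_r; [apply Rdiv_lt_0_compat; lra|lra].
Qed.
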